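(* Let $\lambda$ be a limit cardinal. The following are equivalent: (i) $\lambda$ is ultraexacting; (ii) for every first-order language $\mathcal{L}$ containing a unary predicate symbol $\dot P$ and every ordinal definable class $\mathcal{C}$ of $\mathcal{L}$-structures, $\mathrm{UXSR}_{\mathcal{C}}(\lambda)$ holds; (iii) $\mathrm{UXSR}_{\mathcal{U}}(\lambda)$ holds, where $\mathcal{U}$ is the class of $\mathcal{L}^*$-structures defined below.
   Context: For $n$ a natural number, $C^{(n)}$ is the class of ordinals $\alpha$ with $V_\alpha\prec_{\Sigma_n}V$. A limit cardinal $\lambda$ is ultraexacting if there exist $n>0$, a cardinal $\eta\in C^{(n)}$ with $\eta>\lambda$, $X\prec V_\eta$ with $V_\lambda\cup\{\lambda\}\subseteq X$, a cardinal $\zeta\in C^{(n+1)}$ with $\zeta>\lambda$, and an elementary $j:X\to V_\zeta$ with $j(\lambda)=\lambda$, $j\restriction\lambda\ne\mathrm{id}_\lambda$ and $j\restriction V_\lambda\in X$. For a function $r:V_\lambda\to V_\lambda$ let $r^+(x)=\bigcup\{r(x\cap V_\alpha):\alpha<\lambda\}$ for $x\subseteq V_\lambda$; for $f:V_\lambda\to V_\lambda$, a square root of $f$ is a function $r:V_\lambda\to V_\lambda$ with $r^+(r)=f$. An $\mathcal{L}$-structure $A$ has type $\langle\mu,\lambda\rangle$ if its universe has rank $\lambda$ and $\dot P^A$ has rank $\mu$. $\mathrm{UXSR}_{\mathcal C}(\lambda)$ asserts: there are a function $f:V_\lambda\to V_\lambda$ and a cardinal $\mu<\lambda$ such that for every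 $B\in\mathcal C$ of type $\langle\mu,\lambda\rangle$ there are $\nu<\mu$, $A\in\mathcal C$ of type $\langle\nu,\lambda\rangle$ and a square root $r$ of $f$ whose restriction to the universe of $A$ is an elementary embedding of $A$ into $B$. A class is ordinal definable if it is definable by a formula with ordinal parameters. $\mathcal{L}^*$ extends the language of set theory by a unary function symbol $\dot f$, a binary relation symbol $\dot E$ and a unary predicate symbol $\dot P$. $\mathcal U$ is the class of $\mathcal{L}^*$-structures $A$ such that for some limit cardinal $\lambda'$: the $\{\in\}$-reduct of $A$ is $\langle V_{\lambda'},\in\rangle$, and, letting $\zeta$ be the least cardinal in $C^{(2)}$ above $\lambda'$, there are $X\prec V_\zeta$ with $V_{\lambda'}\cup\{\lambda',\dot f^A\}\subseteq X$ and a bijection $\tau:X\to V_{\lambda'}$ with $\tau(\lambda')=\langle0,0\rangle$, $\tau(x)=\langle 1,x\rangle$ for all $x\in V_{\lambda'}$, and $x\in y\iff\tau(x)\,\dot E^A\,\tau(y)$ for all $x,y\in X$.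
   Formalization: In (ii) the language is required to be an element of V_λ; with no bound (e.g. constants c_a for all a<λ, interpreted as a, and Ṗ as V_ν) clause (ii) fails for every λ, so it could not follow from (i). *)

(* Defs.v *)
Set Implicit Arguments.

(** Statements of ZFC set theory are rendered as statements about an arbitrary
    model [M] of first-order ZFC.  Everything that is a set in set theory
    (functions, languages, structures, formulas of a language, assignments) is an
    element of [M]; only definable classes and the Levy hierarchy over the
    universe, which ZFC treats by schemata, use formulas outside of [M].
    Operations of set theory appear as graphs: [is_pair p x y] is p = <x,y>. *)

Record universe : Type := Universe {
  carrier :> Type;
  mem : carrier -> carrier -> Prop }.

Arguments mem {u} _ _.
Notation "x ∈ y" := (mem x y) (at level 70, no associativity).

(** * Formulas of set theory, with variables indexed by [nat] *)

Inductive form : Type :=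
| f_mem (i j : nat)
| f_eq (i j : nat)
| f_not (p : form)
| f_and (p q : form)
| f_imp (p q : form)
| f_ex (i : nat) (p : form)
| f_all (i : nat) (p : form).

Definition upd (T : Type) (v : nat -> T) (i : nat) (x : T) : nat -> T :=
  fun k => if Nat.eqb k i then x else v k.

(** [satisfies D p v]: truth of [p] under [v] in the substructure of [M] with
    domain the class [D]. *)
Fixpoint satisfies {M : universe} (D : M -> Prop) (p : form) (v : nat -> M) : Prop :=
  match p with
  | f_mem i j => v i ∈ v j
  | f_eq i j => v i = v j
  | f_not q => ~ satisfies D q v
  | f_and q r => satisfies D q v /\ satisfies D r v
  | f_imp q r => satisfies D q v -> satisfies D r v
  | f_ex i q => exists x, D x /\ satisfies D q (upd v i x)
  | f_all i q => forall x, D x -> satisfies D q (upd v i x)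
  end.

Definition all_sets (M : universe) : M -> Prop := fun _ => True.

Inductive Delta0 : form -> Prop :=
| Delta0_mem i j : Delta0 (f_mem i j)
| Delta0_eq i j : Delta0 (f_eq i j)
| Delta0_not p : Delta0 p -> Delta0 (f_not p)
| Delta0_and p q : Delta0 p -> Delta0 q -> Delta0 (f_and p q)
| Delta0_imp p q : Delta0 p -> Delta0 q -> Delta0 (f_imp p q)
| Delta0_bex i j p : i <> j -> Delta0 p -> Delta0 (f_ex i (f_and (f_mem i j) p))
| Delta0_ball i j p : i <> j -> Delta0 p -> Delta0 (f_all i (f_imp (f_mem i j) p)).

Inductive Sigma : nat -> form -> Prop :=
| Sigma_zero p : Delta0 p -> Sigma 0 p
| Sigma_Pi n p : Pi n p -> Sigma (S n) p
| Sigma_ex n i p : Sigma (S n) p -> Sigma (S n) (f_ex i p)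
with Pi : nat -> form -> Prop :=
| Pi_zero p : Delta0 p -> Pi 0 p
| Pi_Sigma n p : Sigma n p -> Pi (S n) p
| Pi_all n i p : Pi (S n) p -> Pi (S n) (f_all i p).

(** * Basic set theory *)

Section Basics.
Context {M : universe}.
Implicit Types a b c f g p q r s t u v w x y z : M.

Definition subset x y : Prop := forall z, z ∈ x -> z ∈ y.

Definition is_empty x : Prop := forall z, ~ z ∈ x.

Definition is_upair p x y : Prop := forall z, z ∈ p <-> z = x \/ z = y.

Definition is_pair p x y : Prop :=
  exists a b, is_upair a x x /\ is_upair b x y /\ is_upair p a b.

Definition is_succ s x : Prop := forall z, z ∈ s <-> z ∈ x \/ z = x.

Fixpoint is_num (n : nat) x : Prop :=
  match n with
  | 0 => is_empty x
  | S m => exists y, is_num m y /\ is_succ x y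
  end.

Definition transitive x : Prop := forall y, y ∈ x -> subset y x.

Definition is_ordinal a : Prop := transitive a /\ forall x, x ∈ a -> transitive x.

Definition is_natural a : Prop :=
  is_ordinal a /\
  forall x, x ∈ a \/ x = a -> is_empty x \/ exists y, is_succ x y.

Definition is_omega w : Prop := forall x, x ∈ w <-> is_natural x.

(** <x,y> ∈ f; for a function f, this is f(x) = y. *)
Definition app f x y : Prop := exists p, is_pair p x y /\ p ∈ f.

Definition is_function f a b : Prop :=
  (forall p, p ∈ f -> exists x y, x ∈ a /\ y ∈ b /\ is_pair p x y) /\
  (forall x, x ∈ a -> exists! y, app f x y).

Definition is_function_on f a : Prop := exists b, is_function f a b.

Definition is_bijection f a b : Prop :=
  is_function f a b /\ forall y, y ∈ b -> exists! x, app f x y.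

Definition is_restriction f a g : Prop :=
  forall p, p ∈ g <-> p ∈ f /\ exists x y, x ∈ a /\ is_pair p x y.

Definition is_identity_on a f : Prop :=
  forall p, p ∈ f <-> exists x, x ∈ a /\ is_pair p x x.

Definition is_cardinal k : Prop :=
  is_ordinal k /\ forall a, a ∈ k -> ~ exists f, is_bijection f a k.

Definition is_limit_cardinal l : Prop :=
  is_cardinal l /\ (exists x, x ∈ l) /\
  forall a, a ∈ l -> exists k, is_cardinal k /\ a ∈ k /\ k ∈ l.

(** v = V_a, through the recursion V_b = U { P(V_c) : c < b } on b <= a. *)
Definition is_V a v : Prop :=
  is_ordinal a /\
  exists s h, is_succ s a /\ is_function_on h s /\
    (forall b u, app h b u ->
       forall x, x ∈ u <-> exists c t, c ∈ b /\ app h c t /\ subset x t) /\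
    app h a v.

Definition is_rank x a : Prop :=
  (exists v, is_V a v /\ subset x v) /\
  forall b v, b ∈ a -> is_V b v -> ~ subset x v.

End Basics.

(** * ZFC *)

Record ZFC (M : universe) : Prop := {
  zfc_ext : forall x y : M, (forall z, z ∈ x <-> z ∈ y) -> x = y;
  zfc_foundation : forall x : M, (exists y, y ∈ x) ->
    exists y, y ∈ x /\ forall z, z ∈ y -> ~ z ∈ x;
  zfc_pairing : forall x y : M, exists p, is_upair p x y;
  zfc_union : forall x : M, exists u, forall z, z ∈ u <-> exists y, y ∈ x /\ z ∈ y;
  zfc_power : forall x : M, exists u, forall z, z ∈ u <-> subset z x;
  zfc_infinity : exists w : M, (exists x, is_empty x /\ x ∈ w) /\
    forall x, x ∈ w -> exists y, is_succ y x /\ y ∈ w;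
  zfc_separation : forall (p : form) (v : nat -> M) (x : M),
    exists y, forall z,
      z ∈ y <-> z ∈ x /\ satisfies (@all_sets M) p (upd v 0 z);
  zfc_replacement : forall (p : form) (v : nat -> M) (x : M),
    (forall z, z ∈ x ->
       exists! y, satisfies (@all_sets M) p (upd (upd v 0 z) 1 y)) ->
    exists u, forall y, y ∈ u <->
      exists z, z ∈ x /\ satisfies (@all_sets M) p (upd (upd v 0 z) 1 y);
  zfc_choice : forall x : M,
    (forall y, y ∈ x -> exists z, z ∈ y) ->
    (forall y y' z, y ∈ x -> y' ∈ x -> z ∈ y -> z ∈ y' -> y = y') ->
    exists c, forall y, y ∈ x -> exists! z, z ∈ y /\ z ∈ c }.

(** * First-order languages, structures and elementary embeddings, inside [M] *)

Section Logic.
Context {M : universe}.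
Implicit Types A B L U I D F R T X Y a b c e f g h i k n p q r s t u v w x y z : M.

(** c = <k,x> with k a numeral. *)
Definition tagged (k : nat) x c : Prop := exists t, is_num k t /\ is_pair c t x.

(** A symbol carries its kind and its arity: the n-ary relation symbols are the
    sets <0,<n,a>>, and the n-ary function symbols are the sets <1,<n,a>>. *)
Definition is_rel_symbol s n : Prop :=
  is_natural n /\ exists a q, is_pair q n a /\ tagged 0 q s.

Definition is_fun_symbol s n : Prop :=
  is_natural n /\ exists a q, is_pair q n a /\ tagged 1 q s.

Definition is_language L : Prop :=
  forall s, s ∈ L -> exists n, is_rel_symbol s n \/ is_fun_symbol s n.

(** A = <U,I>, where I interprets the symbols of L over U; n-tuples of elements
    of U are functions from n to U. *)
Definition structure_data L A U I : Prop :=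
  is_pair A U I /\ (exists u, u ∈ U) /\ is_function_on I L /\
  (forall s n R, s ∈ L -> is_rel_symbol s n -> app I s R ->
     forall t, t ∈ R -> is_function t n U) /\
  (forall s n F, s ∈ L -> is_fun_symbol s n -> app I s F ->
     exists T, (forall t, t ∈ T <-> is_function t n U) /\ is_function F T U).

Definition is_structure L A : Prop := exists U I, structure_data L A U I.

(** Terms are coded by <0,i> (the i-th variable, i < omega) and <1,<s,ts>> (the
    symbol s applied to the sequence ts of terms); the set of terms is the least
    set closed under these rules. *)
Definition is_term L t : Prop :=
  forall S : M,
    (forall i c, is_natural i -> tagged 0 i c -> c ∈ S) ->
    (forall s n ts q c, s ∈ L -> is_fun_symbol s n -> is_function ts n S ->
       is_pair q s ts -> tagged 1 q c -> c ∈ S) ->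
    t ∈ S.

Definition is_assignment U e : Prop :=
  exists w, is_omega w /\ is_function e w U.

(** The least relation between terms and values closed under evaluation. *)
Definition term_value L U I e t a : Prop :=
  forall R,
    (forall i x c, app e i x -> tagged 0 i c -> app R c x) ->
    (forall s n F ts xs x q c, s ∈ L -> is_fun_symbol s n -> app I s F ->
       is_function_on ts n -> is_function xs n U ->
       (forall k u y, k ∈ n -> app ts k u -> app xs k y -> app R u y) ->
       app F xs x ->
       is_pair q s ts -> tagged 1 q c -> app R c x) ->
    app R t a.

(** Formulas are coded by <0,<s,ts>> (atomic), <1,<t,t'>> (equality), <2,p>
    (negation), <3,<p,q>> (conjunction) and <4,<i,p>> (existential
    quantification of the i-th variable).  [formula_extension L U I p T]: p is an
    L-formula and T is the set of assignments that satisfy p in <U,I>.  It is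
    the least relation closed under the clauses of Tarski's definition; a set
    that codes no formula has no extension. *)
Definition extension_closed L U I D : Prop :=
  (forall s n R ts q c T, s ∈ L -> is_rel_symbol s n -> app I s R ->
     is_function_on ts n -> (forall k t, app ts k t -> is_term L t) ->
     is_pair q s ts -> tagged 0 q c ->
     (forall e, e ∈ T <-> is_assignment U e /\
        exists xs, xs ∈ R /\
          forall k t x, app ts k t -> app xs k x -> term_value L U I e t x) ->
     app D c T) /\
  (forall t t' q c T, is_term L t -> is_term L t' ->
     is_pair q t t' -> tagged 1 q c ->
     (forall e, e ∈ T <-> is_assignment U e /\
        exists x, term_value L U I e t x /\ term_value L U I e t' x) ->
     app D c T) /\
  (forall p P c T, app D p P -> tagged 2 p c ->
     (forall e, e ∈ T <-> is_assignment U e /\ ~ e ∈ P) ->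
     app D c T) /\
  (forall p P p' P' q c T, app D p P -> app D p' P' ->
     is_pair q p p' -> tagged 3 q c ->
     (forall e, e ∈ T <-> e ∈ P /\ e ∈ P') ->
     app D c T) /\
  (forall p P i q c T, app D p P -> is_natural i ->
     is_pair q i p -> tagged 4 q c ->
     (forall e, e ∈ T <-> is_assignment U e /\
        exists e', e' ∈ P /\ forall k x, k <> i -> (app e k x <-> app e' k x)) ->
     app D c T).

Definition formula_extension L U I p T : Prop :=
  forall D, extension_closed L U I D -> app D p T.

Definition structure_satisfies L A p e : Prop :=
  exists U I T, structure_data L A U I /\ formula_extension L U I p T /\ e ∈ T.

Definition elementary_embedding L A B h : Prop :=
  exists U I U' I', structure_data L A U I /\ structure_data L B U' I' /\
    is_function h U U' /\
    forall p e e', is_assignment U e -> is_assignment U' e' ->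
      (forall i x y, app e i x -> app h x y -> app e' i y) ->
      (structure_satisfies L A p e <-> structure_satisfies L B p e').

(** The one- and two-term sequences of elements. *)
Definition is_seq1 t x : Prop :=
  exists z p, is_num 0 z /\ is_pair p z x /\ is_upair t p p.

Definition is_seq2 t x y : Prop :=
  exists z o p q, is_num 0 z /\ is_num 1 o /\ is_pair p z x /\ is_pair q o y /\
    is_upair t p q.

Definition interprets A s R : Prop := exists U I, is_pair A U I /\ app I s R.

Definition rel1 A s x : Prop := exists R t, interprets A s R /\ is_seq1 t x /\ t ∈ R.

Definition rel2 A s x y : Prop :=
  exists R t, interprets A s R /\ is_seq2 t x y /\ t ∈ R.

Definition fun1 A s x y : Prop :=
  exists F t, interprets A s F /\ is_seq1 t x /\ app F t y.

(** The symbol of kind [k] (0: relation, 1: function), arity [n] and name [m]. *)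
Definition is_std_symbol (k n m : nat) s : Prop :=
  exists n' m' q, is_num n n' /\ is_num m m' /\ is_pair q n' m' /\ tagged k q s.

Definition is_mem_symbol s : Prop := is_std_symbol 0 2 0 s.
Definition is_E_symbol s : Prop := is_std_symbol 0 2 1 s.
Definition is_P_symbol s : Prop := is_std_symbol 0 1 0 s.
Definition is_f_symbol s : Prop := is_std_symbol 1 1 0 s.

Definition is_unary_predicate_symbol s : Prop :=
  exists n, is_num 1 n /\ is_rel_symbol s n.

(** A has universe X, and the membership symbol is interpreted in A as ∈. *)
Definition has_membership_reduct A X : Prop :=
  (exists I, is_pair A X I) /\
  forall s, is_mem_symbol s -> forall x y, x ∈ X -> y ∈ X -> (rel2 A s x y <-> x ∈ y).

(** h : <X,∈> -> <Y,∈> is elementary. *)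
Definition elementary_map X Y h : Prop :=
  exists L A B, (forall s, s ∈ L <-> is_mem_symbol s) /\
    is_structure L A /\ has_membership_reduct A X /\
    is_structure L B /\ has_membership_reduct B Y /\
    elementary_embedding L A B h.

Definition elementary_subset X Y : Prop :=
  subset X Y /\ exists i, is_identity_on X i /\ elementary_map X Y i.

(** * The classes C^(n) and ultraexacting cardinals *)

Definition in_C (n : nat) a : Prop :=
  exists v, is_V a v /\
    forall (p : form) (o : nat -> M), Sigma n p -> (forall i : nat, o i ∈ v) ->
      (satisfies (fun x => x ∈ v) p o <-> satisfies (@all_sets M) p o).

Definition ultraexacting l : Prop :=
  is_limit_cardinal l /\
  exists (n : nat) (eta zeta Vl Veta Vzeta X j jl : M),
    0 < n /\
    is_V l Vl /\ is_V eta Veta /\ is_V zeta Vzeta /\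
    is_cardinal eta /\ in_C n eta /\ l ∈ eta /\
    elementary_subset X Veta /\ subset Vl X /\ l ∈ X /\
    is_cardinal zeta /\ in_C (S n) zeta /\ l ∈ zeta /\
    elementary_map X Vzeta j /\ app j l l /\
    (exists a, a ∈ l /\ ~ app j a a) /\
    is_restriction j Vl jl /\ jl ∈ X.

(** * Square root reflection *)

(** y = r^+(x) for r : V_l -> V_l and x a subset of V_l. *)
Definition is_plus l r x y : Prop :=
  forall z, z ∈ y <->
    exists a v c u, a ∈ l /\ is_V a v /\
      (forall w, w ∈ c <-> w ∈ x /\ w ∈ v) /\ app r c u /\ z ∈ u.

Definition is_square_root l f r : Prop :=
  (exists v, is_V l v /\ is_function r v v) /\ is_plus l r r f.

Definition has_type P A m l : Prop :=
  exists U I PA, is_pair A U I /\ is_rank U l /\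
    (forall x, x ∈ PA <-> rel1 A P x) /\ is_rank PA m.

Definition UXSR L P (C : M -> Prop) l : Prop :=
  exists f m, (exists v, is_V l v /\ is_function f v v) /\
    is_cardinal m /\ m ∈ l /\
    forall B, C B -> has_type P B m l ->
      exists n A r U I g, n ∈ m /\ C A /\ has_type P A n l /\
        is_square_root l f r /\
        is_pair A U I /\ is_restriction r U g /\ elementary_embedding L A B g.

Definition ordinal_definable (C : M -> Prop) : Prop :=
  exists (p : form) (v : nat -> M), (forall i : nat, is_ordinal (v i)) /\
    forall x, C x <-> satisfies (@all_sets M) p (upd v 0 x).

(** * The language L^* and the class U *)

Definition is_Lstar L : Prop :=
  forall s, s ∈ L <->
    is_mem_symbol s \/ is_f_symbol s \/ is_E_symbol s \/ is_P_symbol s.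

Definition is_least_C2_cardinal_above l z : Prop :=
  is_cardinal z /\ in_C 2 z /\ l ∈ z /\
  forall y, is_cardinal y -> in_C 2 y -> l ∈ y -> ~ y ∈ z.

Definition classU A : Prop :=
  exists L l Vl, is_Lstar L /\ is_structure L A /\
    is_limit_cardinal l /\ is_V l Vl /\ has_membership_reduct A Vl /\
    exists zeta Vzeta X fA sf sE tau,
      is_least_C2_cardinal_above l zeta /\ is_V zeta Vzeta /\
      is_f_symbol sf /\ is_E_symbol sE /\
      (forall p, p ∈ fA <-> exists x y, is_pair p x y /\ fun1 A sf x y) /\
      elementary_subset X Vzeta /\ subset Vl X /\ l ∈ X /\ fA ∈ X /\
      is_bijection tau X Vl /\
      (exists o c, is_num 0 o /\ tagged 0 o c /\ app tau l c) /\
      (forall x c, x ∈ Vl -> tagged 1 x c -> app tau x c) /\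
      (forall x y x' y', app tau x x' -> app tau y y' ->
         (x ∈ y <-> rel2 A sE x' y')).

End Logic.

(* Main.v *)
(** From square root reflection to ultraexactness: take a structure B in U that codes, through a
    bijection onto V_lambda, an elementary X_B in V_zeta containing V_lambda, lambda and f, and whose
    predicate is mu.  Reflection gives A in U, coding X_A, and a square root r of f that embeds A into B.
    Decoding r yields j : X_A -> X_B, elementary into V_zeta, which fixes lambda and extends r.  Since
    f(r x) = r(r x), the function of A is r itself, whence r is in X_A.  If r were trivial on
    ordinals it would be the identity, and the predicates of A and B would have the same rank.

    From ultraexactness to reflection: let j : X -> V_zeta be given and suppose that reflection fails
    for some ordinal definable class.  Reflection of formulas yields a V_delta that sees this
    failure; as zeta is in C^(2), the least one is in V_eta and is fixed by j.  Inside it the least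
    ordinal parameters of a counterexample are fixed by j, and by Kunen's argument j is the identity on
    V_rho for every fixed rho < lambda, hence on the language.  Let k be the restriction of j to V_lambda,
    and mu a cardinal moved by j.  If B in X were a counterexample for f = k and mu, then j(B) would be
    one for j(k) and j(mu); but k is a square root of j(k) and embeds B into j(B), and B has type
    <mu,lambda> with mu < j(mu).

    Ordinal definability of U rests on the definability of C^(2): over classes in which every set lies
    in a transitive model of a fixed finite theory, a single Sigma_2 formula decides all Sigma_2 formulas. *)

From Stdlib Require Import Classical ClassicalEpsilon FunctionalExtensionality
  ProofIrrelevance PeanoNat Lia List.
Require Import Defs.
Set Implicit Arguments.
Unset Strict Implicit.

(** * Definability *)

(** The model [M] may have nonstandard natural numbers, so two notions of formula coexist: external
    formulas, in which definability, reflection and C^(n) are stated, and codes inside [M], on which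
    [elementary_embedding] rests. A property that has to pass between universes is shown to be
    defined by one formula in all of them ([UD]); it then moves along an embedding through
    [ext_elem]. A claim about all codes needs an induction inside the universe instead, or the fact
    that satisfaction depends on an assignment only below some natural number of the universe. The
    segment V_delta cannot be asked to satisfy all of ZFC, since reflection handles one formula at a
    time. It satisfies separation as a rank level and a finite list of reflected facts. The
    embedding acts on V_delta only from outside; its restriction k to V_lambda is an element, and
    inductions on fixed points are phrased through k. Kunen's argument is applied to fixed sets
    below lambda directly, so the critical sequence does not occur. Along with the ordinal
    parameters an ordinal rho < lambda with the language in V_rho is minimized: this is why the
    language is fixed pointwise. *)

Definition scons (T : Type) (x : T) (v : nat -> T) : nat -> T :=
  fun k => match k with 0 => x | S k => v k end.
Notation "x .: v" := (scons x v) (at level 55, right associativity).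

(* First-order formulas with de Bruijn variables and constants from [K]. *)
Inductive fml (K : Type) : Type :=
| Mem (s t : nat + K)
| Eql (s t : nat + K)
| Neg (p : fml K)
| And (p q : fml K)
| Exs (p : fml K).

Definition teval (N : universe) (K : Type) (c : K -> N) (t : nat + K) (v : nat -> N) : N :=
  match t with inl i => v i | inr k => c k end.

Fixpoint fsat (N : universe) (K : Type) (c : K -> N) (q : fml K) (v : nat -> N) : Prop :=
  match q with
  | Mem s t => teval c s v ∈ teval c t v
  | Eql s t => teval c s v = teval c t v
  | Neg p => ~ fsat c p v
  | And p r => fsat c p v /\ fsat c r v
  | Exs p => exists x, fsat c p (x .: v)
  end.

Definition tlift (K : Type) (t : nat + K) : nat + K :=
  match t with inl i => inl (S i) | inr k => inr k end.

Fixpoint fsub (K K' : Type) (s : nat -> nat + K') (c : K -> nat + K') (q : fml K) : fml K' :=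
  let ts t := match t with inl i => s i | inr k => c k end in
  match q with
  | Mem a b => Mem (ts a) (ts b)
  | Eql a b => Eql (ts a) (ts b)
  | Neg p => Neg (fsub s c p)
  | And p r => And (fsub s c p) (fsub s c r)
  | Exs p => Exs (fsub (inl 0 .: fun i => tlift (s i)) (fun k => tlift (c k)) p)
  end.

Lemma teval_lift (N : universe) (K : Type) (c : K -> N) t x v :
  teval c (tlift t) (x .: v) = teval c t v.
Proof. destruct t; reflexivity. Qed.

(* Substituted constants become variables of the environment, so they are first
   evaluated and then treated as constants of the substituted formula. *)
Lemma fsat_sub (N : universe) (K K' : Type) (q : fml K) :
  forall (c' : K' -> N) (s : nat -> nat + K') (c : K -> nat + K') v,
  fsat c' (fsub s c q) v <->
  fsat (fun k => teval c' (c k) v) q (fun i => teval c' (s i) v).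
Proof.
induction q as [a b|a b|p IH|p IHp r IHr|p IH]; intros c' s c v; simpl.
- destruct a, b; reflexivity.
- destruct a, b; reflexivity.
- rewrite IH; reflexivity.
- rewrite IHp, IHr; reflexivity.
- assert (E : forall x,
    fsat c' (fsub (inl 0 .: (fun i => tlift (s i))) (fun k => tlift (c k)) p) (x .: v) <->
    fsat (fun k => teval c' (c k) v) p (x .: (fun i => teval c' (s i) v))).
  { intro x. rewrite IH.
    replace (fun k => teval c' (tlift (c k)) (x .: v)) with (fun k => teval c' (c k) v)
      by (apply functional_extensionality; intro; symmetry; apply teval_lift).
    replace (fun i => teval c' ((inl 0 .: (fun i => tlift (s i))) i) (x .: v))
      with (x .: (fun i => teval c' (s i) v)); [reflexivity|].
    apply functional_extensionality; intros [|i]; simpl; [reflexivity|].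
    symmetry; apply teval_lift. }
  split; intros [x H]; exists x; apply E; exact H.
Qed.

Definition noc (T : Type) (e : Empty_set) : T := match e with end.

Lemma fsat_noc (N : universe) (c c' : Empty_set -> N) q v : fsat c q v <-> fsat c' q v.
Proof. replace c' with c; [tauto|]. apply functional_extensionality; intros []. Qed.

(* Uniformly definable: one parameter-free formula works in all universes. *)
Definition UD (P : forall N : universe, (nat -> N) -> Prop) : Prop :=
  exists q : fml Empty_set, forall (N : universe) (v : nat -> N),
    P N v <-> fsat (@noc N) q v.

(** Definability with parameters in one universe: every element of [M] is available as a constant.
    Separation, replacement and the induction principles ask for this notion, transfer between
    universes asks for [UD]. *)
Definition dfn (M : universe) (P : (nat -> M) -> Prop) : Prop :=
  exists q : fml M, forall v, P v <-> fsat (fun x => x) q v.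

Definition tm (M : universe) (s : (nat -> M) -> M) : Prop :=
  exists t : nat + M, forall v, s v = teval (fun x => x) t v.

Lemma tm_var (M : universe) i : tm (fun v : nat -> M => v i).
Proof. exists (inl i); reflexivity. Qed.

Lemma tm_cst (M : universe) (c : M) : tm (fun v : nat -> M => c).
Proof. exists (inr c); reflexivity. Qed.

Section UDclosure.
Implicit Types A B : forall N : universe, (nat -> N) -> Prop.

Lemma UD_ext A B : (forall N v, A N v <-> B N v) -> UD A -> UD B.
Proof. intros E [q H]. exists q. intros N v. rewrite <- E. apply H. Qed.

Lemma UD_mem i j : UD (fun N v => v i ∈ v j).
Proof. exists (Mem (inl i) (inl j)); simpl; tauto. Qed.

Lemma UD_eq i j : UD (fun N v => v i = v j).
Proof. exists (Eql (inl i) (inl j)); simpl; tauto. Qed.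

Lemma UD_not A : UD A -> UD (fun N v => ~ A N v).
Proof. intros [q H]. exists (Neg q). intros; simpl. rewrite H; tauto. Qed.

Lemma UD_and A B : UD A -> UD B -> UD (fun N v => A N v /\ B N v).
Proof. intros [q H] [r G]. exists (And q r). intros; simpl. rewrite H, G; tauto. Qed.

Lemma UD_or A B : UD A -> UD B -> UD (fun N v => A N v \/ B N v).
Proof.
intros H G. apply UD_ext with (fun N v => ~ (~ A N v /\ ~ B N v)).
- intros; split; [|tauto]. intro K. apply NNPP. tauto.
- apply UD_not, UD_and; apply UD_not; assumption.
Qed.

Lemma UD_imp A B : UD A -> UD B -> UD (fun N v => A N v -> B N v).
Proof.
intros H G. apply UD_ext with (fun N v => ~ A N v \/ B N v).
- intros; split; [tauto|]. intro K. destruct (classic (A N v)); tauto.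
- apply UD_or; [apply UD_not|]; assumption.
Qed.

Lemma UD_iff A B : UD A -> UD B -> UD (fun N v => A N v <-> B N v).
Proof. intros; apply UD_and; apply UD_imp; assumption. Qed.

Lemma UD_ex (A : forall N : universe, (nat -> N) -> N -> Prop) :
  UD (fun N v => A N (fun k => v (S k)) (v 0)) -> UD (fun N v => exists x, A N v x).
Proof.
intros [q H]. exists (Exs q). intros N v; simpl.
split; intros [x K]; exists x; apply (H N (x .: v)); exact K.
Qed.

Lemma UD_all (A : forall N : universe, (nat -> N) -> N -> Prop) :
  UD (fun N v => A N (fun k => v (S k)) (v 0)) -> UD (fun N v => forall x, A N v x).
Proof.
intro H. apply UD_ext with (fun N v => ~ exists x, ~ A N v x).
- intros; split; [|firstorder]. intros K x. apply NNPP. firstorder.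
- apply UD_not, (@UD_ex (fun N v x => ~ A N v x)), UD_not, H.
Qed.

Lemma UD_true : UD (fun N v => True).
Proof. exists (Eql (inl 0) (inl 0)); simpl; tauto. Qed.

Lemma UD_false : UD (fun N v => False).
Proof. apply (UD_ext (A := fun N v => ~ True)); [tauto|]. apply UD_not, UD_true. Qed.

Lemma UD_ren A (s : nat -> nat) : UD A -> UD (fun N v => A N (fun i => v (s i))).
Proof.
intros [q H]. exists (fsub (fun i => inl (s i)) (@noc _) q). intros N v.
rewrite fsat_sub, H. apply fsat_noc.
Qed.

End UDclosure.

Section dfnclosure.
Variable M : universe.
Implicit Types A B : (nat -> M) -> Prop.

Lemma dfn_ext A B : (forall v, A v <-> B v) -> dfn A -> dfn B.
Proof. intros E [q H]. exists q. intros v. rewrite <- E. apply H. Qed.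

Lemma dfn_mem s t : tm s -> tm t -> dfn (fun v : nat -> M => s v ∈ t v).
Proof. intros [a H] [b G]. exists (Mem a b); intro v; simpl. rewrite H, G. tauto. Qed.

Lemma dfn_eq s t : tm s -> tm t -> dfn (fun v : nat -> M => s v = t v).
Proof. intros [a H] [b G]. exists (Eql a b); intro v; simpl. rewrite H, G. tauto. Qed.

Lemma dfn_not A : dfn A -> dfn (fun v => ~ A v).
Proof. intros [q H]. exists (Neg q). intros; simpl. rewrite H; tauto. Qed.

Lemma dfn_and A B : dfn A -> dfn B -> dfn (fun v => A v /\ B v).
Proof. intros [q H] [r G]. exists (And q r). intros; simpl. rewrite H, G; tauto. Qed.

Lemma dfn_or A B : dfn A -> dfn B -> dfn (fun v => A v \/ B v).
Proof.
intros H G. apply dfn_ext with (fun v => ~ (~ A v /\ ~ B v)).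
- intros; split; [|tauto]. intro K. apply NNPP. tauto.
- apply dfn_not, dfn_and; apply dfn_not; assumption.
Qed.

Lemma dfn_imp A B : dfn A -> dfn B -> dfn (fun v => A v -> B v).
Proof.
intros H G. apply dfn_ext with (fun v => ~ A v \/ B v).
- intros; split; [tauto|]. intro K. destruct (classic (A v)); tauto.
- apply dfn_or; [apply dfn_not|]; assumption.
Qed.

Lemma dfn_iff A B : dfn A -> dfn B -> dfn (fun v => A v <-> B v).
Proof. intros; apply dfn_and; apply dfn_imp; assumption. Qed.

Lemma dfn_ex (A : (nat -> M) -> M -> Prop) :
  dfn (fun v => A (fun k => v (S k)) (v 0)) -> dfn (fun v => exists x, A v x).
Proof.
intros [q H]. exists (Exs q). intros v; simpl.
split; intros [x K]; exists x; apply (H (x .: v)); exact K.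
Qed.

Lemma dfn_all (A : (nat -> M) -> M -> Prop) :
  dfn (fun v => A (fun k => v (S k)) (v 0)) -> dfn (fun v => forall x, A v x).
Proof.
intro H. apply dfn_ext with (fun v => ~ exists x, ~ A v x).
- intros; split; [|firstorder]. intros K x. apply NNPP. firstorder.
- apply dfn_not, (@dfn_ex (fun v x => ~ A v x)), dfn_not, H.
Qed.

(** A proposition in which no variable occurs is decided classically and becomes a trivially true or
    trivially false formula. The automation falls back on it, so conditions on fixed parameters may
    have any form. *)
Lemma dfn_prop (P : Prop) : dfn (fun v : nat -> M => P).
Proof.
destruct (classic P) as [H|H].
- exists (Eql (inl 0) (inl 0)); simpl; tauto.
- exists (Neg (Eql (inl 0) (inl 0))); simpl; tauto.
Qed.

Lemma dfn_sub A (s : nat -> (nat -> M) -> M) : (forall i, tm (s i)) -> dfn A ->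
  dfn (fun v => A (fun i => s i v)).
Proof.
intros T [q H].
destruct (constructive_indefinite_description _
  (choice (fun i t => forall v, s i v = teval (fun x => x) t v) T)) as [t E].
exists (fsub t (fun c => inr c) q). intro v. rewrite fsat_sub, H.
replace (fun i => teval (fun x => x) (t i) v) with (fun i => s i v); [reflexivity|].
apply functional_extensionality; intro; apply E.
Qed.

Lemma dfn_UD (P : forall N : universe, (nat -> N) -> Prop) (s : nat -> (nat -> M) -> M) :
  (forall i, tm (s i)) -> UD P -> dfn (fun v => P M (fun i => s i v)).
Proof.
intros T [q H]. apply (@dfn_sub (P M)); [assumption|].
exists (fsub (fun i => inl i) (@noc _) q). intros v. rewrite fsat_sub, H. apply fsat_noc.
Qed.

End dfnclosure.

Definition dfn1 (M : universe) (P : M -> Prop) := dfn (fun v : nat -> M => P (v 0)).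
Definition dfn2 (M : universe) (P : M -> M -> Prop) :=
  dfn (fun v : nat -> M => P (v 0) (v 1)).
Definition dfn3 (M : universe) (P : M -> M -> M -> Prop) :=
  dfn (fun v : nat -> M => P (v 0) (v 1) (v 2)).

Definition UD1 (P : forall N : universe, N -> Prop) := UD (fun N v => P N (v 0)).
Definition UD2 (P : forall N : universe, N -> N -> Prop) := UD (fun N v => P N (v 0) (v 1)).
Definition UD3 (P : forall N : universe, N -> N -> N -> Prop) :=
  UD (fun N v => P N (v 0) (v 1) (v 2)).
Definition UD4 (P : forall N : universe, N -> N -> N -> N -> Prop) :=
  UD (fun N v => P N (v 0) (v 1) (v 2) (v 3)).
Definition UD5 (P : forall N : universe, N -> N -> N -> N -> N -> Prop) :=
  UD (fun N v => P N (v 0) (v 1) (v 2) (v 3) (v 4)).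
Definition UD6 (P : forall N : universe, N -> N -> N -> N -> N -> N -> Prop) :=
  UD (fun N v => P N (v 0) (v 1) (v 2) (v 3) (v 4) (v 5)).
Existing Class UD1. Existing Class UD2. Existing Class UD3.
Existing Class UD4. Existing Class UD5. Existing Class UD6.

(** Six entries, the last repeated forever: an environment, or a renaming, for predicates of at most
    six arguments. *)
Definition sel (T : Type) (a b c d e f : T) (i : nat) : T :=
  match i with 0 => a | 1 => b | 2 => c | 3 => d | 4 => e | _ => f end.

Lemma sel_all (T : Type) (P : T -> Prop) a b c d e f :
  P a -> P b -> P c -> P d -> P e -> P f -> forall i, P (sel a b c d e f i).
Proof. intros. do 5 (destruct i as [|i]; [assumption|]). assumption. Qed.

Lemma UD_app1 P : UD1 P -> forall a, UD (fun N v => P N (v a)).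
Proof. intros H a. exact (UD_ren (sel a a a a a a) H). Qed.
Lemma UD_app2 P : UD2 P -> forall a b, UD (fun N v => P N (v a) (v b)).
Proof. intros H a b. exact (UD_ren (sel a b a a a a) H). Qed.
Lemma UD_app3 P : UD3 P -> forall a b c, UD (fun N v => P N (v a) (v b) (v c)).
Proof. intros H a b c. exact (UD_ren (sel a b c a a a) H). Qed.
Lemma UD_app4 P : UD4 P -> forall a b c d, UD (fun N v => P N (v a) (v b) (v c) (v d)).
Proof. intros H a b c d. exact (UD_ren (sel a b c d a a) H). Qed.
Lemma UD_app5 P : UD5 P ->
  forall a b c d e, UD (fun N v => P N (v a) (v b) (v c) (v d) (v e)).
Proof. intros H a b c d e. exact (UD_ren (sel a b c d e a) H). Qed.
Lemma UD_app6 P : UD6 P ->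
  forall a b c d e f, UD (fun N v => P N (v a) (v b) (v c) (v d) (v e) (v f)).
Proof. intros H a b c d e f. exact (UD_ren (sel a b c d e f) H). Qed.

Section dfn_app.
Variable M : universe.
Implicit Types a b c d e f : (nat -> M) -> M.

Lemma dfn_UD1 P : UD1 P -> forall a, tm a -> dfn (fun v => P M (a v)).
Proof.
intros H a Ha.
exact (dfn_UD (s := sel a a a a a a) (@sel_all _ _ _ _ _ _ _ _ Ha Ha Ha Ha Ha Ha) H).
Qed.
Lemma dfn_UD2 P : UD2 P -> forall a b, tm a -> tm b -> dfn (fun v => P M (a v) (b v)).
Proof.
intros H a b Ha Hb.
exact (dfn_UD (s := sel a b a a a a) (@sel_all _ _ _ _ _ _ _ _ Ha Hb Ha Ha Ha Ha) H).
Qed.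
Lemma dfn_UD3 P : UD3 P -> forall a b c, tm a -> tm b -> tm c ->
  dfn (fun v => P M (a v) (b v) (c v)).
Proof.
intros H a b c Ha Hb Hc.
exact (dfn_UD (s := sel a b c a a a) (@sel_all _ _ _ _ _ _ _ _ Ha Hb Hc Ha Ha Ha) H).
Qed.
Lemma dfn_UD4 P : UD4 P -> forall a b c d, tm a -> tm b -> tm c -> tm d ->
  dfn (fun v => P M (a v) (b v) (c v) (d v)).
Proof.
intros H a b c d Ha Hb Hc Hd.
exact (dfn_UD (s := sel a b c d a a) (@sel_all _ _ _ _ _ _ _ _ Ha Hb Hc Hd Ha Ha) H).
Qed.
Lemma dfn_UD5 P : UD5 P -> forall a b c d e, tm a -> tm b -> tm c -> tm d -> tm e ->
  dfn (fun v => P M (a v) (b v) (c v) (d v) (e v)).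
Proof.
intros H a b c d e Ha Hb Hc Hd He.
exact (dfn_UD (s := sel a b c d e a) (@sel_all _ _ _ _ _ _ _ _ Ha Hb Hc Hd He Ha) H).
Qed.
Lemma dfn_UD6 P : UD6 P ->
  forall a b c d e f, tm a -> tm b -> tm c -> tm d -> tm e -> tm f ->
  dfn (fun v => P M (a v) (b v) (c v) (d v) (e v) (f v)).
Proof.
intros H a b c d e f Ha Hb Hc Hd He Hf.
exact (dfn_UD (s := sel a b c d e f) (@sel_all _ _ _ _ _ _ _ _ Ha Hb Hc Hd He Hf) H).
Qed.

Lemma dfn_app1 P : @dfn1 M P -> forall a, tm a -> dfn (fun v => P (a v)).
Proof.
intros H a Ha. exact (dfn_sub (s := sel a a a a a a) (@sel_all _ _ _ _ _ _ _ _ Ha Ha Ha Ha Ha Ha) H).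
Qed.
Lemma dfn_app2 P : @dfn2 M P -> forall a b, tm a -> tm b -> dfn (fun v => P (a v) (b v)).
Proof.
intros H a b Ha Hb.
exact (dfn_sub (s := sel a b a a a a) (@sel_all _ _ _ _ _ _ _ _ Ha Hb Ha Ha Ha Ha) H).
Qed.
Lemma dfn_app3 P : @dfn3 M P -> forall a b c, tm a -> tm b -> tm c ->
  dfn (fun v => P (a v) (b v) (c v)).
Proof.
intros H a b c Ha Hb Hc.
exact (dfn_sub (s := sel a b c a a a) (@sel_all _ _ _ _ _ _ _ _ Ha Hb Hc Ha Ha Ha) H).
Qed.
End dfn_app.

Create HintDb ud.
Ltac ud_inst := solve [typeclasses eauto].

(** Definability is read off the shape of a statement, with one instance for each defined predicate.
    An implication is a product without dependency, so it is tried before universal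
    quantification. *)
Ltac ud := cbv beta; cbv delta [unique]; cbv beta;
  first [ solve [auto with ud] |
  lazymatch goal with
  | |- UD (fun N v => @?A N v /\ @?B N v) => apply (@UD_and A B); ud
  | |- UD (fun N v => @?A N v \/ @?B N v) => apply (@UD_or A B); ud
  | |- UD (fun N v => ~ @?A N v) => apply (@UD_not A); ud
  | |- UD (fun N v => @?A N v <-> @?B N v) => apply (@UD_iff A B); ud
  | |- UD (fun N v => exists x, @?A N v x) => apply (@UD_ex A); ud
  | |- UD (fun N v => True) => exact UD_true
  | |- UD (fun N v => False) => exact UD_false
  | |- UD (fun N v => _ ∈ _) => apply UD_mem
  | |- UD (fun N v => _ = _) => apply UD_eq
  | |- UD (fun N v => forall x, @?A N v x) =>
      first [ (match goal with
               | |- UD (fun N v => @?A N v -> @?B N v) => apply (@UD_imp A B); ud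
               end)
            | apply (@UD_all A); ud ]
  | |- UD (fun N v => ?F N _) => apply (@UD_app1 F ltac:(ud_inst))
  | |- UD (fun N v => ?F N _ _) => apply (@UD_app2 F ltac:(ud_inst))
  | |- UD (fun N v => ?F N _ _ _) => apply (@UD_app3 F ltac:(ud_inst))
  | |- UD (fun N v => ?F N _ _ _ _) => apply (@UD_app4 F ltac:(ud_inst))
  | |- UD (fun N v => ?F N _ _ _ _ _) => apply (@UD_app5 F ltac:(ud_inst))
  | |- UD (fun N v => ?F N _ _ _ _ _ _) => apply (@UD_app6 F ltac:(ud_inst))
  end ].

Ltac tms := first [apply tm_var | apply tm_cst].

Ltac df := cbv beta; cbv delta [unique]; cbv beta;
  first [ solve [auto with ud] |
  lazymatch goal with
  | |- dfn1 _ => unfold dfn1; df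
  | |- dfn2 _ => unfold dfn2; df
  | |- dfn3 _ => unfold dfn3; df
  | |- dfn (fun v => @?A v /\ @?B v) => apply (@dfn_and _ A B); df
  | |- dfn (fun v => @?A v \/ @?B v) => apply (@dfn_or _ A B); df
  | |- dfn (fun v => ~ @?A v) => apply (@dfn_not _ A); df
  | |- dfn (fun v => @?A v <-> @?B v) => apply (@dfn_iff _ A B); df
  | |- dfn (fun v => exists x, @?A v x) => apply (@dfn_ex _ A); df
  | |- dfn (fun v => @?a v ∈ @?b v) => apply (@dfn_mem _ a b); tms
  | |- dfn (fun v => @?a v = @?b v) => apply (@dfn_eq _ a b); tms
  | |- dfn (fun v => forall x, @?A v x) =>
      first [ (match goal with
               | |- dfn (fun v => @?A v -> @?B v) => apply (@dfn_imp _ A B); df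
               end)
            | apply (@dfn_all _ A); df ]
  | |- _ => df_head
  end | apply dfn_prop ]
with df_head :=
  match goal with
  | |- @dfn ?M (fun v => ?F ?M (@?a v) (@?b v) (@?c v) (@?d v) (@?e v) (@?f v)) =>
      apply (@dfn_UD6 M F ltac:(ud_inst) a b c d e f); tms
  | |- @dfn ?M (fun v => ?F ?M (@?a v) (@?b v) (@?c v) (@?d v) (@?e v)) =>
      apply (@dfn_UD5 M F ltac:(ud_inst) a b c d e); tms
  | |- @dfn ?M (fun v => ?F ?M (@?a v) (@?b v) (@?c v) (@?d v)) =>
      apply (@dfn_UD4 M F ltac:(ud_inst) a b c d); tms
  | |- @dfn ?M (fun v => ?F ?M (@?a v) (@?b v) (@?c v)) =>
      apply (@dfn_UD3 M F ltac:(ud_inst) a b c); tms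
  | |- @dfn ?M (fun v => ?F ?M (@?a v) (@?b v)) =>
      apply (@dfn_UD2 M F ltac:(ud_inst) a b); tms
  | |- @dfn ?M (fun v => ?F ?M (@?a v)) =>
      apply (@dfn_UD1 M F ltac:(ud_inst) a); tms
  | |- @dfn ?M (fun v => ?F (@?a v) (@?b v) (@?c v)) => apply (@dfn_app3 M F); [df_hyp | tms ..]
  | |- @dfn ?M (fun v => ?F (@?a v) (@?b v)) => apply (@dfn_app2 M F); [df_hyp | tms ..]
  | |- @dfn ?M (fun v => ?F (@?a v)) => apply (@dfn_app1 M F); [df_hyp | tms ..]
  end
with df_hyp := first [assumption | solve [auto with ud] | df].

#[global] Hint Resolve UD_mem UD_eq UD_true UD_false : ud.

#[global] Instance UD_subset : UD2 (@subset).
Proof. unfold UD2, subset. ud. Qed.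
#[global] Instance UD_empty : UD1 (@is_empty).
Proof. unfold UD1, is_empty. ud. Qed.
#[global] Instance UD_upair : UD3 (@is_upair).
Proof. unfold UD3, is_upair. ud. Qed.
#[global] Instance UD_pair : UD3 (@is_pair).
Proof. unfold UD3, is_pair. ud. Qed.
#[global] Instance UD_succ : UD2 (@is_succ).
Proof. unfold UD2, is_succ. ud. Qed.
Lemma UD_num n : forall i, UD (fun N v => is_num n (v i)).
Proof. induction n; intro i; simpl; ud. Qed.
#[global] Hint Resolve UD_num : ud.
#[global] Instance UD_transitive : UD1 (@transitive).
Proof. unfold UD1, transitive. ud. Qed.
#[global] Instance UD_ordinal : UD1 (@is_ordinal).
Proof. unfold UD1, is_ordinal. ud. Qed.
#[global] Instance UD_natural : UD1 (@is_natural).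
Proof. unfold UD1, is_natural. ud. Qed.
#[global] Instance UD_omega : UD1 (@is_omega).
Proof. unfold UD1, is_omega. ud. Qed.
#[global] Instance UD_app : UD3 (@app).
Proof. unfold UD3, app. ud. Qed.
#[global] Instance UD_function : UD3 (@is_function).
Proof. unfold UD3, is_function. ud. Qed.
#[global] Instance UD_function_on : UD2 (@is_function_on).
Proof. unfold UD2, is_function_on. ud. Qed.
#[global] Instance UD_bijection : UD3 (@is_bijection).
Proof. unfold UD3, is_bijection. ud. Qed.
#[global] Instance UD_restriction : UD3 (@is_restriction).
Proof. unfold UD3, is_restriction. ud. Qed.
#[global] Instance UD_identity : UD2 (@is_identity_on).
Proof. unfold UD2, is_identity_on. ud. Qed.
#[global] Instance UD_cardinal : UD1 (@is_cardinal).
Proof. unfold UD1, is_cardinal. ud. Qed.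
#[global] Instance UD_limit_cardinal : UD1 (@is_limit_cardinal).
Proof. unfold UD1, is_limit_cardinal. ud. Qed.
#[global] Instance UD_V : UD2 (@is_V).
Proof. unfold UD2, is_V. ud. Qed.
#[global] Instance UD_rank : UD2 (@is_rank).
Proof. unfold UD2, is_rank. ud. Qed.
Lemma UD_tagged k i j : UD (fun N v => tagged k (v i) (v j)).
Proof. unfold tagged. ud. Qed.
#[global] Hint Resolve UD_tagged : ud.
#[global] Instance UD_rel_symbol : UD2 (@is_rel_symbol).
Proof. unfold UD2, is_rel_symbol. ud. Qed.
#[global] Instance UD_fun_symbol : UD2 (@is_fun_symbol).
Proof. unfold UD2, is_fun_symbol. ud. Qed.
#[global] Instance UD_language : UD1 (@is_language).
Proof. unfold UD1, is_language. ud. Qed.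
#[global] Instance UD_structure_data : UD4 (@structure_data).
Proof. unfold UD4, structure_data. ud. Qed.
#[global] Instance UD_structure : UD2 (@is_structure).
Proof. unfold UD2, is_structure. ud. Qed.
#[global] Instance UD_term : UD2 (@is_term).
Proof. unfold UD2, is_term. ud. Qed.
#[global] Instance UD_assignment : UD2 (@is_assignment).
Proof. unfold UD2, is_assignment. ud. Qed.
#[global] Instance UD_term_value : UD6 (@term_value).
Proof. unfold UD6, term_value. ud. Qed.
#[global] Instance UD_extension_closed : UD4 (@extension_closed).
Proof. unfold UD4, extension_closed. ud. Qed.
#[global] Instance UD_formula_extension : UD5 (@formula_extension).
Proof. unfold UD5, formula_extension. ud. Qed.
#[global] Instance UD_satisfies : UD4 (@structure_satisfies).
Proof. unfold UD4, structure_satisfies. ud. Qed.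
#[global] Instance UD_elementary_embedding : UD4 (@elementary_embedding).
Proof. unfold UD4, elementary_embedding. ud. Qed.
#[global] Instance UD_seq1 : UD2 (@is_seq1).
Proof. unfold UD2, is_seq1. ud. Qed.
#[global] Instance UD_seq2 : UD3 (@is_seq2).
Proof. unfold UD3, is_seq2. ud. Qed.
#[global] Instance UD_interprets : UD3 (@interprets).
Proof. unfold UD3, interprets. ud. Qed.
#[global] Instance UD_rel1 : UD3 (@rel1).
Proof. unfold UD3, rel1. ud. Qed.
#[global] Instance UD_rel2 : UD4 (@rel2).
Proof. unfold UD4, rel2. ud. Qed.
#[global] Instance UD_fun1 : UD4 (@fun1).
Proof. unfold UD4, fun1. ud. Qed.
Lemma UD_std_symbol k n m i : UD (fun N v => is_std_symbol k n m (v i)).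
Proof. unfold is_std_symbol. ud. Qed.
#[global] Hint Resolve UD_std_symbol : ud.
#[global] Instance UD_mem_symbol : UD1 (@is_mem_symbol).
Proof. unfold UD1, is_mem_symbol. ud. Qed.
#[global] Instance UD_E_symbol : UD1 (@is_E_symbol).
Proof. unfold UD1, is_E_symbol. ud. Qed.
#[global] Instance UD_P_symbol : UD1 (@is_P_symbol).
Proof. unfold UD1, is_P_symbol. ud. Qed.
#[global] Instance UD_f_symbol : UD1 (@is_f_symbol).
Proof. unfold UD1, is_f_symbol. ud. Qed.
#[global] Instance UD_unary_predicate_symbol : UD1 (@is_unary_predicate_symbol).
Proof. unfold UD1, is_unary_predicate_symbol. ud. Qed.
#[global] Instance UD_membership_reduct : UD2 (@has_membership_reduct).
Proof. unfold UD2, has_membership_reduct. ud. Qed.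
#[global] Instance UD_elementary_map : UD3 (@elementary_map).
Proof. unfold UD3, elementary_map. ud. Qed.
#[global] Instance UD_elementary_subset : UD2 (@elementary_subset).
Proof. unfold UD2, elementary_subset. ud. Qed.
#[global] Instance UD_plus : UD4 (@is_plus).
Proof. unfold UD4, is_plus. ud. Qed.
#[global] Instance UD_square_root : UD3 (@is_square_root).
Proof. unfold UD3, is_square_root. ud. Qed.
#[global] Instance UD_has_type : UD4 (@has_type).
Proof. unfold UD4, has_type. ud. Qed.
#[global] Instance UD_Lstar : UD1 (@is_Lstar).
Proof. unfold UD1, is_Lstar. ud. Qed.

Lemma dfn_num (M : universe) n a : tm a -> @dfn M (fun v => is_num n (a v)).
Proof. exact (@dfn_UD1 M (fun N => @is_num N n) (UD_num n 0) a). Qed.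
Lemma dfn_tagged (M : universe) n a b :
  tm a -> tm b -> @dfn M (fun v => tagged n (a v) (b v)).
Proof. exact (@dfn_UD2 M (fun N => @tagged N n) (UD_tagged n 0 1) a b). Qed.
Lemma dfn_std_symbol (M : universe) k n m a :
  tm a -> @dfn M (fun v => is_std_symbol k n m (a v)).
Proof. exact (@dfn_UD1 M (fun N => @is_std_symbol N k n m) (UD_std_symbol k n m 0) a). Qed.
#[global] Hint Resolve tm_var tm_cst : ud.
#[global] Hint Extern 1 (dfn (fun v => is_num _ _)) => apply dfn_num; tms : ud.
#[global] Hint Extern 1 (dfn (fun v => tagged _ _ _)) => apply dfn_tagged; tms : ud.
#[global] Hint Extern 1 (dfn (fun v => is_std_symbol _ _ _ _)) =>
  apply dfn_std_symbol; tms : ud.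

(** * Translation between formulas with named variables and de Bruijn formulas *)

Definition rename1 (i k : nat) : nat + Empty_set :=
  if Nat.eqb k i then inl 0 else inl (S k).

Fixpoint of_form (p : form) : fml Empty_set :=
  let ren i q := fsub (rename1 i) (@noc _) q in
  match p with
  | f_mem i j => Mem (inl i) (inl j)
  | f_eq i j => Eql (inl i) (inl j)
  | f_not q => Neg (of_form q)
  | f_and q r => And (of_form q) (of_form r)
  | f_imp q r => Neg (And (of_form q) (Neg (of_form r)))
  | f_ex i q => Exs (ren i (of_form q))
  | f_all i q => Neg (Exs (ren i (Neg (of_form q))))
  end.

Lemma fsat_rename1 (N : universe) i (q : fml Empty_set) (x : N) v :
  fsat (@noc N) (fsub (rename1 i) (@noc _) q) (x .: v) <-> fsat (@noc N) q (upd v i x).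
Proof.
rewrite fsat_sub.
replace (fun k => teval (@noc N) (rename1 i k) (x .: v)) with (upd v i x); [apply fsat_noc|].
apply functional_extensionality; intro k. unfold upd, rename1.
destruct (Nat.eqb k i); reflexivity.
Qed.

Lemma of_form_sat (N : universe) p : forall v : nat -> N,
  fsat (@noc N) (of_form p) v <-> satisfies (@all_sets N) p v.
Proof.
induction p as [i j|i j|q IH|q IHq r IHr|q IHq r IHr|i q IH|i q IH]; intro v; simpl.
- tauto.
- tauto.
- rewrite IH; tauto.
- rewrite IHq, IHr; tauto.
- rewrite IHq, IHr. split; [|tauto]. intros H K. apply NNPP. tauto.
- split.
  + intros [x H]. exists x. split; [exact I|]. apply IH, fsat_rename1, H.
  + intros [x [_ H]]. exists x. apply fsat_rename1, IH, H.
- split.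
  + intros H x _. apply NNPP; intro K. apply H. exists x. intro L. apply K.
    apply IH, fsat_rename1, L.
  + intros H [x K]. apply K. apply fsat_rename1, IH, H. exact I.
Qed.

Definition nm (r c : nat -> nat) (t : nat + nat) : nat :=
  match t with inl i => r i | inr k => c k end.

(* [r] and [c] name the variables and the constants; the names from [n] on are fresh. *)
Fixpoint to_form (r c : nat -> nat) (n : nat) (q : fml nat) : form :=
  match q with
  | Mem s t => f_mem (nm r c s) (nm r c t)
  | Eql s t => f_eq (nm r c s) (nm r c t)
  | Neg p => f_not (to_form r c n p)
  | And p q => f_and (to_form r c n p) (to_form r c n q)
  | Exs p => f_ex n (to_form (n .: r) c (S n) p)
  end.

Definition tbnd (b b' : nat) (t : nat + nat) : Prop :=
  match t with inl i => i < b | inr k => k < b' end.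

(** [P] depends on the number of variables in scope. The same recursion thus expresses bounds on
    variables and constants as well as agreement of two interpretations of the constants that
    occur. *)
Fixpoint fbnd (K : Type) (P : nat -> nat + K -> Prop) (b : nat) (q : fml K) : Prop :=
  match q with
  | Mem s t | Eql s t => P b s /\ P b t
  | Neg p => fbnd P b p
  | And p q => fbnd P b p /\ fbnd P b q
  | Exs p => fbnd P (S b) p
  end.

Lemma fbnd_mono (K : Type) (P : nat -> nat + K -> Prop) (P' : nat -> nat + K -> Prop) q :
  forall b b', b <= b' -> (forall d d' t, d <= d' -> P d t -> P' d' t) ->
  fbnd P b q -> fbnd P' b' q.
Proof.
induction q; intros b b' L M; simpl.
- intros []; split; eauto.
- intros []; split; eauto.
- eauto.
- intros []; split; eauto.
- apply IHq; [lia|assumption].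
Qed.

Lemma fbnd_ex (q : fml nat) : exists b b', fbnd (fun d => tbnd d b') b q.
Proof.
assert (A : forall s t, exists b b', tbnd b b' s /\ tbnd b b' t).
{ intros [i|i] [j|j]; exists (S (i + j)), (S (i + j)); simpl; lia. }
induction q as [s t|s t|p IH|p IHp r IHr|p IH]; simpl.
- apply A.
- apply A.
- exact IH.
- destruct IHp as [b [b' H]], IHr as [d [d' G]]. exists (b + d), (b' + d').
  split; [revert H | revert G]; apply fbnd_mono; try lia;
    intros ? ? [i|i]; simpl; lia.
- destruct IH as [b [b' H]]. exists b, b'. revert H. apply fbnd_mono; [lia|].
  intros ? ? [i|i]; simpl; lia.
Qed.

Lemma fsat_ext (N : universe) (K : Type) (c c' : K -> N) q : forall b v v',
  fbnd (fun d t => match t with inl i => i < d | inr k => c k = c' k end) b q ->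
  (forall i, i < b -> v i = v' i) -> (fsat c q v <-> fsat c' q v').
Proof.
assert (A : forall b v v' t, match t with inl i => i < b | inr k => c k = c' k end ->
  (forall i, i < b -> v i = v' i) -> teval c t v = teval c' t v').
{ intros b v v' [i|k]; simpl; auto. }
induction q as [s t|s t|p IH|p IHp r IHr|p IH]; intros b v v' B E; simpl in *.
- rewrite (A _ _ _ _ (proj1 B) E), (A _ _ _ _ (proj2 B) E). tauto.
- rewrite (A _ _ _ _ (proj1 B) E), (A _ _ _ _ (proj2 B) E). tauto.
- rewrite (IH _ _ _ B E). tauto.
- rewrite (IHp _ _ _ (proj1 B) E), (IHr _ _ _ (proj2 B) E). tauto.
- assert (E' : forall x, fsat c p (x .: v) <-> fsat c' p (x .: v')).
  { intro x. apply (IH (S b)); [exact B|]. intros [|i] L; simpl; [reflexivity|].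
    apply E. lia. }
  split; intros [x H]; exists x; apply E'; exact H.
Qed.

(** The names of all variables and constants in scope stay below [n], so binding the name [n]
    captures none of them. *)
Lemma to_form_sat (N : universe) (q : fml nat) b' : forall b r c n (w : nat -> N),
  fbnd (fun d => tbnd d b') b q -> (forall i, i < b -> r i < n) ->
  (forall k, k < b' -> c k < n) ->
  (satisfies (@all_sets N) (to_form r c n q) w <->
   fsat (fun k => w (c k)) q (fun i => w (r i))).
Proof.
assert (T : forall r c (w : nat -> N) t,
  w (nm r c t) = teval (fun k => w (c k)) t (fun i => w (r i))).
{ intros r c w [i|i]; reflexivity. }
induction q as [s t|s t|p IH|p IHp q IHq|p IH]; intros b r c n w B R C; simpl.
- rewrite <- !T. tauto.
- rewrite <- !T. tauto.
- rewrite (IH b); auto. tauto.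
- destruct B. rewrite (IHp b), (IHq b); auto. tauto.
- assert (E : forall x, satisfies (@all_sets N) (to_form (n .: r) c (S n) p) (upd w n x) <->
     fsat (fun k => w (c k)) p (x .: (fun i => w (r i)))).
  { intro x. rewrite (IH (S b)).
    - apply fsat_ext with (S b).
      + revert B. simpl. apply fbnd_mono; [lia|]. intros d d' [i|i] L; simpl; [lia|].
        intro H. unfold upd. specialize (C _ H).
        destruct (Nat.eqb_spec (c i) n); [lia|reflexivity].
      + intros [|i] L; simpl; unfold upd.
        * rewrite Nat.eqb_refl. reflexivity.
        * assert (r i < n) by (apply R; lia).
          destruct (Nat.eqb_spec (r i) n); [lia|reflexivity].
    - exact B.
    - intros [|i] L; simpl; [lia|]. assert (r i < n) by (apply R; lia). lia.
    - intros k L. specialize (C _ L). lia. }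
  split.
  + intros [x [_ H]]. exists x. apply E, H.
  + intros [x H]. exists x. split; [exact I|]. apply E, H.
Qed.

Lemma fml_consts (M : universe) (d : M) (q : fml M) :
  exists (q0 : fml nat) (c : nat -> M), forall v,
    fsat (fun x => x) q v <-> fsat c q0 v.
Proof.
assert (A : forall (s t : nat + M), exists (s0 t0 : nat + nat) (c : nat -> M), forall v,
  teval (fun x => x) s v = teval c s0 v /\ teval (fun x => x) t v = teval c t0 v).
{ intros [i|x] [j|y].
  - exists (inl i), (inl j), (fun _ => d). auto.
  - exists (inl i), (inr 0), (fun _ => y). auto.
  - exists (inr 0), (inl j), (fun _ => x). auto.
  - exists (inr 0), (inr 1), (x .: fun _ => y). auto. }
induction q as [s t|s t|p IH|p IHp r IHr|p IH].
- destruct (A s t) as [s0 [t0 [c E]]]. exists (Mem s0 t0), c. intro v; simpl.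
  destruct (E v) as [-> ->]. tauto.
- destruct (A s t) as [s0 [t0 [c E]]]. exists (Eql s0 t0), c. intro v; simpl.
  destruct (E v) as [-> ->]. tauto.
- destruct IH as [q0 [c E]]. exists (Neg q0), c. intro v; simpl. rewrite E; tauto.
- destruct IHp as [p0 [c E]], IHr as [r0 [c' E']].
  (* The two sequences of constants are interleaved: even indices serve the left conjunct, odd ones
     the right. *)
  exists (And (fsub (fun i => inl i) (fun k => inr (2 * k)) p0)
              (fsub (fun i => inl i) (fun k => inr (2 * k + 1)) r0)),
         (fun n => if Nat.even n then c (Nat.div2 n) else c' (Nat.div2 n)).
  intro v. cbn [fsat]. rewrite !fsat_sub. cbn [teval].
  replace (fun k => if Nat.even (2 * k) then c (Nat.div2 (2 * k)) else c' (Nat.div2 (2 * k)))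
    with c; [|apply functional_extensionality; intro k;
      rewrite Nat.even_mul, Nat.div2_double; reflexivity].
  replace (fun k => if Nat.even (2 * k + 1) then c (Nat.div2 (2 * k + 1))
      else c' (Nat.div2 (2 * k + 1)))
    with c'; [|apply functional_extensionality; intro k;
      rewrite Nat.even_add, Nat.even_mul, Nat.add_1_r, Nat.div2_succ_double; reflexivity].
  rewrite E, E'. reflexivity.
- destruct IH as [q0 [c E]]. exists (Exs q0), c. intro v; simpl.
  split; intros [x H]; exists x; apply E; exact H.
Qed.

Lemma fsat_map_noc (N : universe) (q : fml Empty_set) (v : nat -> N) (c : nat -> N) :
  fsat c (fsub (fun i => inl i) (@noc _) q) v <-> fsat (@noc N) q v.
Proof. rewrite fsat_sub. apply fsat_noc. Qed.

Lemma UD_form P : UD P ->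
  exists p : form, forall (N : universe) (v : nat -> N), P N v <-> satisfies (@all_sets N) p v.
Proof.
intros [q H]. set (q' := fsub (fun i => inl i) (@noc (nat + nat)) q).
destruct (fbnd_ex q') as [b [b' B]].
exists (to_form (fun i => i) (fun i => i) (b + b') q'). intros N v.
rewrite (to_form_sat (b' := b') (b := b)); [|exact B|intros; lia|intros; lia].
rewrite H. unfold q'. rewrite fsat_map_noc. reflexivity.
Qed.

(** All de Bruijn variables receive the name 0, so the formula is evaluated in the constant
    environment [z]; the constants occupy the names from 1 on. *)
Lemma dfn1_form (M : universe) (P : M -> Prop) : M -> dfn1 P ->
  exists (p : form) (w : nat -> M), forall z,
    P z <-> satisfies (@all_sets M) p (upd w 0 z).
Proof.
intros d [q H]. destruct (fml_consts d q) as [q0 [c E]].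
destruct (fbnd_ex q0) as [b [b' B]].
exists (to_form (fun i => 0) S (S (S (b + b'))) q0), (d .: c). intros z.
rewrite (to_form_sat (b' := b') (b := b)); [|exact B|intros; lia|intros; lia].
exact (iff_trans (H (fun _ => z)) (E (fun _ => z))).
Qed.

Lemma dfn2_form (M : universe) (P : M -> M -> Prop) : M -> dfn2 P ->
  exists (p : form) (w : nat -> M), forall x y,
    P x y <-> satisfies (@all_sets M) p (upd (upd w 0 x) 1 y).
Proof.
intros d [q H]. destruct (fml_consts d q) as [q0 [c E]].
destruct (fbnd_ex q0) as [b [b' B]].
exists (to_form (0 .: fun i => 1) (fun i => S (S i)) (S (S (S (b + b')))) q0),
  (d .: d .: c). intros x y.
rewrite (to_form_sat (b' := b') (b := b));
  [|exact B|intros [|i] _; simpl; lia|intros; lia].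
replace (fun i => upd (upd (d .: d .: c) 0 x) 1 y ((0 .: (fun _ => 1)) i))
  with (x .: fun _ => y) by (apply functional_extensionality; intros [|i]; reflexivity).
exact (iff_trans (H (x .: fun _ => y)) (E _)).
Qed.

Lemma UD_sat p : UD (fun N v => satisfies (@all_sets N) p v).
Proof. exists (of_form p). intros. symmetry. apply of_form_sat. Qed.

(** * Relativization to classes *)

(** The class [D] becomes a universe of its own. A predicate such as [is_V] or
    [structure_satisfies], instantiated at [subu D], is then its relativization to [D]. *)
Definition subu (M : universe) (D : M -> Prop) : universe :=
  @Universe {x : M | D x} (fun a b => proj1_sig a ∈ proj1_sig b).

Lemma sub_eq (T : Type) (D : T -> Prop) (a b : {x | D x}) :
  proj1_sig a = proj1_sig b -> a = b.
Proof. destruct a, b; simpl; intros ->. f_equal. apply proof_irrelevance. Qed.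

Lemma satisfies_subu (M : universe) (D : M -> Prop) p : forall o : nat -> subu D,
  satisfies (@all_sets (subu D)) p o <-> satisfies D p (fun i => proj1_sig (o i)).
Proof.
assert (U : forall (o : nat -> subu D) i (x : M) (h : D x),
  (fun k => proj1_sig (upd o i (exist D x h) k)) = upd (fun k => proj1_sig (o k)) i x).
{ intros. apply functional_extensionality; intro k. unfold upd.
  destruct (Nat.eqb k i); reflexivity. }
induction p as [i j|i j|q IH|q IHq r IHr|q IHq r IHr|i q IH|i q IH]; intro o; simpl.
- tauto.
- split; [congruence|apply sub_eq].
- rewrite IH; tauto.
- rewrite IHq, IHr; tauto.
- rewrite IHq, IHr; tauto.
- split.
  + intros [[x h] [_ H]]. exists x. split; [exact h|]. apply IH in H. rewrite U in H. exact H.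
  + intros [x [h H]]. exists (exist D x h). split; [exact I|]. apply IH. rewrite U. exact H.
- split.
  + intros H x h. rewrite <- (U o i x h). apply IH, H. exact I.
  + intros H [x h] _. apply IH. rewrite U. apply H, h.
Qed.

Lemma dfn_fsat (M : universe) (q : fml M) : dfn (fsat (fun x : M => x) q).
Proof. exists q. intro; reflexivity. Qed.

Section relativize.
Variables (M : universe) (W : M).
Definition setu : universe := subu (fun x => x ∈ W).
Definition tval (t : nat + setu) : nat + M :=
  match t with inl i => inl i | inr k => inr (proj1_sig k) end.
Fixpoint frel (q : fml setu) : fml M :=
  match q with
  | Mem s t => Mem (tval s) (tval t)
  | Eql s t => Eql (tval s) (tval t)
  | Neg p => Neg (frel p)
  | And p r => And (frel p) (frel r)
  | Exs p => Exs (And (Mem (inl 0) (inr W)) (frel p))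
  end.

Lemma frel_sat q : forall v : nat -> setu,
  fsat (fun x => x) q v <-> fsat (fun x => x) (frel q) (fun i => proj1_sig (v i)).
Proof.
assert (A : forall (v : nat -> setu) t, proj1_sig (teval (fun x => x) t v) =
  teval (fun x : M => x) (tval t) (fun i => proj1_sig (v i))).
{ intros v [i|k]; reflexivity. }
induction q as [s t|s t|p IH|p IHp r IHr|p IH]; intro v; simpl.
- rewrite <- !A. tauto.
- rewrite <- !A. split; [intro E; exact (f_equal (@proj1_sig _ _) E)|apply sub_eq].
- rewrite IH; tauto.
- rewrite IHp, IHr; tauto.
- assert (E : forall x : setu, (fun i => proj1_sig ((x .: v) i)) =
    proj1_sig x .: (fun i => proj1_sig (v i))).
  { intro x; apply functional_extensionality; intros [|i]; reflexivity. }
  split.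
  + intros [x H]. exists (proj1_sig x). split; [exact (proj2_sig x)|].
    apply IH in H. rewrite E in H. exact H.
  + intros [x [h H]]. exists (exist _ x h). apply IH. rewrite E. exact H.
Qed.

(** Bounding all quantifiers by [W] turns a definition inside the structure into one in [M]. For [W]
    closed under subsets this yields full separation in the structure. *)
Lemma dfn1_setu (P : setu -> Prop) : dfn1 P ->
  dfn1 (fun z : M => exists h : z ∈ W, P (exist _ z h)).
Proof.
intros [q H].
assert (D : dfn1 (fun z : M => z ∈ W /\ fsat (fun x => x) (frel q) (fun _ => z))).
{ unfold dfn1. apply dfn_and; [df|].
  exact (@dfn_sub M (fsat (fun x => x) (frel q)) (fun _ v => v 0)
    (fun _ => @tm_var M 0) (dfn_fsat (frel q))). }
revert D. apply dfn_ext. intro v. split.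
- intros [h K]. exists h. apply (H (fun _ => exist _ (v 0) h)), frel_sat, K.
- intros [h K]. split; [exact h|]. apply (H (fun _ => exist _ (v 0) h)) in K.
  apply frel_sat in K. exact K.
Qed.
End relativize.

(** * Set theory without replacement *)

(** This fragment holds in [M] and in the rank levels to which the argument is reflected, so
    whatever is derived from it is available in both. *)
Record Zer (N : universe) : Prop := {
  z_inh : inhabited N;
  z_ext : forall x y : N, (forall z, z ∈ x <-> z ∈ y) -> x = y;
  z_found : forall x : N, (exists y, y ∈ x) ->
    exists y, y ∈ x /\ forall z, z ∈ y -> ~ z ∈ x;
  z_pair : forall x y : N, exists p, is_upair p x y;
  z_union : forall x : N, exists u, forall z, z ∈ u <-> exists y, y ∈ x /\ z ∈ y;
  z_power : forall x : N, exists u, forall z, z ∈ u <-> subset z x;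
  z_sep : forall P : N -> Prop, dfn1 P ->
    forall x, exists y, forall z, z ∈ y <-> z ∈ x /\ P z }.

Existing Class Zer.
Existing Class ZFC.

#[global] Instance ZFC_Zer (M : universe) {H : ZFC M} : Zer M.
Proof.
 destruct (zfc_infinity H) as [w _]. constructor.
- exact (inhabits w).
- apply (zfc_ext H).
- apply (zfc_foundation H).
- apply (zfc_pairing H).
- apply (zfc_union H).
- apply (zfc_power H).
- intros P D x. destruct (dfn1_form w D) as [p [v E]].
  destruct (zfc_separation H p v x) as [y K]. exists y. intro z. rewrite E. apply K.
Qed.

(** * Total set operations, picked by [epsilon] from the existence axioms *)

Section ops.
Variable N : universe.
Definition upr (x y : N) : N := epsilon (inhabits x) (fun p => is_upair p x y).
Definition opr (x y : N) : N := epsilon (inhabits x) (fun p => is_pair p x y).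
Definition sep (x : N) (P : N -> Prop) : N :=
  epsilon (inhabits x) (fun y => forall z, z ∈ y <-> z ∈ x /\ P z).
Definition Un (x : N) : N :=
  epsilon (inhabits x) (fun u => forall z, z ∈ u <-> exists y, y ∈ x /\ z ∈ y).
Definition Pw (x : N) : N := epsilon (inhabits x) (fun u => forall z, z ∈ u <-> subset z x).
Definition adj (x y : N) : N := Un (upr x (upr y y)).
Definition suc (x : N) : N := adj x x.
Definition ap (f x : N) : N := epsilon (inhabits x) (fun y => app f x y).
(** Closure under the empty set and under adjoining one element is all that hereditarily finite
    constructions need: natural numbers, pairs and finite sequences over [S] stay in [S]. Such sets
    bound the codes of terms and formulas. *)
Definition adjcl (S : N) : Prop := (forall e, is_empty e -> e ∈ S) /\
  forall x y z, x ∈ S -> y ∈ S -> (forall w, w ∈ z <-> w ∈ x \/ w = y) -> z ∈ S.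
End ops.
#[global] Instance UD_adjcl : UD1 (@adjcl).
Proof. unfold UD1, adjcl. ud. Qed.

Section Zermelo.
Context {N : universe} {H : Zer N}.
Implicit Types x y z a b c f g p s t u w : N.

Lemma uprE x y z : z ∈ upr x y <-> z = x \/ z = y.
Proof. exact (epsilon_spec (inhabits x) _ (z_pair H x y) z). Qed.
Lemma is_uprE p x y : is_upair p x y <-> p = upr x y.
Proof.
split.
- intro K. apply (z_ext H). intro z. rewrite (K z), uprE. tauto.
- intros -> z. apply uprE.
Qed.
Lemma UnE x z : z ∈ Un x <-> exists y, y ∈ x /\ z ∈ y.
Proof. exact (epsilon_spec (inhabits x) _ (z_union H x) z). Qed.
Lemma PwE x z : z ∈ Pw x <-> subset z x.
Proof. exact (epsilon_spec (inhabits x) _ (z_power H x) z). Qed.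
Lemma sepE x (P : N -> Prop) : dfn1 P -> forall z, z ∈ sep x P <-> z ∈ x /\ P z.
Proof. intros D z. exact (epsilon_spec (inhabits x) _ (z_sep H D x) z). Qed.
Lemma adjE x y z : z ∈ adj x y <-> z ∈ x \/ z = y.
Proof.
unfold adj. rewrite UnE. split.
- intros [u [K L]]. apply uprE in K. destruct K as [->| ->]; [tauto|].
  apply uprE in L. tauto.
- intros [K|K]; [exists x|exists (upr y y)]; rewrite !uprE; tauto.
Qed.
Lemma sucE x z : z ∈ suc x <-> z ∈ x \/ z = x.
Proof. apply adjE. Qed.
Lemma is_succE x s : is_succ s x <-> s = suc x.
Proof.
split.
- intro K. apply (z_ext H). intro z. rewrite (K z), sucE. tauto.
- intros -> z. apply sucE.
Qed.

Lemma is_pair_ex x y : is_pair (upr (upr x x) (upr x y)) x y.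
Proof. exists (upr x x), (upr x y). rewrite !is_uprE. tauto. Qed.
Lemma oprP x y : is_pair (opr x y) x y.
Proof. apply (epsilon_spec (inhabits x) (fun p => is_pair p x y)). eexists. apply is_pair_ex. Qed.
Lemma opr_upr x y : opr x y = upr (upr x x) (upr x y).
Proof.
destruct (oprP x y) as [a [b [A [B C]]]]. apply is_uprE in A, B, C. subst. exact C.
Qed.
Lemma is_pairE p x y : is_pair p x y <-> p = opr x y.
Proof.
split.
- intros [a [b [A [B C]]]]. apply is_uprE in A, B, C. subst. symmetry. apply opr_upr.
- intros ->. apply oprP.
Qed.
Lemma upr_eq x y z w : upr x y = upr z w -> (x = z /\ y = w) \/ (x = w /\ y = z).
Proof.
intro E.
assert (A := uprE x y x). assert (B := uprE x y y).
assert (C := uprE x y z). assert (D := uprE x y w).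
rewrite E, uprE in A. rewrite E, uprE in B. rewrite E, uprE in C. rewrite E, uprE in D.
destruct A as [_ A]; destruct B as [_ B]; destruct C as [C _]; destruct D as [D _].
specialize (A (or_introl eq_refl)). specialize (B (or_intror eq_refl)).
specialize (C (or_introl eq_refl)). specialize (D (or_intror eq_refl)).
intuition congruence.
Qed.
Lemma opr_inj x y z w : opr x y = opr z w -> x = z /\ y = w.
Proof.
rewrite !opr_upr. intro E. apply upr_eq in E. destruct E as [[E F]|[E F]].
- apply upr_eq in E, F. intuition congruence.
- apply upr_eq in E, F. intuition congruence.
Qed.
Lemma appE f x y : app f x y <-> opr x y ∈ f.
Proof.
unfold app. split.
- intros [p [K L]]. apply is_pairE in K. subst. exact L.
- intro K. exists (opr x y). split; [apply oprP|exact K].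
Qed.

Lemma set_ext x y : (forall z, z ∈ x <-> z ∈ y) -> x = y.
Proof. apply (z_ext H). Qed.
Definition emp : N := epsilon (z_inh H) (@is_empty N).
Lemma empE z : ~ z ∈ emp.
Proof.
revert z. apply (epsilon_spec (z_inh H) (@is_empty N)).
destruct (z_inh H) as [d]. exists (sep d (fun _ => False)). intros z K.
apply sepE in K; [tauto|]. df.
Qed.
Lemma is_empE e : is_empty e <-> e = emp.
Proof.
split.
- intro K. apply set_ext. intro z. specialize (K z). specialize (@empE z). tauto.
- intros -> z. apply empE.
Qed.

Fixpoint num (n : nat) : N := match n with 0 => emp | S n => suc (num n) end.
Lemma is_numE n : forall x, is_num n x <-> x = num n.
Proof.
induction n as [|n IH]; intro x; simpl; [apply is_empE|].
split.
- intros [y [K L]]. apply IH in K. apply is_succE in L. congruence.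
- intros ->. exists (num n). rewrite IH, is_succE. tauto.
Qed.
Lemma taggedE k x c : tagged k x c <-> c = opr (num k) x.
Proof.
unfold tagged. split.
- intros [t [K L]]. apply is_numE in K. apply is_pairE in L. congruence.
- intros ->. exists (num k). rewrite is_numE, is_pairE. tauto.
Qed.

Lemma mem_irr x : ~ x ∈ x.
Proof.
intro K. destruct (z_found H (x := upr x x)) as [y [A B]].
- exists x. apply uprE. tauto.
- apply uprE in A. assert (y = x) by tauto. subst. apply (B x K), uprE. tauto.
Qed.
Lemma mem_asym x y : x ∈ y -> ~ y ∈ x.
Proof.
intros K L. destruct (z_found H (x := upr x y)) as [z [A B]].
- exists x. apply uprE. tauto.
- apply uprE in A. destruct A as [->| ->].
  + apply (B y L), uprE. tauto.
  + apply (B x K), uprE. tauto.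
Qed.

Definition prod_ex a b : exists u, forall z, z ∈ u <-> exists x y, x ∈ a /\ y ∈ b /\ z = opr x y.
Proof.
assert (D : dfn1 (fun z => exists x y, x ∈ a /\ y ∈ b /\ is_pair z x y)) by df.
exists (sep (Pw (Pw (Un (upr a b)))) (fun z => exists x y, x ∈ a /\ y ∈ b /\ is_pair z x y)).
intro z. rewrite sepE; [|exact D]. split.
- intros [_ [x [y [A [B C]]]]]. exists x, y. apply is_pairE in C. tauto.
- intros [x [y [A [B ->]]]]. split.
  + apply PwE. intros u K. rewrite opr_upr in K. apply uprE in K. apply PwE.
    intros w L. apply UnE.
    destruct K as [->| ->]; apply uprE in L; destruct L as [->| ->];
      first [exists a; rewrite uprE; tauto | exists b; rewrite uprE; tauto].
  + exists x, y. rewrite is_pairE. tauto.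
Qed.
Definition prod a b : N :=
  epsilon (inhabits a) (fun u => forall z, z ∈ u <-> exists x y, x ∈ a /\ y ∈ b /\ z = opr x y).
Lemma prodE a b z : z ∈ prod a b <-> exists x y, x ∈ a /\ y ∈ b /\ z = opr x y.
Proof. exact (epsilon_spec (inhabits a) _ (prod_ex a b) z). Qed.
Lemma prod_opr a b x y : opr x y ∈ prod a b <-> x ∈ a /\ y ∈ b.
Proof.
rewrite prodE. split; [|intros []; eauto].
intros [x' [y' [A [B C]]]]. apply opr_inj in C. destruct C; subst; tauto.
Qed.

Lemma rel_ex a b (R : N -> N -> Prop) : dfn2 R ->
  exists f, (forall x y, app f x y <-> x ∈ a /\ y ∈ b /\ R x y) /\ subset f (prod a b).
Proof.
intro D. assert (D' : dfn1 (fun z => exists x y, is_pair z x y /\ R x y)) by df.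
exists (sep (prod a b) (fun z => exists x y, is_pair z x y /\ R x y)).
split.
- intros x y. rewrite appE, sepE, prod_opr; [|exact D']. split.
  + intros [[A B] [x' [y' [C E]]]]. apply is_pairE in C. apply opr_inj in C.
    destruct C; subst; tauto.
  + intros [A [B C]]. split; [tauto|]. exists x, y. split; [apply oprP|exact C].
- intros z K. apply sepE in K; tauto.
Qed.

(** The codomain is prescribed, so the graph is separated from a product and replacement is
    avoided. *)
Lemma fun_ex a b (R : N -> N -> Prop) : dfn2 R ->
  (forall x, x ∈ a -> exists! y, y ∈ b /\ R x y) ->
  exists f, is_function f a b /\ forall x y, app f x y <-> x ∈ a /\ y ∈ b /\ R x y.
Proof.
intros D U. destruct (rel_ex a b D) as [f [A B]]. exists f. split; [|exact A]. split.
- intros p K. apply B in K. apply prodE in K. destruct K as [x [y [K [L ->]]]].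
  exists x, y. split; [exact K|]. split; [exact L|apply oprP].
- intros x K. destruct (U x K) as [y [[Y R1] Q]]. exists y. split.
  + apply A. tauto.
  + intros y' L. apply A in L. apply Q. tauto.
Qed.

Lemma fun_app f a b x : is_function f a b -> x ∈ a -> app f x (ap f x).
Proof.
intros [_ F] K. destruct (F x K) as [y [L _]].
exact (epsilon_spec (inhabits x) _ (ex_intro _ y L)).
Qed.
Lemma fun_dom f a b x y : is_function f a b -> app f x y -> x ∈ a /\ y ∈ b.
Proof.
intros [F _] K. apply appE in K. destruct (F _ K) as [x' [y' [A [B C]]]].
apply is_pairE in C. apply opr_inj in C. destruct C; subst; tauto.
Qed.
Lemma fun_val f a b x y : is_function f a b -> app f x y -> y = ap f x.
Proof.
intros F K. assert (X := proj1 (fun_dom F K)). assert (L := fun_app F X).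
destruct F as [_ F]. destruct (F x X) as [z [_ Q]].
rewrite <- (Q _ K), <- (Q _ L). reflexivity.
Qed.
Lemma fun_unique f a b x y y' : is_function f a b -> app f x y -> app f x y' -> y = y'.
Proof. intros F K L. rewrite (fun_val F K), (fun_val F L). reflexivity. Qed.
Lemma fun_ap_in f a b x : is_function f a b -> x ∈ a -> ap f x ∈ b.
Proof. intros F K. exact (proj2 (fun_dom F (fun_app F K))). Qed.
Lemma fun_appE f a b x y : is_function f a b -> x ∈ a -> (app f x y <-> y = ap f x).
Proof. intros F K. split; [intro E; exact (fun_val F E)|]. intros ->. exact (fun_app F K). Qed.
Lemma fun_mem f a b z : is_function f a b ->
  (z ∈ f <-> exists x, x ∈ a /\ z = opr x (ap f x)).
Proof.
intro F. split.
- intro K. destruct (proj1 F _ K) as [x [y [A [B C]]]]. apply is_pairE in C. subst.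
  exists x. split; [exact A|]. f_equal. apply (fun_val F). apply appE, K.
- intros [x [A ->]]. apply appE. exact (fun_app F A).
Qed.
Lemma fun_ext f g a b b' : is_function f a b -> is_function g a b' ->
  (forall x, x ∈ a -> ap f x = ap g x) -> f = g.
Proof.
intros F G E. apply set_ext. intro z. rewrite (fun_mem _ F), (fun_mem _ G).
split; intros [x [A B]]; exists x; split; try exact A; rewrite B, E; auto.
Qed.
Lemma fun_widen f a b b' : is_function f a b -> subset b b' -> is_function f a b'.
Proof.
intros [F G] S. split; [|exact G]. intros p K. destruct (F p K) as [x [y [A [B C]]]].
exists x, y. auto.
Qed.
Lemma fun_range f a b b' : is_function f a b -> (forall x, x ∈ a -> ap f x ∈ b') ->
  is_function f a b'.
Proof.
intros F R. split; [|exact (proj2 F)]. intros p K. apply (fun_mem _ F) in K.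
destruct K as [x [A ->]]. exists x, (ap f x). split; [exact A|]. split; [auto|apply oprP].
Qed.
Lemma restr_ex f a : exists g, is_restriction f a g.
Proof.
assert (D : dfn1 (fun p => exists x y, x ∈ a /\ is_pair p x y)) by df.
exists (sep f (fun p => exists x y, x ∈ a /\ is_pair p x y)).
intro p. apply (sepE _ D).
Qed.
Lemma restr_app f a g : is_restriction f a g ->
  forall x y, app g x y <-> app f x y /\ x ∈ a.
Proof.
intros R x y. rewrite !appE, (R (opr x y)). split.
- intros [A [x' [y' [B C]]]]. apply is_pairE in C. apply opr_inj in C. destruct C; subst; tauto.
- intros [A B]. split; [exact A|]. exists x, y. split; [exact B|apply oprP].
Qed.
Lemma restr_fun f a b a' g : is_function f a b -> is_restriction f a' g -> subset a' a ->
  is_function g a' b /\ forall x, x ∈ a' -> ap g x = ap f x.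
Proof.
intros F R S.
assert (G : is_function g a' b).
{ split.
  - intros p K. apply R in K. destruct K as [K [x [y [A B]]]]. exists x, y.
    split; [exact A|]. split; [|exact B]. apply is_pairE in B; subst.
    apply appE in K. exact (proj2 (fun_dom F K)).
  - intros x K. exists (ap f x). split.
    + apply (restr_app R). split; [exact (fun_app F (S _ K))|exact K].
    + intros y L. apply (restr_app R) in L. symmetry. apply (fun_val F). tauto. }
split; [exact G|]. intros x K. symmetry. apply (fun_val G). apply (restr_app R).
split; [exact (fun_app F (S _ K))|exact K].
Qed.
Lemma restr_unique f a g g' : is_restriction f a g -> is_restriction f a g' -> g = g'.
Proof. intros A B. apply set_ext. intro z. rewrite (A z), (B z). tauto. Qed.
Lemma bij_inj f a b x y : is_bijection f a b -> x ∈ a -> y ∈ a -> ap f x = ap f y -> x = y.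
Proof.
intros [F B] X Y E. destruct (B (ap f x) (fun_ap_in F X)) as [z [_ Q]].
rewrite <- (Q x), <- (Q y); [reflexivity| |exact (fun_app F X)].
rewrite E. exact (fun_app F Y).
Qed.
Lemma bij_surj f a b y : is_bijection f a b -> y ∈ b -> exists x, x ∈ a /\ ap f x = y.
Proof.
intros [F B] Y. destruct (B y Y) as [x [K _]]. exists x. split.
- exact (proj1 (fun_dom F K)).
- symmetry. exact (fun_val F K).
Qed.
Lemma bij_mk f a b : is_function f a b ->
  (forall x y, x ∈ a -> y ∈ a -> ap f x = ap f y -> x = y) ->
  (forall y, y ∈ b -> exists x, x ∈ a /\ ap f x = y) -> is_bijection f a b.
Proof.
intros F I S. split; [exact F|]. intros y Y. destruct (S y Y) as [x [X E]].
exists x. split.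
- rewrite <- E. exact (fun_app F X).
- intros x' K. apply I; [exact X|exact (proj1 (fun_dom F K))|].
  rewrite E. exact (fun_val F K).
Qed.

End Zermelo.

(** * Ordinals *)

Section Ordinals.
Context {N : universe} {H : Zer N}.
Implicit Types x y z a b c f g p s t u w n m : N.

Lemma set_min (P : N -> Prop) s : dfn1 P -> (exists x, x ∈ s /\ P x) ->
  exists x, x ∈ s /\ P x /\ forall y, y ∈ x -> y ∈ s -> ~ P y.
Proof.
intros D [x [A B]]. destruct (z_found H (x := sep s P)) as [y [C E]].
- exists x. apply sepE; auto.
- apply sepE in C; [|exact D]. exists y. split; [tauto|]. split; [tauto|].
  intros z F G K. apply (E z F). apply sepE; auto.
Qed.

Lemma ord_trans a : is_ordinal a -> transitive a.
Proof. intros []; assumption. Qed.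
Lemma ord_el a x : is_ordinal a -> x ∈ a -> is_ordinal x.
Proof.
intros [T E] K. split; [exact (E x K)|]. intros y L. apply E. exact (T x K y L).
Qed.
Lemma ord_mem_trans a b c : is_ordinal c -> a ∈ b -> b ∈ c -> a ∈ c.
Proof. intros [T _] A B. exact (T b B a A). Qed.
Lemma ord_suc a : is_ordinal a -> is_ordinal (suc a).
Proof.
intros [T E]. split.
- intros y K z L. apply sucE. apply sucE in K. destruct K as [K| ->]; [|tauto].
  left. exact (T y K z L).
- intros x K. apply sucE in K. destruct K as [K| ->]; auto.
Qed.
Lemma suc_mem a : a ∈ suc a.
Proof. apply sucE. tauto. Qed.
Lemma ord_min (P : N -> Prop) : dfn1 P -> (exists a, is_ordinal a /\ P a) ->
  exists a, is_ordinal a /\ P a /\ forall b, b ∈ a -> ~ P b.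
Proof.
intros D [a [A B]]. destruct (set_min (s := suc a) D) as [x [C [E F]]].
- exists a. split; [apply suc_mem|exact B].
- exists x. split; [exact (ord_el (ord_suc A) C)|]. split; [exact E|].
  intros b G. apply F; [exact G|]. exact (ord_mem_trans (ord_suc A) G C).
Qed.
Lemma ord_ind (P : N -> Prop) : dfn1 P ->
  (forall a, is_ordinal a -> (forall b, b ∈ a -> P b) -> P a) ->
  forall a, is_ordinal a -> P a.
Proof.
intros D S a A. apply NNPP; intro K.
assert (D' : dfn1 (fun x => ~ P x)) by df.
destruct (ord_min D') as [x [B [C E]]]; [eauto|].
apply C, S; [exact B|]. intros b G. apply NNPP. auto.
Qed.
Lemma ord_tri a b : is_ordinal a -> is_ordinal b -> a ∈ b \/ a = b \/ b ∈ a.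
Proof.
intro A. revert b.
assert (D : dfn1 (fun a => forall b, is_ordinal b -> a ∈ b \/ a = b \/ b ∈ a)) by df.
revert a A. apply (ord_ind D). intros a A IH.
assert (D2 : dfn1 (fun b => a ∈ b \/ a = b \/ b ∈ a)) by df.
apply (ord_ind D2). intros b B IH2. apply NNPP; intro K.
assert (a = b); [|tauto]. apply set_ext. intro z. split; intro Z.
- destruct (IH z Z b B) as [L|[L|L]]; [exact L| |].
  + subst. tauto.
  + exfalso. apply K. right; right. exact (ord_mem_trans A L Z).
- destruct (IH2 z Z) as [L|[L|L]]; [|subst; tauto|exact L].
  exfalso. apply K. left. exact (ord_mem_trans B L Z).
Qed.
Lemma ord_sub a b : is_ordinal a -> is_ordinal b -> (subset a b <-> a ∈ b \/ a = b).
Proof.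
intros A B. split.
- intro S. destruct (ord_tri A B) as [K|[K|K]]; auto. exfalso. exact (mem_irr (S b K)).
- intros [K| ->]; [|intros z; auto]. intros z Z. exact (ord_mem_trans B Z K).
Qed.
Lemma ord_not_mem a b : is_ordinal a -> is_ordinal b -> ~ a ∈ b -> subset b a.
Proof. intros A B K. apply ord_sub; auto. destruct (ord_tri A B) as [L|[->|L]]; tauto. Qed.
Lemma ord_suc_sub a b : is_ordinal b -> a ∈ b -> suc a ∈ b \/ suc a = b.
Proof.
intros B K. assert (A := ord_el B K).
apply ord_sub; [exact (ord_suc A)|exact B|]. intros z Z. apply sucE in Z.
destruct Z as [Z| ->]; [|exact K]. exact (ord_mem_trans B Z K).
Qed.
Lemma ord_Un s : (forall x, x ∈ s -> is_ordinal x) -> is_ordinal (Un s).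
Proof.
intro K. split.
- intros y Y z Z. apply UnE in Y. destruct Y as [x [A B]]. apply UnE. exists x.
  split; [exact A|]. exact (ord_mem_trans (K x A) Z B).
- intros y Y. apply UnE in Y. destruct Y as [x [A B]]. apply (K x A), B.
Qed.
Lemma ord_least_unique (P : N -> Prop) a b : is_ordinal a -> is_ordinal b ->
  P a -> P b -> (forall x, x ∈ a -> ~ P x) -> (forall x, x ∈ b -> ~ P x) -> a = b.
Proof.
intros A B PA PB LA LB. destruct (ord_tri A B) as [K|[K|K]]; [|exact K|].
- exfalso. exact (LB a K PA).
- exfalso. exact (LA b K PB).
Qed.
Lemma emp_ord : is_ordinal emp.
Proof. split; intros x K; exfalso; exact (empE K). Qed.

Lemma nat_ord n : is_natural n -> is_ordinal n.
Proof. intros []; assumption. Qed.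
Lemma nat_emp : is_natural emp.
Proof.
split; [apply emp_ord|]. intros x [K| ->]; [exfalso; exact (empE K)|].
left. apply is_empE. reflexivity.
Qed.
Lemma nat_suc n : is_natural n -> is_natural (suc n).
Proof.
intros [A B]. split; [apply ord_suc, A|]. intros x [K| ->].
- apply B. apply sucE, K.
- right. exists n. apply is_succE. reflexivity.
Qed.
Lemma nat_el n x : is_natural n -> x ∈ n -> is_natural x.
Proof.
intros [A B] K. split; [exact (ord_el A K)|]. intros y [L| ->]; apply B; left; auto.
exact (ord_mem_trans A L K).
Qed.
Lemma nat_case n : is_natural n -> n = emp \/ exists m, is_natural m /\ n = suc m.
Proof.
intro K. destruct (proj2 K n (or_intror eq_refl)) as [E|[m E]].
- left. apply is_empE, E.
- right. apply is_succE in E. exists m. split; [|exact E].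
  apply (nat_el K). subst. apply suc_mem.
Qed.
Lemma nat_ind (P : N -> Prop) : dfn1 P -> P emp ->
  (forall n, is_natural n -> P n -> P (suc n)) -> forall n, is_natural n -> P n.
Proof.
intros D P0 PS n K. generalize (nat_ord K). revert K.
assert (D' : dfn1 (fun n => is_natural n -> P n)) by df.
intros K O. revert K. revert n O. apply (ord_ind D'). intros a A IH K.
destruct (nat_case K) as [->|[m [B ->]]]; [exact P0|].
apply PS; [exact B|]. apply IH; [apply suc_mem|exact B].
Qed.
Lemma num_nat (n : nat) : is_natural (num n).
Proof. induction n; [apply nat_emp|apply nat_suc; assumption]. Qed.
Lemma num_lt (i j : nat) : i < j -> num i ∈ num j.
Proof.
induction j; intro L; [lia|]. simpl. apply sucE.
destruct (Nat.eq_dec i j) as [->|]; [tauto|]. left. apply IHj. lia.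
Qed.
Lemma num_inj (i j : nat) : num i = num j -> i = j.
Proof.
intro E. destruct (Nat.lt_trichotomy i j) as [L|[L|L]]; [|exact L|];
  apply num_lt in L; rewrite E in L; exfalso; exact (mem_irr L).
Qed.
Lemma nat_max n m : is_natural n -> is_natural m ->
  exists k, is_natural k /\ (n ∈ k \/ n = k) /\ (m ∈ k \/ m = k).
Proof.
intros A B. destruct (ord_tri (nat_ord A) (nat_ord B)) as [K|[K|K]].
- exists m; auto.
- exists m; auto.
- exists n; auto.
Qed.

(** Collection over a finite index set, by induction on its length and hence without replacement. It
    bounds the variables on which a term or atomic formula depends, and the stage at which finitely
    many elements of a hull have appeared. *)
Lemma fin_bound (R : N -> N -> Prop) : dfn2 R ->
  (forall k m m', R k m -> m ∈ m' -> is_natural m' -> R k m') ->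
  forall n, is_natural n -> (forall k, k ∈ n -> exists m, is_natural m /\ R k m) ->
  exists m, is_natural m /\ forall k, k ∈ n -> R k m.
Proof.
intros D Mono.
assert (D' : dfn1 (fun n => (forall k, k ∈ n -> exists m, is_natural m /\ R k m) ->
  exists m, is_natural m /\ forall k, k ∈ n -> R k m)) by df.
apply (nat_ind D').
- intros _. exists emp. split; [apply nat_emp|]. intros k K. exfalso; exact (empE K).
- intros n A IH K. destruct IH as [m [B C]].
  { intros k L. apply K. apply sucE. auto. }
  destruct (K n (suc_mem n)) as [m' [B' C']].
  destruct (nat_max B B') as [l [L [L1 L2]]]. exists l. split; [exact L|].
  intros k Q. apply sucE in Q. destruct Q as [Q| ->].
  + destruct L1 as [L1| ->]; [|auto]. apply (Mono k m); auto.
  + destruct L2 as [L2| ->]; [|auto]. apply (Mono n m'); auto.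
Qed.

Section adjclosed.
Variables (S : N) (C : adjcl S).
Lemma adjcl_emp : emp ∈ S.
Proof. apply C, is_empE. reflexivity. Qed.
Lemma adjcl_adj x y : x ∈ S -> y ∈ S -> adj x y ∈ S.
Proof. intros A B. apply (proj2 C x y); auto. intro w. apply adjE. Qed.
Lemma adjcl_upr x y : x ∈ S -> y ∈ S -> upr x y ∈ S.
Proof.
intros A B. replace (upr x y) with (adj (adj emp x) y).
- apply adjcl_adj; [apply adjcl_adj|]; auto. apply adjcl_emp.
- apply set_ext. intro z. rewrite !adjE, uprE. generalize (@empE _ _ z). tauto.
Qed.
Lemma adjcl_opr x y : x ∈ S -> y ∈ S -> opr x y ∈ S.
Proof. intros A B. rewrite opr_upr. apply adjcl_upr; apply adjcl_upr; auto. Qed.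
Lemma adjcl_nat n : is_natural n -> n ∈ S.
Proof.
assert (D : dfn1 (fun n => n ∈ S)) by df. revert n. apply (nat_ind D).
- apply adjcl_emp.
- intros n _ K. apply adjcl_adj; auto.
Qed.
(** Induction on the length: a sequence of length n + 1 is its restriction to n with one more pair
    adjoined. *)
Lemma adjcl_fun n t : is_natural n -> is_function t n S -> t ∈ S.
Proof.
intro A. revert t. revert n A.
assert (D : dfn1 (fun n => forall t, is_function t n S -> t ∈ S)) by df.
apply (nat_ind D).
- intros t F. replace t with emp; [apply adjcl_emp|]. apply set_ext. intro z.
  rewrite (fun_mem _ F). generalize (@empE _ _ z). intro E. split; [tauto|].
  intros [x [K _]]. exfalso; exact (empE K).
- intros n A IH t F. destruct (restr_ex t n) as [g G].
  assert (S' : subset n (suc n)) by (intros z Z; apply sucE; auto).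
  destruct (restr_fun F G S') as [F' E].
  replace t with (adj g (opr n (ap t n))).
  + apply adjcl_adj; [exact (IH g F')|]. apply adjcl_opr; [exact (adjcl_nat A)|].
    apply (fun_ap_in F), suc_mem.
  + apply set_ext. intro z. rewrite adjE, (fun_mem _ F), (fun_mem _ F'). split.
    * intros [[x [X ->]]| ->].
      -- exists x. split; [auto|]. rewrite E; auto.
      -- exists n. split; [apply suc_mem|reflexivity].
    * intros [x [X ->]]. apply sucE in X. destruct X as [X| ->]; [|auto].
      left. exists x. split; [exact X|]. rewrite E; auto.
Qed.
End adjclosed.

Lemma asg_upd U e i x : is_assignment U e -> is_natural i -> x ∈ U ->
  exists e', is_assignment U e' /\ app e' i x /\
    forall k y, k <> i -> (app e k y <-> app e' k y).
Proof.
intros [w [W F]] I X.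
assert (D : dfn2 (fun k y => (k = i /\ y = x) \/ (k <> i /\ app e k y))) by df.
destruct (fun_ex (a := w) (b := U) D) as [e' [F' E]].
- intros k K. destruct (classic (k = i)) as [->|L].
  + exists x. split; [tauto|]. intros y [_ [A|A]]; [symmetry; tauto|tauto].
  + exists (ap e k). split.
    * split; [exact (fun_ap_in F K)|]. right. split; [exact L|exact (fun_app F K)].
    * intros y [_ [A|A]]; [tauto|]. symmetry. exact (fun_val F (proj2 A)).
- exists e'. split; [exists w; auto|]. split.
  + apply E. split; [apply W, I|auto].
  + intros k y L. rewrite E. split; [|tauto]. intro A. destruct (fun_dom F A). tauto.
Qed.

End Ordinals.

(** * The cumulative hierarchy *)

Section Hierarchy.
Context {N : universe} {H : Zer N}.
Implicit Types x y z a b c f g p s t u v w n m h : N.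

Lemma V_ordinal a v : is_V a v -> is_ordinal a.
Proof. intros []; assumption. Qed.

Lemma V_below a v : is_V a v -> exists h, (forall c, c ∈ a -> is_V c (ap h c)) /\
  forall x, x ∈ v <-> exists c, c ∈ a /\ subset x (ap h c).
Proof.
intros [A [s [h [S [[b F] [R E]]]]]]. apply is_succE in S. subst s. exists h.
split.
- intros c C. split; [exact (ord_el A C)|]. exists (suc c).
  destruct (restr_ex h (suc c)) as [g G].
  assert (SS : subset (suc c) (suc a)).
  { intros z Z. apply sucE. apply sucE in Z. left. destruct Z as [Z| ->]; [|exact C].
    exact (ord_mem_trans A Z C). }
  destruct (restr_fun F G SS) as [F' E']. exists g.
  split; [apply is_succE; reflexivity|]. split; [exists b; exact F'|]. split.
  + intros d u K x. apply (restr_app G) in K. destruct K as [K L].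
    rewrite (R d u K x). split.
    * intros [e [t [P [Q T]]]]. exists e, t. split; [exact P|]. split; [|exact T].
      apply (restr_app G). split; [exact Q|].
      exact (ord_mem_trans (ord_suc (ord_el A C)) P L).
    * intros [e [t [P [Q T]]]]. exists e, t. apply (restr_app G) in Q. tauto.
  + rewrite <- (E' c (suc_mem c)). exact (fun_app F' (suc_mem c)).
- intro x. rewrite (R a v E x). split.
  + intros [c [t [C [K L]]]]. exists c. split; [exact C|]. rewrite <- (fun_val F K). exact L.
  + intros [c [C L]]. exists c, (ap h c). split; [exact C|]. split; [|exact L].
    apply (fun_app F). apply sucE. auto.
Qed.

Lemma V_unique a v v' : is_V a v -> is_V a v' -> v = v'.
Proof.
intro K. assert (A := V_ordinal K). revert v v' K. revert a A.
assert (D : dfn1 (fun a => forall v v', is_V a v -> is_V a v' -> v = v')) by df.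
apply (ord_ind D). intros a A IH v v' K K'.
destruct (V_below K) as [h [P Q]], (V_below K') as [h' [P' Q']].
apply set_ext. intro x. rewrite Q, Q'.
split; intros [c [C L]]; exists c; (split; [exact C|]).
- rewrite (IH c C _ _ (P' c C) (P c C)). exact L.
- rewrite (IH c C _ _ (P c C) (P' c C)). exact L.
Qed.

Lemma V_eqn a v x : is_V a v ->
  (x ∈ v <-> exists c u, c ∈ a /\ is_V c u /\ subset x u).
Proof.
intro K. destruct (V_below K) as [h [P Q]]. rewrite Q. split.
- intros [c [C L]]. exists c, (ap h c). auto.
- intros [c [u [C [U L]]]]. exists c. split; [exact C|].
  rewrite (V_unique (P c C) U). exact L.
Qed.
Lemma V_ex_below a v c : is_V a v -> c ∈ a -> exists u, is_V c u.
Proof. intros K C. destruct (V_below K) as [h [P _]]. eauto. Qed.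
Lemma V_super a v x y : is_V a v -> x ∈ v -> subset y x -> y ∈ v.
Proof.
intros K X S. apply (V_eqn _ K). apply (V_eqn _ K) in X.
destruct X as [c [u [A [B C]]]]. exists c, u. split; [exact A|]. split; [exact B|].
intros z Z. auto.
Qed.
Lemma V_trans a v : is_V a v -> transitive v.
Proof.
intros K x X y Y. apply (V_eqn _ K). apply (V_eqn _ K) in X.
destruct X as [c [u [A [B C]]]]. apply C, (V_eqn _ B) in Y.
destruct Y as [d [t [D [E F]]]]. exists d, t.
split; [exact (ord_mem_trans (V_ordinal K) D A)|auto].
Qed.
Lemma V_mem a v c u : is_V a v -> is_V c u -> c ∈ a -> u ∈ v.
Proof. intros K L C. apply (V_eqn _ K). exists c, u. split; [exact C|]. split; [exact L|]. intros z; auto. Qed.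
Lemma V_mono a v c u : is_V a v -> is_V c u -> c ∈ a -> subset u v.
Proof. intros K L C. apply (V_trans K). exact (V_mem K L C). Qed.
Lemma V_mono_sub a v c u : is_V a v -> is_V c u -> subset c a -> subset u v.
Proof.
intros K L C. apply ord_sub in C; [|exact (V_ordinal L)|exact (V_ordinal K)].
destruct C as [C|C]; [exact (V_mono K L C)|]. subst.
rewrite (V_unique K L). intros z; auto.
Qed.
Lemma V_self a v : is_V a v -> subset a v /\ ~ a ∈ v.
Proof.
intro K. assert (A := V_ordinal K). revert v K. revert a A.
assert (D : dfn1 (fun a => forall v, is_V a v -> subset a v /\ ~ a ∈ v)) by df.
apply (ord_ind D). intros a A IH v K. split.
- intros x X. destruct (V_ex_below K X) as [u U]. apply (V_eqn _ K). exists x, u.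
  split; [exact X|]. split; [exact U|]. exact (proj1 (IH x X u U)).
- intro L. apply (V_eqn _ K) in L. destruct L as [c [u [C [U S]]]].
  exact (proj2 (IH c C u U) (S c C)).
Qed.
Lemma V_ord_mem a v b : is_V a v -> is_ordinal b -> (b ∈ v <-> b ∈ a).
Proof.
intros K B. destruct (V_self K) as [S T]. split; [|apply S].
intro L. destruct (ord_tri B (V_ordinal K)) as [C|[C|C]]; [exact C| |].
- subst; tauto.
- exfalso. apply T. exact (V_trans K L C).
Qed.
Lemma rank_unique x a b : is_rank x a -> is_rank x b -> a = b.
Proof.
intros [[v [V S]] L] [[v' [V' S']] L'].
destruct (ord_tri (V_ordinal V) (V_ordinal V')) as [C|[C|C]]; [|exact C|].
- exfalso. exact (L' a v C V S).
- exfalso. exact (L b v' C V' S').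
Qed.
Lemma rank_V a v : is_V a v -> is_rank v a.
Proof.
intro K. split; [exists v; split; [exact K|intros z; auto]|]. intros b u B U S.
apply (proj2 (V_self U)), S, (proj1 (V_self K)), B.
Qed.
Lemma rank_ord a v : is_V a v -> is_rank a a.
Proof.
intro K. split; [exists v; split; [exact K|]; exact (proj1 (V_self K))|].
intros b u B U S. apply (proj2 (V_self U)), S, B.
Qed.

Definition limit a := is_ordinal a /\ (exists x, x ∈ a) /\
  forall x s, x ∈ a -> is_succ s x -> s ∈ a.
Lemma limit_suc a x : limit a -> x ∈ a -> suc x ∈ a.
Proof. intros [_ [_ L]] X. apply (L x); [exact X|]. apply is_succE. reflexivity. Qed.
Lemma limit_emp a : limit a -> emp ∈ a.
Proof.
intros [A [[x X] _]]. destruct (ord_tri emp_ord A) as [C|[C|C]]; [exact C| |].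
- subst a. exfalso; exact (empE X).
- exfalso; exact (empE C).
Qed.
Lemma limit_max a x y : limit a -> x ∈ a -> y ∈ a ->
  exists z, z ∈ a /\ subset x z /\ subset y z.
Proof.
intros L X Y. assert (A := proj1 L).
destruct (ord_tri (ord_el A X) (ord_el A Y)) as [C|[C|C]].
- exists y. split; [exact Y|]. split; [|intros z; auto].
  apply ord_sub; eauto using ord_el.
- subst. exists y. split; [exact Y|]. split; intros z; auto.
- exists x. split; [exact X|]. split; [intros z; auto|]. apply ord_sub; eauto using ord_el.
Qed.
Lemma limit_V_two a v x y : limit a -> is_V a v -> x ∈ v -> y ∈ v ->
  exists c u, c ∈ a /\ is_V c u /\ x ∈ u /\ y ∈ u /\ subset x u /\ subset y u.
Proof.
intros L K X Y. apply (V_eqn _ K) in X, Y.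
destruct X as [c [u [C [U S]]]], Y as [d [t [D [T S']]]].
destruct (limit_max L C D) as [e [E [E1 E2]]].
destruct (V_ex_below K (limit_suc L E)) as [r R].
assert (A := proj1 L).
assert (SC : c ∈ suc e).
{ apply sucE. apply ord_sub; eauto using ord_el. }
assert (SD : d ∈ suc e).
{ apply sucE. apply ord_sub; eauto using ord_el. }
exists (suc e), r. split; [exact (limit_suc L E)|]. split; [exact R|].
assert (X' : x ∈ r) by (apply (V_eqn _ R); eauto).
assert (Y' : y ∈ r) by (apply (V_eqn _ R); eauto).
split; [exact X'|]. split; [exact Y'|]. split; apply (V_trans R); assumption.
Qed.
Lemma limit_V_adjcl a v : limit a -> is_V a v -> adjcl v.
Proof.
intros L K. split.
- intros e E. apply is_empE in E. subst. apply (V_ord_mem K emp_ord). exact (limit_emp L).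
- intros x y z X Y Z. destruct (limit_V_two L K X Y) as [c [u [C [U [X' [Y' [SX SY]]]]]]].
  apply (V_eqn _ K). exists c, u. split; [exact C|]. split; [exact U|].
  intros w W. apply Z in W. destruct W as [W| ->]; auto.
Qed.
Lemma limit_V_opr a v x y : limit a -> is_V a v -> x ∈ v -> y ∈ v -> opr x y ∈ v.
Proof. intros L K. apply adjcl_opr. exact (limit_V_adjcl L K). Qed.
Lemma limit_V_Pw a v x : limit a -> is_V a v -> x ∈ v -> Pw x ∈ v.
Proof.
intros L K X. destruct (limit_V_two L K X X) as [c [u [C [U [X' _]]]]].
apply (V_eqn _ K). exists c, u. split; [exact C|]. split; [exact U|].
intros z Z. apply PwE in Z. exact (V_super U X' Z).
Qed.
Lemma limit_V_prod a v x y : limit a -> is_V a v -> x ∈ v -> y ∈ v -> prod x y ∈ v.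
Proof.
intros L K X Y. destruct (limit_V_two L K X Y) as [c [u [C [U [_ [_ [SX SY]]]]]]].
assert (UV := V_mem K U C).
apply (V_super K (limit_V_Pw L K (limit_V_Pw L K UV))).
intros z Z. apply prodE in Z. destruct Z as [p [q [P [Q ->]]]]. apply PwE.
rewrite opr_upr. intros w W. apply uprE in W. apply PwE. intros r R.
destruct W as [->| ->]; apply uprE in R; destruct R as [->| ->]; auto.
Qed.
Lemma limit_V_Un a v x : limit a -> is_V a v -> x ∈ v -> Un x ∈ v.
Proof.
intros L K X. apply (V_eqn _ K) in X. destruct X as [c [u [C [U S]]]].
apply (V_eqn _ K). exists c, u. split; [exact C|]. split; [exact U|].
intros z Z. apply UnE in Z. destruct Z as [y [Y Z]]. exact (V_trans U (S _ Y) Z).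
Qed.
Lemma limit_cardinal_limit l : is_limit_cardinal l -> limit l.
Proof.
intros [[A _] [E L]]. split; [exact A|]. split; [exact E|].
intros x s X S. apply is_succE in S. subst s. destruct (L x X) as [k [_ [K1 K2]]].
destruct (ord_suc_sub (ord_el A K2) K1) as [K| ->]; [|exact K2].
exact (ord_mem_trans A K K2).
Qed.
End Hierarchy.
#[global] Instance UD_limit : UD1 (@limit).
Proof. unfold UD1, limit. ud. Qed.

(** * Replacement, recursion and choice *)

Section Replacement.
Context {M : universe} {hM : ZFC M}.
Implicit Types x y z a b c f g p s t u v w n m h : M.

Lemma repl (R : M -> M -> Prop) x : dfn2 R -> (forall z, z ∈ x -> exists! y, R z y) ->
  exists u, forall y, y ∈ u <-> exists z, z ∈ x /\ R z y.
Proof.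
intros D U. destruct (dfn2_form x D) as [p [v E]].
destruct (zfc_replacement hM p v x) as [u K].
- intros z Z. destruct (U z Z) as [y [A B]]. exists y. split; [apply E, A|].
  intros y' A'. apply B, E, A'.
- exists u. intro y. rewrite K. split; intros [z [A B]]; exists z; split; auto; apply E, B.
Qed.

Lemma lam (R : M -> M -> Prop) a : dfn2 R -> (forall z, z ∈ a -> exists! y, R z y) ->
  exists f b, is_function f a b /\ forall x y, app f x y <-> x ∈ a /\ R x y.
Proof.
intros D U. destruct (repl D U) as [b B].
destruct (fun_ex (a := a) (b := b) D) as [f [F E]].
- intros x X. destruct (U x X) as [y [A Q]]. exists y. split.
  + split; [|exact A]. apply B. eauto.
  + intros y' [_ A']. auto.
- exists f, b. split; [exact F|]. intros x y. rewrite E. split; [tauto|].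
  intros [X R']. split; [exact X|]. split; [|exact R']. apply B. eauto.
Qed.

Definition appr (Q : M -> M -> Prop) a h := is_function_on h a /\
  forall b y, app h b y -> exists g, is_restriction h b g /\ Q g y.

Lemma appr_agree Q a h a' h' : dfn2 Q -> (forall g y y', Q g y -> Q g y' -> y = y') ->
  is_ordinal a -> is_ordinal a' -> appr Q a h -> appr Q a' h' ->
  forall b, b ∈ a -> b ∈ a' -> forall y, app h b y <-> app h' b y.
Proof.
intros D U A A' K K' b B.
assert (D' : dfn1 (fun b => b ∈ a -> b ∈ a' -> forall y, app h b y <-> app h' b y)) by df.
generalize B. revert b B.
assert (I : forall b, is_ordinal b -> b ∈ a -> b ∈ a' -> forall y, app h b y <-> app h' b y).
{ apply (ord_ind D'). intros b O IH B B'.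
  destruct K as [[r F] G], K' as [[r' F'] G'].
  destruct (G _ _ (fun_app F B)) as [g [R1 Q1]].
  destruct (G' _ _ (fun_app F' B')) as [g' [R2 Q2]].
  assert (g = g').
  { assert (SB : subset b a) by (apply (ord_trans A), B).
    assert (SB' : subset b a') by (apply (ord_trans A'), B').
    destruct (restr_fun F R1 SB) as [F1 E1]. destruct (restr_fun F' R2 SB') as [F2 E2].
    apply (fun_ext F1 F2). intros x X. rewrite E1, E2 by exact X.
    apply (fun_val F'). apply (IH x X); auto. exact (fun_app F (SB _ X)). }
  subst g'. assert (E := U _ _ _ Q1 Q2). intro y.
  rewrite (fun_appE _ F B), (fun_appE _ F' B'), E. tauto. }
intros b B B1 B2. apply I; auto. exact (ord_el A B).
Qed.

(** Approximations below [a] are unique, so replacement collects the values that [Q] assigns to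
    them; the resulting function is the approximation on [a]. *)
Lemma appr_ex Q : dfn2 Q -> (forall g, exists! y, Q g y) ->
  forall a, is_ordinal a -> exists h, appr Q a h.
Proof.
intros D U.
assert (UQ : forall g y y', Q g y -> Q g y' -> y = y').
{ intros g y y' A B. destruct (U g) as [z [_ K]]. rewrite <- (K y A), <- (K y' B). reflexivity. }
assert (DA : dfn2 (appr Q)) by (unfold appr; df).
assert (D' : dfn1 (fun a => exists h, appr Q a h)) by df.
assert (uniq : forall a h h', is_ordinal a -> appr Q a h -> appr Q a h' -> h = h').
{ intros a h h' A K K'. assert (E := appr_agree D UQ A A K K').
  destruct K as [[r F] _], K' as [[r' F'] _]. apply (fun_ext F F'). intros x X.
  apply (fun_val F'). apply E; auto. exact (fun_app F X). }
apply (ord_ind D'). intros a A IH.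
assert (DR : dfn2 (fun b y => exists h, appr Q b h /\ Q h y)) by df.
assert (UR : forall b, b ∈ a -> exists! y, exists h, appr Q b h /\ Q h y).
{ intros b B. destruct (IH b B) as [h K]. destruct (U h) as [y [Y _]]. exists y.
  split; [eauto|]. intros y' [h' [K' Y']].
  rewrite (uniq b h h' (ord_el A B) K K') in Y. eauto. }
destruct (lam DR UR) as [h [r [F E]]]. exists h. split; [exists r; exact F|].
intros b y K. apply E in K. destruct K as [B [hb [K Y]]]. exists hb.
split; [|exact Y]. intro z.
assert (V : forall c u, c ∈ b -> (app hb c u <-> app h c u)).
{ assert (I : forall c u, c ∈ b -> app hb c u -> app h c u).
  { intros c u C L. apply E. split; [exact (ord_mem_trans A C B)|].
    destruct (proj2 K c u L) as [g [G Q1]]. exists g. split; [|exact Q1].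
    destruct K as [[r' F'] G'].
    assert (SC : subset c b) by (apply (ord_trans (ord_el A B)), C).
    destruct (restr_fun F' G SC) as [F1 E1]. split; [exists r'; exact F1|].
    intros d w P. apply (restr_app G) in P. destruct P as [P P'].
    destruct (G' d w P) as [g' [R' Q']]. exists g'. split; [|exact Q'].
    intro p. rewrite (R' p), (G p). split; [|tauto].
    intros [P1 [x [y' [X X']]]]. split; [|eauto]. split; [exact P1|].
    exists x, y'. split; [|exact X'].
    exact (ord_mem_trans (ord_el (ord_el A B) C) X P'). }
  intros c u C. split; [apply I, C|]. intro L. destruct K as [[r' F'] G'].
  assert (L' := I c _ C (fun_app F' C)). rewrite (fun_unique F L L').
  exact (fun_app F' C). }
destruct K as [[r' F'] G']. split.
- intro Z. assert (Z' := Z). apply (fun_mem _ F') in Z'. destruct Z' as [c [C ->]]. split.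
  + apply appE, V; [exact C|]. exact (fun_app F' C).
  + exists c, (ap hb c). split; [exact C|apply oprP].
- intros [Z [c [u [C P]]]]. apply is_pairE in P. subst z. apply appE, V; [exact C|].
  apply appE, Z.
Qed.

(* The value is forced by [Q] only where [Q] determines it. *)
Lemma recursion (Q : M -> M -> Prop) : dfn2 Q -> forall a, is_ordinal a ->
  exists h b, is_function h a b /\ forall c g, c ∈ a -> is_restriction h c g ->
    (exists! y, Q g y) -> Q g (ap h c).
Proof.
intros D a A.
(* The empty set is the default value where [Q] determines none, which makes the relation functional
   everywhere. *)
set (Q' := fun g y => (Q g y /\ exists! y', Q g y') \/ ((~ exists! y', Q g y') /\ y = emp)).
assert (D' : dfn2 Q') by (unfold Q'; df).
destruct (@appr_ex Q' D') with (a := a) as [h [[b F] G]]; [|exact A|].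
- intro g. unfold Q'. destruct (classic (exists! y, Q g y)) as [E|E].
  + assert (E' := E). destruct E as [y [Y U]]. exists y. split; [tauto|].
    intros y' [[K _]|[K _]]; [auto|tauto].
  + exists emp. split; [tauto|]. intros y' [[_ K]|[_ K]]; [tauto|auto].
- exists h, b. split; [exact F|]. intros c g C R U.
  destruct (G c _ (fun_app F C)) as [g' [R' K]].
  rewrite (restr_unique R R'). rewrite (restr_unique R R') in U.
  destruct K as [[K _]|[K _]]; [exact K|tauto].
Qed.

Lemma omega_ex : exists w, is_omega w.
Proof.
destruct (zfc_infinity hM) as [w [[e [E W]] S]].
assert (D : dfn1 (@is_natural M)) by df.
exists (sep w (@is_natural M)). intro x. rewrite sepE by exact D.
split; [tauto|]. intro X. split; [|exact X]. revert x X.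
assert (D' : dfn1 (fun x => x ∈ w)) by df. apply (nat_ind D').
- apply is_empE in E. subst. exact W.
- intros n _ K. destruct (S n K) as [y [Y Z]]. apply is_succE in Y. subst. exact Z.
Qed.
Definition om : M := epsilon (z_inh ZFC_Zer) (@is_omega M).
Lemma omE x : x ∈ om <-> is_natural x.
Proof. exact (epsilon_spec (z_inh ZFC_Zer) _ omega_ex x). Qed.
Lemma is_omE w : is_omega w <-> w = om.
Proof.
split.
- intro K. apply set_ext. intro z. rewrite (K z), omE. tauto.
- intros -> z. apply omE.
Qed.
Lemma om_ord : is_ordinal om.
Proof.
split.
- intros n K x X. apply omE. apply omE in K. exact (nat_el K X).
- intros n K. apply omE in K. apply ord_trans, nat_ord, K.
Qed.
Lemma asgE U e : is_assignment U e <-> is_function e om U.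
Proof.
split.
- intros [w [W F]]. apply is_omE in W. subst. exact F.
- intro F. exists om. split; [apply is_omE; reflexivity|exact F].
Qed.
Lemma V_ex a : is_ordinal a -> exists v, is_V a v.
Proof.
intro A.
set (Q := fun h y => forall x, x ∈ y <-> exists c t, app h c t /\ subset x t).
assert (D : dfn2 Q) by (unfold Q; df).
destruct (recursion D (ord_suc A)) as [h [b [F G]]].
assert (U : forall g, exists! y, Q g y).
{ intro g.
  assert (D' : dfn1 (fun x => exists c t, app g c t /\ subset x t)) by df.
  (* A value t of [g] is an element of the double union of [g], so the subsets of t are subsets of
     the triple union. *)
  exists (sep (Pw (Un (Un (Un g)))) (fun x => exists c t, app g c t /\ subset x t)).
  split.
  - intro x. rewrite sepE by exact D'. split; [tauto|].
    intros [c [t [K S]]]. split; [|eauto]. apply PwE. intros z Z.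
    apply UnE. exists t. split; [|auto]. apply appE in K. rewrite opr_upr in K.
    apply UnE. exists (upr c t). split; [|apply uprE; auto].
    apply UnE. eexists. split; [exact K|]. apply uprE; auto.
  - intros y Y. apply set_ext. intro x. rewrite (Y x), sepE by exact D'. split; [tauto|].
    intros [c [t [K S]]]. split; [|eauto]. apply PwE. intros z Z.
    apply UnE. exists t. split; [|auto]. apply appE in K. rewrite opr_upr in K.
    apply UnE. exists (upr c t). split; [|apply uprE; auto].
    apply UnE. eexists. split; [exact K|]. apply uprE; auto. }
exists (ap h a). split; [exact A|]. exists (suc a), h.
split; [apply is_succE; reflexivity|]. split; [exists b; exact F|].
split; [|exact (fun_app F (suc_mem a))].
intros c u K x. destruct (restr_ex h c) as [g R].
rewrite (fun_val F K). rewrite (G c g (proj1 (fun_dom F K)) R (U g) x). split.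
- intros [d [t [P S]]]. apply (restr_app R) in P. exists d, t. tauto.
- intros [d [t [P [S S']]]]. exists d, t. rewrite (restr_app R). tauto.
Qed.
Definition V_ a : M := epsilon (inhabits a) (is_V a).
Lemma VP a : is_ordinal a -> is_V a (V_ a).
Proof. intro A. exact (epsilon_spec (inhabits a) _ (V_ex A)). Qed.
Lemma is_VE a v : is_V a v -> v = V_ a.
Proof. intro K. exact (V_unique K (VP (V_ordinal K))). Qed.

(** h(n) consists of [x] and of the elements of elements of the h(m) with m < n; the union of all
    h(n) is transitive. *)
Lemma trcl x : exists t, transitive t /\ x ∈ t.
Proof.
set (Q := fun h y => forall z, z ∈ y <-> z = x \/ exists n w u, app h n w /\ u ∈ w /\ z ∈ u).
assert (D : dfn2 Q) by (unfold Q; df).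
destruct (recursion D om_ord) as [h [b [F G]]].
assert (Spec : forall n z, is_natural n -> (z ∈ ap h n <-> z = x \/
  exists m u, m ∈ n /\ u ∈ ap h m /\ z ∈ u)).
{ intros n z K. destruct (restr_ex h n) as [g R].
  assert (On : n ∈ om) by (apply omE, K).
  assert (RA := restr_app R).
  assert (QE : Q g (ap h n)).
  { apply (G n g On R).
    assert (D' : dfn1 (fun z => exists m w u, app g m w /\ u ∈ w /\ z ∈ u)) by df.
    set (Y := adj (sep (Un (Un b)) (fun z => exists m w u, app g m w /\ u ∈ w /\ z ∈ u)) x).
    assert (QY : Q g Y).
    { intro y. unfold Y. rewrite adjE, sepE by exact D'. split; [tauto|].
      intros [->|[m [w [u [A [B C]]]]]]; [tauto|]. left. split; [|eauto 6].
      apply UnE. exists u. split; [|exact C]. apply UnE. exists w. split; [|exact B].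
      apply RA in A. exact (proj2 (fun_dom F (proj1 A))). }
    exists Y. split; [exact QY|]. intros y' K'. apply set_ext. intro y.
    rewrite (QY y), (K' y). tauto. }
  rewrite (QE z). split.
  - intros [->|[m [w [u [A B]]]]]; [tauto|]. right. apply RA in A. exists m, u.
    rewrite <- (fun_val F (proj1 A)). tauto.
  - intros [->|[m [u [A B]]]]; [tauto|]. right. exists m, (ap h m), u.
    split; [|exact B]. apply RA. split; [|exact A]. apply (fun_app F).
    apply omE. exact (nat_el K A). }
assert (D' : dfn1 (fun z => exists n w, app h n w /\ z ∈ w)) by df.
exists (sep (Un b) (fun z => exists n w, app h n w /\ z ∈ w)). split.
- intros y Y z Z. apply (sepE _ D') in Y. destruct Y as [_ [n [w [A B]]]].
  assert (K : is_natural n) by (apply omE, (fun_dom F A)).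
  rewrite (fun_val F A) in B. assert (K' := nat_suc K).
  assert (Z' : z ∈ ap h (suc n)).
  { apply Spec; [exact K'|]. right. exists n, y. split; [apply suc_mem|auto]. }
  assert (L := fun_app F (proj2 (omE (suc n)) K')).
  apply (sepE _ D'). split; [|eauto].
  apply UnE. exists (ap h (suc n)). split; [|exact Z']. exact (proj2 (fun_dom F L)).
- assert (L := fun_app F (proj2 (omE emp) nat_emp)).
  assert (Z' : x ∈ ap h emp) by (apply Spec; [apply nat_emp|tauto]).
  apply (sepE _ D'). split; [|eauto]. apply UnE. exists (ap h emp). split; [|exact Z'].
  exact (proj2 (fun_dom F L)).
Qed.

(** A minimal element of a transitive set outside the hierarchy has all its elements inside.
    Replacement collects the least levels of these elements, and their supremum puts the set itself
    into the hierarchy. *)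
Lemma V_univ x : exists a, is_ordinal a /\ x ∈ V_ a.
Proof.
apply NNPP; intro K. destruct (trcl x) as [t [T X]].
assert (D : dfn1 (fun y => ~ exists a v, is_V a v /\ y ∈ v)) by df.
destruct (set_min (s := t) D) as [y [Y [NY L]]].
{ exists x. split; [exact X|]. intros [a [v [A B]]]. apply K. exists a.
  split; [exact (V_ordinal A)|]. rewrite <- (is_VE A). exact B. }
set (R := fun z a => is_ordinal a /\ (exists v, is_V a v /\ z ∈ v) /\
  forall b, b ∈ a -> ~ exists v, is_V b v /\ z ∈ v).
assert (DR : dfn2 R) by (unfold R; df).
destruct (@repl R y DR) as [u U].
{ intros z Z. assert (K' : exists a v, is_V a v /\ z ∈ v).
  { apply NNPP. apply L; [exact Z|]. exact (T y Y z Z). }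
  assert (D2 : dfn1 (fun a => exists v, is_V a v /\ z ∈ v)) by df.
  destruct (ord_min D2) as [a [A [B C]]].
  { destruct K' as [a [v [P Q]]]. exists a. split; [exact (V_ordinal P)|eauto]. }
  exists a. split; [split; auto|]. intros a' [A' [B' C']].
  apply (ord_least_unique (P := fun a => exists v, is_V a v /\ z ∈ v)); auto. }
assert (OU : is_ordinal (Un u)).
{ apply ord_Un. intros a A. apply U in A. destruct A as [z [_ [A _]]]. exact A. }
apply NY. exists (suc (suc (Un u))), (V_ (suc (suc (Un u)))).
assert (O2 := VP (ord_suc (ord_suc OU))). split; [exact O2|].
apply (V_eqn _ O2). exists (suc (Un u)), (V_ (suc (Un u))).
assert (O1 := VP (ord_suc OU)).
split; [apply suc_mem|]. split; [exact O1|]. intros z Z.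
assert (E : exists a, a ∈ u /\ R z a).
{ assert (Z' : exists! a, R z a) by (apply NNPP; intro Q;
    assert (K' : exists a v, is_V a v /\ z ∈ v) by
      (apply NNPP; apply L; [exact Z|exact (T y Y z Z)]);
    assert (D2 : dfn1 (fun a => exists v, is_V a v /\ z ∈ v)) by df;
    destruct (ord_min D2) as [a [A [B C]]];
    [destruct K' as [a [v [P Q']]]; exists a; split; [exact (V_ordinal P)|eauto]|];
    apply Q; exists a; split; [split; auto|]; intros a' [A' [B' C']];
    apply (ord_least_unique (P := fun a => exists v, is_V a v /\ z ∈ v)); auto).
  destruct Z' as [a [A _]]. exists a. split; [|exact A]. apply U. eauto. }
destruct E as [a [A [OA [[v [V Zv]] _]]]].
assert (S : subset a (Un u)) by (intros q Q; apply UnE; eauto).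
apply (V_mono_sub O1 V); [|exact Zv]. intros q Q. apply sucE. auto.
Qed.

Lemma V_bound s : exists a, is_ordinal a /\ subset s (V_ a).
Proof.
destruct (V_univ s) as [a [A S]]. exists a. split; [exact A|].
exact (V_trans (VP A) S).
Qed.
Lemma ord_sup (P : M -> Prop) s : dfn1 P -> (forall a, P a -> a ∈ s /\ is_ordinal a) ->
  exists b, is_ordinal b /\ forall a, P a -> a ∈ b.
Proof.
intros _ K. destruct (V_univ s) as [b [B S]]. exists b. split; [exact B|].
intros a A. destruct (K a A) as [A1 A2]. apply (V_ord_mem (VP B) A2).
exact (V_trans (VP B) S A1).
Qed.

(** Scott's trick: [z] is sent to the least level that contains a witness, a function to which
    replacement applies. *)
Lemma collection (R : M -> M -> Prop) x : dfn2 R ->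
  exists b, is_ordinal b /\
    forall z, z ∈ x -> (exists y, R z y) -> exists y, y ∈ V_ b /\ R z y.
Proof.
intro D.
set (Q := fun z a => is_ordinal a /\
  (exists v y, is_V a v /\ y ∈ v /\ R z y) /\
  forall c, c ∈ a -> ~ exists v y, is_V c v /\ y ∈ v /\ R z y).
assert (DQ : dfn2 Q) by (unfold Q; df).
assert (E1 : dfn1 (fun z => exists y, R z y)) by df.
set (x' := sep x (fun z => exists y, R z y)).
assert (Ex : forall z, z ∈ x' -> exists a, Q z a).
{ intros z Z. apply (sepE _ E1) in Z. destruct Z as [_ [y Y]].
  assert (D2 : dfn1 (fun a => exists v y, is_V a v /\ y ∈ v /\ R z y)) by df.
  destruct (ord_min D2) as [a [A [B C]]].
  - destruct (V_univ y) as [a [A P]]. exists a. split; [exact A|].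
    exists (V_ a), y. split; [exact (VP A)|auto].
  - exists a. split; auto. }
destruct (@repl Q x' DQ) as [u U].
{ intros z Z. destruct (Ex z Z) as [a A]. exists a. split; [exact A|].
  intros a' [A' [B' C']]. destruct A as [A [B C]].
  apply (ord_least_unique (P := fun a => exists v y, is_V a v /\ y ∈ v /\ R z y)); auto. }
assert (DU : dfn1 (fun a => a ∈ u)) by df.
destruct (ord_sup (s := u) DU) as [b [B S]].
{ intros a A. split; [exact A|]. apply U in A. destruct A as [z [_ [A _]]]. exact A. }
exists b. split; [exact B|]. intros z Z Y.
assert (Z' : z ∈ x') by (apply (sepE _ E1); auto).
destruct (Ex z Z') as [a A]. assert (AU : a ∈ u) by (apply U; eauto).
destruct A as [A [[v [y [V [Yv YR]]]] _]]. exists y. split; [|exact YR].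
exact (V_mono (VP B) V (S a AU) Yv).
Qed.

(** The sets of pairs <x,y> with y in [b] and [R x y], one for each x, are nonempty and pairwise
    disjoint, as the axiom of choice requires. A set meeting each of them in one point provides the
    choice function. *)
Lemma choice_fun (R : M -> M -> Prop) a b : dfn2 R ->
  (forall x, x ∈ a -> exists y, y ∈ b /\ R x y) ->
  exists f, is_function f a b /\ forall x, x ∈ a -> R x (ap f x).
Proof.
intros D K.
set (S := fun x k => forall z, z ∈ k <-> exists y, y ∈ b /\ R x y /\ is_pair z x y).
assert (DS : dfn2 S) by (unfold S; df).
assert (US : forall x, x ∈ a -> exists! k, S x k).
{ intros x X. assert (D' : dfn1 (fun z => exists y, y ∈ b /\ R x y /\ is_pair z x y)) by df.
  assert (SS : S x (sep (prod a b) (fun z => exists y, y ∈ b /\ R x y /\ is_pair z x y))).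
  { intro z. rewrite sepE by exact D'. split; [tauto|].
    intros [y [Y [Q P]]]. split; [|eauto]. apply is_pairE in P. subst. apply prod_opr. auto. }
  eexists. split; [exact SS|]. intros k' K'. apply set_ext. intro z. rewrite (SS z), (K' z). tauto. }
destruct (repl DS US) as [F HF].
destruct (zfc_choice hM F) as [c C].
- intros k Hk. apply HF in Hk. destruct Hk as [x [X Sx]]. destruct (K x X) as [y [Y Q]].
  exists (opr x y). apply Sx. exists y. split; [exact Y|]. split; [exact Q|apply oprP].
- intros k k' z Hk Hk' Z Z'. apply HF in Hk, Hk'.
  destruct Hk as [x [X Sx]], Hk' as [x' [X' Sx']].
  apply Sx in Z. apply Sx' in Z'. destruct Z as [y [_ [_ P]]], Z' as [y' [_ [_ P']]].
  apply is_pairE in P, P'. subst z. apply opr_inj in P'. destruct P' as [-> _].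
  apply set_ext. intro z. rewrite (Sx z), (Sx' z). tauto.
- assert (D' : dfn2 (fun x y => R x y /\ exists z, is_pair z x y /\ z ∈ c)) by df.
  destruct (fun_ex (a := a) (b := b) D') as [f [Ff E]].
  { intros x X. destruct (US x X) as [k [Sk _]].
    assert (Hk : k ∈ F) by (apply HF; eauto).
    destruct (C k Hk) as [z [[Z Zc] Uz]]. assert (Z' := Z). apply Sk in Z'.
    destruct Z' as [y [Y [Q P]]]. exists y. split; [eauto 6|].
    intros y' [Y' [Q' [z' [P' Z'c]]]]. assert (z = z').
    { apply Uz. split; [|exact Z'c]. apply Sk. eauto. }
    subst z'. apply is_pairE in P, P'. subst z. apply opr_inj in P'. tauto. }
  exists f. split; [exact Ff|]. intros x X.
  apply E. exact (fun_app Ff X).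
Qed.

Lemma dependent_choice (R : M -> M -> Prop) K k0 : dfn2 R -> k0 ∈ K ->
  (forall x, x ∈ K -> exists y, y ∈ K /\ R x y) ->
  exists s, is_function s om K /\ ap s emp = k0 /\
    forall n, is_natural n -> R (ap s n) (ap s (suc n)).
Proof.
intros D K0 T. destruct (choice_fun D T) as [f [F RF]].
(* The recursion step sees only the function built so far, so [n] is located as the last point of
   its domain. *)
set (Q := fun h y => (is_empty h /\ y = k0) \/
  exists n u, app h n u /\ (forall m, (exists w, app h m w) -> m ∈ n \/ m = n) /\ app f u y).
assert (DQ : dfn2 Q) by (unfold Q; df).
destruct (recursion DQ om_ord) as [h [b [Fh G]]].
assert (E0 : ap h emp = k0).
{ destruct (restr_ex h emp) as [g R0].
  assert (Eg : is_empty g).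
  { intros z Z. apply R0 in Z. destruct Z as [_ [x [y [X _]]]]. exact (empE X). }
  assert (Z : Q g (ap h emp)).
  { apply (G _ _ (proj2 (omE emp) nat_emp) R0). exists k0. split; [left; auto|].
    intros y [[_ Y]|[n [u [A _]]]]; [auto|]. exfalso. apply appE in A. exact (Eg _ A). }
  destruct Z as [[_ Y]|[n [u [A _]]]]; [exact Y|]. exfalso. apply appE in A. exact (Eg _ A). }
assert (ES : forall n, is_natural n -> ap h n ∈ K -> ap h (suc n) = ap f (ap h n)).
{ intros n On Kn. assert (On1 := proj2 (omE n) On). assert (Os := nat_suc On).
  assert (Os1 := proj2 (omE _) Os). destruct (restr_ex h (suc n)) as [g Rg].
  assert (RA := restr_app Rg).
  assert (L : forall y, Q g y <-> y = ap f (ap h n)).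
  { intro y. assert (An : app g n (ap h n)).
    { apply RA. split; [exact (fun_app Fh On1)|apply suc_mem]. }
    split.
    - intros [[A _]|[m [u [A [B C]]]]].
      + exfalso. apply appE in An. exact (A _ An).
      + assert (m = n).
        { destruct (B n) as [P|P]; [eauto| |auto]. apply RA in A. destruct A as [_ A].
          apply sucE in A. destruct A as [A|A]; [|exact A]. exfalso; exact (mem_asym A P). }
        subst m. apply RA in A, An. rewrite <- (fun_unique Fh (proj1 A) (proj1 An)).
        exact (fun_val F C).
    - intros ->. right. exists n, (ap h n). split; [exact An|]. split.
      + intros m [w W]. apply RA in W. apply sucE. tauto.
      + exact (fun_app F Kn). }
  apply L. apply (G _ _ Os1 Rg). exists (ap f (ap h n)). split; [apply L; reflexivity|].
  intros y Y. symmetry. apply L, Y. }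
assert (Dn : dfn1 (fun n => exists y, app h n y /\ y ∈ K)) by df.
assert (HK : forall n, is_natural n -> ap h n ∈ K).
{ intros n On. assert (X : exists y, app h n y /\ y ∈ K).
  { revert n On. apply (nat_ind Dn).
    - exists (ap h emp). split; [exact (fun_app Fh (proj2 (omE _) nat_emp))|].
      rewrite E0. exact K0.
    - intros n On [y [A B]]. rewrite (fun_val Fh A) in B.
      exists (ap h (suc n)). split; [exact (fun_app Fh (proj2 (omE _) (nat_suc On)))|].
      rewrite (ES n On B). exact (fun_ap_in F B). }
  destruct X as [y [A B]]. rewrite (fun_val Fh A) in B. exact B. }
exists h. split; [|split; [exact E0|]].
- apply (fun_range Fh). intros n On. apply HK, omE, On.
- intros n On. rewrite (ES n On (HK n On)). apply RF, HK, On.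
Qed.

End Replacement.

Section Closure.
Context {M : universe} {hM : ZFC M}.
Implicit Types x y z a b c f g p s t u v w n m h : M.

Lemma ord_above s : exists b, is_ordinal b /\ forall a, a ∈ s -> is_ordinal a -> a ∈ b.
Proof.
destruct (V_bound s) as [b [B S]]. exists b. split; [exact B|].
intros a A O. apply (V_ord_mem (VP B) O). auto.
Qed.

(** Omega steps: the next value is the least ordinal that lies above [a0] and above all earlier
    values c and satisfies [T c]. The supremum is a limit; an ordinal below it is below some value,
    and the bound for that value serves it by antitonicity of [T]. *)
Lemma closure_ordinal (T : M -> M -> Prop) : dfn2 T ->
  (forall c, is_ordinal c -> exists b, is_ordinal b /\ T c b) ->
  (forall c b b', is_ordinal b' -> T c b -> b ∈ b' -> T c b') ->
  (forall c c' b, is_ordinal c -> c' ∈ c -> T c b -> T c' b) ->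
  forall a0, is_ordinal a0 -> exists a, limit a /\ a0 ∈ a /\
    forall c, c ∈ a -> exists b, b ∈ a /\ T c b.
Proof.
intros D Ex Mono Anti a0 A0.
set (P := fun h y => is_ordinal y /\ a0 ∈ y /\ forall n c, app h n c -> c ∈ y /\ T c y).
set (Q := fun h y => P h y /\ forall z, z ∈ y -> ~ P h z).
assert (DP : dfn2 P) by (unfold P; df). assert (DQ : dfn2 Q) by (unfold Q; df).
destruct (recursion DQ om_ord) as [h [r [F G]]].
assert (UQ : forall g, (exists y, P g y) -> exists! y, Q g y).
{ intros g [y Y]. assert (D1 : dfn1 (fun y => P g y)) by df.
  destruct (ord_min D1) as [b [B [C E]]]; [exists y; split; [exact (proj1 Y)|exact Y]|].
  exists b. split; [split; auto|]. intros b' [C' E'].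
  apply (ord_least_unique (P := fun y => P g y)); auto. exact (proj1 C'). }
assert (ExP : forall n g, is_natural n -> is_restriction h n g ->
  (forall k, k ∈ n -> is_ordinal (ap h k)) -> exists y, P g y).
{ intros n g On R Ord. assert (RA := restr_app R).
  assert (GO : forall k c, app g k c -> is_ordinal c /\ c ∈ r).
  { intros k c K. apply RA in K. destruct K as [K K1]. split.
    - rewrite (fun_val F K). apply Ord, K1.
    - exact (proj2 (fun_dom F K)). }
  assert (D1 : dfn2 (fun c b => is_ordinal b /\ T c b)) by df.
  destruct (collection r D1) as [be [B S]].
  destruct (ord_above r) as [ga [Ga Sr]].
  destruct (ord_above (upr a0 (suc be))) as [d1 [O1 S1]].
  destruct (ord_above (upr d1 ga)) as [de [O2 S2]].
  assert (Ad1 : d1 ∈ de) by (apply S2; [apply uprE; auto|exact O1]).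
  assert (Aga : ga ∈ de) by (apply S2; [apply uprE; auto|exact Ga]).
  assert (Aa0 : a0 ∈ de).
  { apply (ord_mem_trans (b := d1) O2); [|exact Ad1]. apply S1; [apply uprE; auto|exact A0]. }
  assert (Abe : be ∈ de).
  { apply (ord_mem_trans (b := (suc be)) O2); [apply suc_mem|].
    apply (ord_mem_trans (b := d1) O2); [|exact Ad1].
    apply S1; [apply uprE; auto|exact (ord_suc B)]. }
  exists de. split; [exact O2|]. split; [exact Aa0|]. intros k c K.
  destruct (GO k c K) as [Oc Rc]. split.
  - apply (ord_mem_trans (b := ga) O2); [|exact Aga]. auto.
  - destruct (S c Rc) as [b [Vb [Ob Tb]]].
    { destruct (Ex c Oc) as [b K']. eauto. }
    apply (Mono c b de); auto. apply (ord_mem_trans (b := be) O2); [|exact Abe].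
    apply (V_ord_mem (VP B) Ob), Vb. }
assert (Dn : dfn1 (fun n => exists y, app h n y /\ is_ordinal y)) by df.
assert (Ord0 : forall n, is_ordinal n -> is_natural n ->
  exists y, app h n y /\ is_ordinal y).
{ assert (Dn' : dfn1 (fun n => is_natural n -> exists y, app h n y /\ is_ordinal y)) by df.
  apply (ord_ind Dn'). intros n _ IH On. destruct (restr_ex h n) as [g R].
  exists (ap h n). split; [exact (fun_app F (proj2 (omE n) On))|].
  apply (G n g (proj2 (omE n) On) R). apply UQ. apply (ExP n g On R).
  intros k K. destruct (IH k K (nat_el On K)) as [y [A B]]. rewrite <- (fun_val F A). exact B. }
assert (Ord : forall n, is_natural n -> is_ordinal (ap h n)).
{ intros n On. destruct (Ord0 n (nat_ord On) On) as [y [A B]].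
  rewrite <- (fun_val F A). exact B. }
assert (Spec : forall n, is_natural n -> a0 ∈ ap h n /\
  forall m, m ∈ n -> ap h m ∈ ap h n /\ T (ap h m) (ap h n)).
{ intros n On. destruct (restr_ex h n) as [g R].
  assert (K : Q g (ap h n)).
  { apply (G n g (proj2 (omE n) On) R). apply UQ. apply (ExP n g On R).
    intros k K. apply Ord. exact (nat_el On K). }
  destruct K as [[_ [K1 K2]] _]. split; [exact K1|]. intros m Om. apply (K2 m).
  apply (restr_app R). split; [|exact Om]. apply (fun_app F), omE. exact (nat_el On Om). }
assert (Dr : dfn1 (fun y => exists n, app h n y)) by df.
set (R := sep r (fun y => exists n, app h n y)).
assert (RE : forall y, y ∈ R <-> exists n, is_natural n /\ y = ap h n).
{ intro y. unfold R. rewrite sepE by exact Dr. split.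
  - intros [_ [n K]]. exists n. split; [apply omE, (fun_dom F K)|exact (fun_val F K)].
  - intros [n [On ->]]. apply omE in On. split; [exact (fun_ap_in F On)|].
    exists n. exact (fun_app F On). }
assert (OU : is_ordinal (Un R)).
{ apply ord_Un. intros x X. apply RE in X. destruct X as [n [On ->]]. auto. }
assert (Hin : forall x, x ∈ Un R <-> exists n, is_natural n /\ x ∈ ap h n).
{ intro x. rewrite UnE. split.
  - intros [y [Y X]]. apply RE in Y. destruct Y as [n [On ->]]. eauto.
  - intros [n [On X]]. exists (ap h n). split; [apply RE; eauto|exact X]. }
assert (A1 : a0 ∈ Un R) by (apply Hin; exists emp; split;
  [apply nat_emp|apply Spec, nat_emp]).
exists (Un R). split; [|split; [exact A1|]].
- split; [exact OU|]. split; [eauto|]. intros x s X S. apply is_succE in S. subst s.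
  apply Hin in X. destruct X as [n [On X]]. apply Hin. exists (suc n).
  assert (Os := nat_suc On). split; [exact Os|].
  destruct (proj2 (Spec _ Os) n (suc_mem n)) as [K _].
  destruct (ord_suc_sub (Ord n On) X) as [Y| ->]; [|exact K].
  exact (ord_mem_trans (Ord _ Os) Y K).
- intros c C. apply Hin in C. destruct C as [n [On C]].
  destruct (proj2 (Spec _ (nat_suc On)) n (suc_mem n)) as [K1 K2].
  exists (ap h (suc n)). split.
  + apply Hin. exists (suc (suc n)). assert (Os := nat_suc (nat_suc On)).
    split; [exact Os|]. exact (proj1 (proj2 (Spec _ Os) (suc n) (suc_mem _))).
  + exact (Anti _ _ _ (Ord n On) C K2).
Qed.

Lemma limit_above a0 : is_ordinal a0 -> exists a, limit a /\ a0 ∈ a.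
Proof.
intro A. assert (D : dfn2 (fun _ _ : M => True)) by df.
destruct (closure_ordinal D) with (a0 := a0) as [a [B [C _]]]; eauto.
Qed.
Lemma limit_V_above x : exists a, limit a /\ x ∈ V_ a.
Proof.
destruct (V_univ x) as [b [B X]]. destruct (limit_above B) as [a [A C]].
exists a. split; [exact A|]. exact (V_mono (VP (proj1 A)) (VP B) C X).
Qed.
Lemma adjcl_above (L : M) : exists S, adjcl S /\ subset L S.
Proof.
destruct (limit_V_above L) as [a [A X]]. exists (V_ a).
split; [exact (limit_V_adjcl A (VP (proj1 A)))|]. exact (V_trans (VP (proj1 A)) X).
Qed.
End Closure.

(** * First-order logic inside the universe *)

Section Codes.
Context {M : universe} {hZ : Zer M}.
Implicit Types x y z i j p q s t : M.
Definition tvar i : M := opr (num 0) i.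
Definition tapp s t : M := opr (num 1) (opr s t).
Definition seq1 x : M := upr (opr (num 0) x) (opr (num 0) x).
Definition seq2 x y : M := upr (opr (num 0) x) (opr (num 1) y).
Definition cAt s t : M := opr (num 0) (opr s t).
Definition cEq s t : M := opr (num 1) (opr s t).
Definition cNeg p : M := opr (num 2) p.
Definition cAnd p q : M := opr (num 3) (opr p q).
Definition cEx i p : M := opr (num 4) (opr i p).
Definition cR2 s i j : M := cAt s (seq2 (tvar i) (tvar j)).
Definition cR1 s i : M := cAt s (seq1 (tvar i)).
Definition cF1 s i j : M := cEq (tapp s (seq1 (tvar i))) (tvar j).

Lemma tag_inj (i j : nat) x y : opr (num i) x = opr (num j) y -> i = j /\ x = y.
Proof. intro E. apply opr_inj in E. destruct E as [E F]. apply num_inj in E. auto. Qed.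
Lemma is_seq1E t x : is_seq1 t x <-> t = seq1 x.
Proof.
split.
- intros [z [p [Z [P K]]]]. apply is_numE in Z. apply is_pairE in P. apply is_uprE in K.
  subst. reflexivity.
- intros ->. exists (num 0), (opr (num 0) x). split; [apply is_numE; reflexivity|].
  split; [apply oprP|]. apply is_uprE. reflexivity.
Qed.
Lemma is_seq2E t x y : is_seq2 t x y <-> t = seq2 x y.
Proof.
split.
- intros [z [o [p [q [Z [O [P [Q K]]]]]]]]. apply is_numE in Z, O. apply is_pairE in P, Q.
  apply is_uprE in K. subst. reflexivity.
- intros ->. exists (num 0), (num 1), (opr (num 0) x), (opr (num 1) y).
  split; [apply is_numE; reflexivity|]. split; [apply is_numE; reflexivity|].
  split; [apply oprP|]. split; [apply oprP|]. apply is_uprE. reflexivity.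
Qed.
Lemma app_seq1 x k y : app (seq1 x) k y <-> k = num 0 /\ y = x.
Proof.
rewrite appE. unfold seq1. rewrite uprE. split.
- intros [E|E]; apply opr_inj in E; tauto.
- intros [-> ->]; auto.
Qed.
Lemma app_seq2 x y k z : app (seq2 x y) k z <-> (k = num 0 /\ z = x) \/ (k = num 1 /\ z = y).
Proof.
rewrite appE. unfold seq2. rewrite uprE. split.
- intros [E|E]; apply opr_inj in E; tauto.
- intros [[-> ->]|[-> ->]]; auto.
Qed.
Lemma num1E x : x ∈ num 1 <-> x = num 0.
Proof. simpl. rewrite sucE. generalize (@empE _ _ x). tauto. Qed.
Lemma num2E x : x ∈ num 2 <-> x = num 0 \/ x = num 1.
Proof. simpl. rewrite !sucE. generalize (@empE _ _ x). tauto. Qed.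
Lemma num01 : num 0 <> num 1.
Proof. intro E. apply num_inj in E. discriminate. Qed.
Lemma seq1_fun x (U : M) : x ∈ U -> is_function (seq1 x) (num 1) U.
Proof.
intro X. split.
- intros p P. unfold seq1 in P. apply uprE in P. assert (p = opr (num 0) x) by tauto.
  exists (num 0), x. rewrite num1E, is_pairE. tauto.
- intros k K. apply num1E in K. subst. exists x. split.
  + apply app_seq1. auto.
  + intros y Y. apply app_seq1 in Y. symmetry. tauto.
Qed.
Lemma seq2_fun x y (U : M) : x ∈ U -> y ∈ U -> is_function (seq2 x y) (num 2) U.
Proof.
intros X Y. split.
- intros p P. unfold seq2 in P. apply uprE in P. destruct P as [->| ->].
  + exists (num 0), x. rewrite num2E, is_pairE. tauto.
  + exists (num 1), y. rewrite num2E, is_pairE. tauto.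
- intros k K. apply num2E in K. destruct K as [->| ->].
  + exists x. split; [apply app_seq2; auto|]. intros z Z. apply app_seq2 in Z.
    destruct Z as [Z|[Z _]]; [symmetry; tauto|]. destruct (num01 Z).
  + exists y. split; [apply app_seq2; auto|]. intros z Z. apply app_seq2 in Z.
    destruct Z as [[Z _]|Z]; [|symmetry; tauto]. destruct (num01 (eq_sym Z)).
Qed.
Lemma fun_seq1 t (U : M) : is_function t (num 1) U -> t = seq1 (ap t (num 0)).
Proof.
intro F. apply set_ext. intro z. rewrite (fun_mem _ F). unfold seq1. rewrite uprE. split.
- intros [k [K ->]]. apply num1E in K. subst. auto.
- intro E. exists (num 0). rewrite num1E. tauto.
Qed.
Lemma fun_seq2 t (U : M) : is_function t (num 2) U -> t = seq2 (ap t (num 0)) (ap t (num 1)).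
Proof.
intro F. apply set_ext. intro z. rewrite (fun_mem _ F). unfold seq2. rewrite uprE. split.
- intros [k [K ->]]. apply num2E in K. destruct K as [->| ->]; auto.
- intros [E|E]; [exists (num 0)|exists (num 1)]; rewrite num2E; tauto.
Qed.
Lemma rel_symbol_unique s (n m : M) : is_rel_symbol s n -> is_rel_symbol s m -> n = m.
Proof.
intros [_ [a [q [A B]]]] [_ [a' [q' [A' B']]]]. apply is_pairE in A, A'.
apply taggedE in B, B'. subst. apply tag_inj in B'. destruct B' as [_ E].
apply opr_inj in E. tauto.
Qed.
Lemma std_symbolE (k n m : nat) s : is_std_symbol k n m s <-> s = opr (num k) (opr (num n) (num m)).
Proof.
split.
- intros [n' [m' [q [A [B [C D]]]]]]. apply is_numE in A, B. apply is_pairE in C.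
  apply taggedE in D. subst. reflexivity.
- intros ->. exists (num n), (num m), (opr (num n) (num m)). rewrite !is_numE, is_pairE, taggedE.
  auto.
Qed.
Lemma std_rel (n m : nat) : is_rel_symbol (opr (num 0) (opr (num n) (num m))) (num n).
Proof.
split; [apply num_nat|]. exists (num m), (opr (num n) (num m)).
rewrite is_pairE, taggedE. auto.
Qed.
Lemma std_fun (n m : nat) : is_fun_symbol (opr (num 1) (opr (num n) (num m))) (num n).
Proof.
split; [apply num_nat|]. exists (num m), (opr (num n) (num m)).
rewrite is_pairE, taggedE. auto.
Qed.
End Codes.

(** * Induction on codes, uniqueness of extensions, finite support *)

Section Satisfaction.
Context {M : universe} {hM : ZFC M}.
Implicit Types A B L U I D F R T X Y S a b c e f g h i k n p q r s t u v w x y z P : M.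

(** The clauses of [extension_closed] with a relation on the universe in place of a set [D], so that
    they can be asserted of [formula_extension] itself. *)
Definition ecl L U I (E : M -> M -> Prop) : Prop :=
  (forall s n R ts q c T, s ∈ L -> is_rel_symbol s n -> app I s R ->
     is_function_on ts n -> (forall k t, app ts k t -> is_term L t) ->
     is_pair q s ts -> tagged 0 q c ->
     (forall e, e ∈ T <-> is_assignment U e /\
        exists xs, xs ∈ R /\
          forall k t x, app ts k t -> app xs k x -> term_value L U I e t x) ->
     E c T) /\
  (forall t t' q c T, is_term L t -> is_term L t' ->
     is_pair q t t' -> tagged 1 q c ->
     (forall e, e ∈ T <-> is_assignment U e /\
        exists x, term_value L U I e t x /\ term_value L U I e t' x) ->
     E c T) /\
  (forall p P c T, E p P -> tagged 2 p c ->
     (forall e, e ∈ T <-> is_assignment U e /\ ~ e ∈ P) ->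
     E c T) /\
  (forall p P p' P' q c T, E p P -> E p' P' ->
     is_pair q p p' -> tagged 3 q c ->
     (forall e, e ∈ T <-> e ∈ P /\ e ∈ P') ->
     E c T) /\
  (forall p P i q c T, E p P -> is_natural i ->
     is_pair q i p -> tagged 4 q c ->
     (forall e, e ∈ T <-> is_assignment U e /\
        exists e', e' ∈ P /\ forall k x, k <> i -> (app e k x <-> app e' k x)) ->
     E c T).

Lemma ecl_iff L U I E E' : (forall p T, E p T <-> E' p T) -> ecl L U I E -> ecl L U I E'.
Proof.
intros K (C1 & C2 & C3 & C4 & C5). repeat split; intros.
- apply K. exact (C1 _ _ _ _ _ _ _ H H0 H1 H2 H3 H4 H5 H6).
- apply K. exact (C2 _ _ _ _ _ H H0 H1 H2 H3).
- apply K in H. apply K. exact (C3 _ _ _ _ H H0 H1).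
- apply K in H, H0. apply K. exact (C4 _ _ _ _ _ _ _ H H0 H1 H2 H3).
- apply K in H. apply K. exact (C5 _ _ _ _ _ _ H H0 H1 H2 H3).
Qed.

Lemma fe_ecl L U I : ecl L U I (formula_extension L U I).
Proof.
repeat split; intros; intros D HD; assert (HD' := HD); destruct HD' as (C1 & C2 & C3 & C4 & C5).
- exact (C1 _ _ _ _ _ _ _ H H0 H1 H2 H3 H4 H5 H6).
- exact (C2 _ _ _ _ _ H H0 H1 H2 H3).
- exact (C3 _ _ _ _ (H D HD) H0 H1).
- exact (C4 _ _ _ _ _ _ _ (H D HD) (H0 D HD) H1 H2 H3).
- exact (C5 _ _ _ _ _ _ (H D HD) H0 H1 H2 H3).
Qed.

Lemma asg_set U : exists Z, forall e, e ∈ Z <-> is_assignment U e.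
Proof.
assert (D : dfn1 (is_assignment U)) by df.
exists (sep (Pw (prod om U)) (is_assignment U)). intro e. rewrite sepE by exact D.
split; [tauto|]. intro A. split; [|exact A]. apply PwE. apply asgE in A. intros z Z.
apply (fun_mem _ A) in Z. destruct Z as [x [X ->]]. apply prod_opr.
split; [exact X|exact (fun_ap_in A X)].
Qed.

Lemma term_var L i : is_natural i -> is_term L (tvar i).
Proof. intros K S C _. apply (C i); [exact K|]. apply taggedE. reflexivity. Qed.
Lemma term_in L S t : adjcl S -> subset L S -> is_term L t -> t ∈ S.
Proof.
intros C LS K. apply K.
- intros i c Ni E. apply taggedE in E. subst. apply (adjcl_opr C); apply (adjcl_nat C); auto.
  apply num_nat.
- intros s n ts q c Ls Fs F Q E. apply taggedE in E. apply is_pairE in Q. subst.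
  apply (adjcl_opr C); [apply (adjcl_nat C), num_nat|]. apply (adjcl_opr C); [auto|].
  exact (adjcl_fun C (proj1 Fs) F).
Qed.
Lemma term_ind L (Q : M -> Prop) : dfn1 Q ->
  (forall i, is_natural i -> Q (tvar i)) ->
  (forall s n ts, s ∈ L -> is_fun_symbol s n -> is_function_on ts n ->
     (forall k t, app ts k t -> is_term L t /\ Q t) -> Q (tapp s ts)) ->
  forall t, is_term L t -> Q t.
Proof.
intros D C1 C2 t K. destruct (adjcl_above L) as [S [C LS]].
assert (D' : dfn1 (fun t => is_term L t /\ Q t)) by df.
assert (X : t ∈ sep S (fun t => is_term L t /\ Q t)); [|apply (sepE _ D') in X; tauto].
assert (E : forall t, t ∈ sep S (fun t => is_term L t /\ Q t) <-> is_term L t /\ Q t).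
{ intro t'. rewrite sepE by exact D'. split; [tauto|]. intros [A B].
  split; [exact (term_in C LS A)|auto]. }
apply K.
- intros i c Ni Ec. apply E. apply taggedE in Ec. subst. split; [apply term_var, Ni|apply C1, Ni].
- intros s n ts q c Ls Fs F Hq Hc. apply E. split.
  + intros S' A' B'. apply (B' s n ts q c); auto.
    apply (fun_range F). intros k Kk. apply (fun_ap_in F), E in Kk. apply Kk; auto.
  + apply taggedE in Hc. apply is_pairE in Hq. subst. apply (C2 s n); auto.
    * exists (sep S (fun t => is_term L t /\ Q t)). exact F.
    * intros k u Ku. apply E. exact (proj2 (fun_dom F Ku)).
Qed.
Lemma term_app L s n ts : s ∈ L -> is_fun_symbol s n -> is_function_on ts n ->
  (forall k t, app ts k t -> is_term L t) -> is_term L (tapp s ts).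
Proof.
intros Ls Fs [b F] Kt S A B. apply (B s n ts (opr s ts)); auto.
- apply (fun_range F). intros k Kk. apply (Kt _ _ (fun_app F Kk)); auto.
- apply oprP.
- apply taggedE. reflexivity.
Qed.

Section Structure.
Variables L A U I : M.
Hypothesis SD : structure_data L A U I.
Notation fe := (formula_extension L U I).
Notation tv := (term_value L U I).

Lemma sd_A : A = opr U I.
Proof. apply is_pairE, SD. Qed.
Lemma sd_I : exists b, is_function I L b.
Proof. apply SD. Qed.
Lemma sd_rel s n R t : s ∈ L -> is_rel_symbol s n -> app I s R -> t ∈ R -> is_function t n U.
Proof. destruct SD as (_ & _ & _ & K & _). intros. eapply K; eauto. Qed.

(** The product of [S] with the set of all sets of assignments is closed under Tarski's clauses,
    hence contains the least closed relation. *)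
Lemma fe_bound S p T : adjcl S -> subset L S -> fe p T ->
  p ∈ S /\ forall e, e ∈ T -> is_assignment U e.
Proof.
intros C LS K. destruct (asg_set U) as [Z HZ].
assert (D0 : dfn2 (fun _ _ : M => True)) by df.
destruct (rel_ex S (Pw Z) D0) as [D [HD _]].
assert (G : app D p T).
{ apply K. clear K p T. repeat split.
  - intros s n R ts q c T Ls Rs IR [b F] TT Q E HT. apply HD.
    apply taggedE in E. apply is_pairE in Q. subst. split; [|split; [|exact Logic.I]].
    + apply (adjcl_opr C); [apply (adjcl_nat C), num_nat|]. apply (adjcl_opr C); [auto|].
      apply (adjcl_fun C (proj1 Rs)). apply (fun_range F). intros k Kk.
      apply (term_in C LS), (TT k). exact (fun_app F Kk).
    + apply PwE. intros e Ee. apply HT in Ee. apply HZ. tauto.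
  - intros t t' q c T Tt Tt' Q E HT. apply HD. apply taggedE in E. apply is_pairE in Q. subst.
    split; [|split; [|exact Logic.I]].
    + apply (adjcl_opr C); [apply (adjcl_nat C), num_nat|].
      apply (adjcl_opr C); apply (term_in C LS); assumption.
    + apply PwE. intros e Ee. apply HT in Ee. apply HZ. tauto.
  - intros p P c T Kp E HT. apply HD in Kp. apply HD. apply taggedE in E. subst.
    split; [|split; [|exact Logic.I]].
    + apply (adjcl_opr C); [apply (adjcl_nat C), num_nat|tauto].
    + apply PwE. intros e Ee. apply HT in Ee. apply HZ. tauto.
  - intros p P p' P' q c T Kp Kp' Q E HT. apply HD in Kp, Kp'. apply HD.
    apply taggedE in E. apply is_pairE in Q. subst. split; [|split; [|exact Logic.I]].
    + apply (adjcl_opr C); [apply (adjcl_nat C), num_nat|]. apply (adjcl_opr C); tauto.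
    + apply PwE. intros e Ee. apply HT in Ee. destruct Kp as [_ [Kp _]].
      apply PwE in Kp. apply Kp. tauto.
  - intros p P i q c T Kp Ni Q E HT. apply HD in Kp. apply HD.
    apply taggedE in E. apply is_pairE in Q. subst. split; [|split; [|exact Logic.I]].
    + apply (adjcl_opr C); [apply (adjcl_nat C), num_nat|].
      apply (adjcl_opr C); [apply (adjcl_nat C), Ni|tauto].
    + apply PwE. intros e Ee. apply HT in Ee. apply HZ. tauto. }
apply HD in G. destruct G as [G1 [G2 _]]. split; [exact G1|].
intros e Ee. apply HZ. apply PwE in G2. auto.
Qed.

(** By [fe_bound] the pairs with property [Q] form a set, and minimality of [formula_extension]
    applies to it. *)
Lemma fe_ind (Q : M -> M -> Prop) : dfn2 Q ->
  ecl L U I (fun p T => fe p T /\ Q p T) -> forall p T, fe p T -> Q p T.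
Proof.
intros DQ E p T K. destruct (adjcl_above L) as [S [C LS]].
destruct (asg_set U) as [Z HZ].
assert (D' : dfn2 (fun p T => fe p T /\ Q p T)) by df.
destruct (rel_ex S (Pw Z) D') as [D [HD _]].
assert (HD' : forall p T, fe p T /\ Q p T <-> app D p T).
{ intros p' T'. rewrite HD. split; [|tauto]. intros [P1 P2].
  destruct (fe_bound C LS P1) as [B1 B2]. split; [exact B1|]. split; [|auto].
  apply PwE. intros e Ee. apply HZ. auto. }
assert (G : app D p T) by (apply K, (ecl_iff HD' E)).
apply HD' in G. tauto.
Qed.

Definition is_at c T := exists s n R ts q, s ∈ L /\ is_rel_symbol s n /\ app I s R /\
  is_function_on ts n /\ (forall k t, app ts k t -> is_term L t) /\
  is_pair q s ts /\ tagged 0 q c /\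
  forall e, e ∈ T <-> is_assignment U e /\
        exists xs, xs ∈ R /\
          forall k t x, app ts k t -> app xs k x -> term_value L U I e t x.
Definition is_eq c T := exists t t' q, is_term L t /\ is_term L t' /\
     is_pair q t t' /\ tagged 1 q c /\
     forall e, e ∈ T <-> is_assignment U e /\
        exists x, term_value L U I e t x /\ term_value L U I e t' x.
Definition is_ng c T := exists p P, fe p P /\ tagged 2 p c /\
     forall e, e ∈ T <-> is_assignment U e /\ ~ e ∈ P.
Definition is_an c T := exists p P p' P' q, fe p P /\ fe p' P' /\
     is_pair q p p' /\ tagged 3 q c /\
     forall e, e ∈ T <-> e ∈ P /\ e ∈ P'.
Definition is_xx c T := exists p P i q, fe p P /\ is_natural i /\
     is_pair q i p /\ tagged 4 q c /\
     forall e, e ∈ T <-> is_assignment U e /\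
        exists e', e' ∈ P /\ forall k x, k <> i -> (app e k x <-> app e' k x).

(** Each pair arises from one of the five clauses, by induction. As numeral tags keep the clauses
    apart, this inversion yields uniqueness of the extension. *)
Lemma fe_inv c T : fe c T -> is_at c T \/ is_eq c T \/ is_ng c T \/ is_an c T \/ is_xx c T.
Proof.
assert (DQ : dfn2 (fun c T =>
  is_at c T \/ is_eq c T \/ is_ng c T \/ is_an c T \/ is_xx c T))
  by (unfold is_at, is_eq, is_ng, is_an, is_xx; df).
apply (fe_ind DQ). clear c T DQ.
destruct (fe_ecl L U I) as (C1 & C2 & C3 & C4 & C5). repeat split.
- exact (C1 _ _ _ _ _ _ _ H H0 H1 H2 H3 H4 H5 H6).
- left. exists s, n, R, ts, q. auto 10.
- exact (C2 _ _ _ _ _ H H0 H1 H2 H3).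
- right; left. exists t, t', q. auto 10.
- destruct H. exact (C3 _ _ _ _ H H0 H1).
- do 2 right; left. exists p, P. tauto.
- destruct H, H0. exact (C4 _ _ _ _ _ _ _ H H0 H1 H2 H3).
- do 3 right; left. exists p, P, p', P', q. tauto.
- destruct H. exact (C5 _ _ _ _ _ _ H H0 H1 H2 H3).
- do 4 right. exists p, P, i, q. tauto.
Qed.

Ltac notag := exfalso; repeat match goal with
  | K : tagged _ _ _ |- _ => apply taggedE in K end; subst;
  match goal with K : opr (num _) _ = opr (num _) _ |- _ => apply tag_inj in K; lia end.

Ltac sametag := repeat match goal with
  | K : tagged _ _ _ |- _ => apply taggedE in K
  | K : is_pair _ _ _ |- _ => apply is_pairE in K end; subst;
  match goal with K : opr (num _) _ = opr (num _) _ |- _ =>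
    apply tag_inj in K; destruct K as [_ K]; try (apply opr_inj in K; destruct K); subst end.

Lemma fe_unique c T T' : fe c T -> fe c T' -> T = T'.
Proof.
assert (DQ : dfn2 (fun c T => forall T', fe c T' -> T = T')) by df.
intro K. revert T'. revert c T K. apply (fe_ind DQ). clear DQ.
destruct (fe_ecl L U I) as (C1 & C2 & C3 & C4 & C5). repeat split.
- exact (C1 _ _ _ _ _ _ _ H H0 H1 H2 H3 H4 H5 H6).
- intros T' K. apply fe_inv in K. destruct K as [K|[K|[K|[K|K]]]]; unfold is_at, is_eq, is_ng, is_an, is_xx in K.
  + destruct K as (s' & n' & R' & ts' & q' & Ls & _ & IR & _ & _ & Hq & Hc & HT).
    sametag. destruct sd_I as [bI FI]. rewrite (fun_unique FI IR H1) in HT.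
    apply set_ext. intro z. rewrite H6, HT. tauto.
  + destruct K as (? & ? & ? & ? & ? & ? & ? & ?). notag.
  + destruct K as (? & ? & ? & ? & ?). notag.
  + destruct K as (? & ? & ? & ? & ? & ? & ? & ? & ? & ?). notag.
  + destruct K as (? & ? & ? & ? & ? & ? & ? & ? & ?). notag.
- exact (C2 _ _ _ _ _ H H0 H1 H2 H3).
- intros T' K. apply fe_inv in K. destruct K as [K|[K|[K|[K|K]]]]; unfold is_at, is_eq, is_ng, is_an, is_xx in K.
  + destruct K as (s' & n' & R' & ts' & q' & Ls & _ & IR & _ & _ & Hq & Hc & HT). notag.
  + destruct K as (t1 & t2 & q' & _ & _ & Hq & Hc & HT). sametag.
    apply set_ext. intro z. rewrite H3, HT. tauto.
  + destruct K as (? & ? & ? & ? & ?). notag.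
  + destruct K as (? & ? & ? & ? & ? & ? & ? & ? & ? & ?). notag.
  + destruct K as (? & ? & ? & ? & ? & ? & ? & ? & ?). notag.
- destruct H. exact (C3 _ _ _ _ H H0 H1).
- destruct H as [Hp IH]. intros T' K. apply fe_inv in K. destruct K as [K|[K|[K|[K|K]]]]; unfold is_at, is_eq, is_ng, is_an, is_xx in K.
  + destruct K as (s' & n' & R' & ts' & q' & Ls & _ & IR & _ & _ & Hq & Hc & HT). notag.
  + destruct K as (? & ? & ? & ? & ? & ? & ? & ?). notag.
  + destruct K as (p1 & P1 & F1 & Hc & HT). apply taggedE in H0, Hc. subst c.
    apply tag_inj in Hc. destruct Hc as [_ <-]. rewrite <- (IH P1 F1) in HT.
    apply set_ext. intro z. rewrite H1, HT. tauto.
  + destruct K as (? & ? & ? & ? & ? & ? & ? & ? & ? & ?). notag.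
  + destruct K as (? & ? & ? & ? & ? & ? & ? & ? & ?). notag.
- destruct H, H0. exact (C4 _ _ _ _ _ _ _ H H0 H1 H2 H3).
- destruct H as [Hp IH], H0 as [Hp' IH']. intros T' K. apply fe_inv in K. destruct K as [K|[K|[K|[K|K]]]]; unfold is_at, is_eq, is_ng, is_an, is_xx in K.
  + destruct K as (s' & n' & R' & ts' & q' & Ls & _ & IR & _ & _ & Hq & Hc & HT). notag.
  + destruct K as (? & ? & ? & ? & ? & ? & ? & ?). notag.
  + destruct K as (? & ? & ? & ? & ?). notag.
  + destruct K as (p1 & P1 & p2 & P2 & q' & F1 & F2 & Hq & Hc & HT). sametag.
    rewrite <- (IH _ F1), <- (IH' _ F2) in HT. apply set_ext. intro z. rewrite H3, HT. tauto.
  + destruct K as (? & ? & ? & ? & ? & ? & ? & ? & ?). notag.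
- destruct H. exact (C5 _ _ _ _ _ _ H H0 H1 H2 H3).
- destruct H as [Hp IH]. intros T' K. apply fe_inv in K. destruct K as [K|[K|[K|[K|K]]]]; unfold is_at, is_eq, is_ng, is_an, is_xx in K.
  + destruct K as (s' & n' & R' & ts' & q' & Ls & _ & IR & _ & _ & Hq & Hc & HT). notag.
  + destruct K as (? & ? & ? & ? & ? & ? & ? & ?). notag.
  + destruct K as (? & ? & ? & ? & ?). notag.
  + destruct K as (? & ? & ? & ? & ? & ? & ? & ? & ? & ?). notag.
  + destruct K as (p1 & P1 & i1 & q' & F1 & _ & Hq & Hc & HT). sametag.
    rewrite <- (IH _ F1) in HT. apply set_ext. intro z. rewrite H3, HT. tauto.
Qed.

Definition isF p := exists T, fe p T.
Definition sat p e := exists T, fe p T /\ e ∈ T.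

Lemma ss_sat p e : structure_satisfies L A p e <-> sat p e.
Proof.
split.
- intros [U' [I' [T [SD' [K E]]]]]. destruct SD' as [P _]. apply is_pairE in P.
  rewrite sd_A in P. apply opr_inj in P. destruct P; subst. exists T; auto.
- intros [T [K E]]. exists U, I, T. auto.
Qed.
Lemma sat_asg p e : sat p e -> is_assignment U e.
Proof.
intros [T [K E]]. destruct (adjcl_above L) as [S [C LS]].
apply (fe_bound C LS K), E.
Qed.
Lemma sat_fe p e T : fe p T -> (sat p e <-> e ∈ T).
Proof.
intro K. split; [|exists T; auto]. intros [T' [K' E]].
rewrite (fe_unique K K'). exact E.
Qed.
Lemma asg_sep (P : M -> Prop) : dfn1 P ->
  exists T, forall e, e ∈ T <-> is_assignment U e /\ P e.
Proof.
intro D. destruct (asg_set U) as [Z HZ]. exists (sep Z P). intro e.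
rewrite sepE by exact D. rewrite HZ. tauto.
Qed.
Lemma isF_neg p : isF p -> isF (cNeg p) /\
  forall e, is_assignment U e -> (sat (cNeg p) e <-> ~ sat p e).
Proof.
intros [P K]. assert (D : dfn1 (fun e => ~ e ∈ P)) by df.
destruct (asg_sep D) as [T HT].
destruct (fe_ecl L U I) as (C1 & C2 & C3 & C4 & C5).
assert (G : fe (cNeg p) T) by (apply (C3 p P); auto; apply taggedE; reflexivity).
split; [exists T; exact G|]. intros e E. rewrite (sat_fe _ G), (sat_fe _ K), HT. tauto.
Qed.
Lemma isF_and p q : isF p -> isF q -> isF (cAnd p q) /\
  forall e, (sat (cAnd p q) e <-> sat p e /\ sat q e).
Proof.
intros [P K] [P' K']. assert (D : dfn1 (fun e => e ∈ P')) by df.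
destruct (fe_ecl L U I) as (C1 & C2 & C3 & C4 & C5).
assert (G : fe (cAnd p q) (sep P (fun e => e ∈ P'))).
{ apply (C4 p P q P' (opr p q)); auto; [apply oprP|apply taggedE; reflexivity|].
  intro e. apply (sepE _ D). }
split; [exists (sep P (fun e => e ∈ P')); exact G|].
intro e. rewrite (sat_fe _ G), (sat_fe _ K), (sat_fe _ K'). apply (sepE _ D).
Qed.
Lemma isF_ex i p : isF p -> is_natural i -> isF (cEx i p) /\
  forall e, is_assignment U e ->
    (sat (cEx i p) e <-> exists e', sat p e' /\
      forall k x, k <> i -> (app e k x <-> app e' k x)).
Proof.
intros [P K] Ni. assert (D : dfn1 (fun e => exists e', e' ∈ P /\
  forall k x, k <> i -> (app e k x <-> app e' k x))) by df.
destruct (asg_sep D) as [T HT].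
destruct (fe_ecl L U I) as (C1 & C2 & C3 & C4 & C5).
assert (G : fe (cEx i p) T).
{ apply (C5 p P i (opr i p)); auto; [apply oprP|apply taggedE; reflexivity]. }
split; [exists T; exact G|]. intros e E. rewrite (sat_fe _ G), HT. split.
- intros [_ [e' [E1 E2]]]. exists e'. rewrite (sat_fe _ K). auto.
- intros [e' [E1 E2]]. split; [exact E|]. exists e'. rewrite <- (sat_fe _ K). auto.
Qed.
Lemma isF_at s n R ts : s ∈ L -> is_rel_symbol s n -> app I s R ->
  is_function_on ts n -> (forall k t, app ts k t -> is_term L t) -> isF (cAt s ts) /\
  forall e, is_assignment U e -> (sat (cAt s ts) e <-> exists xs, xs ∈ R /\
          forall k t x, app ts k t -> app xs k x -> term_value L U I e t x).
Proof.
intros Ls Rs IR Ft Tt. assert (D : dfn1 (fun e => exists xs, xs ∈ R /\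
          forall k t x, app ts k t -> app xs k x -> term_value L U I e t x)) by df.
destruct (asg_sep D) as [T HT].
destruct (fe_ecl L U I) as (C1 & C2 & C3 & C4 & C5).
assert (G : fe (cAt s ts) T).
{ apply (C1 s n R ts (opr s ts)); auto; [apply oprP|apply taggedE; reflexivity]. }
split; [exists T; exact G|]. intros e E. rewrite (sat_fe _ G), HT. tauto.
Qed.
Lemma isF_eq t t' : is_term L t -> is_term L t' -> isF (cEq t t') /\
  forall e, is_assignment U e -> (sat (cEq t t') e <-> exists x, tv e t x /\ tv e t' x).
Proof.
intros Tt Tt'. assert (D : dfn1 (fun e => exists x, tv e t x /\ tv e t' x)) by df.
destruct (asg_sep D) as [T HT].
destruct (fe_ecl L U I) as (C1 & C2 & C3 & C4 & C5).
assert (G : fe (cEq t t') T).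
{ apply (C2 t t' (opr t t')); auto; [apply oprP|apply taggedE; reflexivity]. }
split; [exists T; exact G|]. intros e E. rewrite (sat_fe _ G), HT. tauto.
Qed.

Lemma tv_var e i x : app e i x -> tv e (tvar i) x.
Proof. intros K R C _. apply (C i x); [exact K|]. apply taggedE. reflexivity. Qed.
Lemma tv_app e s n F ts xs x : s ∈ L -> is_fun_symbol s n -> app I s F ->
  is_function_on ts n -> is_function xs n U ->
  (forall k u y, k ∈ n -> app ts k u -> app xs k y -> tv e u y) -> app F xs x ->
  tv e (tapp s ts) x.
Proof.
intros Ls Fs IF Ft Fx K Fx' R C1 C2.
apply (C2 s n F ts xs x (opr s ts)); auto; [|apply oprP|apply taggedE; reflexivity].
intros k u y Kk Ku Ky. apply (K k u y Kk Ku Ky); auto.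
Qed.
(** The evaluated pairs that arise from one of the two rules form a set, and this set is again
    closed under the rules. *)
Lemma tv_inv e t a : is_assignment U e -> tv e t a ->
  (exists i, app e i a /\ t = tvar i) \/
  (exists s n F ts xs, s ∈ L /\ is_fun_symbol s n /\ app I s F /\ is_function_on ts n /\
    is_function xs n U /\ (forall k u y, k ∈ n -> app ts k u -> app xs k y -> tv e u y) /\
    app F xs a /\ t = tapp s ts).
Proof.
intros E K. apply asgE in E.
set (Q := fun t a => (exists i, app e i a /\ tagged 0 i t) \/
  (exists s n F ts xs q, s ∈ L /\ is_fun_symbol s n /\ app I s F /\ is_function_on ts n /\
    is_function xs n U /\ (forall k u y, k ∈ n -> app ts k u -> app xs k y -> tv e u y) /\
    app F xs a /\ is_pair q s ts /\ tagged 1 q t)).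
assert (D : dfn2 (fun t a => tv e t a /\ Q t a)) by (unfold Q; df).
destruct (adjcl_above L) as [S [C LS]].
destruct (rel_ex S U D) as [R [HR _]].
assert (G : app R t a).
{ apply K.
  - intros i x c Ei Tc. apply HR. assert (Tc' := Tc). apply taggedE in Tc. subst c.
    destruct (fun_dom E Ei) as [Oi Ux].
    split; [apply (adjcl_opr C); apply (adjcl_nat C); [apply num_nat|apply omE, Oi]|].
    split; [exact Ux|]. split; [exact (tv_var Ei)|]. left. eauto.
  - intros s n F ts xs x q c Ls Fs IF Ft Fx Kr Fx' Hq Hc. apply HR.
    assert (Tx : forall k u y, k ∈ n -> app ts k u -> app xs k y -> tv e u y).
    { intros k u y A1 A2 A3. assert (A4 := Kr k u y A1 A2 A3). apply HR in A4. tauto. }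
    assert (Hq' := Hq). assert (Hc' := Hc). apply is_pairE in Hq. apply taggedE in Hc. subst.
    destruct Ft as [b Ft].
    split; [|split; [|split]].
    + apply (adjcl_opr C); [apply (adjcl_nat C), num_nat|]. apply (adjcl_opr C); [auto|].
      apply (adjcl_fun C (proj1 Fs)). apply (fun_range Ft). intros k Kk.
      assert (A4 := Kr k _ _ Kk (fun_app Ft Kk) (fun_app Fx Kk)). apply HR in A4. tauto.
    + destruct SD as (_ & _ & _ & _ & KF). destruct (KF s n F Ls Fs IF) as [T [_ FF]].
      exact (proj2 (fun_dom FF Fx')).
    + apply (tv_app Ls Fs IF (ex_intro _ b Ft) Fx Tx Fx').
    + right. exists s, n, F, ts, xs, (opr s ts).
      assert (is_function_on ts n) by (exists b; exact Ft). auto 12. }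
apply HR in G. destruct G as (_ & _ & _ & [[i [A1 A2]]|G]).
- left. apply taggedE in A2. subst. eauto.
- right. destruct G as (s & n & F & ts & xs & q & G1 & G2 & G3 & G4 & G5 & G6 & G7 & G8 & G9).
  apply is_pairE in G8. apply taggedE in G9. subst. exists s, n, F, ts, xs. auto 12.
Qed.
Lemma tv_varE e i x : is_assignment U e -> (tv e (tvar i) x <-> app e i x).
Proof.
intro E. split; [|apply tv_var]. intro K. apply (tv_inv E) in K.
destruct K as [[j [A1 A2]]|K].
- apply tag_inj in A2. destruct A2 as [_ ->]. exact A1.
- destruct K as (s & n & F & ts & xs & _ & _ & _ & _ & _ & _ & _ & K).
  apply tag_inj in K. lia.
Qed.

Lemma interpE s R : interprets A s R <-> app I s R.
Proof.
split.
- intros [U' [I' [P K]]]. apply is_pairE in P. rewrite sd_A in P. apply opr_inj in P.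
  destruct P; subst; exact K.
- intro K. exists U, I. split; [|exact K]. apply is_pairE, sd_A.
Qed.
Lemma sym_interp s : s ∈ L -> exists R, app I s R.
Proof. intro Ls. destruct sd_I as [b F]. exists (ap I s). exact (fun_app F Ls). Qed.

Lemma sat_R2 s i j : s ∈ L -> is_rel_symbol s (num 2) -> is_natural i -> is_natural j ->
  isF (cR2 s i j) /\ forall e, is_assignment U e ->
    (sat (cR2 s i j) e <-> rel2 A s (ap e i) (ap e j)).
Proof.
intros Ls Rs Ni Nj. destruct (sym_interp Ls) as [R IR].
assert (Ft : is_function (seq2 (tvar i) (tvar j)) (num 2) (upr (tvar i) (tvar j))).
{ apply seq2_fun; apply uprE; auto. }
destruct (@isF_at s (num 2) R (seq2 (tvar i) (tvar j))) as [G1 G2]; auto.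
- eexists; exact Ft.
- intros k t Kt. apply app_seq2 in Kt. destruct Kt as [[_ ->]|[_ ->]]; apply term_var; auto.
- split; [exact G1|]. intros e E. unfold cR2. rewrite (G2 e E). split.
  + intros [xs [X1 X2]]. exists R, xs. split; [apply interpE, IR|]. split; [|exact X1].
    apply is_seq2E. assert (Fx := sd_rel Ls Rs IR X1).
    rewrite (fun_seq2 Fx) at 1. apply asgE in E. assert (E' := proj2 (asgE _ _) E).
    f_equal.
    * apply (fun_val E). apply (tv_varE _ _ E'). apply (X2 (num 0)).
      -- apply app_seq2; auto.
      -- apply (fun_app Fx), num2E; auto.
    * apply (fun_val E). apply (tv_varE _ _ E'). apply (X2 (num 1)).
      -- apply app_seq2; auto.
      -- apply (fun_app Fx), num2E; auto.
  + intros [R' [t [IR' [Tt Rt]]]]. apply interpE in IR'. destruct sd_I as [bI FI].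
    rewrite (fun_unique FI IR' IR) in Rt. exists t. split; [exact Rt|].
    apply is_seq2E in Tt. subst t. intros k t x K1 K2. apply app_seq2 in K1, K2.
    assert (E' := E). apply asgE in E.
    destruct K1 as [[-> ->]|[-> ->]], K2 as [[K2 ->]|[K2 ->]];
      try (destruct (num01 K2)); try (destruct (num01 (eq_sym K2)));
      apply tv_var; apply (fun_app E); apply omE; assumption.
Qed.
Lemma sat_R1 s i : s ∈ L -> is_rel_symbol s (num 1) -> is_natural i ->
  isF (cR1 s i) /\ forall e, is_assignment U e -> (sat (cR1 s i) e <-> rel1 A s (ap e i)).
Proof.
intros Ls Rs Ni. destruct (sym_interp Ls) as [R IR].
assert (Ft : is_function (seq1 (tvar i)) (num 1) (upr (tvar i) (tvar i))).
{ apply seq1_fun; apply uprE; auto. }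
destruct (@isF_at s (num 1) R (seq1 (tvar i))) as [G1 G2]; auto.
- eexists; exact Ft.
- intros k t Kt. apply app_seq1 in Kt. destruct Kt as [_ ->]. apply term_var; auto.
- split; [exact G1|]. intros e E. unfold cR1. rewrite (G2 e E). split.
  + intros [xs [X1 X2]]. exists R, xs. split; [apply interpE, IR|]. split; [|exact X1].
    apply is_seq1E. assert (Fx := sd_rel Ls Rs IR X1).
    rewrite (fun_seq1 Fx) at 1. apply asgE in E. assert (E' := proj2 (asgE _ _) E).
    f_equal. apply (fun_val E). apply (tv_varE _ _ E'). apply (X2 (num 0)).
    * apply app_seq1; auto.
    * apply (fun_app Fx), num1E; auto.
  + intros [R' [t [IR' [Tt Rt]]]]. apply interpE in IR'. destruct sd_I as [bI FI].
    rewrite (fun_unique FI IR' IR) in Rt. exists t. split; [exact Rt|].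
    apply is_seq1E in Tt. subst t. intros k t x K1 K2. apply app_seq1 in K1, K2.
    apply asgE in E. destruct K1 as [-> ->], K2 as [_ ->].
    apply tv_var; apply (fun_app E); apply omE; assumption.
Qed.
Lemma sat_Eqv i j : is_natural i -> is_natural j ->
  isF (cEq (tvar i) (tvar j)) /\ forall e, is_assignment U e ->
    (sat (cEq (tvar i) (tvar j)) e <-> ap e i = ap e j).
Proof.
intros Ni Nj. destruct (isF_eq (term_var (L := L) Ni) (term_var (L := L) Nj)) as [G1 G2].
split; [exact G1|]. intros e E. rewrite (G2 e E). assert (E' := E). apply asgE in E.
split.
- intros [x [A1 A2]]. apply (proj1 (tv_varE _ _ E')) in A1, A2.
  rewrite <- (fun_val E A1), <- (fun_val E A2). reflexivity.
- intro Q. exists (ap e i). split; apply tv_var.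
  + apply (fun_app E), omE, Ni.
  + rewrite Q. apply (fun_app E), omE, Nj.
Qed.
Lemma sat_F1 s i j : s ∈ L -> is_fun_symbol s (num 1) -> is_natural i -> is_natural j ->
  isF (cF1 s i j) /\ forall e, is_assignment U e ->
    (sat (cF1 s i j) e <-> fun1 A s (ap e i) (ap e j)).
Proof.
intros Ls Fs Ni Nj. destruct (sym_interp Ls) as [F IF].
assert (Ft : is_function (seq1 (tvar i)) (num 1) (upr (tvar i) (tvar i))).
{ apply seq1_fun; apply uprE; auto. }
assert (Tt : is_term L (tapp s (seq1 (tvar i)))).
{ apply (term_app Ls Fs); [eexists; exact Ft|]. intros k t Kt. apply app_seq1 in Kt.
  destruct Kt as [_ ->]. apply term_var; auto. }
destruct (isF_eq Tt (term_var (L := L) Nj)) as [G1 G2]. split; [exact G1|].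
intros e E. unfold cF1. rewrite (G2 e E). assert (E' := E). apply asgE in E.
assert (Ei := fun_app E (proj2 (omE i) Ni)). assert (Ej := fun_app E (proj2 (omE j) Nj)).
split.
- intros [x [A1 A2]]. apply (proj1 (tv_varE _ _ E')) in A2. apply (tv_inv E') in A1.
  destruct A1 as [[k [_ A1]]|A1]; [apply tag_inj in A1; lia|].
  destruct A1 as (s' & n & F' & ts & xs & B1 & B2 & B3 & B4 & B5 & B6 & B7 & B8).
  apply tag_inj in B8. destruct B8 as [_ B8]. apply opr_inj in B8. destruct B8; subst.
  assert (n = num 1).
  { destruct Fs as [_ [a [q [P1 P2]]]], B2 as [_ [a' [q' [P1' P2']]]].
    apply is_pairE in P1, P1'. apply taggedE in P2, P2'. subst.
    apply tag_inj in P2'. destruct P2' as [_ P]. apply opr_inj in P. symmetry; tauto. }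
  subst n. exists F', xs. split; [apply interpE, B3|]. split.
  + apply is_seq1E. rewrite (fun_seq1 B5) at 1. f_equal. apply (fun_val E).
    apply (tv_varE _ _ E'). apply (B6 (num 0)).
    * apply num1E; reflexivity.
    * apply app_seq1; auto.
    * apply (fun_app B5), num1E; reflexivity.
  + rewrite <- (fun_val E A2). exact B7.
- intros [F' [t [IF' [Ht K]]]]. apply interpE in IF'. apply is_seq1E in Ht. subst t.
  exists (ap e j). split; [|apply tv_var, Ej].
  apply (tv_app (n := num 1) (F := F') (xs := seq1 (ap e i)) Ls Fs IF'); auto.
  + eexists; exact Ft.
  + apply seq1_fun. exact (proj2 (fun_dom E Ei)).
  + intros k u y _ K1 K2. apply app_seq1 in K1, K2. destruct K1 as [_ ->], K2 as [_ ->].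
    apply tv_var, Ei.
Qed.

Definition agree n e e' := forall k x, k ∈ n -> (app e k x <-> app e' k x).

Definition tsupp t n := forall e e', is_assignment U e -> is_assignment U e' ->
  agree n e e' -> forall a, tv e t a -> tv e' t a.
Lemma agree_mono n n' e e' : is_ordinal n' -> n ∈ n' -> agree n' e e' -> agree n e e'.
Proof. intros O K G k x Kk. apply G. exact (ord_mem_trans O Kk K). Qed.
Lemma term_supp t : is_term L t -> exists n, is_natural n /\ tsupp t n.
Proof.
assert (D : dfn1 (fun t => exists n, is_natural n /\ tsupp t n))
  by (unfold tsupp, agree; df).
revert t. apply (term_ind D).
- intros i Ni. exists (suc i). split; [apply nat_suc, Ni|]. intros e e' E E' G a K.
  apply (proj1 (tv_varE _ _ E)) in K. apply tv_var. apply G; [apply suc_mem|exact K].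
- intros s n ts Ls Fs [b Ft] IH.
  assert (DR : dfn2 (fun k m => forall t, app ts k t -> tsupp t m))
    by (unfold tsupp, agree; df).
  destruct (fin_bound DR) with (n := n) as [m [Nm Hm]].
  + intros k m m' K Mm Nm' t Kt e e' E E' G. apply (K t Kt); auto.
    exact (agree_mono (nat_ord Nm') Mm G).
  + apply Fs.
  + intros k Kk. destruct (IH k _ (fun_app Ft Kk)) as [_ [m [Nm Hm]]]. exists m.
    split; [exact Nm|]. intros t Kt. rewrite (fun_val Ft Kt). exact Hm.
  + exists m. split; [exact Nm|]. intros e e' E E' G a K. apply (tv_inv E) in K.
    destruct K as [[i [_ K]]|K]; [apply tag_inj in K; lia|].
    destruct K as (s' & n' & F & ts' & xs & B1 & B2 & B3 & B4 & B5 & B6 & B7 & B8).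
    apply tag_inj in B8. destruct B8 as [_ B8]. apply opr_inj in B8. destruct B8; subst.
    apply (tv_app B1 B2 B3 B4 B5); [|exact B7].
    intros k u y Kk Ku Ky. apply (Hm k (proj1 (fun_dom Ft Ku)) u Ku e e' E E' G).
    exact (B6 k u y Kk Ku Ky).
Qed.

(** The induction runs inside the universe and so reaches codes of nonstandard length. What codes no
    formula is satisfied by no assignment, and the bound 0 serves for it. *)
Lemma sat_supp p : exists n, is_natural n /\ forall e e', is_assignment U e ->
  is_assignment U e' -> agree n e e' -> sat p e -> sat p e'.
Proof.
set (Q := fun p T => exists n, is_natural n /\ forall e e', is_assignment U e ->
  is_assignment U e' -> agree n e e' -> e ∈ T -> e' ∈ T).
assert (DQ : dfn2 Q) by (unfold Q, agree; df).
assert (Sym : forall n e e', agree n e e' -> agree n e' e).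
{ intros n e e' G k x K. symmetry. apply G, K. }
assert (Main : forall p T, fe p T -> Q p T).
{ apply (fe_ind DQ). destruct (fe_ecl L U I) as (C1 & C2 & C3 & C4 & C5). repeat split.
  - exact (C1 _ _ _ _ _ _ _ H H0 H1 H2 H3 H4 H5 H6).
  - destruct H2 as [b Ft].
    assert (DR : dfn2 (fun k m => forall t, app ts k t -> tsupp t m))
      by (unfold tsupp, agree; df).
    destruct (fin_bound DR) with (n := n) as [m [Nm Hm]].
    + intros k m m' K Mm Nm' t Kt e e' E E' G. apply (K t Kt); auto.
      exact (agree_mono (nat_ord Nm') Mm G).
    + apply H0.
    + intros k Kk. destruct (term_supp (H3 k _ (fun_app Ft Kk))) as [m [Nm Hm]].
      exists m. split; [exact Nm|]. intros t Kt. rewrite (fun_val Ft Kt). exact Hm.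
    + exists m. split; [exact Nm|]. intros e e' E E' G K. apply H6. split; [exact E'|].
      apply H6 in K. destruct K as [_ [xs [X1 X2]]]. exists xs. split; [exact X1|].
      intros k t x Kt Kx. apply (Hm k (proj1 (fun_dom Ft Kt)) t Kt e e' E E' G). eauto.
  - exact (C2 _ _ _ _ _ H H0 H1 H2 H3).
  - destruct (term_supp H) as [n [Nn Hn]], (term_supp H0) as [n' [Nn' Hn']].
    destruct (nat_max Nn Nn') as [m [Nm [M1 M2]]]. exists m. split; [exact Nm|].
    intros e e' E E' G K. apply H3. split; [exact E'|]. apply H3 in K.
    assert (G1 : agree n e e')
      by (destruct M1 as [M1| ->]; [exact (agree_mono (nat_ord Nm) M1 G)|exact G]).
    assert (G2 : agree n' e e')
      by (destruct M2 as [M2| ->]; [exact (agree_mono (nat_ord Nm) M2 G)|exact G]).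
    destruct K as [_ [x [X1 X2]]]. exists x.
    split; [exact (Hn e e' E E' G1 x X1)|exact (Hn' e e' E E' G2 x X2)].
  - destruct H. exact (C3 _ _ _ _ H H0 H1).
  - destruct H as [_ [n [Nn Hn]]]. exists n. split; [exact Nn|].
    intros e e' E E' G K. apply H1. apply H1 in K. split; [exact E'|]. intro K'.
    apply K. eapply Hn; [exact E'|exact E|apply Sym, G|exact K'].
  - destruct H, H0. exact (C4 _ _ _ _ _ _ _ H H0 H1 H2 H3).
  - destruct H as [_ [n [Nn Hn]]], H0 as [_ [n' [Nn' Hn']]].
    destruct (nat_max Nn Nn') as [m [Nm [M1 M2]]]. exists m. split; [exact Nm|].
    intros e e' E E' G K. apply H3. apply H3 in K.
    assert (G1 : agree n e e')
      by (destruct M1 as [M1| ->]; [exact (agree_mono (nat_ord Nm) M1 G)|exact G]).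
    assert (G2 : agree n' e e')
      by (destruct M2 as [M2| ->]; [exact (agree_mono (nat_ord Nm) M2 G)|exact G]).
    split; [exact (Hn e e' E E' G1 (proj1 K))|exact (Hn' e e' E E' G2 (proj2 K))].
  - destruct H. exact (C5 _ _ _ _ _ _ H H0 H1 H2 H3).
  - destruct H as [Hp [n [Nn Hn]]]. exists n. split; [exact Nn|].
    intros e e' E E' G K. apply H3. split; [exact E'|]. apply H3 in K.
    destruct K as [_ [e1 [K1 K2]]].
    assert (E1 : is_assignment U e1).
    { destruct (adjcl_above L) as [S [C LS]]. apply (fe_bound C LS Hp), K1. }
    assert (F1 := E1). apply asgE in F1.
    (* The witness at i is copied from [e1] into [e']; the result agrees with [e1] below [n], at i
       as well. *)
    destruct (asg_upd (x := ap e1 i) E' H0) as [e2 [E2 [U1 U2]]].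
    { apply (fun_ap_in F1), omE, H0. }
    exists e2. split; [|exact U2]. apply (Hn e1 e2 E1 E2); [|exact K1].
    intros k x Kk. destruct (classic (k = i)) as [->|NK].
    + assert (F2 := E2). apply asgE in F2. split; intro X.
      * rewrite (fun_val F1 X). exact U1.
      * rewrite (fun_unique F2 X U1). apply (fun_app F1), omE, H0.
    + rewrite <- (U2 k x NK), <- (K2 k x NK). apply G, Kk. }
destruct (classic (isF p)) as [[T K]|K].
- destruct (Main p T K) as [n [Nn Hn]]. exists n. split; [exact Nn|].
  intros e e' E E' G. rewrite !(sat_fe _ K). apply Hn; auto.
- exists emp. split; [apply nat_emp|]. intros e e' _ _ _ [T [K' _]]. exfalso. apply K.
  exists T. exact K'.
Qed.

End Structure.

(** With membership as the only symbol every term is a variable, so the atomic cases are reduced to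
    two. *)
Lemma mform_ind L A U I (Q : M -> Prop) sm : structure_data L A U I ->
  is_mem_symbol sm -> (forall s, s ∈ L <-> is_mem_symbol s) -> dfn1 Q ->
  (forall i j, is_natural i -> is_natural j -> Q (cR2 sm i j)) ->
  (forall i j, is_natural i -> is_natural j -> Q (cEq (tvar i) (tvar j))) ->
  (forall p, isF L U I p -> Q p -> Q (cNeg p)) ->
  (forall p q, isF L U I p -> isF L U I q -> Q p -> Q q -> Q (cAnd p q)) ->
  (forall i p, isF L U I p -> is_natural i -> Q p -> Q (cEx i p)) ->
  forall p, isF L U I p -> Q p.
Proof.
intros SD Hsm HL DQ Q1 Q2 Q3 Q4 Q5 p [T K].
assert (TV : forall t, is_term L t -> exists i, is_natural i /\ t = tvar i).
{ assert (D : dfn1 (fun t => exists i, is_natural i /\ tagged 0 i t)) by df.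
  intros t Tt. assert (X : exists i, is_natural i /\ tagged 0 i t).
  { revert t Tt. apply (term_ind D).
    - intros i Ni. exists i. split; [exact Ni|]. apply taggedE. reflexivity.
    - intros s n ts Ls [_ [a [q [P1 P2]]]]. apply HL, std_symbolE in Ls. subst s.
      apply taggedE in P2. apply tag_inj in P2. lia. }
  destruct X as [i [Ni X]]. apply taggedE in X. eauto. }
assert (DQ' : dfn2 (fun p T : M => Q p)) by df.
revert K. revert T. intros T K. apply (fe_ind (L := L) (U := U) (I := I) DQ') with (T := T); [|exact K].
destruct (fe_ecl L U I) as (C1 & C2 & C3 & C4 & C5). repeat split.
- exact (C1 _ _ _ _ _ _ _ H H0 H1 H2 H3 H4 H5 H6).
- assert (s = sm).
  { apply HL, std_symbolE in H. apply std_symbolE in Hsm. congruence. }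
  subst s. apply std_symbolE in Hsm. assert (n = num 2).
  { apply (rel_symbol_unique H0). rewrite Hsm. apply std_rel. }
  subst n. destruct H2 as [b Ft].
  destruct (TV _ (H3 _ _ (fun_app Ft (proj2 (num2E _) (or_introl eq_refl))))) as [i [Ni Ei]].
  destruct (TV _ (H3 _ _ (fun_app Ft (proj2 (num2E _) (or_intror eq_refl))))) as [j [Nj Ej]].
  apply is_pairE in H4. apply taggedE in H5. subst c q.
  rewrite (fun_seq2 Ft), Ei, Ej. exact (Q1 i j Ni Nj).
- exact (C2 _ _ _ _ _ H H0 H1 H2 H3).
- destruct (TV t H) as [i [Ni ->]], (TV t' H0) as [j [Nj ->]].
  apply is_pairE in H1. apply taggedE in H2. subst. exact (Q2 i j Ni Nj).
- destruct H. exact (C3 _ _ _ _ H H0 H1).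
- apply taggedE in H0. subst. destruct H. apply Q3; [exists P|]; auto.
- destruct H, H0. exact (C4 _ _ _ _ _ _ _ H H0 H1 H2 H3).
- apply is_pairE in H1. apply taggedE in H2. subst. destruct H, H0.
  apply Q4; [exists P|exists P'| |]; auto.
- destruct H. exact (C5 _ _ _ _ _ _ H H0 H1 H2 H3).
- apply is_pairE in H1. apply taggedE in H2. subst. destruct H. apply Q5; [exists P| |]; auto.
Qed.

End Satisfaction.

(** * Reflection *)

Definition vbnd (b : nat) (t : nat + Empty_set) : Prop :=
  match t with inl i => i < b | inr _ => True end.

Lemma vbnd_ex (q : fml Empty_set) : exists b, fbnd vbnd b q.
Proof.
assert (A : forall s t : nat + Empty_set, exists b, vbnd b s /\ vbnd b t).
{ intros [i|[]] [j|[]]. exists (S (i + j)); simpl; lia. }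
assert (Mo : forall (d d' : nat) t, d <= d' -> vbnd d t -> vbnd d' t).
{ intros d d' [i|i]; simpl; lia || tauto. }
induction q as [s t|s t|p IH|p IHp r IHr|p IH]; simpl; auto.
- destruct IHp as [b H], IHr as [d G]. exists (b + d).
  split; [revert H | revert G]; apply fbnd_mono; auto; lia.
- destruct IH as [b H]. exists b. revert H. apply fbnd_mono; auto; lia.
Qed.

Lemma fsat_vbnd (N : universe) q b (v v' : nat -> N) : fbnd vbnd b q ->
  (forall i, i < b -> v i = v' i) -> (fsat (@noc N) q v <-> fsat (@noc N) q v').
Proof.
intros B E. apply fsat_ext with b; [|exact E]. revert B. apply fbnd_mono; [lia|].
intros d d' [i|[]] L; simpl; lia.
Qed.

Section Reflection.
Context {M : universe} {hM : ZFC M}.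
Notation fs := (fsat (@noc M)).

(** A Skolem condition: an existential subformula of [q] with parameters in [A] that has a witness
    at all has one in [B]. For A = B the Tarski-Vaught argument makes [q] absolute ([stp_fix]);
    closing off the levels of the hierarchy under this condition gives reflection. *)
Fixpoint stp (q : fml Empty_set) (A B : M) : Prop :=
  match q with
  | Mem _ _ | Eql _ _ => True
  | Neg p => stp p A B
  | And p r => stp p A B /\ stp r A B
  | Exs p => stp p A B /\ forall v, (forall i, v i ∈ A) ->
      (exists x, fs p (x .: v)) -> exists x, x ∈ B /\ fs p (x .: v)
  end.

(** A block of [n] quantifiers bounded by [A]. As [k] variables are already bound, [A] is the
    variable [k], and [S k] under the new quantifier. *)
Fixpoint allq (n k : nat) (q : fml Empty_set) : fml Empty_set :=
  match n with
  | 0 => q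
  | S n => Neg (Exs (And (Mem (inl 0) (inl (S k))) (Neg (allq n (S k) q))))
  end.

Definition envB (k : nat) (l : nat -> M) (A B : M) : nat -> M :=
  fun i => if i <? k then l i else if i =? k then A else B.

Lemma envB_cons k l A B x : x .: envB k l A B = envB (S k) (x .: l) A B.
Proof.
apply functional_extensionality; intros [|i]; unfold envB; simpl; reflexivity.
Qed.

Lemma allq_sat n q : forall k l A B,
  fs (allq n k q) (envB k l A B) <->
  forall v, (forall i, i < n -> v i ∈ A) ->
    fs q (envB (n + k) (fun i => if i <? n then v i else l (i - n)) A B).
Proof.
induction n as [|n IH]; intros k l A B.
- simpl. split.
  + intros K v _. replace (fun i => l (i - 0)) with l; [exact K|].
    apply functional_extensionality; intro i. f_equal; lia.
  + intro K. specialize (K l). replace (fun i => l (i - 0)) with l in K; [apply K; lia|].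
    apply functional_extensionality; intro i. f_equal; lia.
- cbn [allq fsat teval]. split.
  + intros K v V.
    assert (K1 : fs (allq n (S k) q) (envB (S k) (v n .: l) A B)).
    { apply NNPP; intro K2. apply K. exists (v n). split.
      - unfold scons, envB. rewrite Nat.ltb_irrefl, Nat.eqb_refl. apply V. lia.
      - rewrite envB_cons. exact K2. }
    rewrite IH in K1. specialize (K1 v (fun i L => V i (Nat.lt_lt_succ_r _ _ L))).
    replace (S n + k) with (n + S k) by lia.
    replace (fun i => if i <? S n then v i else l (i - S n)) with
      (fun i => if i <? n then v i else (v n .: l) (i - n)); [exact K1|].
    apply functional_extensionality; intro i.
    destruct (Nat.ltb_spec i n), (Nat.ltb_spec i (S n)); try lia; try reflexivity.
    * replace (i - n) with 0 by lia. simpl. f_equal; lia.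
    * replace (i - n) with (S (i - S n)) by lia. reflexivity.
  + intros K [x [X N]]. apply N. rewrite envB_cons. apply IH. intros v V.
    assert (XA : x ∈ A).
    { unfold scons, envB in X. rewrite Nat.ltb_irrefl, Nat.eqb_refl in X. exact X. }
    specialize (K (fun i => if i =? n then x else v i)).
    replace (S n + k) with (n + S k) in K by lia.
    replace (fun i => if i <? n then v i else (x .: l) (i - n)) with
      (fun i => if i <? S n then if i =? n then x else v i else l (i - S n)).
    * apply K. intros i L. destruct (Nat.eqb_spec i n); [exact XA|]. apply V. lia.
    * apply functional_extensionality; intro i.
      destruct (Nat.ltb_spec i n), (Nat.ltb_spec i (S n)), (Nat.eqb_spec i n);
        try lia; try reflexivity.
      -- replace (i - n) with 0 by lia. reflexivity.
      -- replace (i - n) with (S (i - S n)) by lia. reflexivity.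
Qed.

(* [wit b p], at [v .: A .: B] with [b] entries in [v]: a witness for [p] exists in [B]
   if it exists at all. *)
Definition wit (b : nat) (p : fml Empty_set) : fml Empty_set :=
  Neg (And (Exs p) (Neg (Exs (And (Mem (inl 0) (inl (S (S b)))) p)))).

Lemma wit_sat b p (l : nat -> M) A B : fbnd vbnd (S b) p ->
  fs (wit b p) (envB b l A B) <->
  ((exists x, fs p (x .: l)) -> exists x, x ∈ B /\ fs p (x .: l)).
Proof.
intro Bd. assert (E : forall x, fs p (x .: envB b l A B) <-> fs p (x .: l)).
{ intro x. apply (fsat_vbnd Bd). intros [|i] L; [reflexivity|]. simpl. unfold envB.
  destruct (Nat.ltb_spec i b); [reflexivity|lia]. }
assert (I2 : forall x, (x .: envB b l A B) (S (S b)) = B).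
{ intro x. simpl. unfold envB. destruct (Nat.ltb_spec (S b) b); [lia|].
  destruct (Nat.eqb_spec (S b) b); [lia|reflexivity]. }
unfold wit. cbn [fsat teval]. split.
- intros K [x X]. apply NNPP; intro N. apply K. split; [exists x; apply E, X|].
  intros [y [Y1 Y2]]. apply N. exists y. rewrite I2 in Y1. split; [exact Y1|apply E, Y2].
- intros K [[x X] N]. apply N. destruct K as [y [Y1 Y2]]; [exists x; apply E, X|].
  exists y. rewrite I2. split; [exact Y1|apply E, Y2].
Qed.

(** Environments are infinite, but only entries below a bound matter. A block of finitely many
    quantifiers bounded by [A] therefore replaces the quantification over environments. *)
Lemma stp_form q : dfn2 (stp q).
Proof.
induction q as [s t|s t|p IH|p IHp r IHr|p IH]; simpl; try df; auto.
(* The extra quantifier ensures that an entry [w 0] in [A] is given; it fills the environment from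
   [b] on. *)
destruct (vbnd_ex p) as [b0 B0]. set (b := S b0).
assert (B : fbnd vbnd (S b) p).
{ revert B0. apply fbnd_mono; [unfold b; lia|]. intros d d' [i|[]] L; simpl; lia. }
unfold dfn2. apply dfn_and; [exact IH|].
apply dfn_ext with (fun v => fs (allq b 0 (wit b p)) (envB 0 v (v 0) (v 1))).
- intro v. rewrite allq_sat. split.
  + intros K w W. specialize (K w (fun i _ => W i)). replace (b + 0) with b in K by lia.
    rewrite (wit_sat _ _ _ B) in K.
    assert (E : forall x, fs p (x .: (fun i => if i <? b then w i else v (i - b))) <->
      fs p (x .: w)).
    { intro x. apply (fsat_vbnd B). intros [|i] L; [reflexivity|]. simpl.
      destruct (Nat.ltb_spec i b); [reflexivity|lia]. }
    intros [x X]. destruct K as [y [Y1 Y2]]; [exists x; apply E, X|].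
    exists y. split; [exact Y1|apply E, Y2].
  + intros K w W. replace (b + 0) with b by lia. rewrite (wit_sat _ _ _ B).
    set (w' := fun i => if i <? b then w i else w 0).
    assert (E : forall x, fs p (x .: (fun i => if i <? b then w i else v (i - b))) <->
      fs p (x .: w')).
    { intro x. apply (fsat_vbnd B). intros [|i] L; [reflexivity|]. simpl. unfold w'.
      destruct (Nat.ltb_spec i b); [reflexivity|lia]. }
    intros [x X]. destruct (K w') as [y [Y1 Y2]].
    * intro i. unfold w'. destruct (Nat.ltb_spec i b); apply W; unfold b in *; lia.
    * exists x. apply E, X.
    * exists y. split; [exact Y1|apply E, Y2].
- apply (@dfn_UD M (fun N w => fsat (@noc N) (allq b 0 (wit b p)) w)
    (fun i v => envB 0 v (v 0) (v 1) i)); [|exists (allq b 0 (wit b p)); intros; tauto].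
  intro i. unfold envB. simpl. destruct (i =? 0); tms.
Qed.

(** Induction on the number of quantifiers still to be read, with one use of collection for each: a
    single level bounds the witnesses for all tuples from [A]. *)
Lemma coll_n p b A : fbnd vbnd (S b) p -> forall n k l, n + k = b ->
  exists c, is_ordinal c /\ forall B, subset (V_ c) B ->
    fs (allq n k (wit b p)) (envB k l A B).
Proof.
intro Bd. induction n as [|n IH]; intros k l E.
- simpl in E. subst k. simpl.
  destruct (classic (exists x, fs p (x .: l))) as [[x X]|N].
  + destruct (V_univ x) as [c [C Xc]]. exists c. split; [exact C|].
    intros B SB0. apply (wit_sat _ _ _ Bd). intros _. exists x. auto.
  + exists emp. split; [apply emp_ord|]. intros B _. apply (wit_sat _ _ _ Bd). tauto.
- set (F := fun x B => fs (allq n (S k) (wit b p)) (envB (S k) (x .: l) A B)).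
  assert (DF : dfn2 F).
  { apply (@dfn_UD M (fun N w => fsat (@noc N) (allq n (S k) (wit b p)) w)
      (fun i v => envB (S k) (v 0 .: l) A (v 1) i)).
    - intro i. unfold envB. destruct (i <? S k).
      + destruct i; simpl; tms.
      + destruct (i =? S k); tms.
    - exists (allq n (S k) (wit b p)); intros; tauto. }
  set (R := fun x c => is_ordinal c /\ forall B V, is_V c V -> subset V B -> F x B).
  assert (D : dfn2 R) by (unfold R; df).
  destruct (collection A D) as [c [C K]]. exists c. split; [exact C|]. intros B SB0.
  cbn [allq fsat teval]. intros [x [X N]]. apply N. rewrite envB_cons.
  assert (XA : x ∈ A).
  { unfold scons, envB in X. rewrite Nat.ltb_irrefl, Nat.eqb_refl in X. exact X. }
  destruct (K x XA) as [d [Dc [Od Rd]]].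
  { destruct (IH (S k) (x .: l)) as [d [Od Rd]]; [lia|]. exists d. split; [exact Od|].
    intros B' V HV SB. apply Rd. rewrite <- (is_VE HV). exact SB. }
  apply (Rd B (V_ d) (VP Od)). intros z Z. apply SB0.
  apply (V_mono (VP C) (VP Od)); [|exact Z]. apply (V_ord_mem (VP C) Od), Dc.
Qed.

Lemma stp_mono q : forall A B B', stp q A B -> subset B B' -> stp q A B'.
Proof.
induction q as [s t|s t|p IH|p IHp r IHr|p IH]; intros A B B' K S; simpl in *; auto.
- eauto.
- destruct K; split; eauto.
- destruct K as [K1 K2]. split; [eauto|]. intros v V E. destruct (K2 v V E) as [x [X Y]].
  exists x. auto.
Qed.
Lemma stp_anti q : forall A A' B, stp q A B -> subset A' A -> stp q A' B.
Proof.
induction q as [s t|s t|p IH|p IHp r IHr|p IH]; intros A A' B K S; simpl in *; auto.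
- eauto.
- destruct K; split; eauto.
- destruct K as [K1 K2]. split; [eauto|]. intros v V E. apply K2; auto.
Qed.

Lemma stp_ex q A : exists c, is_ordinal c /\ stp q A (V_ c).
Proof.
induction q as [s t|s t|p IH|p IHp r IHr|p IH]; simpl.
- exists emp. split; [apply emp_ord|exact I].
- exists emp. split; [apply emp_ord|exact I].
- exact IH.
- destruct IHp as [c [C K]], IHr as [d [D L]].
  destruct (ord_above (upr c d)) as [e [E SE]]. exists e. split; [exact E|].
  assert (c ∈ e) by (apply SE; [apply uprE; auto|exact C]).
  assert (d ∈ e) by (apply SE; [apply uprE; auto|exact D]).
  split.
  + apply (stp_mono K). exact (V_mono (VP E) (VP C) H).
  + apply (stp_mono L). exact (V_mono (VP E) (VP D) H0).
- destruct IH as [c [C K]]. destruct (vbnd_ex p) as [b0 B0].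
  assert (B : fbnd vbnd (S b0) p).
  { revert B0. apply fbnd_mono; [lia|]. intros d d' [i|[]] L; simpl; lia. }
  destruct (coll_n A B (n := b0) (k := 0) (fun _ => A)) as [d [D L]]; [lia|].
  destruct (ord_above (upr c d)) as [e [E SE]]. exists e. split; [exact E|].
  assert (Hc : c ∈ e) by (apply SE; [apply uprE; auto|exact C]).
  assert (Hd : d ∈ e) by (apply SE; [apply uprE; auto|exact D]).
  split.
  + apply (stp_mono K). exact (V_mono (VP E) (VP C) Hc).
  + intros v V Ex. specialize (L (V_ e) (V_mono (VP E) (VP D) Hd)).
    rewrite allq_sat in L. specialize (L v (fun i _ => V i)).
    replace (b0 + 0) with b0 in L by lia. rewrite (wit_sat _ _ _ B) in L.
    assert (Eq : forall x, fs p (x .: (fun i => if i <? b0 then v i else A)) <->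
      fs p (x .: v)).
    { intro x. apply (fsat_vbnd B). intros [|i] Li; [reflexivity|]. simpl.
      destruct (Nat.ltb_spec i b0); [reflexivity|lia]. }
    destruct Ex as [x X]. destruct L as [y [Y1 Y2]]; [exists x; apply Eq, X|].
    exists y. split; [exact Y1|apply Eq, Y2].
Qed.

Lemma stp_fix q W : stp q W W -> forall v : nat -> setu W,
  fsat (@noc (setu W)) q v <-> fs q (fun i => proj1_sig (v i)).
Proof.
induction q as [s t|s t|p IH|p IHp r IHr|p IH]; simpl; intros K v.
- destruct s as [i|[]], t as [j|[]]. simpl. tauto.
- destruct s as [i|[]], t as [j|[]]. simpl.
  split; [intro E; exact (f_equal (@proj1_sig _ _) E)|apply sub_eq].
- rewrite (IH K). tauto.
- rewrite (IHp (proj1 K)), (IHr (proj2 K)). tauto.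
- destruct K as [K1 K2].
  assert (E : forall x : setu W, (fun i => proj1_sig ((x .: v) i)) =
    proj1_sig x .: (fun i => proj1_sig (v i))).
  { intro x; apply functional_extensionality; intros [|i]; reflexivity. }
  split.
  + intros [x X]. exists (proj1_sig x). apply (IH K1) in X. rewrite E in X. exact X.
  + intro X. destruct (K2 (fun i => proj1_sig (v i)) (fun i => proj2_sig (v i)) X)
      as [x [h Y]]. exists (exist _ x h). apply (IH K1). rewrite E. exact Y.
Qed.

(** [a] is closed under passing from c to some b with [stp q] from V_c to V_b. An environment over
    V_a has finitely many relevant entries, and these lie in one V_c with c < a. *)
Lemma reflection (q : fml Empty_set) a0 : is_ordinal a0 -> exists a, limit a /\ a0 ∈ a /\
  stp q (V_ a) (V_ a).
Proof.
intro A0.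
assert (D : dfn2 (fun c b => exists u v, is_V c u /\ is_V b v /\ stp q u v)).
{ assert (D0 := stp_form q). df. }
destruct (closure_ordinal D) with (a0 := a0) as [a [L [A K]]].
- intros c C. destruct (stp_ex q (V_ c)) as [b [B S]]. exists b. split; [exact B|].
  exists (V_ c), (V_ b). split; [exact (VP C)|]. split; [exact (VP B)|exact S].
- intros c b b' B' [u [v [U [V S]]]] Hb. exists u, (V_ b'). split; [exact U|].
  split; [exact (VP B')|]. apply (stp_mono S). exact (V_mono (VP B') V Hb).
- intros c c' b Oc Hc [u [v [U [V S]]]]. exists (V_ c'), v.
  assert (Oc' := ord_el Oc Hc). split; [exact (VP Oc')|]. split; [exact V|].
  apply (stp_anti S). exact (V_mono U (VP Oc') Hc).
- exact A0.
- exists a. split; [exact L|]. split; [exact A|].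
  assert (T : forall c, c ∈ a -> stp q (V_ c) (V_ a)).
  { intros c C. destruct (K c C) as [b [B [u [v [U [V S]]]]]].
    rewrite (is_VE U) in S. apply (stp_mono S). exact (V_mono (VP (proj1 L)) V B). }
  assert (Fin : forall (v : nat -> M) n, (forall i, v i ∈ V_ a) -> exists c, c ∈ a /\
    forall i, i < n -> v i ∈ V_ c).
  { intros v n V. induction n as [|n [c [C IH]]].
    - exists a0. split; [exact A|]. intros i Li. lia.
    - assert (X := V n). apply (V_eqn _ (VP (proj1 L))) in X.
      destruct X as [d [u [Hd [Hu Su]]]].
      destruct (limit_max L C Hd) as [e [E [E1 E2]]].
      assert (Oe := ord_el (proj1 L) E). exists (suc e).
      split; [exact (limit_suc L E)|]. intros i Li.
      assert (Os := VP (ord_suc Oe)).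
      destruct (Nat.eq_dec i n) as [->|Ne].
      + apply (V_eqn _ Os). exists e, (V_ e). split; [apply suc_mem|].
        split; [exact (VP Oe)|]. intros z Z. apply Su in Z.
        exact (V_mono_sub (VP Oe) Hu E2 Z).
      + assert (Vi : v i ∈ V_ c) by (apply IH; lia).
        apply (V_mono_sub Os (VP (ord_el (proj1 L) C))); [|exact Vi].
        intros z Z. apply sucE. left. auto. }
  clear K D.
  induction q as [s t|s t|p IH|p IHp r IHr|p IH]; simpl in *.
  + exact I.
  + exact I.
  + apply IH. exact T.
  + split; [apply IHp|apply IHr]; intros c C; apply (T c C).
  + split; [apply IH; intros c C; apply (T c C)|].
    intros v V Ex. destruct (vbnd_ex p) as [b B].
    destruct (Fin v (S b) V) as [c [C Vc]].
    set (w := fun i => if i <? S b then v i else v 0).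
    assert (E : forall x, fs p (x .: w) <-> fs p (x .: v)).
    { intro x. apply (fsat_vbnd B). intros [|i] Li; [reflexivity|]. simpl. unfold w.
      destruct (Nat.ltb_spec i (S b)); [reflexivity|lia]. }
    destruct (proj2 (T c C) w) as [x [X Y]].
    * intro i. unfold w. destruct (Nat.ltb_spec i (S b)); apply Vc; lia.
    * destruct Ex as [x X]. exists x. apply E, X.
    * exists x. split; [exact X|apply E, Y].
Qed.

End Reflection.

(** * The Levy hierarchy *)

(** Bound names count as well, so every name from [m] on is fresh. *)
Fixpoint names (m : nat) (p : form) : Prop :=
  match p with
  | f_mem i j | f_eq i j => i < m /\ j < m
  | f_not q => names m q
  | f_and q r | f_imp q r => names m q /\ names m r
  | f_ex i q | f_all i q => i < m /\ names m q
  end.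

Lemma names_mono p : forall m m', m <= m' -> names m p -> names m' p.
Proof. induction p; simpl; intros m m' L; intuition eauto with arith; lia. Qed.
Lemma names_ex p : exists m, names m p.
Proof.
induction p as [i j|i j|q IH|q IHq r IHr|q IHq r IHr|i q IH|i q IH]; simpl.
- exists (S (i + j)). lia.
- exists (S (i + j)). lia.
- exact IH.
- destruct IHq as [m H], IHr as [n G]. exists (m + n).
  split; [revert H|revert G]; apply names_mono; lia.
- destruct IHq as [m H], IHr as [n G]. exists (m + n).
  split; [revert H|revert G]; apply names_mono; lia.
- destruct IH as [m H]. exists (S (i + m)). split; [lia|]. revert H. apply names_mono; lia.
- destruct IH as [m H]. exists (S (i + m)). split; [lia|]. revert H. apply names_mono; lia.
Qed.

Lemma upd_same (T : Type) (v : nat -> T) i x : upd v i x i = x.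
Proof. unfold upd. rewrite Nat.eqb_refl. reflexivity. Qed.
Lemma upd_other (T : Type) (v : nat -> T) i j x : j <> i -> upd v i x j = v j.
Proof. intro N. unfold upd. destruct (Nat.eqb_spec j i); congruence. Qed.

Lemma satisfies_ext (M : universe) (D D' : M -> Prop) p m :
  (forall x, D x <-> D' x) -> names m p -> forall v v', (forall i, i < m -> v i = v' i) ->
  (satisfies D p v <-> satisfies D' p v').
Proof.
intros E. induction p as [i j|i j|q IH|q IHq r IHr|q IHq r IHr|i q IH|i q IH];
  simpl; intros B v v' V.
- rewrite !V; tauto.
- rewrite !V; tauto.
- rewrite (IH B v v' V); tauto.
- rewrite (IHq (proj1 B) v v' V), (IHr (proj2 B) v v' V); tauto.
- rewrite (IHq (proj1 B) v v' V), (IHr (proj2 B) v v' V); tauto.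
- assert (K : forall x, satisfies D q (upd v i x) <-> satisfies D' q (upd v' i x)).
  { intro x. apply IH; [tauto|]. intros k L. unfold upd. destruct (Nat.eqb k i); auto. }
  split; intros [x [X Y]]; exists x; (split; [apply E, X|apply K, Y]).
- assert (K : forall x, satisfies D q (upd v i x) <-> satisfies D' q (upd v' i x)).
  { intro x. apply IH; [tauto|]. intros k L. unfold upd. destruct (Nat.eqb k i); auto. }
  split; intros X x Y; apply K, X, E, Y.
Qed.

Fixpoint rel (w : nat) (p : form) : form :=
  match p with
  | f_mem i j => f_mem i j
  | f_eq i j => f_eq i j
  | f_not q => f_not (rel w q)
  | f_and q r => f_and (rel w q) (rel w r)
  | f_imp q r => f_imp (rel w q) (rel w r)
  | f_ex i q => f_ex i (f_and (f_mem i w) (rel w q))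
  | f_all i q => f_all i (f_imp (f_mem i w) (rel w q))
  end.

Lemma rel_Delta0 w p : names w p -> Delta0 (rel w p).
Proof.
induction p as [i j|i j|q IH|q IHq r IHr|q IHq r IHr|i q IH|i q IH]; simpl; intro B;
  constructor; try tauto; lia.
Qed.

Lemma rel_sat (M : universe) (D : M -> Prop) w p : names w p -> forall v,
  (forall x, x ∈ v w -> D x) ->
  (satisfies D (rel w p) v <-> satisfies (fun x => x ∈ v w) p v).
Proof.
induction p as [i j|i j|q IH|q IHq r IHr|q IHq r IHr|i q IH|i q IH];
  simpl; intros B v V; try tauto.
- rewrite (IH B v V); tauto.
- rewrite (IHq (proj1 B) v V), (IHr (proj2 B) v V); tauto.
- rewrite (IHq (proj1 B) v V), (IHr (proj2 B) v V); tauto.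
- assert (E : forall x, upd v i x w = v w) by (intro x; apply upd_other; lia).
  assert (K : forall x, satisfies D (rel w q) (upd v i x) <->
    satisfies (fun y => y ∈ v w) q (upd v i x)).
  { intro x. rewrite (IH (proj2 B)); rewrite E; [tauto|exact V]. }
  split.
  + intros [x [X [Y Z]]]. exists x. rewrite upd_same, E in Y. split; [exact Y|apply K, Z].
  + intros [x [X Y]]. exists x. rewrite upd_same, E. split; [auto|]. split; [auto|apply K, Y].
- assert (E : forall x, upd v i x w = v w) by (intro x; apply upd_other; lia).
  assert (K : forall x, satisfies D (rel w q) (upd v i x) <->
    satisfies (fun y => y ∈ v w) q (upd v i x)).
  { intro x. rewrite (IH (proj2 B)); rewrite E; [tauto|exact V]. }
  split.
  + intros X x Y. apply K, X; [auto|]. rewrite upd_same, E. exact Y.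
  + intros X x Y Z. rewrite upd_same, E in Z. apply K, X, Z.
Qed.

Definition trcls (M : universe) (D : M -> Prop) := forall x y, D x -> y ∈ x -> D y.

Lemma Delta0_abs (M : universe) (D D' : M -> Prop) p : trcls D -> trcls D' -> Delta0 p ->
  forall o, (forall i, D (o i)) -> (forall i, D' (o i)) ->
  (satisfies D p o <-> satisfies D' p o).
Proof.
intros T T' K.
assert (U : forall (E : M -> Prop) o i x,
  (forall k, E (o k)) -> E x -> forall k, E (upd o i x k)).
{ intros E o i x A B k. unfold upd. destruct (Nat.eqb k i); auto. }
induction K as [i j|i j|p K IH|p q Kp IHp Kq IHq|p q Kp IHp Kq IHq|i j p N K IH|i j p N K IH];
  intros o O O'; simpl.
- tauto.
- tauto.
- rewrite (IH o O O'); tauto.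
- rewrite (IHp o O O'), (IHq o O O'); tauto.
- rewrite (IHp o O O'), (IHq o O O'); tauto.
- split; intros [x [X [Y Z]]]; exists x; assert (Y' := Y);
    rewrite upd_same, upd_other in Y' by auto.
  + assert (X' : D' x) by exact (T' _ _ (O' j) Y'). split; [exact X'|].
    split; [exact Y|]. apply (IH _ (U D o i x O X) (U D' o i x O' X')), Z.
  + assert (X' : D x) by exact (T _ _ (O j) Y'). split; [exact X'|].
    split; [exact Y|]. apply (IH _ (U D o i x O X') (U D' o i x O' X)), Z.
- split; intros Z x X Y; assert (Y' := Y); rewrite upd_same, upd_other in Y' by auto.
  + assert (X' : D x) by exact (T _ _ (O j) Y').
    apply (IH _ (U D o i x O X') (U D' o i x O' X)), Z; assumption.
  + assert (X' : D' x) by exact (T' _ _ (O' j) Y').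
    apply (IH _ (U D o i x O X) (U D' o i x O' X')), Z; assumption.
Qed.

Scheme Sigma_mut := Induction for Sigma Sort Prop
  with Pi_mut := Induction for Pi Sort Prop.
Combined Scheme Sigma_Pi_ind from Sigma_mut, Pi_mut.

Lemma Sigma_Pi_mono : (forall n p, Sigma n p -> Sigma (S n) p) /\
  (forall n p, Pi n p -> Pi (S n) p).
Proof.
apply Sigma_Pi_ind; intros.
- apply Sigma_Pi, Pi_zero, d.
- apply Sigma_Pi. assumption.
- apply Sigma_ex. assumption.
- apply Pi_Sigma, Sigma_zero, d.
- apply Pi_Sigma. assumption.
- apply Pi_all. assumption.
Qed.
Lemma Sigma_le n m p : n <= m -> Sigma n p -> Sigma m p.
Proof. induction 1; intro K; [exact K|]. apply Sigma_Pi_mono; auto. Qed.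

Definition exs (l : list nat) (p : form) : form := fold_right f_ex p l.
Definition alls (l : list nat) (p : form) : form := fold_right f_all p l.

Lemma Pi1_inv p : Pi 1 p -> exists l d, Delta0 d /\ p = alls l d.
Proof.
intro K. remember 1 as n eqn:E. revert E.
induction K as [p D|n p S|n i p K IH]; intro E.
- discriminate.
- injection E as ->. inversion S; subst. exists nil, p. auto.
- destruct (IH E) as [l [d [D ->]]]. exists (i :: l), d. auto.
Qed.
Lemma Sigma2_inv p : Sigma 2 p -> exists l d, Pi 1 d /\ p = exs l d.
Proof.
intro K. remember 2 as n eqn:E. revert E.
induction K as [p D|n p S|n i p K IH]; intro E.
- discriminate.
- injection E as ->. exists nil, p. auto.
- destruct (IH E) as [l [d [D ->]]]. exists (i :: l), d. auto.
Qed.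

Lemma exs_sat (M : universe) (D : M -> Prop) l p : forall o,
  satisfies D (exs l p) o <-> exists o', (forall i, ~ In i l -> o' i = o i) /\
    (forall i, In i l -> D (o' i)) /\ satisfies D p o'.
Proof.
induction l as [|i l IH]; intro o; simpl.
- split.
  + intro K. exists o. split; [auto|]. split; [tauto|exact K].
  + intros [o' [E [_ K]]]. replace o with o'; [exact K|].
    apply functional_extensionality; auto.
- split.
  + intros [x [X K]]. apply IH in K. destruct K as [o' [E [F K]]].
    exists o'. split; [|split; [|exact K]].
    * intros k N. rewrite E by tauto. apply upd_other. intros ->. tauto.
    * intros k [<-|J]; [|auto]. destruct (in_dec Nat.eq_dec i l) as [J|J]; [auto|].
      rewrite (E i J), upd_same. exact X.
  + intros [o' [E [F K]]]. exists (o' i). split; [auto|]. apply IH. exists o'.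
    split; [|split; [|exact K]]; [|auto]. intros k N.
    destruct (Nat.eq_dec k i) as [->|N']; [rewrite upd_same; auto|].
    rewrite upd_other by exact N'. apply E. intros [J|J]; auto.
Qed.

Lemma alls_mono (M : universe) (D D' : M -> Prop) l d : trcls D -> trcls D' ->
  (forall x, D' x -> D x) -> Delta0 d -> forall o, (forall i, D' (o i)) ->
  satisfies D (alls l d) o -> satisfies D' (alls l d) o.
Proof.
intros T T' S Dd. induction l as [|i l IH]; intros o O; simpl.
- apply Delta0_abs; auto.
- intros K x X. apply IH; [|apply K; auto].
  intro k. unfold upd. destruct (Nat.eqb k i); auto.
Qed.

(* A false Pi_1 statement stays false in every transitive set that contains the
   finitely many elements of a counterexample. *)
Lemma alls_fail (M : universe) (D : M -> Prop) l d : trcls D -> Delta0 d ->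
  forall o, (forall i, D (o i)) -> ~ satisfies D (alls l d) o ->
  exists ys : list M, (forall y, In y ys -> D y) /\
    forall D' : M -> Prop, trcls D' -> (forall i, D' (o i)) ->
      (forall y, In y ys -> D' y) -> ~ satisfies D' (alls l d) o.
Proof.
intros T Dd. induction l as [|i l IH]; intros o O; simpl.
- intro K. exists nil. split; [intros y []|]. intros D' T' O' _ K'. apply K.
  apply (Delta0_abs T T' Dd O O'), K'.
- intro K. assert (E : exists x, D x /\ ~ satisfies D (alls l d) (upd o i x)).
  { apply NNPP; intro N. apply K. intros x X. apply NNPP; intro L. apply N. eauto. }
  destruct E as [x [X E]].
  destruct (IH (upd o i x)) as [ys [Y1 Y2]]; [|exact E|].
  + intro k. unfold upd. destruct (Nat.eqb k i); auto.
  + exists (x :: ys). split; [intros y [<-|J]; auto|].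
    intros D' T' O' Z K'. apply (Y2 D' T').
    * intro k. unfold upd. destruct (Nat.eqb k i); [|auto]. apply Z. left. reflexivity.
    * intros y J. apply Z. right. exact J.
    * apply K'. apply Z. left. reflexivity.
Qed.

(** * Codes of external formulas *)

Section Codes_of_forms.
Variable N : universe.
Implicit Types c d q t : N.

Definition is_cMem c i j := exists s ti tj ts q, is_mem_symbol s /\ tagged 0 i ti /\
  tagged 0 j tj /\ is_seq2 ts ti tj /\ is_pair q s ts /\ @tagged N 0 q c.
Definition is_cEq c i j := exists ti tj q, tagged 0 i ti /\ tagged 0 j tj /\
  is_pair q ti tj /\ @tagged N 1 q c.
Definition is_cNeg c d := @tagged N 2 d c.
Definition is_cAnd c d d' := exists q, is_pair q d d' /\ @tagged N 3 q c.
Definition is_cEx c i d := exists q, is_pair q i d /\ @tagged N 4 q c.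

(** The coded language has negation, conjunction and existential quantification only; implication
    and universal quantification are coded through them. Being phrased by predicates, the coding
    makes sense in every universe, in particular in transitive sets. *)
Fixpoint codes (p : form) c : Prop :=
  match p with
  | f_mem i j => exists i' j', is_num i i' /\ is_num j j' /\ is_cMem c i' j'
  | f_eq i j => exists i' j', is_num i i' /\ is_num j j' /\ is_cEq c i' j'
  | f_not q => exists d, codes q d /\ is_cNeg c d
  | f_and q r => exists d d', codes q d /\ codes r d' /\ is_cAnd c d d'
  | f_imp q r => exists d d' n a, codes q d /\ codes r d' /\ is_cNeg n d' /\
      is_cAnd a d n /\ is_cNeg c a
  | f_ex i q => exists i' d, is_num i i' /\ codes q d /\ is_cEx c i' d
  | f_all i q => exists i' d n a, is_num i i' /\ codes q d /\ is_cNeg n d /\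
      is_cEx a i' n /\ is_cNeg c a
  end.

Definition gstr (L A U I : N) := structure_data L A U I /\
  (forall s, is_mem_symbol s -> s ∈ L) /\ has_membership_reduct A U.
Definition isFm (L U I p : N) := exists T, formula_extension L U I p T.
End Codes_of_forms.
#[global] Instance UD_cMem : UD3 is_cMem.
Proof. unfold UD3, is_cMem. ud. Qed.
#[global] Instance UD_cEq : UD3 is_cEq.
Proof. unfold UD3, is_cEq. ud. Qed.
#[global] Instance UD_cNeg : UD2 is_cNeg.
Proof. unfold UD2, is_cNeg. ud. Qed.
#[global] Instance UD_cAnd : UD3 is_cAnd.
Proof. unfold UD3, is_cAnd. ud. Qed.
#[global] Instance UD_cEx : UD3 is_cEx.
Proof. unfold UD3, is_cEx. ud. Qed.
#[global] Instance UD_gstr : UD4 gstr.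
Proof. unfold UD4, gstr. ud. Qed.
#[global] Instance UD_isFm : UD4 isFm.
Proof. unfold UD4, isFm. ud. Qed.

(* The finitely many facts on finite sets, assignments and satisfaction that make the
   internal satisfaction relation correct for codes of external formulas. *)
Definition Tarski (N : universe) : Prop :=
  (exists e : N, is_empty e) /\
  (forall x y : N, exists z, forall w, w ∈ z <-> w ∈ x \/ w = y) /\
  (forall e : N, is_empty e -> is_natural e) /\
  (forall n s : N, is_natural n -> is_succ s n -> is_natural s) /\
  (forall U e i x : N, is_assignment U e -> is_natural i -> x ∈ U ->
    exists e', is_assignment U e' /\ app e' i x /\
      forall k y, k <> i -> (app e k y <-> app e' k y)) /\
  (forall U x : N, x ∈ U -> exists e, is_assignment U e) /\
  (forall x y : N, exists u, transitive u /\ x ∈ u /\ y ∈ u) /\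
  (forall u U e : N, transitive u -> e ∈ u -> is_assignment U e -> is_assignment u e) /\
  (forall u x : N, x ∈ u ->
    exists L A I, (forall s, s ∈ L <-> is_mem_symbol s) /\ gstr L A u I) /\
  forall L A U I : N, gstr L A U I ->
  (forall i j c, is_natural i -> is_natural j -> is_cMem c i j -> isFm L U I c /\
    forall e x y, is_assignment U e -> app e i x -> app e j y ->
      (structure_satisfies L A c e <-> x ∈ y)) /\
  (forall i j c, is_natural i -> is_natural j -> is_cEq c i j -> isFm L U I c /\
    forall e x y, is_assignment U e -> app e i x -> app e j y ->
      (structure_satisfies L A c e <-> x = y)) /\
  (forall d c, isFm L U I d -> is_cNeg c d -> isFm L U I c /\
    forall e, is_assignment U e ->
      (structure_satisfies L A c e <-> ~ structure_satisfies L A d e)) /\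
  (forall d d' c, isFm L U I d -> isFm L U I d' -> is_cAnd c d d' -> isFm L U I c /\
    forall e, structure_satisfies L A c e <->
      structure_satisfies L A d e /\ structure_satisfies L A d' e) /\
  (forall i d c, is_natural i -> isFm L U I d -> is_cEx c i d -> isFm L U I c /\
    forall e, is_assignment U e ->
      (structure_satisfies L A c e <-> exists e', is_assignment U e' /\
        structure_satisfies L A d e' /\ forall k x, k <> i -> (app e k x <-> app e' k x))).

Lemma UD_Tarski : UD (fun N v => Tarski N).
Proof. unfold Tarski. ud. Qed.

(** Distinctness of numerals is a scheme indexed by external numbers and cannot be part of the
    single sentence [Tarski]. Like the other added clauses it holds by absoluteness in every
    transitive set. *)
Record Std (N : universe) : Prop := {
  std_T : Tarski N;
  std_pair : forall p x y x' y' : N, is_pair p x y -> is_pair p x' y' -> x = x' /\ y = y';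
  std_num : forall i j (x : N), is_num i x -> is_num j x -> i = j;
  std_num1 : forall i (x y : N), is_num i x -> is_num i y -> x = y;
  std_ext : forall x y : N, (forall z, z ∈ x <-> z ∈ y) -> x = y }.

Section ExternalFormulas.
Variables (N : universe) (HS : Std N).

Lemma std_asg (U e k : N) : is_assignment U e -> is_natural k ->
  exists x, x ∈ U /\ app e k x /\ forall y, app e k y -> y = x.
Proof.
intros [w [W [F1 F2]]] K. apply W in K. destruct (F2 k K) as [x [X1 X2]]. exists x.
split; [|split; [exact X1|]].
- destruct X1 as [p [P Q]]. destruct (F1 p Q) as [k' [x' [_ [X' P']]]].
  destruct (std_pair HS P P') as [_ ->]. exact X'.
- intros y Y. symmetry. exact (X2 y Y).
Qed.
Lemma std_num_nat i : forall x : N, is_num i x -> is_natural x.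
Proof.
destruct (std_T HS) as (_ & _ & T3 & T4 & _).
induction i as [|i IH]; intros x; simpl; [apply T3|].
intros [y [Y S]]. exact (T4 y x (IH y Y) S).
Qed.
Lemma std_adj (x y : N) : exists z, forall w, w ∈ z <-> w ∈ x \/ w = y.
Proof. apply (std_T HS). Qed.
Lemma std_num_ex i : exists x : N, is_num i x.
Proof.
destruct (std_T HS) as (T1 & T2 & _).
induction i as [|i [y Y]]; [exact T1|]. destruct (T2 y y) as [z Z]. exists z.
exists y. split; [exact Y|exact Z].
Qed.
Lemma std_upair_ex (x y : N) : exists p, is_upair p x y.
Proof.
destruct (std_T HS) as ([e E] & T2 & _). destruct (T2 e x) as [a Ha], (T2 a y) as [b Hb].
exists b. intro z. rewrite Hb, Ha. specialize (E z). tauto.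
Qed.
Lemma std_pair_ex (x y : N) : exists p, is_pair p x y.
Proof.
destruct (std_upair_ex x x) as [a Ha], (std_upair_ex x y) as [b Hb], (std_upair_ex a b) as [p Hp].
exists p, a, b. auto.
Qed.
Lemma std_tag_ex k (x : N) : exists c, tagged k x c.
Proof.
destruct (std_num_ex k) as [t T], (std_pair_ex t x) as [c C]. exists c, t. auto.
Qed.
Lemma codes_ex p : exists c : N, codes p c.
Proof.
induction p as [i j|i j|q [d IH]|q [d IHq] r [d' IHr]|q [d IHq] r [d' IHr]|i q [d IH]|i q [d IH]]; simpl.
- destruct (std_num_ex i) as [i' I], (std_num_ex j) as [j' J].
  destruct (std_num_ex 2) as [n2 N2], (std_num_ex 0) as [z Z], (std_num_ex 1) as [o O].
  destruct (std_pair_ex n2 z) as [q0 Q0], (std_tag_ex 0 q0) as [s S].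
  destruct (std_tag_ex 0 i') as [ti Ti], (std_tag_ex 0 j') as [tj Tj].
  destruct (std_pair_ex z ti) as [a Ha], (std_pair_ex o tj) as [b Hb].
  destruct (std_upair_ex a b) as [ts Ts], (std_pair_ex s ts) as [q Q], (std_tag_ex 0 q) as [c C].
  exists c, i', j'. split; [exact I|]. split; [exact J|]. exists s, ti, tj, ts, q.
  split; [exists n2, z, q0; auto|]. split; [exact Ti|]. split; [exact Tj|].
  split; [exists z, o, a, b; auto|auto].
- destruct (std_num_ex i) as [i' I], (std_num_ex j) as [j' J].
  destruct (std_tag_ex 0 i') as [ti Ti], (std_tag_ex 0 j') as [tj Tj].
  destruct (std_pair_ex ti tj) as [q Q], (std_tag_ex 1 q) as [c C].
  exists c, i', j'. split; [exact I|]. split; [exact J|]. exists ti, tj, q. auto.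
- destruct (std_tag_ex 2 d) as [c C]. exists c, d. auto.
- destruct (std_pair_ex d d') as [q0 Q], (std_tag_ex 3 q0) as [c C]. exists c, d, d'.
  split; [exact IHq|]. split; [exact IHr|]. exists q0. auto.
- destruct (std_tag_ex 2 d') as [n N1], (std_pair_ex d n) as [q0 Q], (std_tag_ex 3 q0) as [a A],
    (std_tag_ex 2 a) as [c C].
  exists c, d, d', n, a. repeat (split; [assumption|]). split; [exists q0; auto|exact C].
- destruct (std_num_ex i) as [i' I], (std_pair_ex i' d) as [q0 Q], (std_tag_ex 4 q0) as [c C].
  exists c, i', d. split; [exact I|]. split; [exact IH|]. exists q0. auto.
- destruct (std_num_ex i) as [i' I], (std_tag_ex 2 d) as [n N1], (std_pair_ex i' n) as [q0 Q],
    (std_tag_ex 4 q0) as [a A], (std_tag_ex 2 a) as [c C].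
  exists c, i', d, n, a. repeat (split; [assumption|]). split; [exists q0; auto|exact C].
Qed.

(** External induction on the formula, where each case is a clause of [Tarski]; inside [N] nothing
    else is used about satisfaction. *)
Lemma codes_sat L A U I p : gstr L A U I -> forall c : N, codes p c ->
  isFm L U I c /\ forall e o, is_assignment U e ->
    (forall i n, is_num i n -> app e n (o i)) ->
    (structure_satisfies L A c e <-> satisfies (fun x => x ∈ U) p o).
Proof.
intro G. destruct (std_T HS) as (_ & _ & _ & _ & Tupd & _ & _ & _ & _ & T).
destruct (T L A U I G) as (T1 & T2 & T3 & T4 & T5). clear T.
(* Isolated because the universal quantifier uses it with a negated body. *)
assert (EX : forall i i' d c q, is_num i i' ->
  (isFm L U I d /\ forall e o, is_assignment U e ->
    (forall i n, is_num i n -> app e n (o i)) ->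
    (structure_satisfies L A d e <-> satisfies (fun x => x ∈ U) q o)) ->
  is_cEx c i' d -> isFm L U I c /\ forall e o, is_assignment U e ->
    (forall i n, is_num i n -> app e n (o i)) ->
    (structure_satisfies L A c e <-> satisfies (fun x => x ∈ U) (f_ex i q) o)).
{ intros i i' d c q Hi [Fd Sd] Hc. destruct (T5 i' d c (std_num_nat Hi) Fd Hc) as [F S].
  split; [exact F|]. intros e o E O. rewrite (S e E). simpl. split.
  - intros [e' [E' [Hs Ag]]]. destruct (std_asg E' (std_num_nat Hi)) as [x [X1 [X2 X3]]].
    exists x. split; [exact X1|]. apply (Sd e'); [exact E'| |exact Hs].
    intros j n Hn. destruct (Nat.eq_dec j i) as [->|NE].
    + rewrite upd_same, (std_num1 HS Hn Hi). exact X2.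
    + rewrite upd_other by exact NE. apply Ag; [|auto]. intros ->.
      apply NE. exact (std_num HS Hn Hi).
  - intros [x [X Hs]]. destruct (Tupd U e i' x E (std_num_nat Hi) X) as [e' [E' [A1 A2]]].
    exists e'. split; [exact E'|]. split; [|exact A2]. apply (Sd e' (upd o i x)); auto.
    intros j n Hn. destruct (Nat.eq_dec j i) as [->|NE].
    + rewrite upd_same, (std_num1 HS Hn Hi). exact A1.
    + rewrite upd_other by exact NE. apply A2; [|auto]. intros ->.
      apply NE. exact (std_num HS Hn Hi). }
induction p as [i j|i j|q IH|q IHq r IHr|q IHq r IHr|i q IH|i q IH]; simpl; intros c C.
- destruct C as [i' [j' [Hi [Hj C]]]].
  destruct (T1 i' j' c (std_num_nat Hi) (std_num_nat Hj) C) as [F S]. split; [exact F|].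
  intros e o E O. apply S; auto.
- destruct C as [i' [j' [Hi [Hj C]]]].
  destruct (T2 i' j' c (std_num_nat Hi) (std_num_nat Hj) C) as [F S]. split; [exact F|].
  intros e o E O. apply S; auto.
- destruct C as [d [Cd C]]. destruct (IH d Cd) as [Fd Sd].
  destruct (T3 d c Fd C) as [F S]. split; [exact F|]. intros e o E O.
  rewrite (S e E), (Sd e o E O). tauto.
- destruct C as [d [d' [Cd [Cd' C]]]]. destruct (IHq d Cd) as [Fd Sd], (IHr d' Cd') as [Fd' Sd'].
  destruct (T4 d d' c Fd Fd' C) as [F S]. split; [exact F|]. intros e o E O.
  rewrite (S e), (Sd e o E O), (Sd' e o E O). tauto.
- destruct C as [d [d' [n [a [Cd [Cd' [Hn [Ha C]]]]]]]].
  destruct (IHq d Cd) as [Fd Sd], (IHr d' Cd') as [Fd' Sd'].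
  destruct (T3 d' n Fd' Hn) as [Fn Sn]. destruct (T4 d n a Fd Fn Ha) as [Fa Sa].
  destruct (T3 a c Fa C) as [F S]. split; [exact F|]. intros e o E O.
  rewrite (S e E), (Sa e), (Sn e E), (Sd e o E O), (Sd' e o E O).
  split; [|tauto]. intros K L1. apply NNPP. tauto.
- destruct C as [i' [d [Hi [Cd C]]]]. exact (EX i i' d c q Hi (IH d Cd) C).
- destruct C as [i' [d [n [a [Hi [Cd [Hn [Ha C]]]]]]]]. destruct (IH d Cd) as [Fd Sd].
  destruct (T3 d n Fd Hn) as [Fn Sn].
  destruct (EX i i' n a (f_not q) Hi) as [Fa Sa]; [|exact Ha|].
  + split; [exact Fn|]. intros e o E O. rewrite (Sn e E), (Sd e o E O). simpl. tauto.
  + destruct (T3 a c Fa C) as [F S]. split; [exact F|]. intros e o E O.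
    rewrite (S e E), (Sa e o E O). simpl. split.
    * intros K x X. apply NNPP; intro L1. apply K. eauto.
    * intros K [x [X L1]]. apply L1, K, X.
Qed.

Lemma std_asg_list (U e : N) (o : nat -> N) (l : list nat) : is_assignment U e ->
  (forall i, In i l -> o i ∈ U) ->
  exists e', is_assignment U e' /\ (forall i n, In i l -> is_num i n -> app e' n (o i)) /\
    forall k, (forall i, In i l -> ~ is_num i k) -> forall x, app e k x <-> app e' k x.
Proof.
intro E. destruct (std_T HS) as (_ & _ & _ & _ & Tupd & _).
induction l as [|i l IH]; intro O.
- exists e. split; [exact E|]. split; [intros i n []|tauto].
- destruct IH as [e1 [E1 [A1 B1]]]; [intros j J; apply O; right; exact J|].
  destruct (std_num_ex i) as [i' Hi].
  destruct (Tupd U e1 i' (o i) E1 (std_num_nat Hi) (O i (or_introl eq_refl))) as [e2 [E2 [A2 B2]]].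
  exists e2. split; [exact E2|]. split.
  + intros j n J Hn. destruct (Nat.eq_dec j i) as [->|NE].
    * rewrite (std_num1 HS Hn Hi). exact A2.
    * apply B2; [intros ->; apply NE; exact (std_num HS Hn Hi)|].
      apply A1; [|exact Hn]. destruct J as [J|J]; [congruence|exact J].
  + intros k K x. rewrite (B1 k); [|intros j J; apply K; right; exact J].
    apply B2. intros ->. exact (K i (or_introl eq_refl) Hi).
Qed.
End ExternalFormulas.

(** * Membership structures on sets of the universe *)

Section MembershipStructures.
Context {M : universe} {hM : ZFC M}.
Implicit Types x y z a b c d e f g i j k p s t u v w n m h A B I L U R : M.

Definition smem : M := opr (num 0) (opr (num 2) (num 0)).
Lemma smemE s : is_mem_symbol s <-> s = smem.
Proof. apply std_symbolE. Qed.
Lemma smem_rel : is_rel_symbol smem (num 2).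
Proof. apply std_rel. Qed.

Lemma mstr_ex u x : x ∈ u ->
  exists L A I, (forall s, s ∈ L <-> is_mem_symbol s) /\ gstr L A u I.
Proof.
intro X.
assert (D : dfn1 (fun t => exists x y, x ∈ u /\ y ∈ u /\ x ∈ y /\ is_seq2 t x y)) by df.
set (R := sep (Pw (prod (num 2) u))
  (fun t => exists x y, x ∈ u /\ y ∈ u /\ x ∈ y /\ is_seq2 t x y)).
assert (HR : forall t, t ∈ R <-> exists x y, x ∈ u /\ y ∈ u /\ x ∈ y /\ t = seq2 x y).
{ intro t. unfold R. rewrite sepE by exact D. split.
  - intros [_ [y [z [Y [Z [K T]]]]]]. apply is_seq2E in T. eauto 6.
  - intros [y [z [Y [Z [K ->]]]]]. split.
    + apply PwE. intros q Q. assert (F := seq2_fun Y Z). apply (fun_mem _ F) in Q.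
      destruct Q as [k [Hk ->]]. apply prod_opr. split; [exact Hk|exact (fun_ap_in F Hk)].
    + exists y, z. rewrite is_seq2E. auto. }
assert (HL : forall s, s ∈ upr smem smem <-> s = smem) by (intro s; rewrite uprE; tauto).
exists (upr smem smem), (opr u (upr (opr smem R) (opr smem R))), (upr (opr smem R) (opr smem R)).
assert (FI : is_function (upr (opr smem R) (opr smem R)) (upr smem smem) (upr R R)).
{ split.
  - intros q Q. apply uprE in Q. exists smem, R. rewrite HL, uprE, is_pairE. tauto.
  - intros s S. apply HL in S. subst s. exists R. split; [apply appE, uprE; auto|].
    intros R' K. apply appE, uprE in K. destruct K as [K|K]; apply opr_inj in K; symmetry; tauto. }
assert (AI : forall s R', app (upr (opr smem R) (opr smem R)) s R' <-> s = smem /\ R' = R).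
{ intros s R'. rewrite appE, uprE. split.
  - intros [K|K]; apply opr_inj in K; exact K.
  - intros [-> ->]. auto. }
split; [intro s; rewrite HL, smemE; tauto|]. split; [|split].
- split; [apply oprP|]. split; [eauto|]. split; [exists (upr R R); exact FI|]. split.
  + intros s n R' S Sn K t T. apply AI in K. destruct K as [-> ->].
    rewrite (rel_symbol_unique Sn smem_rel). apply HR in T.
    destruct T as [y [z [Y [Z [_ ->]]]]]. apply seq2_fun; assumption.
  + intros s n F S [_ [a [q [P T]]]]. apply HL in S. subst s. apply taggedE in T.
    apply tag_inj in T. lia.
- intros s S. apply HL, smemE, S.
- split; [exists (upr (opr smem R) (opr smem R)); apply oprP|].
  intros s S y z Y Z. apply smemE in S. subst s. split.
  + intros [R' [t [[U' [I' [P K]]] [T T']]]]. apply is_pairE, opr_inj in P.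
    destruct P; subst. apply AI in K. destruct K as [_ ->]. apply HR in T'.
    destruct T' as [y' [z' [_ [_ [K E]]]]]. apply is_seq2E in T. subst t.
    assert (Q1 : app (seq2 y z) (num 0) y) by (apply app_seq2; auto).
    assert (Q2 : app (seq2 y z) (num 1) z) by (apply app_seq2; auto).
    rewrite E in Q1, Q2. apply app_seq2 in Q1, Q2.
    destruct Q1 as [[_ ->]|[Q1 _]]; [|destruct (num01 Q1)].
    destruct Q2 as [[Q2 _]|[_ ->]]; [destruct (num01 (eq_sym Q2))|exact K].
  + intro K. exists R, (seq2 y z). split; [exists u, (upr (opr smem R) (opr smem R))|].
    * split; [apply oprP|]. apply AI. auto.
    * split; [apply is_seq2E; reflexivity|]. apply HR. eauto 6.
Qed.

Lemma is_cMemE c i j : is_cMem c i j <-> c = cR2 smem i j.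
Proof.
split.
- intros (s & ti & tj & ts & q & S & Ti & Tj & Ts & Q & C). apply smemE in S.
  apply taggedE in Ti, Tj, C. apply is_seq2E in Ts. apply is_pairE in Q. subst. reflexivity.
- intros ->. exists smem, (tvar i), (tvar j), (seq2 (tvar i) (tvar j)),
    (opr smem (seq2 (tvar i) (tvar j))).
  rewrite smemE, !taggedE, is_seq2E, is_pairE. auto 10.
Qed.
Lemma is_cEqE c i j : is_cEq c i j <-> c = cEq (tvar i) (tvar j).
Proof.
split.
- intros (ti & tj & q & Ti & Tj & Q & C).
  apply taggedE in Ti, Tj, C. apply is_pairE in Q. subst. reflexivity.
- intros ->. exists (tvar i), (tvar j), (opr (tvar i) (tvar j)).
  rewrite !taggedE, is_pairE. auto 10.
Qed.
Lemma is_cNegE c d : is_cNeg c d <-> c = cNeg d.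
Proof. apply taggedE. Qed.
Lemma is_cAndE c d d' : is_cAnd c d d' <-> c = cAnd d d'.
Proof.
split.
- intros (q & Q & C). apply taggedE in C. apply is_pairE in Q. subst. reflexivity.
- intros ->. exists (opr d d'). rewrite taggedE, is_pairE. auto.
Qed.
Lemma is_cExE c i d : is_cEx c i d <-> c = cEx i d.
Proof.
split.
- intros (q & Q & C). apply taggedE in C. apply is_pairE in Q. subst. reflexivity.
- intros ->. exists (opr i d). rewrite taggedE, is_pairE. auto.
Qed.

Lemma codes_unique (p : form) : forall c c', codes p c -> codes p c' -> c = c'.
Proof.
induction p as [i j|i j|q IH|q IHq r IHr|q IHq r IHr|i q IH|i q IH]; simpl; intros c c'.
- intros (a & b & A & B & C) (a' & b' & A' & B' & C').
  apply is_numE in A, B, A', B'. apply is_cMemE in C, C'. congruence.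
- intros (a & b & A & B & C) (a' & b' & A' & B' & C').
  apply is_numE in A, B, A', B'. apply is_cEqE in C, C'. congruence.
- intros (d & D & C) (d' & D' & C'). apply is_cNegE in C, C'.
  rewrite (IH _ _ D D') in C. congruence.
- intros (d & e & D & E & C) (d' & e' & D' & E' & C'). apply is_cAndE in C, C'.
  rewrite (IHq _ _ D D'), (IHr _ _ E E') in C. congruence.
- intros (d & e & n & a & D & E & Hn & A & C) (d' & e' & n' & a' & D' & E' & Hn' & A' & C').
  apply is_cAndE in A, A'. apply is_cNegE in Hn, Hn', C, C'.
  rewrite (IHr _ _ E E') in Hn. rewrite (IHq _ _ D D') in A. congruence.
- intros (i1 & d & A & D & C) (i2 & d' & A' & D' & C'). apply is_numE in A, A'.
  apply is_cExE in C, C'. rewrite (IH _ _ D D') in C. congruence.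
- intros (i1 & d & n & a & Hi & D & Hn & A & C) (i2 & d' & n' & a' & Hi' & D' & Hn' & A' & C').
  apply is_numE in Hi, Hi'. apply is_cExE in A, A'. apply is_cNegE in Hn, Hn', C, C'.
  rewrite (IH _ _ D D') in Hn. congruence.
Qed.

Lemma asg_const U x : x ∈ U -> exists e, is_assignment U e.
Proof.
intro X. assert (D : dfn2 (fun _ y : M => y = x)) by df.
destruct (fun_ex (a := om) (b := U) D) as [e [E _]].
- intros k K. exists x. split; [auto|]. intros y [_ Y]. auto.
- exists e. apply asgE, E.
Qed.
Lemma asg_trans u U e : transitive u -> e ∈ u -> is_assignment U e -> is_assignment u e.
Proof.
intros T E A. apply asgE. apply asgE in A. apply (fun_range A). intros k K.
assert (P := fun_app A K). apply appE in P. rewrite opr_upr in P.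
assert (Q := T _ E _ P).
assert (Q2 := T _ Q (upr k (ap e k)) (proj2 (uprE _ _ _) (or_intror eq_refl))).
exact (T _ Q2 _ (proj2 (uprE _ _ _) (or_intror eq_refl))).
Qed.

Lemma Tarski_M : Tarski M.
Proof.
split; [exists emp; apply is_empE; reflexivity|].
split; [intros x y; exists (adj x y); apply adjE|].
split; [intros e E; apply is_empE in E; subst; apply nat_emp|].
split; [intros n s K S; apply is_succE in S; subst; apply nat_suc, K|].
split; [intros U e i x; apply asg_upd|].
split; [apply asg_const|].
split.
{ intros x y. destruct (trcl (upr x y)) as [t [T K]]. exists t. split; [exact T|].
  split; apply (T _ K), uprE; auto. }
split; [apply asg_trans|].
split; [apply mstr_ex|].
intros L A U I [SD [HL [_ Red]]].
assert (Ls : smem ∈ L) by (apply HL, smemE; reflexivity).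
split; [|split; [|split; [|split]]].
- intros i j c Ni Nj C. apply is_cMemE in C. subst c.
  destruct (sat_R2 SD Ls smem_rel Ni Nj) as [F S]. split; [exact F|].
  intros e x y E X Y. rewrite (ss_sat SD), (S e E). apply asgE in E.
  rewrite (fun_val E X), (fun_val E Y). apply Red.
  + apply smemE; reflexivity.
  + rewrite <- (fun_val E X). exact (proj2 (fun_dom E X)).
  + rewrite <- (fun_val E Y). exact (proj2 (fun_dom E Y)).
- intros i j c Ni Nj C. apply is_cEqE in C. subst c.
  destruct (sat_Eqv SD Ni Nj) as [F S]. split; [exact F|].
  intros e x y E X Y. rewrite (ss_sat SD), (S e E). apply asgE in E.
  rewrite (fun_val E X), (fun_val E Y). tauto.
- intros d c Fd C. apply is_cNegE in C. subst c. destruct (isF_neg SD Fd) as [F S].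
  split; [exact F|]. intros e E. rewrite !(ss_sat SD). apply S, E.
- intros d d' c Fd Fd' C. apply is_cAndE in C. subst c. destruct (isF_and SD Fd Fd') as [F S].
  split; [exact F|]. intros e. rewrite !(ss_sat SD). apply S.
- intros i d c Ni Fd C. apply is_cExE in C. subst c. destruct (isF_ex SD Fd Ni) as [F S].
  split; [exact F|]. intros e E. rewrite (ss_sat SD), (S e E). split.
  + intros [e' [K1 K2]]. exists e'. split; [exact (sat_asg K1)|].
    split; [apply (ss_sat SD), K1|exact K2].
  + intros [e' [K1 [K2 K3]]]. exists e'. split; [apply (ss_sat SD), K2|exact K3].
Qed.

Lemma Std_M : Std M.
Proof.
constructor.
- exact Tarski_M.
- intros p x y x' y' A B. apply is_pairE in A, B. subst. apply opr_inj, B.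
- intros i j x A B. apply is_numE in A, B. subst. apply num_inj, B.
- intros i x y A B. apply is_numE in A, B. congruence.
- apply set_ext.
Qed.

End MembershipStructures.

(** * Absoluteness for transitive sets *)

Section Absoluteness.
Context {M : universe} {hM : ZFC M}.
Variable W : M.
Hypothesis TW : transitive W.
Notation N := (setu W).
Notation "' a" := (proj1_sig a) (at level 1, format "' a").
Implicit Types a b c d e f g p q s t u x y z : N.

Lemma inW (x y : M) : x ∈ W -> y ∈ x -> y ∈ W.
Proof. intros X Y. exact (TW X Y). Qed.

Lemma abs_all (x : N) (P : M -> Prop) :
  (forall z : M, z ∈ 'x -> P z) <-> (forall z : N, z ∈ x -> P 'z).
Proof.
split; intros K z Z.
- exact (K 'z Z).
- exact (K (exist _ z (inW (proj2_sig x) Z)) Z).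
Qed.
Lemma abs_subset x y : subset x y <-> subset 'x 'y.
Proof. symmetry. apply (abs_all x (fun z : M => z ∈ 'y)). Qed.
Lemma abs_upair p x y : is_upair p x y <-> is_upair 'p 'x 'y.
Proof.
split.
- intros K z. split.
  + intro Z. destruct (proj1 (K (exist _ z (inW (proj2_sig p) Z))) Z) as [E|E];
      apply (f_equal (@proj1_sig _ _)) in E; auto.
  + intros [->| ->]; [exact (proj2 (K x) (or_introl eq_refl))|].
    exact (proj2 (K y) (or_intror eq_refl)).
- intros K z. split.
  + intro Z. destruct (proj1 (K 'z) Z) as [E|E]; apply sub_eq in E; auto.
  + intros [->| ->]; [exact (proj2 (K 'x) (or_introl eq_refl))|].
    exact (proj2 (K 'y) (or_intror eq_refl)).
Qed.
Lemma abs_pair p x y : is_pair p x y <-> is_pair 'p 'x 'y.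
Proof.
split.
- intros [a [b [A [B C]]]]. exists 'a, 'b. rewrite <- !abs_upair. auto.
- intros [a [b [A [B C]]]].
  assert (Ha : a ∈ W) by (apply (inW (proj2_sig p)), C; auto).
  assert (Hb : b ∈ W) by (apply (inW (proj2_sig p)), C; auto).
  exists (exist _ a Ha), (exist _ b Hb). rewrite !abs_upair. auto.
Qed.
Lemma abs_empty x : is_empty x <-> is_empty 'x.
Proof. symmetry. apply (abs_all x (fun z : M => False)). Qed.
Lemma abs_succ s x : is_succ s x <-> is_succ 's 'x.
Proof.
split.
- intros K z. split.
  + intro Z. destruct (proj1 (K (exist _ z (inW (proj2_sig s) Z))) Z) as [E|E]; [auto|].
    apply (f_equal (@proj1_sig _ _)) in E; auto.
  + intros [Z| ->]; [|exact (proj2 (K x) (or_intror eq_refl))].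
    exact (proj2 (K (exist _ z (inW (proj2_sig x) Z))) (or_introl Z)).
- intros K z. split.
  + intro Z. destruct (proj1 (K 'z) Z) as [E|E]; [auto|]. apply sub_eq in E; auto.
  + intros [Z| ->]; [exact (proj2 (K 'z) (or_introl Z))|].
    exact (proj2 (K 'x) (or_intror eq_refl)).
Qed.
Lemma abs_num i : forall x, is_num i x <-> is_num i 'x.
Proof.
induction i as [|i IH]; intro x; simpl; [apply abs_empty|]. split.
- intros [y [Y S]]. exists 'y. split; [apply IH, Y|apply abs_succ, S].
- intros [y [Y S]].
  assert (Hy : y ∈ W) by (apply (inW (proj2_sig x)), S; auto).
  exists (exist _ y Hy). split; [apply IH, Y|apply abs_succ, S].
Qed.
Lemma abs_trans x : transitive x <-> transitive 'x.
Proof.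
split.
- intros K y Y z Z. assert (Hy := inW (proj2_sig x) Y). assert (Hz := inW Hy Z).
  exact (K (exist _ y Hy) Y (exist _ z Hz) Z).
- intros K y Y z Z. exact (K 'y Y 'z Z).
Qed.
Lemma abs_ord x : is_ordinal x <-> is_ordinal 'x.
Proof.
unfold is_ordinal. rewrite abs_trans.
split; intros [A B]; (split; [exact A|]).
- apply (abs_all x (@transitive M)). intros z Z. apply abs_trans, B, Z.
- intros z Z. apply abs_trans, B, Z.
Qed.
Lemma app_parts (f : M) (x y : M) : f ∈ W -> app f x y -> x ∈ W /\ y ∈ W.
Proof.
intros F K. apply appE in K. rewrite opr_upr in K.
assert (P := inW F K).
assert (Q := inW P (proj2 (uprE (upr x x) (upr x y) _) (or_intror eq_refl))).
split; apply (inW Q), uprE; auto.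
Qed.
Lemma abs_app f x y : app f x y <-> app 'f 'x 'y.
Proof.
split.
- intros [p [P K]]. exists 'p. split; [apply abs_pair, P|exact K].
- intros [p [P K]]. exists (exist _ p (inW (proj2_sig f) K)).
  split; [apply abs_pair, P|exact K].
Qed.
Lemma abs_function f a b : is_function f a b <-> is_function 'f 'a 'b.
Proof.
unfold is_function. split; intros [A B]; split.
- apply (abs_all f (fun p : M => exists x y : M, x ∈ 'a /\ y ∈ 'b /\ is_pair p x y)).
  intros p P. destruct (A p P) as [x [y [X [Y Q]]]]. exists 'x, 'y.
  split; [exact X|]. split; [exact Y|]. apply abs_pair, Q.
- apply (abs_all a (fun x : M => exists! y : M, app 'f x y)). intros x X.
  destruct (B x X) as [y [Y U]]. exists 'y. split; [apply abs_app, Y|].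
  intros y' Y'. destruct (app_parts (proj2_sig f) Y') as [_ H'].
  rewrite (U (exist _ y' H')); [reflexivity|]. apply abs_app, Y'.
- intros p P. destruct (A 'p P) as [x [y [X [Y Q]]]].
  exists (exist _ x (inW (proj2_sig a) X)), (exist _ y (inW (proj2_sig b) Y)).
  split; [exact X|]. split; [exact Y|]. apply abs_pair, Q.
- intros x X. destruct (B 'x X) as [y [Y U]].
  destruct (app_parts (proj2_sig f) Y) as [_ Hy]. exists (exist _ y Hy).
  split; [apply abs_app, Y|]. intros y' Y'. apply sub_eq. apply U. apply abs_app, Y'.
Qed.
Lemma abs_natural x : is_natural x <-> is_natural 'x.
Proof.
unfold is_natural. rewrite abs_ord. split; intros [A B]; (split; [exact A|]).
- intros z Z. assert (Hz : z ∈ W).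
  { destruct Z as [Z| ->]; [exact (inW (proj2_sig x) Z)|exact (proj2_sig x)]. }
  destruct (B (exist _ z Hz)) as [E|[y E]].
  + destruct Z as [Z|Z]; [left; exact Z|right; apply sub_eq; exact Z].
  + left. apply abs_empty in E. exact E.
  + right. exists 'y. apply abs_succ in E. exact E.
- intros z Z. destruct (B 'z) as [E|[y E]].
  + destruct Z as [Z| ->]; auto.
  + left. apply abs_empty, E.
  + right. assert (Hy : y ∈ W) by (apply (inW (proj2_sig z)), E; auto).
    exists (exist _ y Hy). apply abs_succ, E.
Qed.
Lemma up_tagged k x c : tagged k x c -> tagged k 'x 'c.
Proof. intros [t [A B]]. exists 't. split; [apply abs_num, A|apply abs_pair, B]. Qed.
Lemma up_seq2 t x y : is_seq2 t x y -> is_seq2 't 'x 'y.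
Proof.
intros (z & o & p & q & A & B & C & D & E). exists 'z, 'o, 'p, 'q.
rewrite <- !abs_num, <- !abs_pair, <- abs_upair. auto.
Qed.
Lemma up_symbol k n m s : is_std_symbol k n m s -> is_std_symbol k n m 's.
Proof.
intros (n' & m' & q & A & B & C & D). exists 'n', 'm', 'q.
rewrite <- !abs_num, <- abs_pair. auto using up_tagged.
Qed.
Lemma up_codes (p : form) : forall c, codes p c -> codes p 'c.
Proof.
assert (CN : forall c d, is_cNeg c d -> is_cNeg 'c 'd) by (intros c d; apply up_tagged).
assert (CA : forall c d d', is_cAnd c d d' -> is_cAnd 'c 'd 'd').
{ intros c d d' [q [A B]]. exists 'q. split; [apply abs_pair, A|apply up_tagged, B]. }
assert (CE : forall c d d', is_cEx c d d' -> is_cEx 'c 'd 'd').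
{ intros c d d' [q [A B]]. exists 'q. split; [apply abs_pair, A|apply up_tagged, B]. }
induction p as [i j|i j|q IH|q IHq r IHr|q IHq r IHr|i q IH|i q IH]; simpl; intros c.
- intros (a & b & A & B & s & ti & tj & ts & q & S & Ti & Tj & Ts & Q & C).
  exists 'a, 'b. rewrite <- !abs_num. split; [exact A|]. split; [exact B|].
  exists 's, 'ti, 'tj, 'ts, 'q. rewrite <- abs_pair.
  split; [apply up_symbol, S|]. auto 10 using up_tagged, up_seq2.
- intros (a & b & A & B & ti & tj & q & Ti & Tj & Q & C).
  exists 'a, 'b. rewrite <- !abs_num. split; [exact A|]. split; [exact B|].
  exists 'ti, 'tj, 'q. rewrite <- abs_pair. auto 10 using up_tagged.
- intros (d & D & C). exists 'd. auto.
- intros (d & e & D & E & C). exists 'd, 'e. auto.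
- intros (d & e & n & a & D & E & Hn & A & C). exists 'd, 'e, 'n, 'a. auto 10.
- intros (i1 & d & A & D & C). exists 'i1, 'd. rewrite <- abs_num. auto.
- intros (i1 & d & n & a & Hi & D & Hn & A & C). exists 'i1, 'd, 'n, 'a.
  rewrite <- abs_num. auto 10.
Qed.

Lemma sat_setu u (p : form) : forall o : nat -> N,
  satisfies (fun x => x ∈ u) p o <-> satisfies (fun x : M => x ∈ 'u) p (fun i => '(o i)).
Proof.
assert (U : forall (o : nat -> N) i x,
  (fun k => '(upd o i x k)) = upd (fun k => '(o k)) i 'x).
{ intros. apply functional_extensionality; intro k. unfold upd.
  destruct (Nat.eqb k i); reflexivity. }
induction p as [i j|i j|q IH|q IHq r IHr|q IHq r IHr|i q IH|i q IH]; intro o; simpl.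
- tauto.
- split; [congruence|apply sub_eq].
- rewrite IH; tauto.
- rewrite IHq, IHr; tauto.
- rewrite IHq, IHr; tauto.
- split.
  + intros [x [X Y]]. exists 'x. split; [exact X|]. rewrite <- U. apply IH, Y.
  + intros [x [X Y]]. assert (Hx := inW (proj2_sig u) X). exists (exist _ x Hx).
    split; [exact X|]. apply IH. rewrite U. exact Y.
- split.
  + intros K x X. assert (Hx := inW (proj2_sig u) X).
    assert (E := U o i (exist _ x Hx)). cbn [proj1_sig] in E. rewrite <- E.
    apply IH, K. exact X.
  + intros K x X. apply IH. rewrite U. apply K, X.
Qed.

Hypothesis TT : Tarski N.

Lemma Std_setu : Std N.
Proof.
constructor.
- exact TT.
- intros p x y x' y' A B. apply abs_pair, is_pairE in A. apply abs_pair, is_pairE in B.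
  rewrite A in B. apply opr_inj in B. destruct B; split; apply sub_eq; assumption.
- intros i j x A B. apply abs_num, is_numE in A. apply abs_num, is_numE in B.
  rewrite A in B. apply num_inj, B.
- intros i x y A B. apply abs_num, is_numE in A. apply abs_num, is_numE in B.
  apply sub_eq. congruence.
- intros x y K. apply sub_eq. apply set_ext. intro z. split; intro Z.
  + exact (proj1 (K (exist _ z (inW (proj2_sig x) Z))) Z).
  + exact (proj2 (K (exist _ z (inW (proj2_sig y) Z))) Z).
Qed.

Lemma nat_in_W (n : M) : is_natural n -> n ∈ W.
Proof.
assert (D : dfn1 (fun n : M => n ∈ W)) by df. revert n. apply (nat_ind D).
- destruct TT as ([e E] & _). apply abs_empty, is_empE in E. rewrite <- E. exact (proj2_sig e).
- intros n _ K. destruct TT as (_ & T2 & _). destruct (T2 (exist _ n K) (exist _ n K)) as [s S].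
  assert (S' : is_succ 's n) by exact (proj1 (abs_succ s (exist _ n K)) S).
  apply is_succE in S'. rewrite <- S'. exact (proj2_sig s).
Qed.

(** Some code of [p] exists inside [W]; upward absoluteness and uniqueness of codes identify it with
    [c]. *)
Lemma codes_in_W (p : form) (c : M) (h : c ∈ W) : codes p c -> codes p (exist _ c h : N).
Proof.
intro C. destruct (codes_ex Std_setu p) as [c' C'].
replace (exist _ c h : N) with c'; [exact C'|]. apply sub_eq. simpl.
exact (codes_unique (up_codes C') C).
Qed.

Lemma abs_asg U e : is_assignment U e <-> is_assignment 'U 'e.
Proof.
(* [W] has an assignment among its elements by [Tarski], and the domain of an assignment is
   omega. *)
assert (OM : exists w : N, is_omega w).
{ destruct TT as ([x E] & T2 & _ & _ & _ & T6 & _). destruct (T2 x x) as [y Y].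
  destruct (T6 y x) as [e' [w [K _]]]; [apply Y; auto|]. exists w; exact K. }
assert (AO : forall w : N, is_omega w <-> is_omega 'w).
{ intro w. split.
  - intros K z. split.
    + intro Z. assert (Z1 := proj1 (K (exist _ z (inW (proj2_sig w) Z))) Z).
      apply abs_natural in Z1. exact Z1.
    + intro Z. refine (proj2 (K (exist _ z (nat_in_W Z))) _). apply abs_natural. exact Z.
  - intros K z. rewrite abs_natural. exact (K 'z). }
split.
- intros [w [K F]]. exists 'w. split; [apply AO, K|apply abs_function, F].
- intros [w [K F]]. destruct OM as [w' K']. assert (E := K'). apply AO, is_omE in E.
  apply is_omE in K. subst w. exists w'. split; [exact K'|]. apply abs_function.
  rewrite E. exact F.
Qed.
End Absoluteness.

(** * Definability of C^(2) *)

(** The last clause is Pi_1 truth: a Pi_1 statement holds exactly when it holds in all transitive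
    sets that contain its parameters. The other clauses make [e'] an assignment that differs from
    [e] only at variables in [w]. [GG] will be evaluated inside sets Q, where it becomes Delta_0. *)
Definition GG (N : universe) (c w e e' : N) : Prop :=
  (exists U, is_assignment U e') /\
  (forall k x, ~ k ∈ w -> (app e k x <-> app e' k x)) /\
  forall u L A I, transitive u -> gstr L A u I -> is_assignment u e' ->
    structure_satisfies L A c e'.
#[global] Instance UD_GG : UD4 GG.
Proof. unfold UD4, GG. ud. Qed.

Section SigmaTwo.
Context {M : universe} {hM : ZFC M}.
Notation "' a" := (proj1_sig a) (at level 1, format "' a").

Definition cof (D : M -> Prop) := forall x y, D x -> D y ->
  exists Q, D Q /\ transitive Q /\ x ∈ Q /\ y ∈ Q /\ Tarski (setu Q).

(* For a code [c] of a Pi_1 formula and a finite set [w] of variables, this is the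
   universal Sigma_2 statement in [D]: some [e'], equal to [e] off [w], satisfies [c]. *)
Definition sig (D : M -> Prop) (c w e : M) := exists e', D e' /\
  forall Q, D Q -> transitive Q ->
  forall (hc : c ∈ Q) (hw : w ∈ Q) (he : e ∈ Q) (he' : e' ∈ Q), Tarski (setu Q) ->
    @GG (setu Q) (exist _ c hc) (exist _ w hw) (exist _ e he) (exist _ e' he').

Lemma cof_list D : trcls D -> cof D -> forall d l, D d -> (forall x, In x l -> D x) ->
  exists Q, D Q /\ transitive Q /\ d ∈ Q /\ (forall x, In x l -> x ∈ Q) /\ Tarski (setu Q).
Proof.
intros T C d l Hd. induction l as [|x l IH]; intro K.
- destruct (C d d Hd Hd) as [Q [A [B [E [_ F]]]]]. exists Q. split; [exact A|].
  split; [exact B|]. split; [exact E|]. split; [intros z []|exact F].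
- destruct IH as [Q [A [B [E [F _]]]]]; [intros z Z; apply K; right; exact Z|].
  destruct (C Q x A (K x (or_introl eq_refl))) as [Q' [A' [B' [E' [F' G']]]]].
  exists Q'. split; [exact A'|]. split; [exact B'|]. split; [exact (B' _ E' _ E)|].
  split; [|exact G']. intros z [<-|Z]; [exact F'|]. exact (B' _ E' _ (F z Z)).
Qed.

Lemma trs_list (N : universe) (d : N) l : Std N ->
  exists u, transitive u /\ d ∈ u /\ forall x, In x l -> x ∈ u.
Proof.
intro HS. destruct (std_T HS) as (_ & _ & _ & _ & _ & _ & T & _).
induction l as [|x l [u [A [B C]]]].
- destruct (T d d) as [u [A [B _]]]. exists u. split; [exact A|]. split; [exact B|intros z []].
- destruct (T u x) as [u' [A' [B' C']]]. exists u'. split; [exact A'|].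
  split; [exact (A' _ B' _ B)|]. intros z [<-|Z]; [exact C'|]. exact (A' _ B' _ (C z Z)).
Qed.

Lemma asg_value U e : is_assignment U e -> exists o : nat -> M,
  (forall i, o i ∈ U) /\ forall i, app e (num i) (o i).
Proof.
intro A. apply asgE in A. exists (fun i => ap e (num i)).
split; intro i; [apply (fun_ap_in A)|apply (fun_app A)]; apply omE, num_nat.
Qed.

Section Correct.
Variables (D : M -> Prop) (TD : trcls D) (CD : cof D).
Variables (xs ls : list nat) (d : form) (m : nat).
Hypothesis Dd : Delta0 d.
Notation pi := (alls ls d).
Hypothesis Nm : names m (exs xs pi).

Lemma names_exs (l : list nat) q : names m (exs l q) -> names m q /\ forall i, In i l -> i < m.
Proof.
induction l as [|i l IH]; simpl; [intuition|]. intros [A B].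
destruct (IH B) as [B1 B2]. split; [exact B1|]. intros j [<-|J]; auto.
Qed.

Variables (o : nat -> M) (c w e : M).
Hypothesis Do : forall i, D (o i).
Hypotheses (Dc : D c) (Dw : D w) (De : D e).
Hypothesis Cc : codes pi c.
Hypothesis Hw : forall k, k ∈ w <-> exists i, In i xs /\ k = num i.
Hypothesis Ae : exists U, is_assignment U e.
Hypothesis Eo : forall i, i < m -> app e (num i) (o i).

Lemma asg_setu (Q : M) (TQ : transitive Q) (TT : Tarski (setu Q)) (U e' : M) (u : setu Q) (h : e' ∈ Q) :
  is_assignment U e' -> transitive u -> (exist _ e' h : setu Q) ∈ u ->
  is_assignment u (exist _ e' h : setu Q).
Proof.
intros A Tu Eu. apply (abs_asg TQ TT). apply (asg_trans (U := U)).
- apply (abs_trans TQ), Tu.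
- exact Eu.
- exact A.
Qed.

(* Satisfaction of [c] at [e'] in a transitive member of [Q] means truth of [pi] there. *)
Lemma ss_setu (Q : M) (TQ : transitive Q) (TT : Tarski (setu Q)) (e' : M) (hc : c ∈ Q) (he : e' ∈ Q)
    (u L A I : setu Q) (o' : nat -> M) : gstr L A u I ->
  is_assignment u (exist _ e' he : setu Q) -> (forall i, o' i ∈ 'u) ->
  (forall i, app e' (num i) (o' i)) ->
  (structure_satisfies L A (exist _ c hc : setu Q) (exist _ e' he : setu Q) <->
   satisfies (fun x => x ∈ 'u) pi o').
Proof.
intros G As Ou Ap.
set (o2 := fun i => exist (fun x => x ∈ Q) (o' i) (inW TQ (proj2_sig u) (Ou i)) : setu Q).
destruct (codes_sat (Std_setu TQ TT) G (codes_in_W TQ TT hc Cc)) as [_ S].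
rewrite (S _ o2 As).
- exact (sat_setu TQ u pi o2).
- intros i n Hn. apply (abs_app TQ). simpl. apply (abs_num TQ), is_numE in Hn.
  rewrite Hn. apply Ap.
Qed.

(** From left to right the values of the existential variables are written into an assignment, and
    the Pi_1 matrix goes down to every transitive set. From right to left, a matrix that failed
    would have a finite counterexample; it lies in a transitive member of some Q, where [GG] would
    be violated. *)
Lemma sig_correct : satisfies D (exs xs pi) o <-> sig D c w e.
Proof.
destruct (names_exs Nm) as [Npi Nxs]. destruct Ae as [U0 Ae0].
rewrite exs_sat. split.
- intros [o' [O1 [O2 K]]].
  assert (DO' : forall i, D (o' i)).
  { intro i. destruct (in_dec Nat.eq_dec i xs); [auto|]. rewrite O1; auto. }
  destruct (cof_list TD CD (d := e) (l := c :: w :: map o' (seq 0 m)) De)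
    as [Q [DQ [TQ [Qe [Ql TT]]]]].
  { intros x [<-|[<-|X]]; auto. apply in_map_iff in X. destruct X as [i [<- _]]. auto. }
  assert (SQ := Std_setu TQ TT).
  assert (Qo : forall i, i < m -> o' i ∈ Q).
  { intros i L. apply Ql. right; right. apply in_map, in_seq. lia. }
  set (o2 := fun i => match Compare_dec.lt_dec i m with
    | left L => exist (fun x => x ∈ Q) (o' i) (Qo i L) | right _ => exist _ e Qe end : setu Q).
  assert (E2 : forall i, i < m -> '(o2 i) = o' i).
  { intros i L. unfold o2. destruct (Compare_dec.lt_dec i m); [reflexivity|lia]. }
  destruct (trs_list (exist _ e Qe : setu Q) (map o2 (seq 0 m)) SQ) as [u [Tu [Ue Uo]]].
  assert (Au := asg_setu TQ TT Ae0 Tu Ue).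
  destruct (std_asg_list SQ (o := o2) (l := xs) Au) as [e' [A' [B' C']]].
  { intros i I. apply Uo, in_map, in_seq. specialize (Nxs i I). lia. }
  assert (AM : is_assignment 'u 'e') by (apply (abs_asg TQ TT), A').
  assert (VX : forall i, In i xs -> app 'e' (num i) (o' i)).
  { intros i I. rewrite <- (E2 i (Nxs i I)).
    assert (Hn := nat_in_W TQ TT (num_nat i)).
    apply (abs_app TQ e' (exist _ (num i) Hn) (o2 i)). apply B'; [exact I|].
    apply (abs_num TQ), is_numE. reflexivity. }
  assert (VO : forall k x, ~ k ∈ w -> (app e k x <-> app 'e' k x)).
  { intros k x Kw.
    assert (G : forall (hk : k ∈ Q) (hx : x ∈ Q), app e k x <-> app 'e' k x).
    { intros hk hx.
      rewrite <- (abs_app TQ (exist _ e Qe) (exist _ k hk) (exist _ x hx)).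
      rewrite <- (abs_app TQ e' (exist _ k hk) (exist _ x hx)). apply C'.
      intros i I Hn. apply Kw, Hw. exists i. split; [exact I|].
      apply (abs_num TQ), is_numE in Hn. exact Hn. }
    split; intro X.
    - destruct (app_parts TQ Qe X) as [hk hx]. apply (G hk hx), X.
    - destruct (app_parts TQ (proj2_sig e') X) as [hk hx]. apply (G hk hx), X. }
  exists 'e'. split; [exact (TD DQ (proj2_sig e'))|].
  intros Q' DQ' TQ' hc hw he he' TT'. split; [|split].
  + destruct (trs_list (exist _ 'e' he' : setu Q') nil (Std_setu TQ' TT')) as [u' [Tu' [Ue' _]]].
    exists u'. exact (asg_setu TQ' TT' AM Tu' Ue').
  + intros k x Kw. rewrite !(abs_app TQ'). simpl. apply VO. exact Kw.
  + intros u' L A I Tu' G As.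
    assert (As' : is_assignment 'u' 'e') by exact (proj1 (abs_asg TQ' TT' u' _) As).
    destruct (asg_value As') as [ob [Ou Ap]].
    apply (ss_setu TQ' TT' hc (o' := ob) G As Ou Ap).
    assert (Du : forall x, x ∈ 'u' -> D x).
    { intros x X. apply (TD (x := 'u')); [|exact X]. exact (TD DQ' (proj2_sig u')). }
    apply (alls_mono (D := D)); auto.
    * intros x y X Y. exact (proj1 (abs_trans TQ' u') Tu' x X y Y).
    * revert K. apply (satisfies_ext (m := m)); [tauto|exact Npi|].
      intros i Li. apply asgE in As'. apply (fun_unique As' (x := num i)); [apply Ap|].
      destruct (in_dec Nat.eq_dec i xs) as [I1|I1]; [exact (VX i I1)|].
      rewrite (O1 i I1). apply VO; [|apply Eo, Li].
      intro X. apply Hw in X. destruct X as [j [J1 J2]]. apply num_inj in J2. congruence.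
- intros [e' [De' K]].
  destruct (cof_list TD CD (d := e') (l := c :: w :: e :: nil) De')
    as [Q [DQ [TQ [Qe [Ql TT]]]]].
  { intros x [<-|[<-|[<-|[]]]]; auto. }
  assert (hc : c ∈ Q) by (apply Ql; simpl; auto).
  assert (hw : w ∈ Q) by (apply Ql; simpl; auto).
  assert (he : e ∈ Q) by (apply Ql; simpl; auto).
  destruct (K Q DQ TQ hc hw he Qe TT) as [[U1 A1] [B1 _]].
  assert (AM : is_assignment 'U1 e') by exact (proj1 (abs_asg TQ TT _ _) A1).
  destruct (asg_value AM) as [ob [Ou Ap]].
  assert (Dob : forall i, D (ob i)).
  { intro i. apply (TD (x := 'U1)); [|apply Ou]. exact (TD DQ (proj2_sig U1)). }
  (* The decoded entries agree with [o] off [xs] only below [m]; from [m] on the formula does not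
     see them, so [o] is restored there. *)
  set (o' := fun i => if in_dec Nat.eq_dec i xs then ob i else o i).
  assert (Eb : forall i, i < m -> ob i = o' i).
  { intros i L. unfold o'. destruct (in_dec Nat.eq_dec i xs) as [I1|I1]; [reflexivity|].
    assert (Hn := nat_in_W TQ TT (num_nat i)).
    assert (Ho : o i ∈ Q) by exact (proj2 (app_parts TQ he (Eo L))).
    assert (X : app e' (num i) (o i)).
    { assert (Y : ~ (exist _ (num i) Hn : setu Q) ∈ (exist _ w hw : setu Q)).
      { intro Z. apply Hw in Z. destruct Z as [j [J1 J2]]. apply num_inj in J2. congruence. }
      assert (Z := B1 _ (exist _ (o i) Ho) Y). rewrite !(abs_app TQ) in Z. simpl in Z.
      apply Z, Eo, L. }
    apply asgE in AM. exact (fun_unique AM (Ap i) X). }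
  exists o'. split; [|split].
  + intros i I1. unfold o'. destruct (in_dec Nat.eq_dec i xs); [tauto|reflexivity].
  + intros i I1. unfold o'. destruct (in_dec Nat.eq_dec i xs); auto.
  + apply (satisfies_ext (D := D) (D' := D) (m := m)) with (v := ob);
      [tauto|exact Npi|exact Eb|].
    (* The finitely many elements [ys] of a counterexample are gathered, together with [e'], in a
       transitive [u] inside a new Q. *)
    apply NNPP; intro F. destruct (alls_fail TD Dd Dob F) as [ys [Y1 Y2]].
    destruct (cof_list TD CD (d := e') (l := c :: w :: e :: ys) De')
      as [Q' [DQ' [TQ' [Qe' [Ql' TT']]]]].
    { intros x [<-|[<-|[<-|X]]]; auto. }
    assert (hc' : c ∈ Q') by (apply Ql'; simpl; auto).
    assert (hw' : w ∈ Q') by (apply Ql'; simpl; auto).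
    assert (he' : e ∈ Q') by (apply Ql'; simpl; auto).
    assert (Hy : forall y, In y ys -> y ∈ Q') by (intros y Y; apply Ql'; simpl; auto).
    assert (LL : exists l : list (setu Q'), forall y, In y ys -> exists z, In z l /\ 'z = y).
    { clear - Hy. induction ys as [|y ys IH].
      - exists nil. intros y [].
      - destruct IH as [l IH]; [intros z Z; apply Hy; right; exact Z|].
        exists (exist _ y (Hy y (or_introl eq_refl)) :: l). intros z [<-|Z].
        + eexists. split; [left; reflexivity|reflexivity].
        + destruct (IH z Z) as [z' [Z1 Z2]]. exists z'. split; [right; exact Z1|exact Z2]. }
    destruct LL as [l LL].
    destruct (trs_list (exist _ e' Qe' : setu Q') l (Std_setu TQ' TT')) as [u [Tu [Ue Ul]]].
    assert (As := asg_setu TQ' TT' AM Tu Ue).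
    destruct TT' as (P1 & P2 & P3 & P4 & P5 & P6 & P7 & P8 & P9 & P10).
    destruct (P9 u _ Ue) as [L [A [I [_ G]]]].
    assert (TT' : Tarski (setu Q')) by (repeat (split; [assumption|]); assumption).
    assert (As' : is_assignment 'u e') by exact (proj1 (abs_asg TQ' TT' u _) As).
    assert (Ou' : forall i, ob i ∈ 'u).
    { intro i. apply asgE in As'. exact (proj2 (fun_dom As' (Ap i))). }
    destruct (K Q' DQ' TQ' hc' hw' he' Qe' TT') as [_ [_ S]].
    apply (Y2 (fun x => x ∈ 'u)).
    * intros x y X Y. exact (proj1 (abs_trans TQ' u) Tu x X y Y).
    * exact Ou'.
    * intros y Y. destruct (LL y Y) as [z [Z1 <-]]. exact (Ul z Z1).
    * apply (ss_setu TQ' TT' hc' G As Ou' Ap). exact (S u L A I Tu G As).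
Qed.
End Correct.

(** All parameters are constructed inside one transitive Q in [D] that satisfies [Tarski]; since [D]
    is transitive they belong to [D]. *)
Lemma sig_params D : trcls D -> cof D -> forall (xs : list nat) pi m (o : nat -> M),
  (forall i, D (o i)) -> exists c w e, D c /\ D w /\ D e /\ codes pi c /\
    (forall k, k ∈ w <-> exists i, In i xs /\ k = num i) /\
    (exists U, is_assignment U e) /\ forall i, i < m -> app e (num i) (o i).
Proof.
intros TD CD xs pi m o Do.
destruct (cof_list TD CD (d := o 0) (l := map o (seq 0 m)) (Do 0))
    as [Q [DQ [TQ [Q0 [Ql TT]]]]].
{ intros x X. apply in_map_iff in X. destruct X as [i [<- _]]. auto. }
assert (SQ := Std_setu TQ TT).
assert (Qo : forall i, i < m -> o i ∈ Q) by (intros i L; apply Ql, in_map, in_seq; lia).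
set (o2 := fun i => match Compare_dec.lt_dec i m with
    | left L => exist (fun x => x ∈ Q) (o i) (Qo i L) | right _ => exist _ (o 0) Q0 end : setu Q).
assert (E2 : forall i, i < m -> '(o2 i) = o i).
{ intros i L. unfold o2. destruct (Compare_dec.lt_dec i m); [reflexivity|lia]. }
destruct (codes_ex SQ pi) as [c C].
assert (W : exists w : setu Q, forall k, k ∈ 'w <-> exists i, In i xs /\ k = num i).
{ clear -TQ TT SQ. induction xs as [|i xs [w IH]].
  - destruct TT as ([x X] & _). exists x. intro k. apply (abs_empty TQ) in X.
    split; [intro K; destruct (X k K)|intros [i [[] _]]].
  - assert (Hn := nat_in_W TQ TT (num_nat i)).
    destruct (std_adj SQ w (exist _ (num i) Hn)) as [z Z]. exists z. intro k. split.
    + intro K. destruct (proj1 (Z (exist _ k (inW TQ (proj2_sig z) K))) K) as [E|E].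
      * apply IH in E. destruct E as [j [J1 J2]]. exists j. split; [right|]; auto.
      * apply (f_equal (@proj1_sig _ _)) in E. exists i. split; [left; reflexivity|exact E].
    + intros [j [[<-|J] E]].
      * subst k. exact (proj2 (Z (exist _ (num i) Hn)) (or_intror eq_refl)).
      * assert (X : k ∈ 'w) by (apply IH; eauto).
        exact (proj2 (Z (exist _ k (inW TQ (proj2_sig w) X))) (or_introl X)). }
destruct W as [w W].
destruct (trs_list (exist _ (o 0) Q0 : setu Q) (map o2 (seq 0 m)) SQ) as [u [Tu [U0 Uo]]].
assert (AC : exists e : setu Q, is_assignment u e).
{ destruct TT as (_ & _ & _ & _ & _ & T6 & _). exact (T6 u _ U0). }
destruct AC as [e0 A0].
destruct (std_asg_list SQ (o := o2) (l := seq 0 m) A0) as [e [A' [B' _]]].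
{ intros i I. apply Uo, in_map, I. }
exists 'c, 'w, 'e.
split; [exact (TD _ _ DQ (proj2_sig c))|]. split; [exact (TD _ _ DQ (proj2_sig w))|].
split; [exact (TD _ _ DQ (proj2_sig e))|]. split; [exact (up_codes TQ C)|].
split; [exact W|]. split; [exists 'u; apply (abs_asg TQ TT), A'|].
intros i L. rewrite <- (E2 i L). assert (Hn := nat_in_W TQ TT (num_nat i)).
apply (abs_app TQ e (exist _ (num i) Hn) (o2 i)). apply B'; [apply in_seq; lia|].
apply (abs_num TQ), is_numE. reflexivity.
Qed.

(* The statement [sig] decides all Sigma_2 formulas, uniformly in the class. *)
Lemma sig_universal (D : M -> Prop) : trcls D -> cof D -> cof (@all_sets M) ->
  (forall c w e, D c -> D w -> D e -> (sig D c w e <-> sig (@all_sets M) c w e)) ->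
  forall p o, Sigma 2 p -> (forall i, D (o i)) ->
  (satisfies D p o <-> satisfies (@all_sets M) p o).
Proof.
intros TD CD CM K p o S Do. destruct (Sigma2_inv S) as [xs [q [P ->]]].
destruct (Pi1_inv P) as [ls [d [Dd ->]]]. destruct (names_ex (exs xs (alls ls d))) as [m Nm].
destruct (sig_params TD CD xs (alls ls d) m Do) as (c & w & e & Dc & Dw & De & C & W & A & E).
rewrite (sig_correct TD CD Dd Nm Do Dc Dw De C W A E).
rewrite (K c w e Dc Dw De). symmetry.
assert (TM : trcls (@all_sets M)) by (intros ? ? ? ?; exact I).
apply (sig_correct TM CM Dd Nm (o := o)); auto; intros; exact I.
Qed.

End SigmaTwo.

Definition bt_form : form := proj1_sig (constructive_indefinite_description _ (UD_form UD_Tarski)).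
Lemma bt_formP (N : universe) (v : nat -> N) :
  Tarski N <-> satisfies (@all_sets N) bt_form v.
Proof. exact (proj2_sig (constructive_indefinite_description _ (UD_form UD_Tarski)) N v). Qed.
Definition gg_form : form := proj1_sig (constructive_indefinite_description _ (UD_form UD_GG)).
Lemma gg_formP (N : universe) (v : nat -> N) :
  GG (v 0) (v 1) (v 2) (v 3) <-> satisfies (@all_sets N) gg_form v.
Proof. exact (proj2_sig (constructive_indefinite_description _ (UD_form UD_GG)) N v). Qed.

Lemma qname_ex : exists K, names K bt_form /\ names K gg_form /\ 4 <= K.
Proof.
destruct (names_ex bt_form) as [m A], (names_ex gg_form) as [n B].
exists (m + n + 4). split; [|split; [|lia]]; [revert A|revert B]; apply names_mono; lia.
Qed.
(** The name of the variable for Q: it lies beyond all names in the two formulas to be relativized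
    to Q and beyond 0, 1, 2, 3, the names of c, w, e, e'. *)
Definition qn : nat := proj1_sig (constructive_indefinite_description _ qname_ex).
Lemma qnP : names qn bt_form /\ names qn gg_form /\ 4 <= qn.
Proof. exact (proj2_sig (constructive_indefinite_description _ qname_ex)). Qed.

Definition trans_form (k : nat) : form :=
  f_all (S k) (f_imp (f_mem (S k) k)
    (f_all (S (S k)) (f_imp (f_mem (S (S k)) (S k)) (f_mem (S (S k)) k)))).

(** The formula for [sig]: one existential quantifier, for e', one universal quantifier, for Q, and
    a matrix whose remaining quantifiers are bounded. *)
Definition sig_form : form :=
  f_ex 3 (f_all qn (f_imp
    (f_and (trans_form qn) (f_and (f_mem 0 qn) (f_and (f_mem 1 qn) (f_and (f_mem 2 qn)
      (f_and (f_mem 3 qn) (rel qn bt_form))))))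
    (rel qn gg_form))).
Definition cof_form : form :=
  f_ex qn (f_and (trans_form qn) (f_and (f_mem 0 qn) (f_and (f_mem 1 qn) (rel qn bt_form)))).

Lemma trans_Delta0 k : Delta0 (trans_form k).
Proof. unfold trans_form. repeat constructor; lia. Qed.
Lemma sig_Sigma2 : Sigma 2 sig_form.
Proof.
destruct qnP as [A [B C]]. unfold sig_form. apply Sigma_ex, Sigma_Pi, Pi_all, Pi_Sigma, Sigma_zero.
apply Delta0_imp; [|apply rel_Delta0, B].
apply Delta0_and; [apply trans_Delta0|]. repeat (apply Delta0_and; [constructor|]).
apply rel_Delta0, A.
Qed.
Lemma cof_Sigma1 : Sigma 1 cof_form.
Proof.
destruct qnP as [A [B C]]. unfold cof_form. apply Sigma_ex, Sigma_Pi, Pi_zero.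
apply Delta0_and; [apply trans_Delta0|]. repeat (apply Delta0_and; [constructor|]).
apply rel_Delta0, A.
Qed.

Definition env3 (N : universe) (c w e : N) : nat -> N :=
  fun i => match i with 0 => c | 1 => w | 2 => e | _ => c end.

Section Cdefinability.
Context {M : universe} {hM : ZFC M}.
Notation "' a" := (proj1_sig a) (at level 1, format "' a").

Lemma trans_form_sat (D : M -> Prop) k o : trcls D -> D (o k) ->
  (satisfies D (trans_form k) o <-> transitive (o k)).
Proof.
intros T Dk. unfold trans_form. cbn [satisfies]. split.
- intros K y Y z Z. specialize (K y (T _ _ Dk Y)).
  rewrite upd_same, (upd_other o (i := S k) (j := k)) in K by lia.
  specialize (K Y z (T _ _ (T _ _ Dk Y) Z)).
  rewrite upd_same in K. rewrite upd_other, upd_same in K by lia.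
  rewrite !upd_other in K by lia. auto.
- intros K y Dy Y z Dz Z. rewrite upd_same, upd_other in Y by lia.
  rewrite upd_same in Z. rewrite upd_other, upd_same in Z by lia.
  rewrite upd_same, !upd_other by lia. exact (K y Y z Z).
Qed.

Lemma rel_setu (D : M -> Prop) k p (Q : M) (o : nat -> M) (v : nat -> setu Q) :
  trcls D -> D Q -> names k p -> (forall i, i < k -> '(v i) = o i) ->
  (satisfies D (rel k p) (upd o k Q) <-> satisfies (@all_sets (setu Q)) p v).
Proof.
intros T DQ Nk E. rewrite rel_sat; [|exact Nk|].
- refine (iff_trans _ (iff_sym (satisfies_subu p v))).
  apply (satisfies_ext (m := k)); [|exact Nk|].
  + intro x. rewrite upd_same. tauto.
  + intros i L. rewrite upd_other by lia. symmetry. apply E, L.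
- intros x X. rewrite upd_same in X. exact (T _ _ DQ X).
Qed.

Lemma sig_form_sat (D : M -> Prop) c w e : trcls D -> D c -> D w -> D e ->
  (satisfies D sig_form (env3 c w e) <-> sig D c w e).
Proof.
intros T Dc Dw De. destruct qnP as [B1 [B2 B3]]. unfold sig_form. cbn [satisfies].
unfold sig.
assert (V : forall (Q : M) (hc : c ∈ Q) (hw : w ∈ Q) (he : e ∈ Q) e' (he' : e' ∈ Q),
  exists v : nat -> setu Q, (forall i, i < qn -> '(v i) = upd (env3 c w e) 3 e' i) /\
  v 0 = exist _ c hc /\ v 1 = exist _ w hw /\ v 2 = exist _ e he /\ v 3 = exist _ e' he').
{ intros Q hc hw he e' he'.
  exists (fun i => match i with 0 => exist _ c hc | 1 => exist _ w hw | 2 => exist _ e he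
    | 3 => exist _ e' he' | _ => exist _ c hc end). split; [|auto].
  intros [|[|[|[|i]]]] _; reflexivity. }
split.
- intros [e' [De' K]]. exists e'. split; [exact De'|].
  intros Q DQ TQ hc hw he he' TT. specialize (K Q DQ).
  destruct (V Q hc hw he e' he') as [v [Ev [E0 [E1 [E2 E3]]]]].
  rewrite !(rel_setu T DQ B1 Ev), !(rel_setu T DQ B2 Ev) in K.
  rewrite <- E0, <- E1, <- E2, <- E3. apply gg_formP. apply K.
  rewrite trans_form_sat; [|exact T|rewrite upd_same; exact DQ].
  rewrite upd_same, !(upd_other _ (i := qn)) by lia.
  split; [exact TQ|]. split; [exact hc|]. split; [exact hw|]. split; [exact he|].
  split; [exact he'|]. apply bt_formP, TT.
- intros [e' [De' K]]. exists e'. split; [exact De'|]. intros Q DQ.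
  rewrite trans_form_sat; [|exact T|rewrite upd_same; exact DQ].
  rewrite upd_same, !(upd_other _ (i := qn)) by lia.
  intros [TQ [hc [hw [he [he' TT]]]]].
  change (c ∈ Q) in hc. change (w ∈ Q) in hw. change (e ∈ Q) in he. change (e' ∈ Q) in he'.
  destruct (V Q hc hw he e' he') as [v [Ev [E0 [E1 [E2 E3]]]]].
  rewrite (rel_setu T DQ B1 Ev), <- bt_formP in TT.
  rewrite (rel_setu T DQ B2 Ev), <- gg_formP, E0, E1, E2, E3. exact (K Q DQ TQ hc hw he he' TT).
Qed.

Lemma cof_form_sat (D : M -> Prop) x y : trcls D -> D x -> D y ->
  (satisfies D cof_form (env3 x y x) <->
   exists Q, D Q /\ transitive Q /\ x ∈ Q /\ y ∈ Q /\ Tarski (setu Q)).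
Proof.
intros T Dx Dy. destruct qnP as [B1 [B2 B3]]. unfold cof_form. cbn [satisfies].
assert (V : forall (Q : M) (hx : x ∈ Q) (hy : y ∈ Q),
  exists v : nat -> setu Q, forall i, i < qn -> '(v i) = env3 x y x i).
{ intros Q hx hy. exists (fun i => match i with 1 => exist _ y hy | _ => exist _ x hx end).
  intros [|[|[|i]]] _; reflexivity. }
split.
- intros [Q [DQ K]]. exists Q. split; [exact DQ|].
  rewrite trans_form_sat in K; [|exact T|rewrite upd_same; exact DQ].
  rewrite upd_same, !(upd_other _ (i := qn)) in K by lia.
  destruct K as [K1 [K2 [K3 K4]]]. change (x ∈ Q) in K2. change (y ∈ Q) in K3.
  destruct (V Q K2 K3) as [v Ev]. rewrite (rel_setu T DQ B1 Ev), <- bt_formP in K4. auto.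
- intros [Q [DQ [K1 [K2 [K3 K4]]]]]. exists Q. split; [exact DQ|].
  rewrite trans_form_sat; [|exact T|rewrite upd_same; exact DQ].
  rewrite upd_same, !(upd_other _ (i := qn)) by lia.
  destruct (V Q K2 K3) as [v Ev]. rewrite (rel_setu T DQ B1 Ev), <- bt_formP. auto.
Qed.

Lemma trcls_all : trcls (@all_sets M).
Proof. intros x y _ _. exact I. Qed.
Lemma trcls_set (v : M) : transitive v -> trcls (fun x => x ∈ v).
Proof. intros T x y X Y. exact (T x X y Y). Qed.

(** [Tarski] is a single sentence true in [M], so it reflects to a rank level that contains both
    sets. *)
Lemma cof_all : cof (@all_sets M).
Proof.
intros x y _ _. destruct (V_univ (upr x y)) as [b [B Vb]].
destruct (reflection (of_form bt_form) B) as [a [L [Ha S]]].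
exists (V_ a). split; [exact I|]. assert (VA := VP (proj1 L)). split; [exact (V_trans VA)|].
assert (Vu : upr x y ∈ V_ a) by exact (V_mono VA (VP B) Ha Vb).
assert (X : x ∈ V_ a) by (apply (V_trans VA Vu), uprE; auto).
split; [exact X|]. split; [apply (V_trans VA Vu), uprE; auto|].
set (v := fun _ : nat => exist (fun z => z ∈ V_ a) x X : setu (V_ a)).
apply (bt_formP v). apply of_form_sat. apply (stp_fix S). apply of_form_sat.
apply bt_formP. exact Tarski_M.
Qed.

(** [in_C 2] quantifies over external formulas and so is not a formula itself. Here two fixed
    formulas stand for all of them. *)
Definition InC2 (N : universe) (a : N) : Prop := limit a /\ exists v, is_V a v /\
  (forall x y, x ∈ v -> y ∈ v -> satisfies (fun z => z ∈ v) cof_form (env3 x y x)) /\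
  forall c w e, c ∈ v -> w ∈ v -> e ∈ v ->
    (satisfies (fun z => z ∈ v) sig_form (env3 c w e) <->
     satisfies (@all_sets N) sig_form (env3 c w e)).

Lemma InC2_E (a : M) : limit a ->
  (in_C 2 a <-> InC2 a).
Proof.
intro La. assert (VA := VP (proj1 La)). assert (TV := trcls_set (V_trans VA)). split.
- intros [v [V K]]. rewrite (is_VE V) in *. clear v V. split; [exact La|].
  exists (V_ a). split; [exact VA|].
  assert (O : forall x y z, x ∈ V_ a -> y ∈ V_ a -> z ∈ V_ a ->
    forall i, env3 x y z i ∈ V_ a) by (intros x y z X Y Z [|[|[|i]]]; assumption).
  split.
  + intros x y X Y. apply (K cof_form).
    * apply (Sigma_le (n := 1)); [lia|exact cof_Sigma1].
    * apply O; assumption.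
    * apply cof_form_sat; try exact I; [exact trcls_all|]. apply cof_all; exact I.
  + intros c w e C W E. apply (K sig_form); [exact sig_Sigma2|]. apply O; assumption.
- intros [_ [v [V [K1 K2]]]]. rewrite (is_VE V) in *. clear v V. exists (V_ a).
  split; [exact VA|]. intros p o S O. apply sig_universal; auto.
  + intros x y X Y. specialize (K1 x y X Y). apply cof_form_sat in K1; auto.
  + exact cof_all.
  + intros c w e C W E. specialize (K2 c w e C W E).
    rewrite (sig_form_sat TV C W E) in K2.
    rewrite (sig_form_sat trcls_all I I I) in K2. exact K2.
Qed.

(** For y < a the Sigma_1 statement that y belongs to some set is true, hence true in V_a. The set
    found lies in a lower level, so y + 1 < a. *)
Lemma in_C_limit n (a x : M) : 0 < n -> x ∈ a -> in_C n a -> limit a.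
Proof.
intros Ln X [v [V K]]. assert (A := V_ordinal V). split; [exact A|]. split; [eauto|].
intros y s Y S. apply is_succE in S. subst s.
assert (Yv : y ∈ v) by (apply (V_ord_mem V (ord_el A Y)), Y).
assert (T : satisfies (fun z => z ∈ v) (f_ex 1 (f_mem 0 1)) (fun _ => y)).
{ apply (K (f_ex 1 (f_mem 0 1))).
  - apply (Sigma_le (n := 1)); [exact Ln|]. apply Sigma_ex, Sigma_Pi, Pi_zero, Delta0_mem.
  - intros _. exact Yv.
  - exists (suc y). split; [exact I|]. apply suc_mem. }
destruct T as [z [Z YZ]]. simpl in YZ. change (y ∈ z) in YZ.
apply (V_eqn _ V) in Z. destruct Z as [c [u [C [U Z]]]].
assert (Yc : y ∈ c) by (apply (V_ord_mem U (ord_el A Y)), Z, YZ).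
destruct (ord_suc_sub (ord_el A C) Yc) as [E| ->]; [|exact C].
exact (ord_mem_trans A E C).
Qed.

(** [g] is the Mostowski collapse of the relation [r] on [a]. *)
Definition collapses (N : universe) (a r : N) := exists g, is_function_on g a /\
  forall x u, app g x u -> forall z, z ∈ u <-> exists y p, y ∈ a /\ is_pair p y x /\ p ∈ r /\ app g y z.

Lemma UD_collapses : UD2 collapses.
Proof. unfold UD2, collapses. ud. Qed.

(** Besides the two formulas of [InC2], the existence of collapses is reflected, which makes [a] a
    cardinal. A bijection [f] from c < a onto [a] would pull the order of [a] back to a relation [r]
    on c. Both c and [r] are in V_a, so V_a contains the collapse of [r], from which [a] itself is
    recovered. *)
Lemma C2_cardinals (b : M) : is_ordinal b -> exists a, is_cardinal a /\ in_C 2 a /\ b ∈ a.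
Proof.
intro B. destruct UD_collapses as [qc Hqc].
destruct (reflection (And (of_form cof_form) (And (of_form sig_form) qc)) B)
  as [a [L [Hb [S1 [S2 S3]]]]].
assert (VA := VP (proj1 L)). assert (TA := V_trans VA).
exists a. split; [|split; [|exact Hb]].
- split; [exact (proj1 L)|]. intros c C [f Bf].
  assert (Ff := proj1 Bf).
  assert (D : dfn2 (fun y x => exists u t, app f y u /\ app f x t /\ u ∈ t)) by df.
  destruct (rel_ex c c D) as [r [Hr Sr]].
  assert (Vc : c ∈ V_ a) by exact (proj1 (V_self VA) c C).
  assert (Vr : r ∈ V_ a) by exact (V_super VA (limit_V_prod L VA Vc Vc) Sr).
  assert (Col : collapses c r).
  { exists f. split; [exists a; exact Ff|]. intros x u K z. split.
    - intro Z. assert (Uu := proj2 (fun_dom Ff K)).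
      assert (Za : z ∈ a) by exact (ord_mem_trans (proj1 L) Z Uu).
      destruct (bij_surj Bf Za) as [y [Y <-]]. exists y, (opr y x).
      split; [exact Y|]. split; [apply oprP|]. split; [|exact (fun_app Ff Y)].
      apply appE, Hr. split; [exact Y|]. split; [exact (proj1 (fun_dom Ff K))|].
      exists (ap f y), u. split; [exact (fun_app Ff Y)|auto].
    - intros [y [p [Y [P [Pr Yz]]]]]. apply is_pairE in P. subst p. apply appE, Hr in Pr.
      destruct Pr as [_ [_ [u1 [t1 [E1 [E2 E3]]]]]].
      rewrite (fun_unique Ff E1 Yz), (fun_unique Ff E2 K) in E3. exact E3. }
  set (v := (exist _ c Vc : setu (V_ a)) .: fun _ => (exist _ r Vr : setu (V_ a))).
  assert (ColV : @collapses (setu (V_ a)) (exist _ c Vc) (exist _ r Vr)).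
  { apply (Hqc _ v). apply (stp_fix S3).
    apply (Hqc M (fun i => proj1_sig (v i))). exact Col. }
  destruct ColV as [g [[bg Fg] Hg]].
  apply (abs_function TA) in Fg. simpl in Fg.
  assert (GE : forall x z, x ∈ c -> (z ∈ ap 'g x <-> exists y, y ∈ c /\ opr y x ∈ r /\ z = ap 'g y)).
  { intros x z X. assert (Xw := TA _ Vc _ X).
    assert (AX := fun_app Fg X). destruct (app_parts TA (proj2_sig g) AX) as [_ Gw].
    assert (K := Hg (exist _ x Xw) (exist (fun z => z ∈ V_ a) (ap 'g x) Gw)
      (proj2 (abs_app TA g (exist _ x Xw) (exist (fun z => z ∈ V_ a) (ap 'g x) Gw)) AX)).
    split.
    - intro Z. destruct (proj1 (K (exist _ z (inW TA Gw Z))) Z) as [y [p [Y [P [Pr E]]]]].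
      apply (abs_pair TA), is_pairE in P. apply (abs_app TA) in E. simpl in P, E.
      exists 'y. split; [exact Y|]. split; [rewrite <- P; exact Pr|exact (fun_val Fg E)].
    - intros [y [Y [Pr ->]]]. assert (Yw := TA _ Vc _ Y). assert (AY := fun_app Fg Y).
      destruct (app_parts TA (proj2_sig g) AY) as [_ Gy].
      refine (proj2 (K (exist _ (ap 'g y) Gy)) _).
      exists (exist _ y Yw), (exist _ (opr y x) (inW TA Vr Pr)).
      split; [exact Y|]. split; [apply (abs_pair TA); apply oprP|]. split; [exact Pr|].
      apply (abs_app TA). exact AY. }
  (* The collapse found in V_a agrees with [f], by induction on the values of [f]. *)
  assert (Dg : dfn1 (fun xi => forall x, app f x xi -> app 'g x xi)) by df.
  assert (E : forall xi, is_ordinal xi -> forall x, app f x xi -> app 'g x xi).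
  { apply (ord_ind Dg). intros xi _ IH x K. assert (X := proj1 (fun_dom Ff K)).
    replace xi with (ap 'g x); [exact (fun_app Fg X)|]. apply set_ext. intro z.
    rewrite (GE x z X). split.
    - intros [y [Y [Pr ->]]]. apply appE, Hr in Pr. destruct Pr as [_ [_ [u1 [t1 [E1 [E2 E3]]]]]].
      rewrite (fun_unique Ff E2 K) in E3. rewrite <- (fun_val Fg (IH u1 E3 y E1)). exact E3.
    - intro Z. assert (Xa := proj2 (fun_dom Ff K)).
      assert (Za : z ∈ a) by exact (ord_mem_trans (proj1 L) Z Xa).
      destruct (bij_surj Bf Za) as [y [Y Ey]]. assert (AY := fun_app Ff Y). rewrite Ey in AY.
      exists y. split; [exact Y|]. split; [|exact (fun_val Fg (IH z Z y AY))].
      apply appE, Hr. split; [exact Y|]. split; [exact X|]. exists z, xi. auto. }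
  (* All elements of [a] are values of [g], so [a] is a subset of the double union of [g] and would
     be an element of V_a. *)
  apply (proj2 (V_self VA)).
  apply (V_super VA (limit_V_Un L VA (limit_V_Un L VA (proj2_sig g)))).
  intros xi Xi. destruct (bij_surj Bf Xi) as [x [X Ex]].
  assert (AX := fun_app Ff X). rewrite Ex in AX.
  apply (E xi (ord_el (proj1 L) Xi)), appE in AX. rewrite opr_upr in AX.
  apply UnE. exists (upr x xi). split; [|apply uprE; auto].
  apply UnE. eexists. split; [exact AX|]. apply uprE; auto.
- apply (InC2_E L). split; [exact L|]. exists (V_ a). split; [exact VA|].
  assert (R : forall p (S : stp (of_form p) (V_ a) (V_ a)) o, (forall i : nat, o i ∈ V_ a) ->
    (satisfies (fun z => z ∈ V_ a) p o <-> satisfies (@all_sets M) p o)).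
  { intros p S o O. set (v := fun i => exist _ (o i) (O i) : setu (V_ a)).
    refine (iff_trans (iff_sym (satisfies_subu p v)) _).
    refine (iff_trans (iff_sym (of_form_sat p v)) _).
    refine (iff_trans (stp_fix S v) _). apply of_form_sat. }
  split.
  + intros x y X Y. apply (R _ S1); [intros [|[|[|i]]]; assumption|].
    apply cof_form_sat; try exact I; [exact trcls_all|]. apply cof_all; exact I.
  + intros c w e C W E. apply (R _ S2). intros [|[|[|i]]]; assumption.
Qed.

Lemma least_C2_unique (l z z' : M) :
  is_least_C2_cardinal_above l z -> is_least_C2_cardinal_above l z' -> z = z'.
Proof.
intros [A [B [C D]]] [A' [B' [C' D']]].
destruct (ord_tri (proj1 A) (proj1 A')) as [E|[E|E]]; [|exact E|].
- exfalso. exact (D' z A B C E).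
- exfalso. exact (D z' A' B' C' E).
Qed.

End Cdefinability.

Lemma UD_satrel p k (s : nat -> nat) :
  UD (fun N v => satisfies (fun x => x ∈ v k) p (fun i => v (s i))).
Proof.
destruct (names_ex p) as [m Nm].
apply (UD_ext (A := fun N v => satisfies (@all_sets N) (rel m p)
  (fun i => v (if Nat.eqb i m then k else s i)))).
- intros N v. rewrite rel_sat; [|exact Nm|intros; exact I].
  apply (satisfies_ext (m := m)); [|exact Nm|].
  + intro x. rewrite Nat.eqb_refl. tauto.
  + intros i L. destruct (Nat.eqb_spec i m); [lia|reflexivity].
- exact (UD_ren (A := fun N v => satisfies (@all_sets N) (rel m p) v)
    (fun i => if Nat.eqb i m then k else s i) (UD_sat (rel m p))).
Qed.

Definition env3n (a b c : nat) : nat -> nat :=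
  fun i => match i with 0 => a | 1 => b | 2 => c | _ => a end.
Lemma env3_n (N : universe) (v : nat -> N) a b c :
  env3 (v a) (v b) (v c) = fun i => v (env3n a b c i).
Proof. apply functional_extensionality; intros [|[|[|i]]]; reflexivity. Qed.

Lemma UD_satrel3 p k a b c :
  UD (fun N v => satisfies (fun x => x ∈ v k) p (env3 (v a) (v b) (v c))).
Proof.
refine (UD_ext _ (UD_satrel p k (env3n a b c))). intros N v. rewrite env3_n. tauto.
Qed.
Lemma UD_sat3 p a b c : UD (fun N v => satisfies (@all_sets N) p (env3 (v a) (v b) (v c))).
Proof.
refine (UD_ext _ (UD_ren (env3n a b c) (UD_sat p))). intros N v. rewrite env3_n. tauto.
Qed.
#[global] Hint Resolve UD_satrel3 UD_sat3 : ud.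
#[global] Instance UD_InC2 : UD1 InC2.
Proof. unfold UD1, InC2. ud. Qed.

(** [InC2] replaces [in_C 2] in the definition of zeta. They agree above [l], where the members of
    C^(2) are limit ordinals. The places of the ordinal parameters are filled with [emp]. *)
Lemma classU_definable (M : universe) {hM : ZFC M} : ordinal_definable (@classU M).
Proof.
set (least := fun (N : universe) (l z : N) => is_cardinal z /\ InC2 z /\ l ∈ z /\
  forall y, is_cardinal y -> InC2 y -> l ∈ y -> ~ y ∈ z).
assert (UL : UD2 least) by (unfold UD2, least; ud).
assert (LE : forall l z : M, is_limit_cardinal l ->
  (is_least_C2_cardinal_above l z <-> least M l z)).
{ intros l z Ll. unfold is_least_C2_cardinal_above, least.
  assert (K : forall y : M, l ∈ y -> is_cardinal y -> (in_C 2 y <-> InC2 y)).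
  { intros y Y Cy. split; intro K.
    - apply InC2_E; [|exact K]. apply (in_C_limit (n := 2) (x := l)); auto.
    - apply InC2_E; [|exact K]. apply K. }
  split; intros (A & B & C & D).
  - split; [exact A|]. split; [apply (K z C A), B|]. split; [exact C|].
    intros y Y1 Y2 Y3. apply (D y Y1); [apply (K y Y3 Y1), Y2|exact Y3].
  - split; [exact A|]. split; [apply (K z C A), B|]. split; [exact C|].
    intros y Y1 Y2 Y3. apply (D y Y1); [apply (K y Y3 Y1), Y2|exact Y3]. }
set (P := fun (N : universe) (A : N) =>
  exists L l Vl, is_Lstar L /\ is_structure L A /\
    is_limit_cardinal l /\ is_V l Vl /\ has_membership_reduct A Vl /\
    exists zeta Vzeta X fA sf sE tau,
      least N l zeta /\ is_V zeta Vzeta /\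
      is_f_symbol sf /\ is_E_symbol sE /\
      (forall p, p ∈ fA <-> exists x y, is_pair p x y /\ fun1 A sf x y) /\
      elementary_subset X Vzeta /\ subset Vl X /\ l ∈ X /\ fA ∈ X /\
      is_bijection tau X Vl /\
      (exists o c, is_num 0 o /\ tagged 0 o c /\ app tau l c) /\
      (forall x c, x ∈ Vl -> tagged 1 x c -> app tau x c) /\
      (forall x y x' y', app tau x x' -> app tau y y' ->
         (x ∈ y <-> rel2 A sE x' y'))).
assert (UP : UD1 P).
{ unfold UD1, P. ud. }
destruct (UD_form UP) as [p Hp]. exists p, (fun _ => emp).
split; [intros _; apply emp_ord|]. intro A.
rewrite <- (Hp M (upd (fun _ => emp) 0 A)). change (upd (fun _ => emp) 0 A 0) with A.
unfold classU, P.
split; intros (L & l & Vl & H1 & H2 & H3 & H4 & H5 & z & Vz & X & fA & sf & sE & tau & H6 & H7);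
  exists L, l, Vl; (repeat (split; [assumption|])); exists z, Vz, X, fA, sf, sE, tau;
  (split; [apply LE; assumption|exact H7]).
Qed.

(** * Elementary embeddings *)

Section Embeddings.
Context {M : universe} {hM : ZFC M}.
Implicit Types A B L U I X Y W K a b c d e f g h i j k n p q r s t u v w x y z : M.
Notation "' a" := (proj1_sig a) (at level 1, format "' a").

Lemma asg_comp X Y h e : is_function h X Y -> is_assignment X e ->
  exists e', is_assignment Y e' /\ forall i, is_natural i -> ap e' i = ap h (ap e i).
Proof.
intros F E. apply asgE in E.
assert (D : dfn2 (fun i y => exists x, app e i x /\ app h x y)) by df.
destruct (fun_ex (a := om) (b := Y) D) as [e' [E' A']].
- intros i Oi. exists (ap h (ap e i)). assert (X1 := fun_ap_in E Oi). split.
  + split; [exact (fun_ap_in F X1)|]. exists (ap e i).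
    split; [exact (fun_app E Oi)|exact (fun_app F X1)].
  + intros y [_ [x [P Q]]]. rewrite (fun_val E P) in Q. symmetry. exact (fun_val F Q).
- exists e'. split; [apply asgE, E'|]. intros i Ni. apply omE in Ni.
  assert (P := fun_app E' Ni). apply A' in P. destruct P as [_ [_ [x [P Q]]]].
  rewrite (fun_val E P) in Q. exact (fun_val F Q).
Qed.

Lemma asg_ext U U' e e' : is_assignment U e -> is_assignment U' e' ->
  (forall i, is_natural i -> ap e i = ap e' i) -> e = e'.
Proof.
intros A B E. apply asgE in A, B. apply (fun_ext A B). intros i Oi. apply E, omE, Oi.
Qed.

Lemma gstr_U L A U I X : structure_data L A U I -> has_membership_reduct A X -> U = X.
Proof.
intros SD [[J P] _]. apply is_pairE in P. rewrite (sd_A SD) in P. apply opr_inj in P. tauto.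
Qed.

Lemma emb_sat L A B h X I Y J : structure_data L A X I -> structure_data L B Y J ->
  elementary_embedding L A B h -> is_function h X Y /\
  forall p e e', is_assignment X e -> is_assignment Y e' ->
    (forall i, is_natural i -> ap e' i = ap h (ap e i)) ->
    (structure_satisfies L A p e <-> structure_satisfies L B p e').
Proof.
intros SA SB (U & I' & U' & J' & SA' & SB' & F & K).
assert (E1 := sd_A SA). rewrite (sd_A SA') in E1. apply opr_inj in E1. destruct E1; subst U I'.
assert (E2 := sd_A SB). rewrite (sd_A SB') in E2. apply opr_inj in E2. destruct E2; subst U' J'.
split; [exact F|]. intros p e e' E E' C. apply K; auto. intros i x y P Q.
apply asgE in E, E'. assert (Oi := proj1 (fun_dom E P)).
rewrite (fun_val E P) in Q. rewrite (fun_val F Q), <- C by (apply omE, Oi).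
exact (fun_app E' Oi).
Qed.

(** Elementarity for external formulas, the form in which uniformly defined properties are
    transferred. [h] is an external function, so the identity qualifies without being a set. *)
Definition ext_elem X Y (h : M -> M) := forall (p : form) (o : nat -> M), (forall i : nat, o i ∈ X) ->
  (satisfies (fun x => x ∈ X) p o <-> satisfies (fun x => x ∈ Y) p (fun i : nat => h (o i))).

Lemma asg_of_list X (o : nat -> M) (m : nat) : (forall i : nat, o i ∈ X) ->
  exists e, is_assignment X e /\ forall i : nat, i < m -> ap e (num i) = o i.
Proof.
intro O. destruct (asg_const (O 0)) as [e0 E0].
destruct (std_asg_list Std_M (o := o) (l := seq 0 m) E0) as [e [E [P _]]]; [auto|].
exists e. split; [exact E|]. intros i L. apply asgE in E. symmetry. apply (fun_val E).
apply P; [apply in_seq; lia|apply is_numE; reflexivity].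
Qed.

(** An external formula has a code, and [codes_sat] compares satisfaction of the code with truth on
    both sides. *)
Lemma emb_ext L A B h X I Y J : gstr L A X I -> gstr L B Y J ->
  elementary_embedding L A B h -> ext_elem X Y (ap h).
Proof.
intros GA GB K p o O. destruct (emb_sat (proj1 GA) (proj1 GB) K) as [F S].
destruct (names_ex p) as [m Nm]. destruct (asg_of_list m O) as [e [E V]].
destruct (asg_comp F E) as [e' [E' V']].
destruct (codes_ex Std_M p) as [c C].
destruct (codes_sat Std_M GA C) as [_ S1]. destruct (codes_sat Std_M GB C) as [_ S2].
assert (Q := S c e e' E E' V').
rewrite (S1 e (fun i : nat => ap e (num i)) E) in Q.
- rewrite (S2 e' (fun i : nat => ap e' (num i)) E') in Q.
  + assert (Q1 : satisfies (fun x => x ∈ X) p (fun i : nat => ap e (num i)) <->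
      satisfies (fun x => x ∈ X) p o)
      by (apply (satisfies_ext (m := m)); [tauto|exact Nm|exact V]).
    assert (Q2 : satisfies (fun x => x ∈ Y) p (fun i : nat => ap e' (num i)) <->
      satisfies (fun x => x ∈ Y) p (fun i : nat => ap h (o i))).
    { apply (satisfies_ext (m := m)); [tauto|exact Nm|].
      intros i Li. rewrite V' by apply num_nat. rewrite V by exact Li. reflexivity. }
    rewrite <- Q1, <- Q2. exact Q.
  + intros i n Hn. apply is_numE in Hn. subst n. apply asgE in E'. apply (fun_app E').
    apply omE, num_nat.
- intros i n Hn. apply is_numE in Hn. subst n. apply asgE in E. apply (fun_app E).
  apply omE, num_nat.
Qed.

Lemma map_gstr X Y h : elementary_map X Y h -> exists L A B I J,
  (forall s, s ∈ L <-> is_mem_symbol s) /\ gstr L A X I /\ gstr L B Y J /\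
  elementary_embedding L A B h.
Proof.
intros (L & A & B & HL & [U [I SA]] & RA & [U' [J SB]] & RB & K).
assert (U = X) by exact (gstr_U SA RA). assert (U' = Y) by exact (gstr_U SB RB). subst.
exists L, A, B, I, J. split; [exact HL|].
split; [split; [exact SA|]; split; [intro s; apply HL|exact RA]|].
split; [split; [exact SB|]; split; [intro s; apply HL|exact RB]|exact K].
Qed.

Lemma map_ext X Y h : elementary_map X Y h -> is_function h X Y /\ ext_elem X Y (ap h).
Proof.
intro K. destruct (map_gstr K) as (L & A & B & I & J & _ & GA & GB & E).
split; [exact (proj1 (emb_sat (proj1 GA) (proj1 GB) E))|exact (emb_ext GA GB E)].
Qed.

Lemma sub_ext X Y : elementary_subset X Y -> subset X Y /\ ext_elem X Y (fun x => x).
Proof.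
intros [S [i [Hi K]]]. split; [exact S|]. destruct (map_ext K) as [F E]. intros p o O.
rewrite (E p o O). assert (Ei : forall x, x ∈ X -> ap i x = x).
{ intros x Hx. symmetry. apply (fun_val F). apply appE, Hi. exists x. split; [exact Hx|apply oprP]. }
replace (fun k : nat => ap i (o k)) with o; [tauto|]. apply functional_extensionality; intro k.
symmetry. apply Ei, O.
Qed.

(** The existential statement is one formula and passes from [Y] to [X]; the witness found there
    satisfies the matrix in [X], hence in [Y]. *)
Lemma tarski_vaught (P : forall N : universe, (nat -> N) -> Prop) X Y (v : nat -> setu Y) :
  UD P -> subset X Y -> ext_elem X Y (fun x => x) -> (forall i : nat, '(v i) ∈ X) ->
  (exists x : setu Y, P (setu Y) (x .: v)) -> exists x : setu Y, 'x ∈ X /\ P (setu Y) (x .: v).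
Proof.
intros UP S E O [x Hx].
assert (UE : UD (fun (N : universe) (v : nat -> N) => exists x : N, P N (x .: v))).
{ destruct UP as [q Hq]. exists (Exs q). intros N w. simpl.
  split; intros [z Z]; exists z; apply Hq, Z. }
destruct (UD_form UE) as [pe He]. destruct (UD_form UP) as [p Hp].
assert (SY : satisfies (fun z => z ∈ Y) pe (fun i : nat => '(v i))).
{ apply (satisfies_subu pe v). apply He. exists x. exact Hx. }
apply (E pe _ O) in SY.
set (vX := fun i : nat => exist (fun z : M => z ∈ X) '(v i) (O i) : setu X).
assert (SX : exists y : setu X, P (setu X) (y .: vX)).
{ apply (He (setu X) vX). apply (satisfies_subu pe vX). exact SY. }
destruct SX as [y Hy]. assert (Yy : 'y ∈ Y) by (apply S; exact (proj2_sig y)).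
exists (exist _ 'y Yy). split; [exact (proj2_sig y)|].
apply Hp in Hy. apply (satisfies_subu p (y .: vX)) in Hy.
apply Hp. apply (satisfies_subu p).
assert (OX : forall i : nat, '((y .: vX) i) ∈ X) by (intro i; exact (proj2_sig ((y .: vX) i))).
apply (E p _ OX) in Hy.
replace (fun i : nat => '(((exist (fun z : M => z ∈ Y) 'y Yy : setu Y) .: v) i)) with (fun i : nat => '((y .: vX) i));
  [exact Hy|]. apply functional_extensionality; intros [|i]; reflexivity.
Qed.

(** [isF] refers to a structure, but whether a code is a formula depends on the language alone. *)
Lemma isF_mem L A X I B Y J : (forall s, s ∈ L <-> is_mem_symbol s) ->
  gstr L A X I -> gstr L B Y J -> forall p, isF L X I p -> isF L Y J p.
Proof.
intros HL GA GB. assert (Ls : smem ∈ L) by (apply HL, smemE; reflexivity).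
assert (D : dfn1 (isF L Y J)) by (unfold isF; df).
intros p Fp. revert Fp. generalize p.
apply (mform_ind (Q := isF L Y J) (sm := smem) (proj1 GA)); auto.
- apply smemE; reflexivity.
- intros i j Ni Nj. apply (sat_R2 (proj1 GB) Ls smem_rel Ni Nj).
- intros i j Ni Nj. apply (sat_Eqv (proj1 GB) Ni Nj).
- intros q _ Fq. apply (isF_neg (proj1 GB) Fq).
- intros q q' _ _ Fq Fq'. apply (isF_and (proj1 GB) Fq Fq').
- intros i q _ Ni Fq. apply (isF_ex (proj1 GB) Fq Ni).
Qed.

(** What codes no formula is satisfied in neither structure, so elementarity has to be checked for
    codes of formulas only. *)
Lemma map_intro L A X I B Y J h : (forall s, s ∈ L <-> is_mem_symbol s) ->
  gstr L A X I -> gstr L B Y J -> is_function h X Y ->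
  (forall p, isF L X I p -> forall e e', is_assignment X e -> is_assignment Y e' ->
    (forall i, is_natural i -> ap e' i = ap h (ap e i)) -> (sat L X I p e <-> sat L Y J p e')) ->
  elementary_map X Y h.
Proof.
intros HL GA GB F K. exists L, A, B. split; [exact HL|].
split; [exists X, I; apply GA|]. split; [apply GA|].
split; [exists Y, J; apply GB|]. split; [apply GB|].
exists X, I, Y, J. split; [apply GA|]. split; [apply GB|]. split; [exact F|].
intros p e e' E E' C. rewrite (ss_sat (proj1 GA)), (ss_sat (proj1 GB)).
destruct (classic (isF L X I p)) as [Fp|Np].
- apply K; auto. intros i Ni. apply omE in Ni. apply asgE in E, E'. symmetry.
  apply (fun_val E'). apply (C i (ap e i)); [exact (fun_app E Ni)|].
  apply (fun_app F). exact (fun_ap_in E Ni).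
- split; intros [T [K1 _]]; exfalso; apply Np.
  + exists T; exact K1.
  + apply (isF_mem HL GB GA). exists T; exact K1.
Qed.

Lemma red_mem L A X I i j e : gstr L A X I -> is_natural i -> is_natural j ->
  is_assignment X e -> (sat L X I (cR2 smem i j) e <-> ap e i ∈ ap e j).
Proof.
intros [SD [HL Red]] Ni Nj E.
assert (Ls : smem ∈ L) by (apply HL, smemE; reflexivity).
rewrite (proj2 (sat_R2 SD Ls smem_rel Ni Nj) e E). apply asgE in E. apply Red.
- apply smemE; reflexivity.
- apply (fun_ap_in E), omE, Ni.
- apply (fun_ap_in E), omE, Nj.
Qed.

(** * Cardinality *)

(** [C] is the least subset of [A] that contains the points outside the range of [g] and is closed
    under applying [f] and then [g]. The bijection is [f] on [C] and the inverse of [g]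
    elsewhere. *)
Lemma schroeder_bernstein A B f g : is_function f A B -> is_function g B A ->
  (forall x y, x ∈ A -> y ∈ A -> ap f x = ap f y -> x = y) ->
  (forall x y, x ∈ B -> y ∈ B -> ap g x = ap g y -> x = y) ->
  exists h, is_bijection h A B.
Proof.
intros F G If Ig.
set (cl := fun Z => subset Z A /\
  (forall x, x ∈ A -> (forall b, b ∈ B -> ~ app g b x) -> x ∈ Z) /\
  (forall x y z, x ∈ Z -> app f x y -> app g y z -> z ∈ Z)).
assert (Dc : dfn1 (fun x => forall Z, cl Z -> x ∈ Z)) by (unfold cl; df).
set (C := sep A (fun x => forall Z, cl Z -> x ∈ Z)).
assert (CE : forall x, x ∈ C <-> x ∈ A /\ forall Z, cl Z -> x ∈ Z) by (intro; apply (sepE _ Dc)).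
assert (Ccl : forall x, x ∈ C -> ap g (ap f x) ∈ C).
{ intros x X. apply CE in X. destruct X as [XA X]. apply CE.
  assert (Y := fun_ap_in F XA). split; [exact (fun_ap_in G Y)|]. intros Z HZ.
  apply HZ with x (ap f x); [exact (X Z HZ)|exact (fun_app F XA)|exact (fun_app G Y)]. }
assert (Cout : forall x, x ∈ A -> ~ x ∈ C -> exists b, b ∈ B /\ ap g b = x).
{ intros x XA N. apply NNPP; intro K. apply N, CE. split; [exact XA|]. intros Z HZ.
  apply HZ; [exact XA|]. intros b Hb P. apply K. exists b. split; [exact Hb|].
  symmetry. exact (fun_val G P). }
assert (Cin : forall b, b ∈ B -> ap g b ∈ C -> exists x, x ∈ C /\ ap f x = b).
{ intros b Hb K. apply NNPP; intro N. apply CE in K. destruct K as [KA K].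
  assert (D' : dfn1 (fun x => x <> ap g b)) by df.
  assert (HZ : cl (sep C (fun x => x <> ap g b))).
  { split; [|split].
    - intros x X. apply (sepE _ D') in X. exact (proj1 (proj1 (CE x) (proj1 X))).
    - intros x XA X. apply (sepE _ D'). split.
      + apply CE. split; [exact XA|]. intros Z HZ. apply HZ; assumption.
      + intros ->. exact (X b Hb (fun_app G Hb)).
    - intros x y z X P Q. apply (sepE _ D') in X. destruct X as [X _]. apply (sepE _ D').
      assert (Y := proj2 (fun_dom F P)). rewrite (fun_val G Q), (fun_val F P).
      split; [apply Ccl, X|]. intro E. apply N. exists x. split; [exact X|].
      apply Ig; [exact (fun_ap_in F (proj1 (proj1 (CE x) X)))|exact Hb|exact E]. }
  specialize (K _ HZ). apply (sepE _ D') in K. tauto. }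
assert (D : dfn2 (fun x y => (x ∈ C /\ app f x y) \/ (~ x ∈ C /\ app g y x))) by df.
destruct (fun_ex (a := A) (b := B) D) as [h [Fh Eh]].
- intros x XA. destruct (classic (x ∈ C)) as [XC|XC].
  + exists (ap f x). split.
    * split; [exact (fun_ap_in F XA)|left; split; [exact XC|exact (fun_app F XA)]].
    * intros y [_ [[_ P]|[N _]]]; [symmetry; exact (fun_val F P)|tauto].
  + destruct (Cout x XA XC) as [b [Hb E]]. exists b. split.
    * split; [exact Hb|]. right. split; [exact XC|]. rewrite <- E. exact (fun_app G Hb).
    * intros y [Hy [[N _]|[_ P]]]; [tauto|]. apply Ig; auto. rewrite E. exact (fun_val G P).
- assert (H1 : forall x, x ∈ C -> ap h x = ap f x).
  { intros x XC. assert (XA := proj1 (proj1 (CE x) XC)). symmetry. apply (fun_val Fh), Eh.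
    split; [exact XA|]. split; [exact (fun_ap_in F XA)|]. left.
    split; [exact XC|exact (fun_app F XA)]. }
  assert (H2 : forall x, x ∈ A -> ~ x ∈ C -> ap h x ∈ B /\ ap g (ap h x) = x).
  { intros x XA XC. assert (P := fun_app Fh XA). apply Eh in P.
    destruct P as [_ [P [[Q _]|[_ Q]]]]; [tauto|]. split; [exact P|].
    symmetry. exact (fun_val G Q). }
  exists h. apply (bij_mk Fh).
  + intros x y X Y E. destruct (classic (x ∈ C)) as [XC|XC], (classic (y ∈ C)) as [YC|YC].
    * rewrite (H1 x XC), (H1 y YC) in E. auto.
    * exfalso. apply YC. destruct (H2 y Y YC) as [_ Q]. rewrite <- Q, <- E, (H1 x XC).
      apply Ccl, XC.
    * exfalso. apply XC. destruct (H2 x X XC) as [_ Q]. rewrite <- Q, E, (H1 y YC).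
      apply Ccl, YC.
    * rewrite <- (proj2 (H2 x X XC)), <- (proj2 (H2 y Y YC)), E. reflexivity.
  + intros b Hb. destruct (classic (ap g b ∈ C)) as [K|K].
    * destruct (Cin b Hb K) as [x [X E]]. exists x. split; [exact (proj1 (proj1 (CE x) X))|].
      rewrite (H1 x X). exact E.
    * assert (Ga := fun_ap_in G Hb). exists (ap g b). split; [exact Ga|].
      destruct (H2 _ Ga K) as [P Q]. apply Ig; auto.
Qed.

(** * The Loewenheim-Skolem theorem *)

Section Skolem.
Variables (L A W I K : M).
Hypothesis HL : forall s, s ∈ L <-> is_mem_symbol s.
Hypothesis GW : gstr L A W I.
Hypothesis CK : adjcl K.
Notation sW := (sat L W I).

Definition supports p n := is_natural n /\ forall e e', is_assignment W e ->
  is_assignment W e' -> agree n e e' -> sW p e -> sW p e'.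

(* [x] is a common witness for all assignments that begin with [g] applied to [t]. *)
Definition witness g p i t x := forall n e c, supports p n -> is_function t n K ->
  is_assignment W e -> (forall k u y, app t k u -> app e k y -> app g u y) ->
  is_cEx c i p -> sW c e ->
  exists e', sW p e' /\ app e' i x /\ forall k y, k <> i -> (app e k y <-> app e' k y).

(** [g] and [t] determine the entries of an assignment on which [p] depends. A value that works for
    one such assignment works for all of them. *)
Lemma witness_ex g p i t : is_natural i -> isF L W I p -> is_function g K W ->
  exists x, x ∈ W /\ witness g p i t x.
Proof.
intros Ni Fp Fg.
destruct (classic (exists n e, supports p n /\ is_function t n K /\ is_assignment W e /\
  (forall k u y, app t k u -> app e k y -> app g u y) /\ sW (cEx i p) e)) as [Ex|N].
- destruct Ex as (n & e & Sn & Ft & E & Et & S).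
  apply (isF_ex (proj1 GW) Fp Ni) in S; [|exact E]. destruct S as [e1 [S1 S2]].
  assert (E1 := sat_asg S1). exists (ap e1 i).
  assert (E1' := proj1 (asgE _ _) E1). assert (Oi := proj2 (omE i) Ni).
  split; [exact (fun_ap_in E1' Oi)|]. intros n' e' c _ Ft' E' Et' _ _.
  destruct (asg_upd (x := ap e1 i) E' Ni (fun_ap_in E1' Oi)) as [e2 [E2 [P Q]]].
  exists e2. split; [|split; [exact P|exact Q]].
  apply (proj2 Sn e1 e2 E1 E2); [|exact S1].
  intros k x Kn. destruct (classic (k = i)) as [->|NE].
  + assert (E2' := proj1 (asgE _ _) E2). split; intro X.
    * rewrite (fun_val E1' X). exact P.
    * rewrite (fun_unique E2' X P). exact (fun_app E1' Oi).
  + rewrite <- (S2 k x NE), <- (Q k x NE).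
    assert (Ok : k ∈ om) by (apply omE; exact (nat_el (proj1 Sn) Kn)).
    assert (Tk := fun_app Ft Kn). apply asgE in E, E'.
    assert (Ee : ap e k = ap e' k)
      by exact (fun_unique Fg (Et _ _ _ Tk (fun_app E Ok)) (Et' _ _ _ Tk (fun_app E' Ok))).
    rewrite (fun_appE _ E Ok), (fun_appE _ E' Ok), Ee. tauto.
- destruct (proj1 (proj2 (proj1 GW))) as [x X]. exists x. split; [exact X|].
  intros n e c Sn Ft E Et C S. apply is_cExE in C. subst c. exfalso. apply N. exists n, e. auto.
Qed.

(** [g] enumerates the elements found so far, with indices in [K]. In [g'] the index <0,b> keeps the
    element with index b, and <1,<p,<i,t>>> names a witness for the existential formula [cEx i p]
    whose parameters have the indices [t]. *)
Definition sk_step g g' := is_function g' K W /\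
  (forall b, b ∈ K -> ap g' (opr (num 0) b) = ap g b) /\
  forall p i t, p ∈ K -> i ∈ K -> t ∈ K -> is_natural i -> isF L W I p ->
    witness g p i t (ap g' (opr (num 1) (opr p (opr i t)))).

Lemma sk_ex g : is_function g K W -> exists g', sk_step g g'.
Proof.
intro Fg.
set (R := fun a x => (forall b, b ∈ K -> tagged 0 b a -> app g b x) /\
  forall p i t q q', is_natural i -> isF L W I p -> is_pair q i t -> is_pair q' p q ->
    tagged 1 q' a -> witness g p i t x).
assert (D : dfn2 R) by (unfold R, witness, supports, agree, isF, sat; df).
destruct (choice_fun (a := K) (b := W) D) as [g' [Fg' HR]].
- intros a Ka. destruct (classic (exists b, b ∈ K /\ a = opr (num 0) b)) as [[b [Kb ->]]|N0].
  + exists (ap g b). split; [exact (fun_ap_in Fg Kb)|]. split.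
    * intros b' _ T. apply taggedE, tag_inj in T. destruct T as [_ <-]. exact (fun_app Fg Kb).
    * intros p i t q q' _ _ _ _ T. apply taggedE, tag_inj in T. lia.
  + assert (Z0 : forall b, b ∈ K -> ~ tagged 0 b a).
    { intros b Kb T. apply taggedE in T. apply N0. eauto. }
    destruct (classic (exists p i t, is_natural i /\ isF L W I p /\
      a = opr (num 1) (opr p (opr i t)))) as [(p & i & t & Ni & Fp & ->)|N1].
    * destruct (witness_ex t Ni Fp Fg) as [x [X Hx]]. exists x. split; [exact X|]. split.
      -- intros b Kb T. destruct (Z0 b Kb T).
      -- intros p' i' t' q q' _ _ Q Q' T. apply is_pairE in Q, Q'. apply taggedE in T. subst.
         apply tag_inj in T. destruct T as [_ T]. apply opr_inj in T. destruct T as [<- T].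
         apply opr_inj in T. destruct T as [<- <-]. exact Hx.
    * destruct (proj1 (proj2 (proj1 GW))) as [x X]. exists x. split; [exact X|]. split.
      -- intros b Kb T. destruct (Z0 b Kb T).
      -- intros p' i' t' q q' Ni Fp Q Q' T. exfalso. apply N1. apply is_pairE in Q, Q'.
         apply taggedE in T. subst. eauto 8.
- assert (K0 : forall m : nat, num m ∈ K) by (intro m; apply (adjcl_nat CK), num_nat).
  exists g'. split; [exact Fg'|]. split.
  + intros b Kb. apply (fun_val Fg).
    apply (HR (opr (num 0) b)); [apply (adjcl_opr CK); auto|exact Kb|].
    apply taggedE; reflexivity.
  + intros p i t Kp Ki Kt Ni Fp.
    apply (proj2 (HR (opr (num 1) (opr p (opr i t)))
      (adjcl_opr CK (K0 1) (adjcl_opr CK Kp (adjcl_opr CK Ki Kt))))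
      p i t (opr i t) (opr p (opr i t)) Ni Fp); [apply oprP|apply oprP|].
    apply taggedE; reflexivity.
Qed.

(** The enumeration is improved omega times and [X] is the set of all values. Codes, variables and
    finite sequences of indices are elements of [K], so every request for a witness has an index in
    [K]. A pair of a stage and an index is again in [K] and determines the element, which gives the
    injection. *)
Theorem loewenheim_skolem g0 : is_function g0 K W -> exists X,
  elementary_subset X W /\ (forall a, a ∈ K -> ap g0 a ∈ X) /\
  exists c, is_function c X K /\ forall x y, x ∈ X -> y ∈ X -> ap c x = ap c y -> x = y.
Proof.
intro F0.
assert (LK : subset L K).
{ intros s S. apply HL, smemE in S. subst s. unfold smem.
  repeat apply (adjcl_opr CK); apply (adjcl_nat CK), num_nat. }
set (Fs := sep (Pw (prod K W)) (fun g => is_function g K W)).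
assert (DF : dfn1 (fun g => is_function g K W)) by df.
assert (FsE : forall g, g ∈ Fs <-> is_function g K W).
{ intro g. unfold Fs. rewrite sepE by exact DF. split; [tauto|]. intro F.
  split; [|exact F]. apply PwE. intros z Z. apply (fun_mem _ F) in Z.
  destruct Z as [x [X ->]]. apply prod_opr. split; [exact X|exact (fun_ap_in F X)]. }
set (St := fun g g' => is_function g' K W /\
  (forall b a x, b ∈ K -> tagged 0 b a -> app g b x -> app g' a x) /\
  forall p i t q q' a x, p ∈ K -> i ∈ K -> t ∈ K -> is_natural i -> isF L W I p ->
    is_pair q i t -> is_pair q' p q -> tagged 1 q' a -> app g' a x -> witness g p i t x).
assert (DS : dfn2 St) by (unfold St, witness, supports, agree, isF, sat; df).
destruct (dependent_choice (K := Fs) (k0 := g0) DS) as [s [Fss [S0 Sn]]].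
- apply FsE, F0.
- intros g Hg. apply FsE in Hg. destruct (sk_ex Hg) as [g' [P1 [P2 P3]]].
  exists g'. split; [apply FsE, P1|]. split; [exact P1|]. split.
  + intros b a x Kb T P. apply taggedE in T. subst a. rewrite (fun_val Hg P), <- (P2 b Kb).
    apply (fun_app P1). apply (adjcl_opr CK); [apply (adjcl_nat CK), num_nat|exact Kb].
  + intros p i t q q' a x Kp Ki Kt Ni Fp Q Q' T P. apply is_pairE in Q, Q'.
    apply taggedE in T. subst. rewrite (fun_val P1 P). apply P3; assumption.
- assert (Fn : forall n, is_natural n -> is_function (ap s n) K W).
  { intros n Nn. apply FsE, (fun_ap_in Fss), omE, Nn. }
  assert (Up : forall m n x a, is_natural n -> m ∈ n -> app (ap s m) a x ->
    exists a', app (ap s n) a' x).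
  { assert (Dn : dfn1 (fun n => forall m g h x a, m ∈ n -> app s m g -> app s n h ->
      app g a x -> exists a', app h a' x)) by df.
    assert (G : forall n, is_natural n -> forall m g h x a, m ∈ n -> app s m g -> app s n h ->
      app g a x -> exists a', app h a' x).
    { apply (nat_ind Dn).
      - intros m g h x a Hm. exfalso; exact (empE Hm).
      - intros n Nn IH m g h x a Hm Hg Hh Ha.
        assert (Hn := fun_app Fss (proj2 (omE n) Nn)).
        assert (G1 : exists a', app (ap s n) a' x).
        { apply sucE in Hm. destruct Hm as [Hm| ->]; [exact (IH m g _ x a Hm Hg Hn Ha)|].
          exists a. rewrite <- (fun_val Fss Hg). exact Ha. }
        destruct G1 as [a' Ha']. rewrite (fun_val Fss Hh).
        destruct (Sn n Nn) as [_ [Q _]]. exists (opr (num 0) a').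
        apply (Q a'); [exact (proj1 (fun_dom (Fn n Nn) Ha'))|apply taggedE; reflexivity|exact Ha']. }
    intros m n x a Nn Hm Ha. apply (G n Nn m (ap s m) (ap s n) x a Hm); [| |exact Ha].
    - apply (fun_app Fss), omE. exact (nat_el Nn Hm).
    - apply (fun_app Fss), omE, Nn. }
  assert (DX : dfn1 (fun x => exists n g a, app s n g /\ app g a x)) by df.
  set (X := sep W (fun x => exists n g a, app s n g /\ app g a x)).
  assert (XE : forall x, x ∈ X <-> exists n a, is_natural n /\ app (ap s n) a x).
  { intro x. unfold X. rewrite sepE by exact DX. split.
    - intros [_ [n [g [a [P Q]]]]]. exists n, a. rewrite (fun_val Fss P) in Q.
      split; [apply omE, (fun_dom Fss P)|exact Q].
    - intros [n [a [Nn P]]]. split; [exact (proj2 (fun_dom (Fn n Nn) P))|].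
      exists n, (ap s n), a. split; [apply (fun_app Fss), omE, Nn|exact P]. }
  assert (XW : subset X W) by (intros x Hx; apply (sepE _ DX) in Hx; tauto).
  assert (X0 : forall a, a ∈ K -> ap g0 a ∈ X).
  { intros a Ka. apply XE. exists emp, a. split; [apply nat_emp|]. rewrite S0.
    exact (fun_app F0 Ka). }
  exists X. split; [|split; [exact X0|]].
  + destruct (mstr_ex (X0 _ (adjcl_emp CK))) as [L' [AX [IX [HL' GX]]]].
    assert (L' = L) by (apply set_ext; intro z; rewrite HL, HL'; tauto). subst L'.
    split; [exact XW|].
    assert (DI : dfn1 (fun p => exists x, x ∈ X /\ is_pair p x x)) by df.
    set (id := sep (prod X X) (fun p => exists x, x ∈ X /\ is_pair p x x)).
    assert (Hid : is_identity_on X id).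
    { intro p. unfold id. rewrite sepE by exact DI. split; [tauto|]. intros [x [Hx P]].
      split; [|eauto]. apply is_pairE in P. subst. apply prod_opr; auto. }
    assert (Fid : is_function id X W).
    { split.
      - intros p P. apply Hid in P. destruct P as [x [Hx P]]. exists x, x. auto.
      - intros x Hx. exists x. split.
        + exists (opr x x). split; [apply oprP|]. apply Hid. exists x. split; [exact Hx|apply oprP].
        + intros y [p [P Q]]. apply Hid in Q. destruct Q as [x' [_ Q]].
          apply is_pairE in P, Q. subst p. apply opr_inj in Q. destruct Q; congruence. }
    assert (Eid : forall x, x ∈ X -> ap id x = x).
    { intros x Hx. symmetry. apply (fun_val Fid), appE, Hid. exists x.
      split; [exact Hx|apply oprP]. }
    exists id. split; [exact Hid|].
    assert (AW : forall e, is_assignment X e -> is_assignment W e).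
    { intros e E. apply asgE. apply asgE in E. exact (fun_widen E XW). }
    assert (Main : forall p, isF L X IX p -> forall e, is_assignment X e ->
      (sat L X IX p e <-> sW p e)).
    { assert (DQ : dfn1 (fun p => forall e, is_assignment X e -> (sat L X IX p e <-> sW p e)))
        by (unfold sat; df).
      apply (mform_ind (Q := fun p => forall e, is_assignment X e -> (sat L X IX p e <-> sW p e))
        (sm := smem) (proj1 GX)); auto.
      - apply smemE; reflexivity.
      - intros i j Ni Nj e E. rewrite (red_mem GX Ni Nj E), (red_mem GW Ni Nj (AW e E)). tauto.
      - intros i j Ni Nj e E. rewrite (proj2 (sat_Eqv (proj1 GX) Ni Nj) e E).
        rewrite (proj2 (sat_Eqv (proj1 GW) Ni Nj) e (AW e E)). tauto.
      - intros p Fp IH e E. rewrite (proj2 (isF_neg (proj1 GX) Fp) e E).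
        rewrite (proj2 (isF_neg (proj1 GW) (isF_mem HL GX GW Fp)) e (AW e E)), (IH e E). tauto.
      - intros p q Fp Fq IHp IHq e E. rewrite (proj2 (isF_and (proj1 GX) Fp Fq) e).
        rewrite (proj2 (isF_and (proj1 GW) (isF_mem HL GX GW Fp) (isF_mem HL GX GW Fq)) e).
        rewrite (IHp e E), (IHq e E). tauto.
      - intros i p Fp Ni IH e E. rewrite (proj2 (isF_ex (proj1 GX) Fp Ni) e E).
        assert (Fp' := isF_mem HL GX GW Fp).
        destruct (isF_ex (proj1 GW) Fp' Ni) as [Fx Sx]. rewrite (Sx e (AW e E)). split.
        + intros [e' [P Q]]. exists e'. split; [|exact Q]. apply IH; [exact (sat_asg P)|exact P].
        + intro Ex. assert (S := proj2 (Sx e (AW e E)) Ex). clear Ex.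
          destruct (sat_supp (proj1 GW) p) as [n [Nn Sup]].
          assert (E1 := proj1 (asgE _ _) E).
          assert (DR : dfn2 (fun k m => forall x g, app e k x -> app s m g -> exists a, app g a x)) by df.
          (* The entries of [e] on which the formula depends all occur at one stage [m]. *)
          destruct (fin_bound DR) with (n := n) as [m [Nm Hm]].
          * intros k m m' R1 Hm Nm' x g P Q.
            destruct (R1 x (ap s m) P (fun_app Fss (proj2 (omE m) (nat_el Nm' Hm)))) as [a Ha].
            rewrite (fun_val Fss Q). exact (Up m m' x a Nm' Hm Ha).
          * exact Nn.
          * intros k Kn. assert (Ok := proj2 (omE k) (nat_el Nn Kn)).
            assert (Xk := fun_ap_in E1 Ok). apply XE in Xk. destruct Xk as [m [a [Nm Ha]]].
            exists m. split; [exact Nm|]. intros x g P Q. exists a.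
            rewrite (fun_val E1 P), (fun_val Fss Q). exact Ha.
          * assert (Hsm := fun_app Fss (proj2 (omE m) Nm)).
            assert (DT : dfn2 (fun k u => forall x, app e k x -> app (ap s m) u x)) by df.
            destruct (choice_fun (a := n) (b := K) DT) as [t [Ft Ht]].
            { intros k Kn. assert (Ok := proj2 (omE k) (nat_el Nn Kn)).
              destruct (Hm k Kn _ _ (fun_app E1 Ok) Hsm) as [a Ha]. exists a.
              split; [exact (proj1 (fun_dom (Fn m Nm) Ha))|]. intros x P.
              rewrite (fun_val E1 P). exact Ha. }
            assert (Kp : p ∈ K) by (destruct Fp' as [T HT]; apply (fe_bound CK LK HT)).
            assert (Ki : i ∈ K) by exact (adjcl_nat CK Ni).
            assert (Kt : t ∈ K) by exact (adjcl_fun CK Nn Ft).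
            set (a := opr (num 1) (opr p (opr i t))).
            assert (Ka : a ∈ K).
            { apply (adjcl_opr CK); [apply (adjcl_nat CK), num_nat|].
              apply (adjcl_opr CK Kp), (adjcl_opr CK Ki Kt). }
            assert (Fs1 := Fn _ (nat_suc Nm)).
            destruct (Sn m Nm) as [_ [_ Wit]].
            assert (Wx := Wit p i t (opr i t) (opr p (opr i t)) a _ Kp Ki Kt Ni Fp'
              (oprP _ _) (oprP _ _) (proj2 (taggedE _ _ _) eq_refl) (fun_app Fs1 Ka)).
            destruct (Wx n e (cEx i p)) as [e' [P [Q R1]]]; auto.
            { split; [exact Nn|]. exact Sup. }
            { intros k u y Tu Ey. rewrite (fun_val Ft Tu). apply (Ht k); [|exact Ey].
              exact (proj1 (fun_dom Ft Tu)). }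
            { apply is_cExE; reflexivity. }
            assert (E' : is_assignment X e').
            { assert (E2 := proj1 (asgE _ _) (sat_asg P)). apply asgE. apply (fun_range E2).
              intros k Ok. destruct (classic (k = i)) as [->|NE].
              - rewrite <- (fun_val E2 Q). apply XE. exists (suc m), a.
                split; [apply nat_suc, Nm|exact (fun_app Fs1 Ka)].
              - assert (Z := fun_app E1 Ok). apply (R1 k _ NE) in Z.
                rewrite <- (fun_val E2 Z). exact (fun_ap_in E1 Ok). }
            exists e'. split; [apply IH; assumption|exact R1]. }
    apply (map_intro HL GX GW Fid). intros p Fp e e' E E' C.
    assert (e = e').
    { apply (asg_ext E E'). intros i Ni. rewrite (C i Ni). symmetry. apply Eid.
      apply asgE in E. apply (fun_ap_in E), omE, Ni. }
    subst e'. apply Main; assumption.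
  + assert (DC : dfn2 (fun x k => exists n g a, app s n g /\ app g a x /\ is_pair k n a)) by df.
    destruct (choice_fun (a := X) (b := K) DC) as [c [Fc Hc]].
    * intros x Hx. apply XE in Hx. destruct Hx as [n [a [Nn P]]]. exists (opr n a). split.
      -- apply (adjcl_opr CK); [apply (adjcl_nat CK), Nn|].
         exact (proj1 (fun_dom (Fn n Nn) P)).
      -- exists n, (ap s n), a. split; [apply (fun_app Fss), omE, Nn|].
         split; [exact P|apply oprP].
    * exists c. split; [exact Fc|]. intros x y Hx Hy E.
      destruct (Hc x Hx) as [n [g [a [P [Q R1]]]]], (Hc y Hy) as [n' [g' [a' [P' [Q' R1']]]]].
      apply is_pairE in R1, R1'. rewrite R1, R1' in E. apply opr_inj in E. destruct E; subst n' a'.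
      rewrite (fun_unique Fss P' P) in Q'.
      assert (Nn : is_natural n) by (apply omE, (fun_dom Fss P)).
      rewrite (fun_val Fss P) in Q, Q'. exact (fun_unique (Fn n Nn) Q Q').
Qed.
End Skolem.
End Embeddings.

(** * Structures for the language of the class U *)

Section Lstar.
Context {M : universe} {hM : ZFC M}.
Implicit Types A B L U I X Y W a b c d e f g h i j k n p q r s t u v w x y z : M.
Notation "' a" := (proj1_sig a) (at level 1, format "' a").

Definition sE : M := opr (num 0) (opr (num 2) (num 1)).
Definition sP : M := opr (num 0) (opr (num 1) (num 0)).
Definition sf : M := opr (num 1) (opr (num 1) (num 0)).

Lemma sEE s : is_E_symbol s <-> s = sE. Proof. apply std_symbolE. Qed.
Lemma sPE s : is_P_symbol s <-> s = sP. Proof. apply std_symbolE. Qed.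
Lemma sfE s : is_f_symbol s <-> s = sf. Proof. apply std_symbolE. Qed.

Lemma std_inj (k n m k' n' m' : nat) :
  opr (num k) (opr (num n) (num m)) = opr (num k') (opr (num n') (num m')) :> M ->
  k = k' /\ n = n' /\ m = m'.
Proof.
intro E. apply tag_inj in E. destruct E as [-> E]. apply opr_inj in E. destruct E as [E1 E2].
apply num_inj in E1, E2. auto.
Qed.

Lemma LstarE L : is_Lstar L -> forall s, s ∈ L <-> s = smem \/ s = sf \/ s = sE \/ s = sP.
Proof. intros H s. rewrite (H s), smemE, sfE, sEE, sPE. tauto. Qed.

Lemma Lstar_ex : exists L, is_Lstar L.
Proof.
exists (adj (adj (upr smem sf) sE) sP). intro s.
rewrite smemE, sfE, sEE, sPE, !adjE, uprE. tauto.
Qed.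

Lemma seq1_inj x y : seq1 x = seq1 y -> x = y.
Proof.
intro E. assert (K : app (seq1 x) (num 0) x) by (apply app_seq1; auto).
rewrite E in K. apply app_seq1 in K. tauto.
Qed.

Lemma seq2_inj x y x' y' : seq2 x y = seq2 x' y' -> x = x' /\ y = y'.
Proof.
intro E. assert (Q1 : app (seq2 x y) (num 0) x) by (apply app_seq2; auto).
assert (Q2 : app (seq2 x y) (num 1) y) by (apply app_seq2; auto).
rewrite E in Q1, Q2. apply app_seq2 in Q1, Q2.
destruct Q1 as [[_ Q1]|[Q1 _]]; [|destruct (num01 Q1)].
destruct Q2 as [[Q2 _]|[_ Q2]]; [symmetry in Q2; destruct (num01 Q2)|]. auto.
Qed.

Lemma tuples2 U (R : M -> M -> Prop) : dfn2 R -> exists S, forall t,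
  t ∈ S <-> exists x y, x ∈ U /\ y ∈ U /\ R x y /\ t = seq2 x y.
Proof.
intro DR. assert (D : dfn1 (fun t => exists x y, x ∈ U /\ y ∈ U /\ R x y /\ is_seq2 t x y)) by df.
exists (sep (Pw (prod (num 2) U)) (fun t => exists x y, x ∈ U /\ y ∈ U /\ R x y /\ is_seq2 t x y)).
intro t. rewrite sepE by exact D. split.
- intros [_ [y [z [Y [Z [K T]]]]]]. apply is_seq2E in T. eauto 6.
- intros [y [z [Y [Z [K ->]]]]]. split.
  + apply PwE. intros q Q. assert (F := seq2_fun Y Z). apply (fun_mem _ F) in Q.
    destruct Q as [k [Hk ->]]. apply prod_opr. split; [exact Hk|exact (fun_ap_in F Hk)].
  + exists y, z. rewrite is_seq2E. auto.
Qed.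

Lemma tuples1 U P : subset P U -> exists S, forall t, t ∈ S <-> exists x, x ∈ P /\ t = seq1 x.
Proof.
intro PU. assert (D : dfn1 (fun t => exists x, x ∈ P /\ is_seq1 t x)) by df.
exists (sep (Pw (prod (num 1) U)) (fun t => exists x, x ∈ P /\ is_seq1 t x)).
intro t. rewrite sepE by exact D. split.
- intros [_ [y [Y T]]]. apply is_seq1E in T. eauto.
- intros [y [Y ->]]. split.
  + apply PwE. intros q Q. assert (F := seq1_fun (PU y Y)). apply (fun_mem _ F) in Q.
    destruct Q as [k [Hk ->]]. apply prod_opr. split; [exact Hk|exact (fun_ap_in F Hk)].
  + exists y. rewrite is_seq1E. auto.
Qed.

Lemma fun_symbol_unique s n m : is_fun_symbol s n -> is_fun_symbol s m -> n = m.
Proof.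
intros [_ [a [q [Q T]]]] [_ [b [q' [Q' T']]]]. apply is_pairE in Q, Q'. apply taggedE in T, T'.
subst. apply tag_inj in T'. destruct T' as [_ T']. apply opr_inj in T'. tauto.
Qed.

Lemma rel_not_fun s n m : is_rel_symbol s n -> ~ is_fun_symbol s m.
Proof.
intros [_ [a [q [Q T]]]] [_ [b [q' [Q' T']]]]. apply taggedE in T, T'. subst.
apply tag_inj in T'. lia.
Qed.

Lemma lstar_structure L U f E P : is_Lstar L -> (exists u, u ∈ U) -> is_function f U U ->
  subset P U -> exists A I, structure_data L A U I /\ has_membership_reduct A U /\
    (forall x y, fun1 A sf x y <-> app f x y) /\
    (forall x y, x ∈ U -> y ∈ U -> (rel2 A sE x y <-> app E x y)) /\
    forall x, rel1 A sP x <-> x ∈ P.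
Proof.
intros HL HU Ff HP. assert (LE := LstarE HL).
destruct (tuples2 U (R := fun x y => x ∈ y) ltac:(df)) as [Rm HRm].
destruct (tuples2 U (R := fun x y => app E x y) ltac:(df)) as [Re HRe].
destruct (tuples1 HP) as [Rp HRp].
assert (DT : dfn1 (fun t => is_function t (num 1) U)) by df.
set (T := sep (Pw (prod (num 1) U)) (fun t => is_function t (num 1) U)).
assert (TE : forall t, t ∈ T <-> is_function t (num 1) U).
{ intro t. unfold T. rewrite sepE by exact DT. split; [tauto|]. intro F.
  split; [|exact F]. apply PwE. intros z Z. apply (fun_mem _ F) in Z.
  destruct Z as [x [X ->]]. apply prod_opr. split; [exact X|exact (fun_ap_in F X)]. }
destruct (fun_ex (a := T) (b := U) (R := fun t y => exists x, is_seq1 t x /\ app f x y) ltac:(df))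
  as [F [FF EF]].
{ intros t Ht. apply TE in Ht. assert (X : ap t (num 0) ∈ U) by (apply (fun_ap_in Ht), num1E; reflexivity).
  exists (ap f (ap t (num 0))). split.
  - split; [exact (fun_ap_in Ff X)|]. exists (ap t (num 0)). split; [apply is_seq1E, (fun_seq1 Ht)|].
    exact (fun_app Ff X).
  - intros y [_ [x [S K]]]. apply is_seq1E in S. rewrite S, (fun_val Ff K). f_equal.
    symmetry. apply (fun_val (seq1_fun (proj1 (fun_dom Ff K)))). apply app_seq1; auto. }
assert (Dme : sE <> smem) by (intro K; apply std_inj in K; lia).
assert (Dmp : sP <> smem) by (intro K; apply std_inj in K; lia).
assert (Dmf : sf <> smem) by (intro K; apply std_inj in K; lia).
assert (Dep : sP <> sE) by (intro K; apply std_inj in K; lia).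
assert (Def : sf <> sE) by (intro K; apply std_inj in K; lia).
assert (Dpf : sf <> sP) by (intro K; apply std_inj in K; lia).
set (Q := fun s R => (s = smem /\ R = Rm) \/ (s = sE /\ R = Re) \/ (s = sP /\ R = Rp) \/ (s = sf /\ R = F)).
set (V := adj (adj (upr Rm Re) Rp) F).
assert (VE : forall z, z ∈ V <-> z = Rm \/ z = Re \/ z = Rp \/ z = F).
{ intro z. unfold V. rewrite !adjE, uprE. tauto. }
assert (DQ : dfn2 Q) by (unfold Q; df).
destruct (fun_ex (a := L) (b := V) DQ) as [I [FI EI]].
{ unfold Q. intros s S. apply LE in S. destruct S as [->|[->|[->| ->]]].
  - exists Rm. split; [split; [apply VE|]; tauto|]. intros y [_ K].
    destruct K as [[_ K]|[[K _]|[[K _]|[K _]]]]; congruence.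
  - exists F. split; [split; [apply VE|]; tauto|]. intros y [_ K].
    destruct K as [[K _]|[[K _]|[[K _]|[_ K]]]]; congruence.
  - exists Re. split; [split; [apply VE|]; tauto|]. intros y [_ K].
    destruct K as [[K _]|[[_ K]|[[K _]|[K _]]]]; congruence.
  - exists Rp. split; [split; [apply VE|]; tauto|]. intros y [_ K].
    destruct K as [[K _]|[[K _]|[[_ K]|[K _]]]]; congruence. }
assert (AI : forall s R, app I s R <-> Q s R).
{ intros s R. rewrite EI. split; [tauto|]. intro K. rewrite LE, VE. unfold Q in *. tauto. }
assert (IA : forall s R, interprets (opr U I) s R <-> Q s R).
{ intros s R. rewrite <- AI. split.
  - intros [U' [I' [K1 K2]]]. apply is_pairE, opr_inj in K1. destruct K1; subst. exact K2.
  - intro K. exists U, I. split; [apply oprP|exact K]. }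
exists (opr U I), I. split; [|split; [|split; [|split]]].
- split; [apply oprP|]. split; [exact HU|]. split; [exists V; exact FI|]. split.
  + intros s n R S Sn K t Ht. apply AI in K. destruct K as [[-> ->]|[[-> ->]|[[-> ->]|[-> ->]]]].
    * rewrite (rel_symbol_unique Sn smem_rel). apply HRm in Ht.
      destruct Ht as [y [z [Y [Z [_ ->]]]]]. apply seq2_fun; assumption.
    * rewrite (rel_symbol_unique Sn (std_rel 2 1)). apply HRe in Ht.
      destruct Ht as [y [z [Y [Z [_ ->]]]]]. apply seq2_fun; assumption.
    * rewrite (rel_symbol_unique Sn (std_rel 1 0)). apply HRp in Ht.
      destruct Ht as [y [Y ->]]. apply seq1_fun, HP, Y.
    * destruct (rel_not_fun Sn (std_fun 1 0)).
  + intros s n R S Sn K. apply AI in K. destruct K as [[-> ->]|[[-> ->]|[[-> ->]|[-> ->]]]].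
    * destruct (rel_not_fun smem_rel Sn).
    * destruct (rel_not_fun (std_rel 2 1) Sn).
    * destruct (rel_not_fun (std_rel 1 0) Sn).
    * rewrite (fun_symbol_unique Sn (std_fun 1 0)). exists T. split; [exact TE|exact FF].
- split; [exists I; apply oprP|]. intros s S x y X Y. apply smemE in S. subst s. split.
  + intros [R [t [K1 [K2 K3]]]]. apply IA in K1. apply is_seq2E in K2. subst t.
    destruct K1 as [[_ ->]|[[K _]|[[K _]|[K _]]]]; try congruence.
    apply HRm in K3. destruct K3 as [x' [y' [_ [_ [K E']]]]]. apply seq2_inj in E'.
    destruct E'; subst; exact K.
  + intro K. exists Rm, (seq2 x y). split; [apply IA; unfold Q; auto 6|].
    split; [apply is_seq2E; reflexivity|]. apply HRm. eauto 8.
- intros x y. split.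
  + intros [R [t [K1 [K2 K3]]]]. apply IA in K1. apply is_seq1E in K2. subst t.
    destruct K1 as [[K _]|[[K _]|[[K _]|[_ ->]]]]; try congruence.
    apply EF in K3. destruct K3 as [_ [_ [x' [K3 K4]]]]. apply is_seq1E, seq1_inj in K3.
    subst; exact K4.
  + intro K. destruct (fun_dom Ff K) as [X Y]. exists F, (seq1 x). rewrite IA, is_seq1E, EF, TE.
    split; [unfold Q; tauto|]. split; [reflexivity|]. split; [apply seq1_fun, X|].
    split; [exact Y|]. exists x. rewrite is_seq1E. auto.
- intros x y X Y. split.
  + intros [R [t [K1 [K2 K3]]]]. apply IA in K1. apply is_seq2E in K2. subst t.
    destruct K1 as [[K _]|[[_ ->]|[[K _]|[K _]]]]; try congruence.
    apply HRe in K3. destruct K3 as [x' [y' [_ [_ [K E']]]]]. apply seq2_inj in E'.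
    destruct E'; subst; exact K.
  + intro K. exists Re, (seq2 x y). split; [apply IA; unfold Q; auto 6|].
    split; [apply is_seq2E; reflexivity|]. apply HRe. eauto 8.
- intros x. split.
  + intros [R [t [K1 [K2 K3]]]]. apply IA in K1. apply is_seq1E in K2. subst t.
    destruct K1 as [[K _]|[[K _]|[[_ ->]|[K _]]]]; try congruence.
    apply HRp in K3. destruct K3 as [x' [K E']]. apply seq1_inj in E'. subst; exact K.
  + intro K. exists Rp, (seq1 x). split; [apply IA; unfold Q; auto 6|].
    split; [apply is_seq1E; reflexivity|]. apply HRp. eauto 8.
Qed.

(* The data that [classU] requires of [A], for a fixed cardinal with [Vl] = V_l, [Vz] = V_zeta. *)
Definition Udata L l Vl Vz A I X fA tau := structure_data L A Vl I /\ has_membership_reduct A Vl /\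
  (forall p, p ∈ fA <-> exists x y, is_pair p x y /\ fun1 A sf x y) /\
  elementary_subset X Vz /\ subset Vl X /\ l ∈ X /\ fA ∈ X /\ is_bijection tau X Vl /\
  ap tau l = opr (num 0) (num 0) /\ (forall x, x ∈ Vl -> ap tau x = opr (num 1) x) /\
  (forall x y, x ∈ X -> y ∈ X -> (x ∈ y <-> rel2 A sE (ap tau x) (ap tau y))).

Lemma Udata_intro L l Vl z Vz A I X fA tau : is_Lstar L -> is_limit_cardinal l -> is_V l Vl ->
  is_least_C2_cardinal_above l z -> is_V z Vz -> Udata L l Vl Vz A I X fA tau -> classU A.
Proof.
intros HL Hl HV Hz HVz (SD & Red & HfA & EX & VX & lX & fX & Bt & Tl & Tx & TE).
destruct Bt as [Ft Bt].
exists L, l, Vl. split; [exact HL|]. split; [exists Vl, I; exact SD|]. split; [exact Hl|].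
split; [exact HV|]. split; [exact Red|]. exists z, Vz, X, fA, sf, sE, tau.
split; [exact Hz|]. split; [exact HVz|]. split; [apply sfE; reflexivity|].
split; [apply sEE; reflexivity|]. split; [exact HfA|]. split; [exact EX|].
split; [exact VX|]. split; [exact lX|]. split; [exact fX|]. split; [split; assumption|].
split; [|split].
- exists (num 0), (opr (num 0) (num 0)). rewrite is_numE, taggedE, <- Tl.
  split; [reflexivity|]. split; [reflexivity|exact (fun_app Ft lX)].
- intros x c Hx T. apply taggedE in T. subst c. rewrite <- (Tx x Hx). exact (fun_app Ft (VX x Hx)).
- intros x y x' y' P Q. rewrite (fun_val Ft P), (fun_val Ft Q).
  apply TE; [exact (proj1 (fun_dom Ft P))|exact (proj1 (fun_dom Ft Q))].
Qed.

(** [classU] leaves the cardinal existentially quantified. V_lambda' has rank lambda', so the rank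
    of the universe identifies it with [l], and then zeta and V_zeta are determined as well. *)
Lemma Udata_elim L l Vl z Vz A U I : is_Lstar L -> is_V l Vl ->
  is_least_C2_cardinal_above l z -> is_V z Vz -> is_pair A U I -> is_rank U l -> classU A ->
  exists I X fA tau, Udata L l Vl Vz A I X fA tau.
Proof.
intros HL HV Hz HVz PA RU (L' & l' & Vl' & HL' & [U' [I' SD]] & Hl' & HV' & Red &
  z' & Vz' & X & fA & sf' & sE' & tau & Hz' & HVz' & Hsf & HsE & HfA & EX & VX & lX & fX & Bt & Tl & Tx & TE).
apply sfE in Hsf. apply sEE in HsE. subst sf' sE'.
assert (L' = L) by (apply set_ext; intro s; rewrite (HL s), (HL' s); tauto). subst L'.
assert (U' = Vl') by exact (gstr_U SD Red). subst U'.
apply is_pairE in PA. rewrite (sd_A SD) in PA. apply opr_inj in PA. destruct PA as [<- <-].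
assert (l = l') by exact (rank_unique RU (rank_V HV')). subst l'.
assert (Vl' = Vl) by exact (V_unique HV' HV). subst Vl'.
assert (z' = z) by exact (least_C2_unique Hz' Hz). subst z'.
assert (Vz' = Vz) by exact (V_unique HVz' HVz). subst Vz'.
exists I', X, fA, tau. assert (Ft := proj1 Bt).
split; [exact SD|]. split; [exact Red|]. split; [exact HfA|]. split; [exact EX|].
split; [exact VX|]. split; [exact lX|]. split; [exact fX|]. split; [exact Bt|]. split; [|split].
- destruct Tl as [o [c [O [T K]]]]. apply is_numE in O. apply taggedE in T. subst.
  symmetry. exact (fun_val Ft K).
- intros x Hx. symmetry. apply (fun_val Ft), (Tx x _ Hx), taggedE. reflexivity.
- intros x y Hx Hy. apply TE; [exact (fun_app Ft Hx)|exact (fun_app Ft Hy)].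
Qed.

Lemma opr_parts W x y : transitive W -> opr x y ∈ W -> x ∈ W /\ y ∈ W.
Proof.
intros T K. rewrite opr_upr in K.
assert (Q : upr x y ∈ W) by (apply (T _ K), uprE; auto).
split; apply (T _ Q), uprE; auto.
Qed.

Lemma opr_in_elementary X a v x y : limit a -> is_V a v -> elementary_subset X v ->
  x ∈ X -> y ∈ X -> opr x y ∈ X.
Proof.
intros La HV EX Hx Hy. destruct (sub_ext EX) as [S E]. assert (TV := V_trans HV).
set (w := fun i : nat => match i with 0 => exist (fun z : M => z ∈ v) x (S x Hx)
  | _ => exist (fun z : M => z ∈ v) y (S y Hy) end : setu v).
destruct (tarski_vaught (P := fun (N : universe) (o : nat -> N) => is_pair (o 0) (o 1) (o 2))
  (v := w) (X := X) UD_pair S E) as [p [P1 P2]].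
- intros [|i]; assumption.
- exists (exist _ (opr x y) (limit_V_opr La HV (S x Hx) (S y Hy))).
  apply (abs_pair TV). simpl. apply oprP.
- apply (abs_pair TV) in P2. simpl in P2. apply is_pairE in P2. rewrite <- P2. exact P1.
Qed.

(** A hull of size at most that of V_l is taken around V_l, [l] and [f]. The values of [tau] on V_l
    and at [l] are prescribed, so the Schroeder-Bernstein theorem is applied to the remainders. *)
Lemma Udata_ex L l Vl z Vz f P : is_Lstar L -> is_limit_cardinal l -> is_V l Vl ->
  limit z -> l ∈ z -> is_V z Vz -> is_function f Vl Vl -> subset P Vl ->
  exists A I X tau, Udata L l Vl Vz A I X f tau /\ (forall x y, fun1 A sf x y <-> app f x y) /\
    forall x, rel1 A sP x <-> x ∈ P.
Proof.
intros HL Hl HV Lz lz HVz Ff HP.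
assert (Ll := limit_cardinal_limit Hl). assert (TV := V_trans HV).
assert (CK := limit_V_adjcl Ll HV).
assert (VVz := V_mono HVz HV lz). assert (Vlz := V_mem HVz HV lz).
assert (lV : l ∈ Vz) by (apply (proj1 (V_self HVz)), lz).
assert (fV : f ∈ Vz).
{ apply (V_super HVz Vlz). intros p Hp. apply (fun_mem _ Ff) in Hp.
  destruct Hp as [x [X ->]]. apply (limit_V_opr Ll HV X), (fun_ap_in Ff X). }
assert (N0 : forall m : nat, num m ∈ Vl) by (intro m; apply (adjcl_nat CK), num_nat).
destruct (mstr_ex lV) as [Lm [AW [IW [HLm GW]]]].
(* The starting enumeration: <0,x> names x, indices with tag 1 name [l], and all others name [f]. *)
set (R := fun a y => (exists x, tagged 0 x a /\ y = x) \/
  (~ (exists x, tagged 0 x a) /\ (exists x, tagged 1 x a) /\ y = l) \/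
  (~ (exists x, tagged 0 x a) /\ ~ (exists x, tagged 1 x a) /\ y = f)).
assert (DR : dfn2 R) by (unfold R; df).
destruct (fun_ex (a := Vl) (b := Vz) DR) as [g0 [Fg Eg]].
{ unfold R. intros a Ha. destruct (classic (exists x, tagged 0 x a)) as [[x T]|N].
  - exists x. split.
    + split; [|eauto]. apply taggedE in T. subst a. apply VVz, (opr_parts TV Ha).
    + intros y [_ [[x' [T' ->]]|[[K _]|[K _]]]]; [|destruct K; eauto|destruct K; eauto].
      apply taggedE in T, T'. subst a. apply tag_inj in T'. tauto.
  - destruct (classic (exists x, tagged 1 x a)) as [K|K].
    + exists l. split; [split; [exact lV|right; left; auto]|].
      intros y [_ [[x' [T' ->]]|[[_ [_ ->]]|[_ [K' _]]]]]; [destruct N; eauto|reflexivity|contradiction].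
    + exists f. split; [split; [exact fV|right; right; auto]|].
      intros y [_ [[x' [T' ->]]|[[_ [K' _]]|[_ [_ ->]]]]]; [destruct N; eauto|contradiction|reflexivity]. }
assert (Gv : forall a y, a ∈ Vl -> y ∈ Vz -> R a y -> ap g0 a = y).
{ intros a y Ha Hy Q. symmetry. apply (fun_val Fg), Eg. auto. }
destruct (loewenheim_skolem HLm GW CK Fg) as [X [EX [GX [c [Fc Ic]]]]].
assert (VX : subset Vl X).
{ intros x Hx. assert (K := adjcl_opr CK (N0 0) Hx).
  rewrite <- (Gv (opr (num 0) x) x K (VVz x Hx)); [apply GX, K|].
  left. exists x. split; [apply taggedE|]; reflexivity. }
assert (lX : l ∈ X).
{ assert (K := adjcl_opr CK (N0 1) (N0 0)). rewrite <- (Gv (opr (num 1) (num 0)) l K lV); [apply GX, K|].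
  right; left. split; [|split; [|reflexivity]].
  - intros [x T]. apply taggedE, tag_inj in T. lia.
  - exists (num 0). apply taggedE. reflexivity. }
assert (fX : f ∈ X).
{ assert (K := adjcl_opr CK (N0 2) (N0 0)). rewrite <- (Gv (opr (num 2) (num 0)) f K fV); [apply GX, K|].
  right; right. split; [|split; [|reflexivity]]; intros [x T]; apply taggedE, tag_inj in T; lia. }
assert (XV := proj1 EX).
assert (lN : ~ l ∈ Vl) by apply (V_self HV).
assert (DA : dfn1 (fun x => x <> l /\ ~ x ∈ Vl)) by df.
(* [A0] and [B0] are what the prescribed values of [tau] leave over in the domain and in the range.
   The maps from x to <2,c(x)> and from y to <l,y> inject each into the other. *)
set (A0 := sep X (fun x => x <> l /\ ~ x ∈ Vl)).
assert (A0E : forall x, x ∈ A0 <-> x ∈ X /\ x <> l /\ ~ x ∈ Vl) by (intro; apply (sepE _ DA)).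
set (o0 := opr (num 0) (num 0) : M).
assert (DB : dfn1 (fun y => y <> o0 /\ ~ exists x, tagged 1 x y)) by df.
set (B0 := sep Vl (fun y => y <> o0 /\ ~ exists x, tagged 1 x y)).
assert (B0E : forall y, y ∈ B0 <-> y ∈ Vl /\ y <> o0 /\ ~ exists x, tagged 1 x y) by (intro; apply (sepE _ DB)).
destruct (fun_ex (a := A0) (b := B0) (R := fun x y => exists w, app c x w /\ tagged 2 w y) ltac:(df))
  as [f1 [F1 E1]].
{ intros x Hx. apply A0E in Hx. destruct Hx as [Hx _]. exists (opr (num 2) (ap c x)). split.
  - split; [|exists (ap c x); split; [exact (fun_app Fc Hx)|apply taggedE; reflexivity]].
    apply B0E. split; [apply (adjcl_opr CK (N0 2)), (fun_ap_in Fc Hx)|]. split.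
    + intro K. apply tag_inj in K. lia.
    + intros [w T]. apply taggedE, tag_inj in T. lia.
  - intros y [_ [w [K T]]]. apply taggedE in T. rewrite T, (fun_val Fc K). reflexivity. }
(* <l,y> is in [X] by elementarity, outside V_l because [l] is, and different from [l] by
   foundation. *)
destruct (fun_ex (a := B0) (b := A0) (R := fun y x => is_pair x l y) ltac:(df)) as [g1 [G1 H1]].
{ intros y Hy. apply B0E in Hy. destruct Hy as [Hy _]. exists (opr l y). split.
  - split; [|apply oprP]. apply A0E. split; [|split].
    + apply (opr_in_elementary Lz HVz EX lX), VX, Hy.
    + intro K. apply (@mem_irr _ _ l). assert (Q : upr l l ∈ l) by (rewrite <- K at 3; rewrite opr_upr; apply uprE; auto).
      apply (ord_trans (proj1 Ll) Q), uprE. auto.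
    + intro K. apply lN, (opr_parts TV K).
  - intros x [_ K]. apply is_pairE in K. auto. }
destruct (schroeder_bernstein F1 G1) as [h Bh].
{ intros x y Hx Hy K. assert (Q1 := fun_app F1 Hx). assert (Q2 := fun_app F1 Hy). rewrite K in Q1.
  apply E1 in Q1, Q2. destruct Q1 as [_ [_ [w [Q1 T1]]]], Q2 as [_ [_ [w' [Q2 T2]]]].
  apply taggedE in T1, T2. rewrite T1 in T2. apply tag_inj in T2. destruct T2 as [_ <-].
  apply A0E in Hx, Hy. apply Ic; try tauto. rewrite <- (fun_val Fc Q1). exact (fun_val Fc Q2). }
{ intros x y Hx Hy K. assert (Q1 := fun_app G1 Hx). assert (Q2 := fun_app G1 Hy). rewrite K in Q1.
  apply H1 in Q1, Q2. destruct Q1 as [_ [_ Q1]], Q2 as [_ [_ Q2]]. apply is_pairE in Q1, Q2.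
  rewrite Q1 in Q2. apply opr_inj in Q2. tauto. }
assert (Fh := proj1 Bh).
assert (oV : o0 ∈ Vl) by (apply (adjcl_opr CK); apply N0).
set (S := fun x y => (x = l /\ y = o0) \/ (x ∈ Vl /\ tagged 1 x y) \/ (x ∈ A0 /\ app h x y)).
assert (DS : dfn2 S) by (unfold S; df).
destruct (fun_ex (a := X) (b := Vl) DS) as [tau [Ft Et]].
{ unfold S. intros x Hx. destruct (classic (x = l)) as [->|Nl].
  - exists o0. split; [split; [exact oV|auto]|].
    intros y [_ [[_ ->]|[[K _]|[K _]]]]; [reflexivity|contradiction|]. apply A0E in K. tauto.
  - destruct (classic (x ∈ Vl)) as [Kx|Kx].
    + exists (opr (num 1) x). split.
      * split; [exact (adjcl_opr CK (N0 1) Kx)|]. right; left. rewrite taggedE. auto.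
      * intros y [_ [[K _]|[[_ T]|[K _]]]]; [contradiction| |].
        -- apply taggedE in T. auto.
        -- apply A0E in K. tauto.
    + assert (K0 : x ∈ A0) by (apply A0E; auto). exists (ap h x). split.
      * split; [apply (proj1 (B0E (ap h x))), (fun_ap_in Fh K0)|]. right; right.
        split; [exact K0|exact (fun_app Fh K0)].
      * intros y [_ [[K _]|[[K _]|[_ K]]]]; [contradiction|contradiction|].
        symmetry. exact (fun_val Fh K). }
assert (Tv : forall x y, x ∈ X -> y ∈ Vl -> S x y -> ap tau x = y).
{ intros x y Hx Hy K. symmetry. apply (fun_val Ft), Et. auto. }
assert (Tl : ap tau l = o0) by (apply Tv; auto; left; auto).
assert (Tx : forall x, x ∈ Vl -> ap tau x = opr (num 1) x).
{ intros x Hx. apply Tv; [apply VX, Hx|exact (adjcl_opr CK (N0 1) Hx)|].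
  right; left. rewrite taggedE. auto. }
assert (Th : forall x, x ∈ A0 -> ap tau x = ap h x).
{ intros x Hx. apply Tv; [apply (proj1 (A0E x)), Hx|apply (proj1 (B0E (ap h x))), (fun_ap_in Fh Hx)|].
  right; right. split; [exact Hx|exact (fun_app Fh Hx)]. }
assert (Cs : forall x, x ∈ X -> x = l \/ x ∈ Vl \/ x ∈ A0).
{ intros x Hx. destruct (classic (x = l)); [tauto|]. destruct (classic (x ∈ Vl)); [tauto|].
  right; right. apply A0E. auto. }
assert (Bt : is_bijection tau X Vl).
{ apply (bij_mk Ft).
  - assert (D1 : forall x, x ∈ A0 -> ap tau x <> o0 /\ ~ exists x', tagged 1 x' (ap tau x)).
    { intros x Hx. rewrite (Th x Hx). apply (proj1 (B0E (ap h x))), (fun_ap_in Fh Hx). }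
    assert (D2 : forall x : M, o0 <> opr (num 1) x) by (intros x K; apply tag_inj in K; lia).
    intros x y Hx Hy K. destruct (Cs x Hx) as [->|[Kx|Kx]], (Cs y Hy) as [->|[Ky|Ky]]; auto.
    + rewrite Tl, (Tx y Ky) in K. destruct (D2 y K).
    + rewrite Tl in K. destruct (D1 y Ky). congruence.
    + rewrite Tl, (Tx x Kx) in K. symmetry in K. destruct (D2 x K).
    + rewrite (Tx x Kx), (Tx y Ky) in K. apply tag_inj in K. tauto.
    + rewrite (Tx x Kx) in K. destruct (D1 y Ky) as [_ Q]. destruct Q. exists x. apply taggedE. auto.
    + rewrite Tl in K. destruct (D1 x Kx). congruence.
    + rewrite (Tx y Ky) in K. destruct (D1 x Kx) as [_ Q]. destruct Q. exists y. apply taggedE. auto.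
    + rewrite (Th x Kx), (Th y Ky) in K. exact (bij_inj Bh Kx Ky K).
  - intros y Hy. destruct (classic (y = o0)) as [->|N1]; [eauto|].
    destruct (classic (exists x, tagged 1 x y)) as [[x T]|N2].
    + apply taggedE in T. subst y. assert (Kx := proj2 (opr_parts TV Hy)). exists x. auto.
    + assert (K : y ∈ B0) by (apply B0E; auto). destruct (bij_surj Bh K) as [x [Kx Q]].
      exists x. split; [apply (proj1 (A0E x)), Kx|]. rewrite (Th x Kx). exact Q. }
destruct (rel_ex Vl Vl (R := fun x' y' => exists x y, app tau x x' /\ app tau y y' /\ x ∈ y) ltac:(df))
  as [E [EE _]].
assert (HU : exists u, u ∈ Vl) by (exists o0; exact oV).
destruct (lstar_structure E HL HU Ff HP) as [A [I [SD [Red [KF [KE KP]]]]]].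
exists A, I, X, tau. split; [|auto].
split; [exact SD|]. split; [exact Red|]. split.
{ intro p. split.
  - intro Hp. assert (K := Hp). apply (fun_mem _ Ff) in K. destruct K as [x [Kx ->]].
    exists x, (ap f x). rewrite KF. split; [apply oprP|exact (fun_app Ff Kx)].
  - intros [x [y [K1 K2]]]. apply KF, appE in K2. apply is_pairE in K1. subst p. exact K2. }
repeat (split; [assumption|]). intros x y Hx Hy.
rewrite KE by (apply (fun_ap_in Ft); assumption). rewrite EE. split.
- intro K. repeat (split; [apply (fun_ap_in Ft); assumption|]). exists x, y.
  split; [exact (fun_app Ft Hx)|]. split; [exact (fun_app Ft Hy)|exact K].
- intros [_ [_ [x' [y' [K1 [K2 K]]]]]].
  assert (Ex := bij_inj Bt Hx (proj1 (fun_dom Ft K1)) (fun_val Ft K1)).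
  assert (Ey := bij_inj Bt Hy (proj1 (fun_dom Ft K2)) (fun_val Ft K2)). subst. exact K.
Qed.

Definition follows t e e' := forall i x y, app e i x -> app t x y -> app e' i y.

Lemma followsE t X Y e e' : is_function t X Y -> is_assignment X e -> is_assignment Y e' ->
  (follows t e e' <-> forall i, is_natural i -> ap e' i = ap t (ap e i)).
Proof.
intros F E E'. apply asgE in E, E'. split.
- intros K i Ni. apply omE in Ni. symmetry. apply (fun_val E'), (K i (ap e i)).
  + exact (fun_app E Ni).
  + apply (fun_app F), (fun_ap_in E Ni).
- intros K i x y P Q. assert (Oi := proj1 (fun_dom E P)). rewrite (fun_val F Q), (fun_val E P).
  rewrite <- K by (apply omE, Oi). exact (fun_app E' Oi).
Qed.

Lemma asg_off U U' e e' i : is_assignment U e -> is_assignment U' e' ->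
  ((forall k x, k <> i -> (app e k x <-> app e' k x)) <->
   forall k, is_natural k -> k <> i -> ap e k = ap e' k).
Proof.
intros E E'. apply asgE in E, E'. split.
- intros K k Nk Ne. apply omE in Nk. apply (fun_val E'), K; [exact Ne|exact (fun_app E Nk)].
- intros K k x Ne. split; intro P.
  + assert (Ok := proj1 (fun_dom E P)). rewrite (fun_val E P), (K k) by (try apply omE; assumption).
    exact (fun_app E' Ok).
  + assert (Ok := proj1 (fun_dom E' P)). rewrite (fun_val E' P), <- (K k) by (try apply omE; assumption).
    exact (fun_app E Ok).
Qed.

Lemma bij_inv t X Y : is_bijection t X Y ->
  exists g, is_function g Y X /\ forall y, y ∈ Y -> ap t (ap g y) = y.
Proof.
intros [F B]. destruct (fun_ex (a := Y) (b := X) (R := fun y x => app t x y) ltac:(df)) as [g [G E]].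
- intros y Hy. destruct (B y Hy) as [x [P Q]]. exists x.
  split; [split; [exact (proj1 (fun_dom F P))|exact P]|]. intros x' [_ K]. exact (Q x' K).
- exists g. split; [exact G|]. intros y Hy. assert (K := fun_app G Hy). apply E in K.
  symmetry. apply (fun_val F). tauto.
Qed.

Definition corr (L1 U1 I1 L2 U2 I2 t p q : M) := isF L1 U1 I1 p /\ isF L2 U2 I2 q /\
  forall e e', is_assignment U1 e -> is_assignment U2 e' -> follows t e e' ->
    (sat L1 U1 I1 p e <-> sat L2 U2 I2 q e').

Section Corr.
Variables L1 A1 U1 I1 L2 A2 U2 I2 t : M.
Hypothesis (S1 : structure_data L1 A1 U1 I1) (S2 : structure_data L2 A2 U2 I2).
Hypothesis Bt : is_bijection t U1 U2.
Notation cr := (corr L1 U1 I1 L2 U2 I2 t).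

Lemma corr_eq i j : is_natural i -> is_natural j ->
  cr (cEq (tvar i) (tvar j)) (cEq (tvar i) (tvar j)).
Proof.
intros Ni Nj. destruct (sat_Eqv S1 Ni Nj) as [F1 K1], (sat_Eqv S2 Ni Nj) as [F2 K2].
split; [exact F1|]. split; [exact F2|]. intros e e' E E' C. rewrite (K1 e E), (K2 e' E').
rewrite (followsE (proj1 Bt) E E') in C. rewrite (C i Ni), (C j Nj).
apply asgE in E. split; [congruence|]. apply (bij_inj Bt); apply (fun_ap_in E), omE; assumption.
Qed.

Lemma corr_neg p q : cr p q -> cr (cNeg p) (cNeg q).
Proof.
intros [Fp [Fq C]]. destruct (isF_neg S1 Fp) as [F1 K1], (isF_neg S2 Fq) as [F2 K2].
split; [exact F1|]. split; [exact F2|]. intros e e' E E' T.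
rewrite (K1 e E), (K2 e' E'), (C e e' E E' T). tauto.
Qed.

Lemma corr_and p p' q q' : cr p q -> cr p' q' -> cr (cAnd p p') (cAnd q q').
Proof.
intros [Fp [Fq C]] [Fp' [Fq' C']].
destruct (isF_and S1 Fp Fp') as [F1 K1], (isF_and S2 Fq Fq') as [F2 K2].
split; [exact F1|]. split; [exact F2|]. intros e e' E E' T.
rewrite (K1 e), (K2 e'), (C e e' E E' T), (C' e e' E E' T). tauto.
Qed.

(** Surjectivity of [t] brings a witness in the second structure back to the first. *)
Lemma corr_ex i p q : is_natural i -> cr p q -> cr (cEx i p) (cEx i q).
Proof.
intros Ni [Fp [Fq C]]. destruct (isF_ex S1 Fp Ni) as [F1 K1], (isF_ex S2 Fq Ni) as [F2 K2].
split; [exact F1|]. split; [exact F2|]. intros e e' E E' T.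
rewrite (K1 e E), (K2 e' E'). assert (Ft := proj1 Bt).
rewrite (followsE Ft E E') in T. split.
- intros [e1 [P Q]]. assert (E1 := sat_asg P). destruct (asg_comp Ft E1) as [e2 [E2 V]].
  exists e2. split.
  + apply (C e1 e2 E1 E2); [|exact P]. apply (followsE Ft E1 E2), V.
  + apply (asg_off i E' E2). intros k Nk Ne. rewrite (T k Nk), (V k Nk). f_equal.
    apply (asg_off i E E1); assumption.
- intros [e2 [P Q]]. assert (E2 := sat_asg P). destruct (bij_inv Bt) as [g [Fg Hg]].
  destruct (asg_comp Fg E2) as [e1 [E1 V]].
  assert (V' : forall k, is_natural k -> ap e2 k = ap t (ap e1 k)).
  { intros k Nk. rewrite (V k Nk), Hg; [reflexivity|]. apply asgE in E2. apply (fun_ap_in E2), omE, Nk. }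
  exists e1. split.
  + apply (C e1 e2 E1 E2); [|exact P]. apply (followsE Ft E1 E2), V'.
  + apply (asg_off i E E1). intros k Nk Ne. assert (Ok := proj2 (omE k) Nk).
    apply (bij_inj Bt).
    * apply asgE in E. exact (fun_ap_in E Ok).
    * apply asgE in E1. exact (fun_ap_in E1 Ok).
    * rewrite <- (T k Nk), <- (V' k Nk). apply (asg_off i E' E2); assumption.
Qed.
End Corr.

Lemma Udata_corr L l Vl Vz A I X f tau Lm AX IX i j : is_Lstar L ->
  Udata L l Vl Vz A I X f tau -> gstr Lm AX X IX -> is_natural i -> is_natural j ->
  corr Lm X IX L Vl I tau (cR2 smem i j) (cR2 sE i j).
Proof.
intros HL (SD & Red & HfA & EX & VX & lX & fX & Bt & Tl & Tx & TE) GX Ni Nj.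
assert (Ls : smem ∈ Lm) by (apply (proj1 (proj2 GX)), smemE; reflexivity).
assert (Le : sE ∈ L) by (apply (LstarE HL); auto).
destruct (sat_R2 SD Le (std_rel 2 1) Ni Nj) as [F2 K2].
split; [exact (proj1 (sat_R2 (proj1 GX) Ls smem_rel Ni Nj))|]. split; [exact F2|].
intros e e' E E' T. rewrite (red_mem GX Ni Nj E), (K2 e' E').
rewrite (followsE (proj1 Bt) E E') in T. rewrite (T i Ni), (T j Nj). apply asgE in E.
apply TE; apply (fun_ap_in E), omE; assumption.
Qed.

(** The translation replaces membership by the symbol E. One code q serves both structures, so an
    embedding that preserves q relates the truth of p on both sides. *)
Lemma corr2_ex L l Vl Vz A I X f tau B J Y g sig Lm AX IX BY JY : is_Lstar L ->
  Udata L l Vl Vz A I X f tau -> Udata L l Vl Vz B J Y g sig ->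
  (forall s, s ∈ Lm <-> is_mem_symbol s) -> gstr Lm AX X IX -> gstr Lm BY Y JY ->
  forall p, isF Lm X IX p -> exists q,
    corr Lm X IX L Vl I tau p q /\ corr Lm Y JY L Vl J sig p q.
Proof.
intros HL UA UB HLm GX GY.
assert (D : dfn1 (fun p => exists q, corr Lm X IX L Vl I tau p q /\ corr Lm Y JY L Vl J sig p q))
  by (unfold corr, sat, isF, follows; df).
assert (BA : is_bijection tau X Vl) by apply UA. assert (BB : is_bijection sig Y Vl) by apply UB.
assert (SA := proj1 UA). assert (SB := proj1 UB). assert (SX := proj1 GX). assert (SY := proj1 GY).
apply (mform_ind (Q := fun p => exists q, corr Lm X IX L Vl I tau p q /\ corr Lm Y JY L Vl J sig p q)
  (sm := smem) SX); auto.
- apply smemE; reflexivity.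
- intros i j Ni Nj. exists (cR2 sE i j).
  split; [exact (Udata_corr HL UA GX Ni Nj)|exact (Udata_corr HL UB GY Ni Nj)].
- intros i j Ni Nj. exists (cEq (tvar i) (tvar j)).
  split; [exact (corr_eq SX SA BA Ni Nj)|exact (corr_eq SY SB BB Ni Nj)].
- intros p _ [q [C1 C2]]. exists (cNeg q). split; [exact (corr_neg SX SA C1)|exact (corr_neg SY SB C2)].
- intros p p' _ _ [q [C1 C2]] [q' [C1' C2']]. exists (cAnd q q').
  split; [exact (corr_and SX SA C1 C1')|exact (corr_and SY SB C2 C2')].
- intros i p _ Ni [q [C1 C2]]. exists (cEx i q).
  split; [exact (corr_ex SX SA BA Ni C1)|exact (corr_ex SY SB BB Ni C2)].
Qed.

(** j is [r] conjugated by the two decodings: [tau], then [r], then the inverse of [sig]. *)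
Lemma lift_embedding L l Vl Vz A I X f tau B J Y g sig r : is_Lstar L ->
  Udata L l Vl Vz A I X f tau -> Udata L l Vl Vz B J Y g sig -> elementary_embedding L A B r ->
  exists j, elementary_map X Vz j /\
    forall x, x ∈ X -> ap j x ∈ Y /\ ap sig (ap j x) = ap r (ap tau x).
Proof.
intros HL UA UB Emb.
destruct (emb_sat (proj1 UA) (proj1 UB) Emb) as [Fr Sr].
assert (BA : is_bijection tau X Vl) by apply UA. assert (BB : is_bijection sig Y Vl) by apply UB.
assert (Ft := proj1 BA). assert (Fs := proj1 BB).
assert (EX : elementary_subset X Vz) by apply UA. assert (EY : elementary_subset Y Vz) by apply UB.
destruct EX as [XV [iX [_ KX]]]. destruct EY as [YV [iY [HiY KY]]].
destruct (map_gstr KX) as (Lm & AX & BX & IX & _ & HLm & GX & _ & _).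
destruct (map_gstr KY) as (Lm' & AY & BY & JY & JV & HLm' & GY & GV & KY').
assert (Lm' = Lm) by (apply set_ext; intro s; rewrite HLm, HLm'; tauto). subst Lm'.
destruct (emb_sat (proj1 GY) (proj1 GV) KY') as [FiY SiY].
assert (EiY : forall x, x ∈ Y -> ap iY x = x).
{ intros x Hx. symmetry. apply (fun_val FiY), appE, HiY. exists x. split; [exact Hx|apply oprP]. }
destruct (fun_ex (a := X) (b := Y)
  (R := fun x y => forall u v w, app tau x u -> app r u v -> app sig y w -> w = v) ltac:(df)) as [j [Fj Ej]].
{ intros x Hx. assert (Tx := fun_ap_in Ft Hx). destruct (bij_surj BB (fun_ap_in Fr Tx)) as [y [Hy Ey]].
  exists y. split.
  - split; [exact Hy|]. intros u v w P Q R. rewrite (fun_val Fs R), (fun_val Fr Q), (fun_val Ft P). exact Ey.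
  - intros y' [Hy' K]. apply (bij_inj BB Hy Hy'). rewrite Ey. symmetry.
    apply (K (ap tau x)); [exact (fun_app Ft Hx)|exact (fun_app Fr Tx)|exact (fun_app Fs Hy')]. }
assert (Kj : forall x, x ∈ X -> ap j x ∈ Y /\ ap sig (ap j x) = ap r (ap tau x)).
{ intros x Hx. assert (K := fun_app Fj Hx). apply Ej in K. destruct K as [_ [K1 K2]].
  split; [exact K1|]. apply (K2 (ap tau x)); [exact (fun_app Ft Hx)| |exact (fun_app Fs K1)].
  apply (fun_app Fr), (fun_ap_in Ft Hx). }
exists j. split; [|exact Kj].
apply (map_intro HLm GX GV (fun_widen Fj YV)). intros p Fp e e' E E' C.
destruct (corr2_ex HL UA UB HLm GX GY Fp) as [q [[_ [_ C1]] [_ [_ C2]]]].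
destruct (asg_comp Ft E) as [e1 [E1 V1]]. destruct (asg_comp Fr E1) as [e2 [E2 V2]].
assert (EY' : is_assignment Y e').
{ apply asgE. apply asgE in E'. apply (fun_range E'). intros i Oi. rewrite C by (apply omE, Oi).
  apply asgE in E. apply Kj, (fun_ap_in E Oi). }
rewrite (C1 e e1 E E1) by (apply (followsE Ft E E1), V1).
assert (K := Sr q e1 e2 E1 E2 V2). rewrite !(ss_sat (proj1 UA)), !(ss_sat (proj1 UB)) in K. rewrite K.
rewrite <- (C2 e' e2 EY' E2).
- assert (K' := SiY p e' e' EY' E'). rewrite (ss_sat (proj1 GY)), (ss_sat (proj1 GV)) in K'. apply K'.
  intros i Ni. symmetry. apply EiY. apply asgE in EY'. apply (fun_ap_in EY'), omE, Ni.
- apply (followsE Fs EY' E2). intros i Ni. rewrite (V2 i Ni), (V1 i Ni), (C i Ni). symmetry.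
  apply Kj. apply asgE in E. apply (fun_ap_in E), omE, Ni.
Qed.
End Lstar.

(** * Square root reflection implies ultraexactness *)

Section Transfer.
Context {M : universe} {hM : ZFC M}.
Implicit Types X Y : M.
Notation "' a" := (proj1_sig a) (at level 1, format "' a").

Lemma ext_UD (P : forall N : universe, (nat -> N) -> Prop) X Y h (v : nat -> setu X) (w : nat -> setu Y) :
  UD P -> ext_elem X Y h -> (forall i : nat, '(w i) = h '(v i)) -> (P (setu X) v <-> P (setu Y) w).
Proof.
intros UP E V. destruct (UD_form UP) as [p Hp]. rewrite !Hp.
rewrite (satisfies_subu p v), (satisfies_subu p w).
rewrite (E p (fun i : nat => '(v i)) (fun i => proj2_sig (v i))).
replace (fun i : nat => '(w i)) with (fun i : nat => h '(v i)); [tauto|].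
apply functional_extensionality; intro i. symmetry. apply V.
Qed.

Lemma ext_UD3 (P : forall N : universe, N -> N -> N -> Prop) X Y h (x y z : setu X) (x' y' z' : setu Y) :
  UD3 P -> ext_elem X Y h -> 'x' = h 'x -> 'y' = h 'y -> 'z' = h 'z -> (P _ x y z <-> P _ x' y' z').
Proof.
intros UP E V1 V2 V3. apply (ext_UD (v := x .: y .: fun _ => z) (w := x' .: y' .: fun _ => z') UP E).
intros [|[|i]]; assumption.
Qed.

Lemma ext_UD2 (P : forall N : universe, N -> N -> Prop) X Y h (x y : setu X) (x' y' : setu Y) :
  UD2 P -> ext_elem X Y h -> 'x' = h 'x -> 'y' = h 'y -> (P _ x y <-> P _ x' y').
Proof.
intros UP E V1 V2. apply (ext_UD (v := x .: fun _ => y) (w := x' .: fun _ => y') UP E).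
intros [|i]; assumption.
Qed.

(** The recursion equation speaks of all subsets of earlier values; closure of [W] under subsets
    makes these the same inside and outside. *)
Lemma up_V (W : M) (a v : setu W) : transitive W -> (forall x y : M, x ∈ W -> subset y x -> y ∈ W) ->
  is_V a v -> is_V 'a 'v.
Proof.
intros TW SW [Oa (s & h & Hs & [b Fh] & Rec & Ha)]. split; [apply (abs_ord TW), Oa|].
exists 's, 'h. split; [apply (abs_succ TW), Hs|].
split; [exists 'b; apply (abs_function TW), Fh|]. split; [|apply (abs_app TW), Ha].
intros c u K x. destruct (app_parts TW (proj2_sig h) K) as [Wc Wu].
assert (K' : app h (exist _ c Wc : setu W) (exist _ u Wu : setu W)) by (apply (abs_app TW); exact K).
assert (Q := Rec _ _ K'). split.
- intro Hx. assert (Wx := inW TW Wu Hx). destruct (proj1 (Q (exist _ x Wx)) Hx) as (d & t & K1 & K2 & K3).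
  exists 'd, 't. split; [exact K1|]. split; [apply (abs_app TW), K2|exact (proj1 (abs_subset TW _ _) K3)].
- intros (d & t & K1 & K2 & K3). destruct (app_parts TW (proj2_sig h) K2) as [Wd Wt].
  assert (Wx := SW t x Wt K3). apply (Q (exist _ x Wx)). exists (exist _ d Wd), (exist _ t Wt).
  split; [exact K1|]. split; [apply (abs_app TW); exact K2|apply (abs_subset TW); exact K3].
Qed.

(** Going down, the recursion function has to be found in V_l. Its values are subsets of [v], so it
    is a subset of the product of a + 1 with the power set of [v], and [l] is a limit. *)
Lemma abs_V (l Vl : M) (a v : setu Vl) : limit l -> is_V l Vl -> (is_V a v <-> is_V 'a 'v).
Proof.
intros Ll HV. assert (TV := V_trans HV). split.
- apply up_V; [exact TV|]. intros x y. exact (V_super HV).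
- intro K. destruct K as [Oa (s & h & Hs & [b Fh] & Rec & Ha)].
  split; [apply (abs_ord TV), Oa|]. apply is_succE in Hs. subst s.
  assert (Vv : is_V 'a 'v).
  { split; [exact Oa|]. exists (suc 'a), h. split; [apply is_succE; reflexivity|].
    split; [exists b; exact Fh|]. split; assumption. }
  assert (Hsub : forall c u, app h c u -> subset u 'v).
  { intros c u K x Hx. apply (Rec c u K) in Hx. destruct Hx as (d & t & K1 & K2 & K3).
    apply (Rec _ _ Ha). exists d, t. split; [|auto].
    assert (Hc := proj1 (fun_dom Fh K)). apply sucE in Hc. destruct Hc as [Hc| ->]; [|exact K1].
    exact (ord_mem_trans Oa K1 Hc). }
  assert (Fp : is_function h (suc 'a) (Pw 'v)).
  { apply (fun_range Fh). intros c Hc. apply PwE, (Hsub c), (fun_app Fh Hc). }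
  assert (sV : suc 'a ∈ Vl).
  { unfold suc. apply (adjcl_adj (limit_V_adjcl Ll HV)); exact (proj2_sig a). }
  assert (pV : Pw 'v ∈ Vl) by exact (limit_V_Pw Ll HV (proj2_sig v)).
  assert (hV : h ∈ Vl).
  { apply (V_super HV (limit_V_prod Ll HV sV pV)). intros q Q. apply (fun_mem _ Fp) in Q.
    destruct Q as [x [Hx ->]]. apply prod_opr. split; [exact Hx|exact (fun_ap_in Fp Hx)]. }
  exists (exist (fun w : M => w ∈ Vl) (suc 'a) sV), (exist (fun w : M => w ∈ Vl) h hV). split; [apply (abs_succ TV); apply is_succE; reflexivity|].
  split; [exists (exist (fun w : M => w ∈ Vl) (Pw 'v) pV); apply (abs_function TV); exact Fp|].
  split; [|apply (abs_app TV); exact Ha].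
  intros c u K x. apply (abs_app TV) in K. rewrite <- (iff_refl ('x ∈ 'u)).
  change (x ∈ u) with ('x ∈ 'u). rewrite (Rec _ _ K). split.
  + intros (d & t & K1 & K2 & K3). destruct (app_parts TV hV K2) as [Vd Vt].
    exists (exist _ d Vd), (exist _ t Vt). split; [exact K1|].
    split; [apply (abs_app TV); exact K2|apply (abs_subset TV); exact K3].
  + intros (d & t & K1 & K2 & K3). exists 'd, 't. split; [exact K1|].
    split; [exact (proj1 (abs_app TV _ _ _) K2)|exact (proj1 (abs_subset TV _ _) K3)].
Qed.
End Transfer.

(** * Elementary embeddings of V_lambda into itself *)

Section SelfEmbedding.
Context {M : universe} {hM : ZFC M}.
Implicit Types a b c d e f g h i j k n p q s t u v w x y z : M.
Notation "' a" := (proj1_sig a) (at level 1, format "' a").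
Variables (l Vl r : M).
Hypothesis (Ll : limit l) (HV : is_V l Vl) (Fr : is_function r Vl Vl).
Hypothesis Er : ext_elem Vl Vl (ap r).
Let Rr x (h : x ∈ Vl) : ap r x ∈ Vl := fun_ap_in Fr h.
Let TV := V_trans HV.
Let el x (h : x ∈ Vl) : setu Vl := exist _ x h.
Let CK := limit_V_adjcl Ll HV.

Lemma se_mem x y : x ∈ Vl -> y ∈ Vl -> (x ∈ y <-> ap r x ∈ ap r y).
Proof.
intros X Y. apply (ext_UD2 (P := fun N (x y : N) => x ∈ y) (h := ap r)
  (x := el X) (y := el Y) (x' := el (Rr X)) (y' := el (Rr Y))); auto. unfold UD2. ud.
Qed.

Lemma se_inj x y : x ∈ Vl -> y ∈ Vl -> ap r x = ap r y -> x = y.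
Proof.
intros X Y E. assert (K := ext_UD2 (P := fun N (x y : N) => x = y) (h := ap r)
  (x := el X) (y := el Y) (x' := el (Rr X)) (y' := el (Rr Y)) ltac:(unfold UD2; ud) Er eq_refl eq_refl).
assert (Q : el X = el Y) by (apply K, sub_eq; exact E). exact (f_equal (@proj1_sig _ _) Q).
Qed.

Lemma se_subset x y : x ∈ Vl -> y ∈ Vl -> (subset x y <-> subset (ap r x) (ap r y)).
Proof.
intros X Y. assert (K := ext_UD2 (P := @subset) (h := ap r)
  (x := el X) (y := el Y) (x' := el (Rr X)) (y' := el (Rr Y)) UD_subset Er eq_refl eq_refl).
rewrite !(abs_subset TV) in K. exact K.
Qed.

Lemma se_V a v : a ∈ Vl -> v ∈ Vl -> is_V a v -> is_V (ap r a) (ap r v).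
Proof.
intros X Y. assert (K := ext_UD2 (P := @is_V) (h := ap r)
  (x := el X) (y := el Y) (x' := el (Rr X)) (y' := el (Rr Y)) UD_V Er eq_refl eq_refl).
rewrite !(abs_V _ _ Ll HV) in K. apply K.
Qed.

Lemma se_opr x y : x ∈ Vl -> y ∈ Vl -> ap r (opr x y) = opr (ap r x) (ap r y).
Proof.
intros X Y. assert (Z := adjcl_opr CK X Y).
assert (K := ext_UD3 (P := @is_pair) (h := ap r)
  (x := el Z) (y := el X) (z := el Y) (x' := el (Rr Z)) (y' := el (Rr X)) (z' := el (Rr Y))
  UD_pair Er eq_refl eq_refl eq_refl).
rewrite !(abs_pair TV) in K. apply is_pairE, K. apply oprP.
Qed.

Lemma se_num (m : nat) : ap r (num m) = num m.
Proof.
assert (X : num m ∈ Vl) by (apply (adjcl_nat CK), num_nat).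
assert (K := ext_UD2 (P := fun N (x y : N) => is_num m x) (h := ap r)
  (x := el X) (y := el X) (x' := el (Rr X)) (y' := el (Rr X)) (UD_num m 0) Er eq_refl eq_refl).
rewrite !(abs_num TV) in K. apply is_numE, K, is_numE. reflexivity.
Qed.

(** Induction on the level: let x be a subset of u = V_d. Then [r] fixes u because it fixes d, so
    r(x) is a subset of u too; as [r] fixes all elements of u, x and r(x) have the same elements. *)
Lemma se_identity : (forall a, a ∈ l -> ap r a = a) -> forall x, x ∈ Vl -> ap r x = x.
Proof.
intros Fix.
assert (G : forall c, is_ordinal c -> c ∈ l -> forall v x y, is_V c v -> x ∈ v -> app r x y -> y = x).
{ apply (@ord_ind _ _ (fun c => c ∈ l -> forall v x y, is_V c v -> x ∈ v -> app r x y -> y = x));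
    [df|].
  intros c Oc IH cl v x y Hc Hx Hy. rewrite (fun_val Fr Hy).
  apply (V_eqn _ Hc) in Hx. destruct Hx as (d & u & dc & Hd & xu).
  assert (dl := ord_mem_trans (proj1 Ll) dc cl).
  assert (uV : u ∈ Vl) by exact (V_mem HV Hd dl). assert (dV : d ∈ Vl) by (apply (V_self HV), dl).
  assert (xV := V_super HV uV xu).
  assert (Fu : forall z, z ∈ u -> ap r z = z).
  { intros z Hz. exact (IH d dc dl u z _ Hd Hz (fun_app Fr (TV uV Hz))). }
  assert (Eu : ap r u = u).
  { assert (K := se_V dV uV Hd). rewrite (Fix d dl) in K. exact (V_unique K Hd). }
  apply set_ext. intro z. split; intro Hz.
  - assert (zu : z ∈ u) by (rewrite <- Eu; apply (proj1 (se_subset xV uV) xu), Hz).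
    apply (se_mem (TV uV zu) xV). rewrite (Fu z zu). exact Hz.
  - rewrite <- (Fu z (xu z Hz)). apply (se_mem (TV xV Hz) xV), Hz. }
intros x Hx. assert (Hx' := Hx). apply (V_eqn _ HV) in Hx. destruct Hx as (c & u & cl & Hc & xu).
assert (sl := limit_suc Ll cl). assert (Os := ord_el (proj1 Ll) sl).
apply (G _ Os sl (V_ (suc c)) x); [exact (VP Os)| |exact (fun_app Fr Hx')].
apply (V_eqn _ (VP Os)). exists c, u. split; [apply suc_mem|auto].
Qed.

(** The pair <x,r(x)> lies in r cut down to a level of the hierarchy. Applying [r] to this
    membership puts <r(x),r(r(x))> into a member of the union that defines f. *)
Lemma square_root_at f x : is_plus l r r f -> x ∈ Vl -> app f (ap r x) (ap r (ap r x)).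
Proof.
intros Hf Hx. assert (Y := Rr Hx).
apply appE, Hf. assert (Z := adjcl_opr CK Hx Y). assert (Z' := Z). apply (V_eqn _ HV) in Z'.
destruct Z' as (c & u & cl & Hc & zu).
assert (sl := limit_suc Ll cl). assert (Os := ord_el (proj1 Ll) sl).
assert (zv : opr x (ap r x) ∈ V_ (suc c)).
{ apply (V_eqn _ (VP Os)). exists c, u. split; [apply suc_mem|auto]. }
assert (DC : dfn1 (fun w => w ∈ V_ (suc c))) by df.
set (C := sep r (fun w => w ∈ V_ (suc c))).
assert (CE : forall w, w ∈ C <-> w ∈ r /\ w ∈ V_ (suc c)) by (intro; apply (sepE _ DC)).
assert (CV : C ∈ Vl).
{ apply (V_super HV (V_mem HV (VP Os) sl)). intros w Hw. apply CE, Hw. }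
exists (suc c), (V_ (suc c)), C, (ap r C). split; [exact sl|]. split; [exact (VP Os)|].
split; [exact CE|]. split; [exact (fun_app Fr CV)|].
rewrite <- (se_opr Hx Y). apply (se_mem Z CV), CE. split; [|exact zv].
apply appE. exact (fun_app Fr Hx).
Qed.
End SelfEmbedding.

Section UXSR_ultraexacting.
Context {M : universe} {hM : ZFC M}.
Implicit Types A B L U I X Y W a b c d e f g h i j k n p q r s t u v w x y z : M.

Lemma least_C2_ex l : is_ordinal l -> exists z, is_least_C2_cardinal_above l z.
Proof.
intro Ol. assert (Q : forall z, l ∈ z -> (in_C 2 z <-> InC2 z)).
{ intros z lz. split; intro K.
  - apply InC2_E; [|exact K]. apply (in_C_limit (n := 2) (x := l)); [lia|exact lz|exact K].
  - apply InC2_E; [apply K|exact K]. }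
assert (D : dfn1 (fun z => is_cardinal z /\ InC2 z /\ l ∈ z)) by df.
destruct (ord_min D) as (z & _ & (Cz & Iz & lz) & Min).
- destruct (C2_cardinals Ol) as (z & Cz & Iz & lz). exists z. split; [apply Cz|].
  split; [exact Cz|]. split; [apply (Q z lz), Iz|exact lz].
- exists z. split; [exact Cz|]. split; [apply (Q z lz), Iz|]. split; [exact lz|].
  intros y Cy Iy ly yz. apply (Min y yz). split; [exact Cy|]. split; [apply (Q y ly), Iy|exact ly].
Qed.

Lemma in_C_le (m n : nat) a : m <= n -> in_C n a -> in_C m a.
Proof.
intros Le (v & Hv & K). exists v. split; [exact Hv|]. intros p o S. apply K, (Sigma_le Le S).
Qed.

Lemma asg_two U x y : x ∈ U -> y ∈ U ->
  exists e, is_assignment U e /\ ap e (num 0) = x /\ ap e (num 1) = y.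
Proof.
intros X Y. destruct (@asg_of_list _ _ U (fun i : nat => match i with 0 => x | _ => y end) 2) as [e [E K]].
- intros [|i]; assumption.
- exists e. split; [exact E|]. split; [apply (K 0); lia|apply (K 1); lia].
Qed.

Theorem UXSR_ultraexacting l L P : is_limit_cardinal l -> is_Lstar L -> is_P_symbol P ->
  UXSR L P classU l -> ultraexacting l.
Proof.
intros Hl HL HP (f & m & [Vl [HV Ff]] & Cm & ml & Main).
apply sPE in HP. subst P.
assert (Ll := limit_cardinal_limit Hl). assert (Ol := proj1 Ll).
destruct (least_C2_ex Ol) as [z Hz]. assert (Hz' := Hz). destruct Hz' as (Cz & Iz & lz & _).
assert (Lz : limit z) by (apply (in_C_limit (n := 2) (x := l)); [lia|exact lz|exact Iz]).
assert (HVz := VP (proj1 Lz)). assert (TV := V_trans HV).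
assert (Lset := LstarE HL).
assert (mV : m ∈ Vl) by (apply (V_self HV), ml).
destruct (Udata_ex HL Hl HV Lz lz HVz Ff (TV m mV)) as (B & J & Y & sig & UB & KF & KP).
assert (SB := proj1 UB).
destruct (Main B) as (n & A & r & U & I & g & nm & CA & TA & SR & PA & Rg & Emb).
- exact (Udata_intro HL Hl HV Hz HVz UB).
- exists Vl, J, m. split; [apply SB|]. split; [exact (rank_V HV)|].
  split; [intro x; rewrite KP; tauto|]. exact (rank_ord (VP (proj1 Cm))).
- destruct TA as (U' & I' & Pa & PA' & RU & HPa & Rn).
  assert (E := PA). apply is_pairE in E. apply is_pairE in PA'. rewrite PA' in E.
  apply opr_inj in E. destruct E; subst U' I'.
  destruct (Udata_elim HL HV Hz HVz PA RU CA) as (I' & X & fA & tau & UA).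
  assert (SA := proj1 UA).
  apply is_pairE in PA. rewrite (sd_A SA) in PA. apply opr_inj in PA. destruct PA; subst U I'.
  destruct SR as [[v [Hv Fr]] Pl]. rewrite (V_unique Hv HV) in Fr. clear v Hv.
  destruct (restr_fun Fr Rg (fun x Hx => Hx)) as [Fg Eg].
  assert (g = r) by (apply (fun_ext Fg Fr); exact Eg). subst g.
  assert (RedA : has_membership_reduct A Vl) by apply UA.
  assert (RedB : has_membership_reduct B Vl) by apply UB.
  assert (Ls : forall s, is_mem_symbol s -> s ∈ L) by (intros s S; apply HL; auto).
  assert (Er : ext_elem Vl Vl (ap r)).
  { apply (emb_ext (L := L) (A := A) (B := B) (I := I) (J := J)); [| |exact Emb];
      split; [exact SA|split; assumption|exact SB|split; assumption]. }
  assert (Rr : forall x, x ∈ Vl -> ap r x ∈ Vl) by (intros x Hx; exact (fun_ap_in Fr Hx)).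
  destruct (emb_sat SA SB Emb) as [_ Sr].
  destruct (lift_embedding HL UA UB Emb) as [j [Kj Hj]].
  destruct UA as (_ & _ & HfA & EX & VX & lX & fX & Bt & Tl & Tx & _).
  destruct UB as (_ & _ & _ & EY & VY & lY & _ & Bs & Sl & Sx & _).
  assert (Fj := proj1 (map_ext Kj)). assert (CK := limit_V_adjcl Ll HV).
  assert (N0 : forall k : nat, num k ∈ Vl) by (intro k; apply (adjcl_nat CK), num_nat).
  (* [l] is coded by <0,0> and x in V_l by <1,x>; [r] fixes the numerals, so j fixes [l] and extends
     [r]. *)
  assert (jl : ap j l = l).
  { destruct (Hj l lX) as [K1 K2]. apply (bij_inj Bs K1 lY). rewrite K2, Tl, Sl.
    rewrite (se_opr Ll HV Fr Er (N0 0) (N0 0)), (se_num Ll HV Fr Er). reflexivity. }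
  assert (jx : forall x, x ∈ Vl -> ap j x = ap r x).
  { intros x Hx. destruct (Hj x (VX x Hx)) as [K1 K2]. apply (bij_inj Bs K1 (VY _ (Rr x Hx))).
    rewrite K2, (Tx x Hx), (Sx _ (Rr x Hx)).
    rewrite (se_opr Ll HV Fr Er (N0 1) Hx), (se_num Ll HV Fr Er). reflexivity. }
  assert (Tr : forall p x y, isF L Vl I p -> x ∈ Vl -> y ∈ Vl -> exists e e',
    is_assignment Vl e /\ is_assignment Vl e' /\ ap e (num 0) = x /\ ap e (num 1) = y /\
    ap e' (num 0) = ap r x /\ ap e' (num 1) = ap r y /\ (sat L Vl I p e <-> sat L Vl J p e')).
  { intros p x y Fp Hx Hy. destruct (asg_two Hx Hy) as [e [E [E0 E1]]].
    destruct (asg_comp Fr E) as [e' [E' V]]. exists e, e'.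
    rewrite !V, E0, E1 by apply num_nat. repeat (split; [auto; fail|]).
    rewrite <- (ss_sat SA), <- (ss_sat SB). apply Sr; assumption. }
  (* fA(x) = y holds if and only if f(r(x)) = r(y), as [r] is an embedding; f(r(x)) = r(r(x)) and
     injectivity then give y = r(x). *)
  assert (fr : fA = r).
  { assert (Lf : sf ∈ L) by (apply Lset; auto).
    assert (Q : forall x y, x ∈ Vl -> y ∈ Vl -> (fun1 A sf x y <-> app f (ap r x) (ap r y))).
    { intros x y Hx Hy.
      destruct (sat_F1 SA Lf (std_fun 1 0) (num_nat 0) (num_nat 1)) as [F1 K1].
      destruct (sat_F1 SB Lf (std_fun 1 0) (num_nat 0) (num_nat 1)) as [F2 K2].
      destruct (Tr _ x y F1 Hx Hy) as (e & e' & E & E' & E0 & E1 & E0' & E1' & K).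
      rewrite (K1 e E), (K2 e' E'), E0, E1, E0', E1', KF in K. exact K. }
    assert (Q' : forall x, x ∈ Vl -> app f (ap r x) (ap r (ap r x))).
    { intros x Hx. exact (square_root_at Ll HV Fr Er Pl Hx). }
    assert (Dm : forall x y, fun1 A sf x y -> x ∈ Vl /\ y ∈ Vl).
    { intros x y (F & t & K1 & K2 & K3). apply (interpE SA) in K1.
      destruct (proj2 (proj2 (proj2 (proj2 SA))) sf _ F Lf (std_fun 1 0) K1) as [T [HT FT]].
      destruct (fun_dom FT K3) as [Ht Hy]. split; [|exact Hy]. apply HT in Ht.
      apply is_seq1E in K2. subst t. assert (K : app (seq1 x) (num 0) x) by (apply app_seq1; auto).
      exact (proj2 (fun_dom Ht K)). }
    apply set_ext. intro p. rewrite HfA, (fun_mem p Fr). split.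
    - intros (x & y & Pp & K). apply is_pairE in Pp. subst p. destruct (Dm x y K) as [Hx Hy].
      exists x. split; [exact Hx|]. f_equal. apply (se_inj Fr Er Hy (Rr x Hx)).
      apply (Q x y Hx Hy) in K. exact (fun_unique Ff K (Q' x Hx)).
    - intros [x [Hx ->]]. exists x, (ap r x). split; [apply oprP|].
      apply (Q x _ Hx (Rr x Hx)), Q', Hx. }
  assert (Mv : exists a, a ∈ l /\ ~ app j a a).
  { apply NNPP. intro N.
    assert (Id : forall x, x ∈ Vl -> ap r x = x).
    { apply (se_identity Ll HV Fr Er). intros a al.
      assert (aV : a ∈ Vl) by (apply (V_self HV), al). rewrite <- (jx a aV).
      symmetry. apply (fun_val Fj). apply NNPP. intro K. apply N. eauto. }
    assert (Lp : sP ∈ L) by (apply Lset; auto).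
    assert (Em : Pa = m).
    { destruct (sat_R1 SA Lp (std_rel 1 0) (num_nat 0)) as [F1 K1].
      destruct (sat_R1 SB Lp (std_rel 1 0) (num_nat 0)) as [F2 K2].
      assert (Q : forall x, x ∈ Vl -> (rel1 A sP x <-> x ∈ m)).
      { intros x Hx. destruct (Tr _ x x F1 Hx Hx) as (e & e' & E & E' & E0 & E1 & E0' & E1' & K).
        rewrite (K1 e E), (K2 e' E'), E0, E0', KP, (Id x Hx) in K. exact K. }
      apply set_ext. intro x. rewrite HPa. split.
      - intro K. apply Q; [|exact K]. destruct K as (R & t & K1' & K2' & K3).
        apply (interpE SA) in K1'. assert (Ft := sd_rel SA Lp (std_rel 1 0) K1' K3).
        apply is_seq1E in K2'. subst t. assert (K : app (seq1 x) (num 0) x) by (apply app_seq1; auto).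
        exact (proj2 (fun_dom Ft K)).
      - intro K. apply Q; [exact (TV m mV x K)|exact K]. }
    subst Pa. apply (mem_irr (x := m)).
    rewrite <- (rank_unique Rn (rank_ord (VP (proj1 Cm)))) at 1. exact nm. }
  (* n = 1 and eta = zeta = [z]: the one cardinal [z] in C^(2) also belongs to C^(1). *)
  split; [exact Hl|]. exists 1, z, z, Vl, (V_ z), (V_ z), X, j, r.
  split; [lia|]. split; [exact HV|]. split; [exact HVz|]. split; [exact HVz|].
  split; [exact Cz|]. split; [exact (in_C_le (m := 1) (n := 2) ltac:(lia) Iz)|]. split; [exact lz|].
  split; [exact EX|]. split; [exact VX|]. split; [exact lX|]. split; [exact Cz|].
  split; [exact Iz|]. split; [exact lz|]. split; [exact Kj|].
  split; [rewrite <- jl at 2; exact (fun_app Fj lX)|]. split; [exact Mv|].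
  split; [|rewrite <- fr; exact fX].
  destruct (restr_ex j Vl) as [k Hk]. destruct (restr_fun Fj Hk VX) as [Fk Ek].
  assert (k = r) by (apply (fun_ext Fk Fr); intros x Hx; rewrite (Ek x Hx); exact (jx x Hx)).
  subst k. exact Hk.
Qed.
End UXSR_ultraexacting.

(** * Kunen's combinatorial lemma *)

Definition hits (N : universe) (phi B a : N) : Prop := exists w n s t,
  is_omega w /\ n ∈ w /\ is_function s w B /\ app phi s t /\ app t n a.

#[global] Instance UD_hits : UD3 hits.
Proof. unfold UD3, hits. ud. Qed.

(** A variant of an omega-Jonsson function. The values of [phi] are sequences, and the points hit
    are their entries. [S] is any set; that a subset has full size is expressed by a bijection onto
    [S]. *)
Definition jonsson (N : universe) (S phi A pi : N) : Prop :=
  (forall s w, is_omega w -> is_function s w S -> exists t, app phi s t /\ is_function t w S) /\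
  (forall s t t', app phi s t -> app phi s t' -> t = t') /\
  subset A S /\ is_bijection pi A S /\
  forall B sg, subset B A -> is_bijection sg B S -> forall a, a ∈ A -> hits phi B a.

#[global] Instance UD_jonsson : UD4 jonsson.
Proof. unfold UD4, jonsson. ud. Qed.

Section Kunen.
Context {M : universe} {hM : ZFC M}.
Implicit Types A B S a b c d e f g h k n p q r s t u v w x y z : M.

Definition eventually s t := exists n, is_natural n /\
  forall m x, is_natural m -> ~ m ∈ n -> (app s m x <-> app t m x).

Lemma eventually_trans s t u : eventually s t -> eventually t u -> eventually s u.
Proof.
intros [n [Nn K]] [n' [Nn' K']]. destruct (nat_max Nn Nn') as (i & Ni & H1 & H2).
exists i. split; [exact Ni|]. intros m x Nm Hm. assert (Oi := nat_ord Ni).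
assert (Q : forall j, j ∈ i \/ j = i -> ~ m ∈ j).
{ intros j [Hj| ->] C; [apply Hm; exact (ord_mem_trans Oi C Hj)|exact (Hm C)]. }
rewrite (K m x Nm (Q _ H1)), (K' m x Nm (Q _ H2)). tauto.
Qed.

(* Erdos and Hajnal: pick representatives [phi s] of sequences modulo eventual equality.
   If every [A] of full size had a full-size subset [B] whose sequences miss some point of [A],
   a descending sequence of such subsets would yield a sequence of missed points, and the
   representative of that sequence agrees with it from some index on. *)
Lemma jonsson_ex S : exists phi A pi, jonsson S phi A pi.
Proof.
assert (DS : dfn1 (fun s => is_function s om S)) by df.
set (Sq := sep (Pw (prod om S)) (fun s => is_function s om S)).
assert (SqE : forall s, s ∈ Sq <-> is_function s om S).
{ intro s. unfold Sq. rewrite sepE by exact DS. split; [tauto|]. intro F.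
  split; [|exact F]. apply PwE. intros z Z. apply (fun_mem _ F) in Z.
  destruct Z as [x [X ->]]. apply prod_opr. split; [exact X|exact (fun_ap_in F X)]. }
assert (Refl : forall s, eventually s s) by (intro s; exists emp; split; [apply nat_emp|tauto]).
assert (Sym : forall s t, eventually s t -> eventually t s).
{ intros s t [n [Nn K]]. exists n. split; [exact Nn|]. intros m x Nm Hm. symmetry. apply K; assumption. }
assert (DE : dfn2 eventually) by (unfold eventually; df).
assert (DC : dfn1 (fun e => exists s, s ∈ Sq /\ forall t, t ∈ e <-> t ∈ Sq /\ eventually s t)) by df.
set (Cl := sep (Pw Sq) (fun e => exists s, s ∈ Sq /\ forall t, t ∈ e <-> t ∈ Sq /\ eventually s t)).
assert (ClE : forall e, e ∈ Cl <-> exists s, s ∈ Sq /\ forall t, t ∈ e <-> t ∈ Sq /\ eventually s t).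
{ intro e. unfold Cl. rewrite sepE by exact DC. split; [tauto|]. intros [s [Hs K]].
  split; [|eauto]. apply PwE. intros t Ht. apply K, Ht. }
assert (Cof : forall s, s ∈ Sq -> exists e, e ∈ Cl /\ forall t, t ∈ e <-> t ∈ Sq /\ eventually s t).
{ intros s Hs. assert (D : dfn1 (fun t => eventually s t)) by (unfold eventually; df).
  exists (sep Sq (eventually s)). assert (K : forall t, t ∈ sep Sq (eventually s) <-> t ∈ Sq /\ eventually s t)
    by (intro t; apply (sepE _ D)). split; [|exact K]. apply ClE. eauto. }
assert (Cun : forall s e e', e ∈ Cl -> e' ∈ Cl -> s ∈ e -> s ∈ e' -> e = e').
{ intros s e e' He He' K K'. apply ClE in He, He'. destruct He as [u [Hu Q]], He' as [u' [Hu' Q']].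
  apply Q in K. apply Q' in K'. apply set_ext. intro t. rewrite Q, Q'.
  split; intros [T1 T2]; split; try exact T1.
  - apply (eventually_trans (proj2 K')). apply (eventually_trans (Sym _ _ (proj2 K))). exact T2.
  - apply (eventually_trans (proj2 K)). apply (eventually_trans (Sym _ _ (proj2 K'))). exact T2. }
destruct (choice_fun (a := Cl) (b := Sq) (R := fun e t => t ∈ e) ltac:(df)) as [c [Fc Hc]].
{ intros e He. apply ClE in He. destruct He as [s [Hs K]]. exists s. split; [exact Hs|].
  apply K. split; [exact Hs|apply Refl]. }
destruct (fun_ex (a := Sq) (b := Sq) (R := fun s t => exists e, app c e t /\ s ∈ e) ltac:(df)) as [phi [Fp Ep]].
{ intros s Hs. destruct (Cof s Hs) as [e [He K]].
  assert (se : s ∈ e) by (apply K; split; [exact Hs|apply Refl]). exists (ap c e). split.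
  - split; [exact (fun_ap_in Fc He)|]. exists e. split; [exact (fun_app Fc He)|exact se].
  - intros t [_ [e' [K1 K2]]]. rewrite (fun_val Fc K1). f_equal.
    exact (Cun s e e' He (proj1 (fun_dom Fc K1)) se K2). }
assert (Pev : forall s, s ∈ Sq -> eventually s (ap phi s)).
{ intros s Hs. assert (K := fun_app Fp Hs). apply Ep in K. destruct K as [_ [_ [e [K1 K2]]]].
  assert (He := proj1 (fun_dom Fc K1)). assert (Q := Hc e He). rewrite <- (fun_val Fc K1) in Q.
  apply ClE in He. destruct He as [u [Hu K]]. apply K in K2, Q.
  exact (eventually_trans (Sym _ _ (proj2 K2)) (proj2 Q)). }
assert (Pinv : forall s s', s ∈ Sq -> s' ∈ Sq -> eventually s s' -> ap phi s = ap phi s').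
{ intros s s' Hs Hs' Ev. assert (K := fun_app Fp Hs). apply Ep in K. destruct K as [_ [_ [e [K1 K2]]]].
  apply (fun_val Fp), Ep. split; [exact Hs'|]. split; [exact (fun_ap_in Fp Hs)|].
  exists e. split; [exact K1|]. assert (He := proj1 (fun_dom Fc K1)).
  apply ClE in He. destruct He as [u [Hu K]]. apply K in K2. apply K. split; [exact Hs'|].
  exact (eventually_trans (proj2 K2) Ev). }
apply NNPP. intro No.
assert (Next : forall A pi, subset A S -> is_bijection pi A S -> exists B sg a,
  subset B A /\ is_bijection sg B S /\ a ∈ A /\ ~ hits phi B a).
{ intros A pi HA Bp. apply NNPP. intro N. apply No. exists phi, A, pi. split; [|split; [|split; [exact HA|split; [exact Bp|]]]].
  - intros s w Hw Fs. apply is_omE in Hw. subst w. apply SqE in Fs. exists (ap phi s).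
    split; [exact (fun_app Fp Fs)|apply SqE, (fun_ap_in Fp Fs)].
  - intros s t t' K K'. exact (fun_unique Fp K K').
  - intros B sg HB Bs a Ha. apply NNPP. intro K. apply N. exists B, sg, a. auto. }
assert (DK : dfn1 (fun A => exists pi, is_bijection pi A S)) by df.
set (KK := sep (Pw S) (fun A => exists pi, is_bijection pi A S)).
assert (KKE : forall A, A ∈ KK <-> subset A S /\ exists pi, is_bijection pi A S).
{ intro A. unfold KK. rewrite sepE, PwE by exact DK. tauto. }
assert (SK : S ∈ KK).
{ apply KKE. split; [intros x Hx; exact Hx|].
  destruct (fun_ex (a := S) (b := S) (R := fun x y => x = y) ltac:(df)) as [i [Fi Ei]].
  - intros x Hx. exists x. split; [auto|]. intros y [_ K]. exact K.
  - assert (Vi : forall x, x ∈ S -> ap i x = x).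
    { intros x Hx. symmetry. apply (fun_val Fi), Ei. auto. }
    exists i. apply (bij_mk Fi).
    + intros x y Hx Hy E. rewrite (Vi x Hx), (Vi y Hy) in E. exact E.
    + intros y Hy. exists y. auto. }
destruct (dependent_choice (R := fun A B => subset B A /\ exists a, a ∈ A /\ ~ hits phi B a)
  (K := KK) (k0 := S) ltac:(df) SK) as [sg [Fsg [_ Hsg]]].
{ intros A HA. apply KKE in HA. destruct HA as [HA [pi Bp]].
  destruct (Next A pi HA Bp) as (B & sb & a & K1 & K2 & K3 & K4). exists B.
  split; [|eauto]. apply KKE. split; [|eauto]. intros x Hx. apply HA, K1, Hx. }
destruct (choice_fun (a := om) (b := S) (R := fun n x => forall A B m, is_succ m n -> app sg n A ->
  app sg m B -> x ∈ A /\ ~ hits phi B x) ltac:(df)) as [al [Fal Hal]].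
{ intros n On. assert (Nn := proj1 (omE n) On). destruct (Hsg n Nn) as [_ [a [K1 K2]]].
  assert (K := fun_ap_in Fsg On). apply KKE in K. exists a. split; [apply K, K1|].
  intros A B m Sm PA PB. apply is_succE in Sm. subst m.
  rewrite (fun_val Fsg PA), (fun_val Fsg PB). auto. }
assert (Mono : forall m n, is_natural n -> m ∈ n \/ m = n -> subset (ap sg n) (ap sg m)).
{ assert (D : dfn1 (fun n => forall m A B, m ∈ n \/ m = n -> app sg n A -> app sg m B -> subset A B)) by df.
  assert (G : forall n, is_natural n -> forall m A B, m ∈ n \/ m = n -> app sg n A -> app sg m B -> subset A B).
  { apply (nat_ind D).
    - intros m A B [K|K] PA PB; [destruct (empE K)|]. subst m.
      rewrite (fun_unique Fsg PA PB). intros x Hx; exact Hx.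
    - intros n Nn IH m A B K PA PB. assert (On := proj2 (omE n) Nn). destruct K as [K|K].
      + apply sucE in K. assert (Q := IH m _ B K (fun_app Fsg On) PB).
        intros x Hx. apply Q. rewrite (fun_val Fsg PA) in Hx. apply (proj1 (Hsg n Nn)), Hx.
      + subst m. rewrite (fun_unique Fsg PA PB). intros x Hx; exact Hx. }
  intros m n Nn K. apply (G n Nn m); [exact K|apply (fun_app Fsg), omE, Nn|].
  apply (fun_app Fsg), omE. destruct K as [K| ->]; [exact (nat_el Nn K)|exact Nn]. }
assert (Al : forall n, is_natural n -> ap al n ∈ ap sg n /\ ~ hits phi (ap sg (suc n)) (ap al n)).
{ intros n Nn. apply (Hal n (proj2 (omE n) Nn) _ _ (suc n)).
  - apply is_succE; reflexivity.
  - apply (fun_app Fsg), omE, Nn.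
  - apply (fun_app Fsg), omE, nat_suc, Nn. }
assert (aSq : al ∈ Sq) by (apply SqE, Fal).
destruct (Pev al aSq) as [n [Nn Hn]].
assert (On := proj2 (omE n) Nn). assert (Ns := nat_suc Nn). assert (Os := proj2 (omE _) Ns).
assert (FsS : subset (ap sg (suc n)) S) by (apply (proj1 (KKE _)), (fun_ap_in Fsg Os)).
(* The entries up to [n] are replaced by a later one, so that the sequence runs in the set with
   index n + 1. Its class and representative are unchanged, and the representative has the value
   [ap al n] at [n], which that set was to miss. *)
destruct (fun_ex (a := om) (b := ap sg (suc n)) (R := fun i x => (n ∈ i /\ app al i x) \/
  (~ n ∈ i /\ app al (suc n) x)) ltac:(df)) as [al' [Fal' Eal']].
{ intros i Oi. assert (Ni := proj1 (omE i) Oi). destruct (classic (n ∈ i)) as [K|K].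
  - exists (ap al i). split.
    + split; [|left; split; [exact K|exact (fun_app Fal Oi)]].
      apply (@Mono (suc n) i Ni); [|apply Al, Ni]. exact (ord_suc_sub (nat_ord Ni) K).
    + intros y [_ [[_ Q]|[Q _]]]; [symmetry; exact (fun_val Fal Q)|contradiction].
  - exists (ap al (suc n)). split.
    + split; [apply Al, Ns|]. right. split; [exact K|exact (fun_app Fal Os)].
    + intros y [_ [[Q _]|[_ Q]]]; [contradiction|symmetry; exact (fun_val Fal Q)]. }
assert (Fal2 := fun_widen Fal' FsS).
assert (Ev : eventually al al').
{ exists (suc n). split; [exact Ns|]. intros m x Nm Hm. assert (Om := proj2 (omE m) Nm).
  assert (nm : n ∈ m).
  { destruct (ord_tri (nat_ord Nn) (nat_ord Nm)) as [K|[K|K]]; [exact K| |]; exfalso; apply Hm, sucE; auto. }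
  rewrite Eal'. split.
  - intro K. split; [exact Om|]. split; [|auto]. rewrite (fun_val Fal K).
    apply (@Mono (suc n) m Nm); [exact (ord_suc_sub (nat_ord Nm) nm)|apply Al, Nm].
  - intros [_ [_ [[_ K]|[K _]]]]; [exact K|contradiction]. }
apply (proj2 (Al n Nn)). exists om, n, al', (ap phi al'). split; [apply is_omE; reflexivity|].
split; [exact On|]. split; [exact Fal'|]. split; [apply (fun_app Fp), SqE, Fal2|].
rewrite <- (Pinv al al' aSq (proj2 (SqE _) Fal2) Ev).
apply (Hn n _ Nn); [apply mem_irr|exact (fun_app Fal On)].
Qed.
End Kunen.

(** * Elementary embeddings of initial segments of the universe *)

(** Dependence of satisfaction on finitely many entries, phrased inside the universe so that the
    embedding transfers it. *)
Definition depends_below (N : universe) (L A U p n : N) : Prop := forall e e',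
  is_assignment U e -> is_assignment U e' -> (forall k x, k ∈ n -> (app e k x <-> app e' k x)) ->
  structure_satisfies L A p e -> structure_satisfies L A p e'.

#[global] Instance UD_depends_below : UD5 depends_below.
Proof. unfold UD5, depends_below. ud. Qed.

(* The first-order consequences of ZFC, apart from separation, that are reflected to a rank
   initial segment. *)
Definition Facts (N : universe) : Prop :=
  (forall x y : N, (forall z, z ∈ x <-> z ∈ y) -> x = y) /\
  (forall x : N, (exists y, y ∈ x) -> exists y, y ∈ x /\ forall z, z ∈ y -> ~ z ∈ x) /\
  (forall x y : N, exists p, is_upair p x y) /\
  (forall x : N, exists u, forall z, z ∈ u <-> exists y, y ∈ x /\ z ∈ y) /\
  (forall x : N, exists u, forall z, z ∈ u <-> subset z x) /\
  (forall x : N, exists a v, is_V a v /\ x ∈ v) /\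
  (forall a : N, is_ordinal a -> exists v, is_V a v) /\
  (exists w : N, is_omega w) /\
  (forall S : N, exists phi A pi, jonsson S phi A pi) /\
  (forall L A p e S : N, structure_satisfies L A p e -> adjcl S -> subset L S -> p ∈ S) /\
  (forall L A U I p : N, structure_data L A U I ->
     exists n, is_natural n /\ depends_below L A U p n).

Lemma UD_Facts : UD (fun N v => Facts N).
Proof. unfold Facts. ud. Qed.

Lemma Facts_M (M : universe) (hM : ZFC M) : Facts M.
Proof.
repeat apply conj.
- exact (z_ext ZFC_Zer).
- exact (z_found ZFC_Zer).
- exact (z_pair ZFC_Zer).
- exact (z_union ZFC_Zer).
- exact (z_power ZFC_Zer).
- intro x. destruct (V_univ x) as [a [Oa K]]. exists a, (V_ a). split; [exact (VP Oa)|exact K].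
- exact V_ex.
- exists om. apply is_omE; reflexivity.
- exact jonsson_ex.
- intros L A p e S (U & I & T & SD & K & _) CS LS. exact (proj1 (fe_bound (L := L) (U := U) (I := I) CS LS K)).
- intros L A U I p SD. destruct (sat_supp SD p) as [n [Nn K]]. exists n. split; [exact Nn|].
  intros e e' E E' Ag. rewrite !(ss_sat SD). exact (K e e' E E' Ag).
Qed.

Lemma Zer_Facts (N : universe) : Facts N ->
  (forall P : N -> Prop, dfn1 P -> forall x, exists y, forall z, z ∈ y <-> z ∈ x /\ P z) -> Zer N.
Proof.
intros (E & F & P & U & Pw & _ & _ & [w _] & _) Sep. constructor; try assumption.
exact (inhabits w).
Qed.

Lemma dfn1_UD (N : universe) (P : forall N : universe, (nat -> N) -> Prop) (v : nat -> N) :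
  UD P -> dfn1 (fun x => P N (x .: v)).
Proof.
intro UP. apply (dfn_ext (A := fun o : nat -> N => P N (fun i => (match i with
  | 0 => fun o : nat -> N => o 0 | S i => fun _ => v i end) o))).
- intro o. replace (o 0 .: v) with (fun i => (match i with
  | 0 => fun o : nat -> N => o 0 | S i => fun _ => v i end) o); [tauto|].
  apply functional_extensionality; intros [|i]; reflexivity.
- apply (dfn_UD (P := P)); [|exact UP]. intros [|i]; tms.
Qed.

(** Each quantified ordinal is prepended to the environment, so the outermost one ends in place k -
    1 and the innermost in place 0. Quantifying one at a time allows each to be chosen least. *)
Fixpoint Exo (k : nat) (Q : forall N : universe, (nat -> N) -> Prop) (N : universe) (v : nat -> N) : Prop :=
  match k with
  | 0 => Q N v
  | S k => exists a, is_ordinal a /\ Exo k Q (a .: v)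
  end.

Lemma UD_Exo k Q : UD Q -> UD (Exo k Q).
Proof.
intro UQ. induction k as [|k IH]; simpl; [exact UQ|].
apply (@UD_ex (fun N v a => is_ordinal a /\ Exo k Q (a .: v))).
apply UD_and; [ud|]. apply (UD_ext (A := Exo k Q)); [|exact IH]. intros N v.
replace (v 0 .: fun i => v (S i)) with v; [tauto|].
apply functional_extensionality; intros [|i]; reflexivity.
Qed.

Lemma Exo_intro k Q (N : universe) : forall v : nat -> N, (forall i, i < k -> is_ordinal (v i)) ->
  Q N v -> Exo k Q (fun i => v (k + i)).
Proof.
induction k as [|k IH]; intros v O K; simpl; [exact K|].
exists (v k). split; [apply O; lia|].
replace (v k .: fun i => v (S (k + i))) with (fun i => v (k + i)).
- apply IH; [|exact K]. intros i Hi. apply O. lia.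
- apply functional_extensionality; intros [|i]; simpl; f_equal; lia.
Qed.

(* The class defined by [p]; its parameters are read from the places 1, ..., m of [w]. *)
Definition CC (p : form) (m : nat) (N : universe) (w : nat -> N) (x : N) : Prop :=
  satisfies (@all_sets N) p (upd (fun i => w (m - i)) 0 x).

(** Place 0 of [w] holds an ordinal rho < lambda with the language in V_rho, and place [S m] holds
    lambda. The parameters of [p] stand between them. *)
Definition Counter (p : form) (m : nat) (N : universe) (w : nat -> N) : Prop :=
  exists vr L P, is_V (w 0) vr /\ w 0 ∈ w (S m) /\ L ∈ vr /\ P ∈ L /\
    (forall A, CC p m w A -> is_structure L A) /\ ~ UXSR L P (CC p m w) (w (S m)).

Lemma UD_CC p (s : nat -> nat) k : UD (fun N v => satisfies (@all_sets N) p (upd (fun i => v (s i)) 0 (v k))).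
Proof.
apply (UD_ext (A := fun N v => satisfies (@all_sets N) p (fun i => v (if Nat.eqb i 0 then k else s i)))).
- intros N v. replace (fun i => v (if Nat.eqb i 0 then k else s i)) with (upd (fun i => v (s i)) 0 (v k));
    [tauto|]. apply functional_extensionality; intros [|i]; reflexivity.
- exact (UD_ren (fun i => if Nat.eqb i 0 then k else s i) (UD_sat p)).
Qed.
#[global] Hint Extern 1 (UD (fun N v => satisfies (@all_sets N) _ (upd _ 0 _))) => apply UD_CC : ud.

Lemma UD_Counter p m : UD (Counter p m).
Proof. unfold Counter, UXSR, CC. ud. Qed.

(** * The embedding seen from a rank initial segment *)

Section Core.
Context {N : universe} {HZ : Zer N}.
Implicit Types A B L P U I S a b c d e f g h i j n p q r s t u v w x y z : N.
(** [N] is to be the segment V_delta, [Y] the part of X inside it and [J] the action of j on [Y].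
    [JE] says that J is elementary for the external formulas and [TVY] that [Y] is elementary in
    [N]; neither [Y] nor [J] is assumed to be definable in [N]. *)
Variables (Y : N -> Prop) (J : N -> N).
Hypothesis JE : forall (P : forall N : universe, (nat -> N) -> Prop) (v : nat -> N), UD P ->
  (forall i : nat, Y (v i)) -> (P N v <-> P N (fun i : nat => J (v i))).
Hypothesis TVY : forall (P : forall N : universe, (nat -> N) -> Prop) (v : nat -> N), UD P ->
  (forall i : nat, Y (v i)) -> (exists x, P N (x .: v)) -> exists x, Y x /\ P N (x .: v).
Hypothesis FN : Facts N.

Lemma JE1 (P : forall N : universe, N -> Prop) x : UD1 P -> Y x -> (P N x <-> P N (J x)).
Proof. intros UP X. apply (JE (v := fun _ => x) UP). intro; exact X. Qed.
Lemma JE2 (P : forall N : universe, N -> N -> Prop) x y : UD2 P -> Y x -> Y y ->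
  (P N x y <-> P N (J x) (J y)).
Proof. intros UP X Z. apply (JE (v := sel x y y y y y) UP). apply sel_all; assumption. Qed.
Lemma JE3 (P : forall N : universe, N -> N -> N -> Prop) x y z : UD3 P -> Y x -> Y y -> Y z ->
  (P N x y z <-> P N (J x) (J y) (J z)).
Proof. intros UP X1 X2 X3. apply (JE (v := sel x y z z z z) UP). apply sel_all; assumption. Qed.
Lemma JE4 (P : forall N : universe, N -> N -> N -> N -> Prop) x y z u : UD4 P -> Y x -> Y y -> Y z -> Y u ->
  (P N x y z u <-> P N (J x) (J y) (J z) (J u)).
Proof. intros UP X1 X2 X3 X4. apply (JE (v := sel x y z u u u) UP). apply sel_all; assumption. Qed.
Lemma JE5 (P : forall N : universe, N -> N -> N -> N -> N -> Prop) x y z u w : UD5 P ->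
  Y x -> Y y -> Y z -> Y u -> Y w -> (P N x y z u w <-> P N (J x) (J y) (J z) (J u) (J w)).
Proof. intros UP X1 X2 X3 X4 X5. apply (JE (v := sel x y z u w w) UP). apply sel_all; assumption. Qed.

Lemma J_mem x y : Y x -> Y y -> (x ∈ y <-> J x ∈ J y).
Proof. apply (JE2 (P := fun (N : universe) (x y : N) => x ∈ y)). unfold UD2. ud. Qed.
Lemma J_up x y : Y x -> Y y -> x ∈ y -> J x ∈ J y. Proof. intros X Z. apply (J_mem X Z). Qed.
Lemma J_down x y : Y x -> Y y -> J x ∈ J y -> x ∈ y. Proof. intros X Z. apply (J_mem X Z). Qed.
Lemma J_inj x y : Y x -> Y y -> J x = J y -> x = y.
Proof. intros X Z. apply (JE2 (P := fun (N : universe) (x y : N) => x = y)); auto. unfold UD2. ud. Qed.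

Lemma J_app f x y : Y f -> Y x -> Y y -> app f x y -> app (J f) (J x) (J y).
Proof. intros X1 X2 X3. apply (JE3 UD_app X1 X2 X3). Qed.

Definition fixed x := Y x /\ J x = x.

(** [TVY] puts the unique solution into [Y], and by elementarity its image solves the same
    condition, as the parameters are fixed. *)
Lemma def_fix (P : forall N : universe, (nat -> N) -> Prop) (v : nat -> N) x : UD P ->
  (forall i : nat, fixed (v i)) -> P N (x .: v) -> (forall y, P N (y .: v) -> y = x) -> fixed x.
Proof.
intros UP F K Un. assert (Yv : forall i : nat, Y (v i)) by (intro i; apply F).
destruct (TVY UP Yv (ex_intro _ x K)) as [y [Yy Ky]]. apply Un in Ky. subst y.
split; [exact Yy|]. apply Un. apply JE in K; [|exact UP|intros [|i]; [exact Yy|apply Yv]].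
replace (J x .: v) with (fun i : nat => J ((x .: v) i)); [exact K|].
apply functional_extensionality; intros [|i]; [reflexivity|apply F].
Qed.

(** The least solution is definable from the parameters; being least is expressed by the condition
    [Q]. *)
Lemma ord_fix (P : forall N : universe, (nat -> N) -> Prop) (v : nat -> N) : UD P ->
  (forall i : nat, fixed (v i)) -> (exists a, is_ordinal a /\ P N (a .: v)) ->
  exists a, fixed a /\ is_ordinal a /\ P N (a .: v).
Proof.
intros UP F Ex. destruct (ord_min (dfn1_UD v UP) Ex) as (a & Oa & Pa & Min).
exists a. split; [|auto].
set (Q := fun (N : universe) (v : nat -> N) => is_ordinal (v 0) /\ P N v /\
  forall b : N, b ∈ v 0 -> ~ P N (b .: fun i : nat => v (S i))).
assert (UQ : UD Q).
{ unfold Q. apply UD_and; [ud|]. apply UD_and; [exact UP|].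
  apply (@UD_all (fun (N : universe) (v : nat -> N) (b : N) => b ∈ v 0 -> ~ P N (b .: fun i : nat => v (S i)))).
  apply UD_imp; [ud|]. apply UD_not.
  apply (UD_ext (A := fun (N : universe) (v : nat -> N) => P N (fun i : nat => v (match i with 0 => 0 | S i => S (S i) end)))).
  - intros N' v'. replace (v' 0 .: fun i : nat => v' (S (S i))) with
      (fun i : nat => v' (match i with 0 => 0 | S i => S (S i) end)); [tauto|].
    apply functional_extensionality; intros [|i]; reflexivity.
  - exact (UD_ren (fun i : nat => match i with 0 => 0 | S i => S (S i) end) UP). }
apply (def_fix UQ F).
- split; [exact Oa|]. split; [exact Pa|exact Min].
- intros b (Ob & Pb & Mb). exact (ord_least_unique Ob Oa Pb Pa Mb Min).
Qed.

(** The ordinals are minimized from the outermost quantifier inwards, each with those already chosen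
    as fixed parameters. *)
Lemma Exo_fixed (k : nat) Q : UD Q -> forall v : nat -> N, (forall i : nat, fixed (v i)) -> Exo k Q v ->
  exists v' : nat -> N, (forall i : nat, fixed (v' i)) /\ (forall i : nat, v' (k + i) = v i) /\ Q N v'.
Proof.
intro UQ. induction k as [|k IH]; intros v F K; simpl in K.
- exists v. auto.
- destruct (ord_fix (UD_Exo k UQ) F K) as (a & Fa & _ & Ka).
  destruct (IH (a .: v)) as (v' & F' & E & K').
  + intros [|i]; [exact Fa|apply F].
  + exact Ka.
  + exists v'. split; [exact F'|]. split; [|exact K']. intro i.
    replace (S k + i) with (k + S i) by lia. exact (E (S i)).
Qed.

Lemma fix1 (P : forall N : universe, N -> N -> Prop) p x : UD2 P -> fixed p -> P N x p ->
  (forall y, P N y p -> y = x) -> fixed x.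
Proof.
intros UP F K Un.
exact (def_fix (P := fun (N : universe) (v : nat -> N) => P N (v 0) (v 1)) (v := fun _ => p) UP (fun _ => F) K Un).
Qed.

Variables l Vl k : N.
Hypothesis Hl : is_limit_cardinal l.
Hypothesis HV : is_V l Vl.
Hypothesis Fl : fixed l.
Hypothesis YV : forall x, x ∈ Vl -> Y x.
Hypothesis Yk : Y k.
Hypothesis Fk : is_function k Vl Vl.
Hypothesis Hk : forall x, x ∈ Vl -> ap k x = J x.
Hypothesis Mv : exists a, a ∈ l /\ J a <> a.
Let Ll := limit_cardinal_limit Hl.
Let TV := V_trans HV.
Let CK := limit_V_adjcl Ll HV.

Lemma k_app x y : x ∈ Vl -> (app k x y <-> y = J x).
Proof. intro X. rewrite (fun_appE y Fk X), (Hk X). tauto. Qed.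

Lemma JV x : x ∈ Vl -> J x ∈ Vl.
Proof. intro X. rewrite <- (Hk X). exact (fun_ap_in Fk X). Qed.

(** [J] lives outside [N]. Through the element [k] being fixed becomes definable in [N] on V_l, so
    that separation, minima and induction apply to it. *)
Lemma fixV x : x ∈ Vl -> (fixed x <-> app k x x).
Proof.
intro X. rewrite (k_app x X). split; [intros [_ E]; auto|]. intro E. split; [exact (YV X)|auto].
Qed.

Lemma nat_fixed n : is_natural n -> fixed n.
Proof.
intro Nn. assert (NV : forall n, is_natural n -> n ∈ Vl) by (intros m Nm; exact (adjcl_nat CK Nm)).
apply (fixV (NV n Nn)). revert n Nn. apply (@nat_ind _ _ (fun n => app k n n)); [df| |].
- apply k_app; [exact (NV _ nat_emp)|]. symmetry. apply is_empE.
  apply (JE1 UD_empty (YV (NV _ nat_emp))). apply is_empE. reflexivity.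
- intros n Nn IH. assert (V1 := NV _ Nn). assert (V2 := NV _ (nat_suc Nn)).
  apply (k_app _ V1) in IH. apply k_app; [exact V2|].
  assert (K : is_succ (J (suc n)) (J n)).
  { apply (JE2 UD_succ (YV V2) (YV V1)). apply is_succE; reflexivity. }
  rewrite <- IH in K. apply is_succE in K. auto.
Qed.

(** Natural numbers are fixed, so the ordinal moved below [l] is not one of them; hence omega is
    below [l]. *)
Lemma omega_fixed : exists w, is_omega w /\ fixed w /\ w ∈ Vl.
Proof.
destruct FN as (_ & _ & _ & _ & _ & _ & _ & [w Hw] & _). exists w. split; [exact Hw|].
split.
- apply (fix1 (P := fun (N : universe) (x y : N) => is_omega x) (p := l)); [unfold UD2; ud|exact Fl|exact Hw|].
  intros y Hy. apply set_ext. intro z. rewrite (Hy z), (Hw z). tauto.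
- apply (V_self HV). destruct Mv as [a [al Ma]].
  assert (Oa := ord_el (proj1 Ll) al).
  assert (Ow : is_ordinal w).
  { split.
    - intros x Hx z Hz. apply Hw in Hx. apply Hw. exact (nat_el Hx Hz).
    - intros x Hx. apply Hw in Hx. exact (ord_trans (nat_ord Hx)). }
  destruct (ord_tri Ow Oa) as [K|[K|K]].
  + exact (ord_mem_trans (proj1 Ll) K al).
  + subst; exact al.
  + destruct Ma. apply nat_fixed, Hw, K.
Qed.

Lemma fixed_V a v : fixed a -> is_V a v -> fixed v.
Proof.
intros Fa Hv. apply (fix1 (P := fun (N : universe) (x y : N) => is_V y x) (p := a)); [unfold UD2; ud|exact Fa|exact Hv|].
intros y Hy. exact (V_unique Hy Hv).
Qed.

(** Take Jonsson data [phi], [A], [pi] for S; their images are such data for the same S. The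
    pointwise image B of [A] is a full-size subset of J(A), so every a in J(A) is an entry of
    J(phi)(s) for a sequence s in B. Such an s is J(t0) with t0 a sequence in [A], whence a is J of
    an entry of phi(t0). Thus J(A) lies in the range of J on S, and composing with [pi] covers S. *)
Lemma kunen_surjective S : S ∈ Vl -> fixed S -> forall x, x ∈ S -> exists y, y ∈ S /\ J y = x.
Proof.
intros SV [YS JS].
assert (SY : forall x, x ∈ S -> x ∈ Vl) by (intros x Hx; exact (TV SV Hx)).
destruct omega_fixed as (w & Hw & [Yw Jw] & wV).
assert (wS : prod w S ∈ Vl) by exact (limit_V_prod Ll HV wV SV).
assert (sq : forall s b, is_function s w b -> subset b S -> s ∈ Vl).
{ intros s b Fs bS. apply (V_super HV wS). intros q Q. apply (fun_mem _ Fs) in Q.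
  destruct Q as [x [Hx ->]]. apply prod_opr. split; [exact Hx|apply bS, (fun_ap_in Fs Hx)]. }
assert (Jo : exists phi A pi, Y phi /\ Y A /\ Y pi /\ jonsson S phi A pi).
{ destruct FN as (_ & _ & _ & _ & _ & _ & _ & _ & JO & _).
  destruct (TVY (P := fun (N : universe) (v : nat -> N) => exists A pi : N, jonsson (v 1) (v 0) A pi) (v := fun _ => S) ltac:(ud)
    (fun _ => YS) (JO S)) as [phi [Yp K]].
  destruct (TVY (P := fun (N : universe) (v : nat -> N) => exists pi : N, jonsson (v 1) (v 2) (v 0) pi) (v := sel S phi phi phi phi phi)
    ltac:(ud) ltac:(apply sel_all; assumption) K) as [A [YA K2]].
  destruct (TVY (P := fun (N : universe) (v : nat -> N) => jonsson (v 1) (v 2) (v 3) (v 0)) (v := sel S phi A A A A)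
    ltac:(ud) ltac:(apply sel_all; assumption) K2) as [pi [Ypi K3]].
  exists phi, A, pi. auto. }
destruct Jo as (phi & A & pi & Yp & YA & Ypi & K).
assert (K' := proj1 (JE4 UD_jonsson YS Yp YA Ypi) K). rewrite JS in K'.
destruct K as (P1 & _ & AS & Bpi & _). destruct K' as (_ & P2 & AS' & Bpi' & Hit).
assert (Fpi := proj1 Bpi).
assert (DB : dfn1 (fun y => exists x, x ∈ A /\ app k x y)) by df.
(* The pointwise image of [A], obtained by separation through [k]. *)
set (B := sep Vl (fun y => exists x, x ∈ A /\ app k x y)).
assert (BE : forall y, y ∈ B <-> exists x, x ∈ A /\ y = J x).
{ intro y. unfold B. rewrite sepE by exact DB. split.
  - intros [_ [x [X K]]]. exists x. split; [exact X|]. apply k_app; [exact (SY x (AS x X))|exact K].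
  - intros [x [X ->]]. assert (XV := SY x (AS x X)). split; [exact (JV XV)|].
    exists x. split; [exact X|]. apply (k_app _ XV). reflexivity. }
assert (AY : forall x, x ∈ A -> Y x) by (intros x X; exact (YV (SY x (AS x X)))).
destruct (fun_ex (a := B) (b := S) (R := fun b y => exists x, x ∈ A /\ app k x b /\ app pi x y) ltac:(df))
  as [sg [Fsg Esg]].
{ intros b Hb. apply BE in Hb. destruct Hb as [x [X ->]]. assert (XV := SY x (AS x X)).
  exists (ap pi x). split.
  - split; [exact (fun_ap_in Fpi X)|]. exists x. split; [exact X|].
    split; [apply (k_app _ XV); reflexivity|exact (fun_app Fpi X)].
  - intros y [_ [x' [X' [K1 K2]]]]. apply k_app in K1; [|exact (SY x' (AS x' X'))].
    apply J_inj in K1; auto. subst x'. symmetry. exact (fun_val Fpi K2). }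
assert (Vsg : forall x, x ∈ A -> ap sg (J x) = ap pi x).
{ intros x X. symmetry. apply (fun_val Fsg), Esg. split; [apply BE; eauto|].
  split; [exact (fun_ap_in Fpi X)|]. exists x. split; [exact X|].
  split; [apply (k_app _ (SY x (AS x X))); reflexivity|exact (fun_app Fpi X)]. }
assert (Bsg : is_bijection sg B S).
{ apply (bij_mk Fsg).
  - intros b b' Hb Hb' E. apply BE in Hb, Hb'. destruct Hb as [x [X ->]], Hb' as [x' [X' ->]].
    rewrite (Vsg x X), (Vsg x' X') in E. f_equal. exact (bij_inj Bpi X X' E).
  - intros y Hy. destruct (bij_surj Bpi Hy) as [x [X E]]. exists (J x).
    split; [apply BE; eauto|]. rewrite (Vsg x X). exact E. }
assert (BA : subset B (J A)).
{ intros b Hb. apply BE in Hb. destruct Hb as [x [X ->]]. apply J_up; auto. }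
assert (Ran : forall a, a ∈ J A -> exists b, b ∈ S /\ a = J b).
{ intros a Ha. destruct (Hit B sg BA Bsg a Ha) as (w' & n & s & t & Hw' & nw & Fs & Pt & Pn).
  assert (w' = w) by (apply set_ext; intro z; rewrite (Hw z), (Hw' z); tauto). subst w'.
  destruct (fun_ex (a := w) (b := A) (R := fun i x => exists y, app s i y /\ app k x y) ltac:(df))
    as [t0 [Ft0 Et0]].
  { intros i Hi. assert (K := fun_ap_in Fs Hi). apply BE in K. destruct K as [x [X E]].
    exists x. split.
    - split; [exact X|]. exists (ap s i). split; [exact (fun_app Fs Hi)|].
      apply k_app; [exact (SY x (AS x X))|exact E].
    - intros x' [X' [y [K1 K2]]]. apply k_app in K2; [|exact (SY x' (AS x' X'))].
      rewrite (fun_val Fs K1), E in K2. apply J_inj in K2; auto. }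
  assert (t0V := sq t0 A Ft0 AS). assert (Yt0 := YV t0V).
  assert (FJ0 : is_function (J t0) w (J A)).
  { rewrite <- Jw at 1. apply (JE3 UD_function Yt0 Yw YA). exact Ft0. }
  (* Omega and all its elements are fixed, so J acts on [t0] entry by entry. *)
  assert (Et : J t0 = s).
  { apply (fun_ext FJ0 Fs). intros i Hi. assert (Q := fun_app Ft0 Hi). apply Et0 in Q.
    destruct Q as [_ [X [y [K1 K2]]]]. apply k_app in K2; [|exact (SY _ (AS _ X))].
    rewrite <- (fun_val Fs K1), K2. symmetry. apply (fun_val FJ0).
    assert (Fi := nat_fixed (proj1 (Hw i) Hi)). rewrite <- (proj2 Fi) at 1.
    apply J_app; [exact Yt0|apply Fi|exact (AY _ X)|]. exact (fun_app Ft0 Hi). }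
  destruct (P1 t0 w Hw (fun_widen Ft0 AS)) as [t1 [Pt1 Ft1]].
  assert (t1V := sq t1 S Ft1 (fun z Hz => Hz)). assert (Yt1 := YV t1V).
  apply (J_app Yp Yt0 Yt1) in Pt1. rewrite Et in Pt1. assert (t = J t1) by exact (P2 _ _ _ Pt Pt1). subst t.
  assert (FJ1 : is_function (J t1) w S).
  { rewrite <- Jw at 1. rewrite <- JS at 1. apply (JE3 UD_function Yt1 Yw YS). exact Ft1. }
  assert (Q := fun_ap_in Ft1 nw). exists (ap t1 n). split; [exact Q|].
  apply (fun_unique FJ1 Pn). assert (Fi := nat_fixed (proj1 (Hw n) nw)). rewrite <- (proj2 Fi) at 1.
  apply J_app; [exact Yt1|apply Fi|exact (YV (SY _ Q))|]. exact (fun_app Ft1 nw). }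
intros x Hx. destruct (bij_surj Bpi' Hx) as [a [Ha E]]. destruct (Ran a Ha) as [b [Hb ->]].
assert (Yb := YV (SY b Hb)). assert (bA : b ∈ A) by (apply J_down; assumption).
assert (Q := fun_ap_in Fpi bA). exists (ap pi b). split; [exact Q|]. rewrite <- E.
apply (fun_val (proj1 Bpi')), J_app; auto. exact (fun_app Fpi bA).
Qed.

(** Let m be a minimal moved element. By surjectivity an element of J(m) is J(y) for some y,
    necessarily in m, and so equals y; hence J(m) = m. *)
Lemma fixed_pointwise S : S ∈ Vl -> transitive S -> fixed S -> forall x, x ∈ S -> fixed x.
Proof.
intros SV TS FS. assert (Sur := kunen_surjective SV FS). destruct FS as [YS JS].
assert (SY : forall x, x ∈ S -> x ∈ Vl) by (intros x Hx; exact (TV SV Hx)).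
intros x Hx. apply NNPP. intro Nx.
destruct (set_min (P := fun x => ~ app k x x) (s := S) ltac:(df)) as (m & mS & Nm & Min).
{ exists x. split; [exact Hx|]. intro K. apply Nx, (fixV (SY x Hx)), K. }
apply Nm. assert (mV := SY m mS). apply (k_app _ mV).
assert (Fx : forall z, z ∈ m -> J z = z).
{ intros z Hz. assert (zS := TS m mS z Hz). apply NNPP. intro K. apply (Min z Hz zS). intro Q. apply K.
  apply (k_app _ (SY z zS)) in Q. auto. }
apply set_ext. intro z. split; intro Hz.
- rewrite <- (Fx z Hz). apply J_up; [apply YV, (TV mV Hz)|exact (YV mV)|exact Hz].
- assert (JmS : J m ∈ S) by (rewrite <- JS; apply J_up; auto).
  destruct (Sur z (TS _ JmS z Hz)) as [y [yS <-]].
  assert (ym : y ∈ m) by (apply J_down; auto). rewrite (Fx y ym). exact ym.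
Qed.

(** For the least b with J(b) < b, applying J gives J(J(b)) < J(b), against minimality. *)
Lemma J_expand a : a ∈ l -> ~ J a ∈ a.
Proof.
intros al K.
destruct (ord_min (P := fun a => a ∈ l /\ exists y, app k a y /\ y ∈ a) ltac:(df))
  as (b & Ob & [bl [y [Q1 Q2]]] & Min).
- exists a. split; [exact (ord_el (proj1 Ll) al)|]. split; [exact al|]. exists (J a).
  split; [|exact K]. apply k_app; [|reflexivity]. apply (V_self HV), al.
- assert (bV : b ∈ Vl) by (apply (V_self HV), bl). apply (k_app _ bV) in Q1. subst y.
  assert (JbV := JV bV). apply (Min (J b) Q2). split; [exact (ord_mem_trans (proj1 Ll) Q2 bl)|].
  exists (J (J b)). split; [apply (k_app _ JbV); reflexivity|]. apply J_up; auto.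
Qed.

(** Choose a cardinal c < l above a moved ordinal. If c were fixed, V_c would be fixed and hence
    fixed pointwise, together with the moved ordinal. *)
Lemma moved_cardinal : exists c, is_cardinal c /\ c ∈ l /\ c ∈ J c.
Proof.
destruct Mv as [a [al Ma]]. destruct (proj2 (proj2 Hl) a al) as (c & Cc & ac & cl).
exists c. split; [exact Cc|]. split; [exact cl|].
assert (cV : c ∈ Vl) by (apply (V_self HV), cl).
assert (OJ : is_ordinal (J c)) by (apply (JE1 UD_ordinal (YV cV)), Cc).
destruct (ord_tri (proj1 Cc) OJ) as [K|[K|K]]; [exact K| |destruct (J_expand cl K)].
exfalso. apply Ma. destruct (V_ex_below HV cl) as [v Hv].
apply (fixed_pointwise (V_mem HV Hv cl) (V_trans Hv)).
- apply (fixed_V (a := c)); [|exact Hv]. split; [exact (YV cV)|auto].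
- apply (V_self Hv), ac.
Qed.

(** k maps k cut down to V_a to J(k) cut down to V_{J(a)}. These sets are parts of J(k), and they
    exhaust it because J(a) is at least a. *)
Lemma k_square_root : is_square_root l (J k) k.
Proof.
split; [exists Vl; auto|].
assert (FV : fixed Vl) by exact (fixed_V Fl HV).
assert (FJk : is_function (J k) Vl Vl).
{ rewrite <- (proj2 FV) at 1 2. apply (JE3 UD_function Yk (proj1 FV) (proj1 FV)). exact Fk. }
assert (Cut : forall v c, v ∈ Vl -> (forall w, w ∈ c <-> w ∈ k /\ w ∈ v) ->
  c ∈ Vl /\ forall w, w ∈ J c <-> w ∈ J k /\ w ∈ J v).
{ intros v c vV Hc. assert (cV : c ∈ Vl) by (apply (V_super HV vV); intros w Hw; apply Hc, Hw).
  split; [exact cV|].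
  apply (JE3 (P := fun (N : universe) (c k v : N) => forall w : N, w ∈ c <-> w ∈ k /\ w ∈ v) (x := c) (y := k) (z := v));
    auto. unfold UD3. ud. }
intro z. split.
- intro Hz. assert (zV : z ∈ Vl).
  { apply (fun_mem _ FJk) in Hz. destruct Hz as [x [X ->]].
    apply (adjcl_opr CK X), (fun_ap_in FJk X). }
  assert (Hz' := zV). apply (V_eqn _ HV) in Hz'. destruct Hz' as (c & u & cl & Hc & zu).
  assert (sl := limit_suc Ll cl). destruct (V_ex_below HV sl) as [v Hv].
  assert (zv : z ∈ v) by (apply (V_eqn _ Hv); exists c, u; split; [apply suc_mem|auto]).
  assert (vV := V_mem HV Hv sl). assert (sV : suc c ∈ Vl) by (apply (V_self HV), sl).
  assert (Dc : dfn1 (fun w => w ∈ v)) by df.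
  set (C := sep k (fun w => w ∈ v)).
  assert (CE : forall w, w ∈ C <-> w ∈ k /\ w ∈ v) by (intro; apply (sepE _ Dc)).
  destruct (Cut v C vV CE) as [CV JC].
  exists (suc c), v, C, (J C). split; [exact sl|]. split; [exact Hv|]. split; [exact CE|].
  split; [apply (k_app _ CV); reflexivity|]. apply JC. split; [exact Hz|].
  assert (HJv : is_V (J (suc c)) (J v)) by (apply (JE2 UD_V (YV sV) (YV vV)), Hv).
  apply (V_mono_sub HJv Hv); [|exact zv].
  apply ord_not_mem; [exact (V_ordinal HJv)|exact (V_ordinal Hv)|exact (J_expand sl)].
- intros (a & v & c & u & al & Hv & Hc & Pu & zu).
  destruct (Cut v c (V_mem HV Hv al) Hc) as [cV JC]. apply (k_app _ cV) in Pu. subst u.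
  apply JC, zu.
Qed.

Lemma Y_pair B U I : Y B -> is_pair B U I -> Y U /\ Y I.
Proof.
intros YB K. split.
- destruct (TVY (P := fun (N : universe) (v : nat -> N) => exists I : N, is_pair (v 1) (v 0) I) (v := fun _ => B) ltac:(ud)
    (fun _ => YB) (ex_intro _ U (ex_intro _ I K))) as [U' [YU [I' K']]].
  simpl in K'. apply is_pairE in K, K'. rewrite K in K'. apply opr_inj in K'. destruct K'; subst. exact YU.
- destruct (TVY (P := fun (N : universe) (v : nat -> N) => exists U : N, is_pair (v 1) U (v 0)) (v := fun _ => B) ltac:(ud)
    (fun _ => YB) (ex_intro _ I (ex_intro _ U K))) as [I' [YI [U' K']]].
  simpl in K'. apply is_pairE in K, K'. rewrite K in K'. apply opr_inj in K'. destruct K'; subst. exact YI.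
Qed.

(** The fixed elements of V_l form a set by separation through [k]. Codes of formulas in a pointwise
    fixed language belong to any set with this closure, so they are all fixed, those of nonstandard
    length included. *)
Lemma adjcl_fixed : exists F, (forall x, x ∈ F <-> x ∈ Vl /\ fixed x) /\ adjcl F.
Proof.
assert (D : dfn1 (fun x => app k x x)) by df.
assert (FE : forall x, x ∈ sep Vl (fun x => app k x x) <-> x ∈ Vl /\ fixed x).
{ intro x. rewrite sepE by exact D. split; intros [X K]; split; try exact X; apply (fixV X), K. }
exists (sep Vl (fun x => app k x x)). split; [exact FE|]. split.
- intros e E. apply is_empE in E. subst e. apply FE. split; [exact (adjcl_emp CK)|exact (nat_fixed nat_emp)].
- intros x y z X Z Q. apply FE in X, Z. destruct X as [XV FX], Z as [ZV FZ].
  apply FE. assert (zV : z ∈ Vl) by exact (proj2 CK x y z XV ZV Q). split; [exact zV|].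
  split; [exact (YV zV)|]. apply set_ext. intro w.
  assert (K := proj1 (JE3 (P := fun (N : universe) (z x y : N) => forall w : N, w ∈ z <-> w ∈ x \/ w = y) (x := z) (y := x) (z := y)
    ltac:(unfold UD3; ud) (YV zV) (proj1 FX) (proj1 FZ)) Q).
  simpl in K. rewrite (K w), (proj2 FX), (proj2 FZ), (Q w). tauto.
Qed.

(* An arbitrary assignment need not be in the domain of [J], but the truth value of a formula
   depends on finitely many of its entries only. *)
Lemma k_elementary L B U I g : fixed L -> subset L Vl -> (forall s, s ∈ L -> fixed s) -> Y B -> subset U Vl ->
  structure_data L B U I -> is_restriction k U g -> elementary_embedding L B (J B) g.
Proof.
intros FL LV FLs YB UV SD Rg.
destruct (Y_pair YB (proj1 SD)) as [YU YI].
assert (SD' : structure_data L (J B) (J U) (J I)).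
{ rewrite <- (proj2 FL). apply (JE4 UD_structure_data (proj1 FL) YB YU YI). exact SD. }
destruct (restr_fun Fk Rg UV) as [Fg Eg].
assert (Vg : forall x, x ∈ U -> ap g x = J x) by (intros x X; rewrite (Eg x X); exact (Hk (UV x X))).
exists U, I, (J U), (J I). split; [exact SD|]. split; [exact SD'|]. split.
{ apply (fun_range Fg). intros x X. rewrite (Vg x X). apply J_up; auto. }
intros p e e' E E' C.
destruct adjcl_fixed as [F [FE CF]].
assert (LF : subset L F) by (intros s S; apply FE; auto).
assert (HF := FN). destruct HF as (_ & _ & _ & _ & _ & _ & _ & _ & _ & Bd & Sup).
(* A code outside [F] is satisfied in neither structure. *)
destruct (classic (p ∈ F)) as [pF|pF].
2:{ split; intro K; exfalso; apply pF; exact (Bd _ _ _ _ _ K CF LF). }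
apply FE in pF. destruct pF as [pV [Yp Jp]].
destruct (Sup L B U I p SD) as [n [Nn Dn]]. destruct (nat_fixed Nn) as [Yn Jn].
assert (Dn' : depends_below L (J B) (J U) p n).
{ apply (JE5 UD_depends_below (proj1 FL) YB YU Yp Yn) in Dn. rewrite (proj2 FL), Jp, Jn in Dn. exact Dn. }
destruct E as [w [Hw Fe]]. destruct E' as [w' [Hw' Fe']].
assert (w' = w) by (apply set_ext; intro z; rewrite (Hw z), (Hw' z); tauto). subst w'.
assert (nw : subset n w) by (intros i Hi; apply Hw; exact (nat_el Nn Hi)).
destruct (restr_ex e n) as [t Rt]. destruct (restr_fun Fe Rt nw) as [Ft Et].
assert (tV : t ∈ Vl) by exact (adjcl_fun CK Nn (fun_widen Ft UV)).
assert (Yt := YV tV).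
(* The finite part [t] of [e] is in V_l and hence in [Y], so some assignment in [Y] begins with
   it. *)
destruct (TVY (P := fun (N : universe) (v : nat -> N) => is_assignment (v 1) (v 0) /\
    forall i x : N, i ∈ v 3 -> (app (v 0) i x <-> app (v 2) i x)) (v := sel U t n n n n)
  ltac:(ud) ltac:(apply sel_all; assumption)) as [e0 [Ye0 [A0 T0]]].
{ exists e. split; [exists w; auto|]. intros i x Hi. simpl in Hi |- *. rewrite (restr_app Rt). tauto. }
simpl in A0, T0.
assert (A0' : is_assignment (J U) (J e0)) by (apply (JE2 UD_assignment YU Ye0), A0).
assert (T0' : forall i x, i ∈ n -> (app (J e0) i x <-> app (J t) i x)).
{ assert (K := proj1 (JE3 (P := fun (N : universe) (e t n : N) => forall i x : N, i ∈ n -> (app e i x <-> app t i x))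
    (x := e0) (y := t) (z := n) ltac:(unfold UD3; ud) Ye0 Yt Yn) T0). simpl in K. rewrite Jn in K. exact K. }
assert (Ag : forall i x, i ∈ n -> (app e i x <-> app e0 i x)).
{ intros i x Hi. rewrite (T0 i x Hi), (restr_app Rt). tauto. }
assert (FJt : is_function (J t) n (J U)).
{ rewrite <- Jn at 1. apply (JE3 UD_function Yt Yn YU). exact Ft. }
assert (Ag' : forall i x, i ∈ n -> (app e' i x <-> app (J e0) i x)).
{ intros i x Hi. rewrite (T0' i x Hi). assert (Uti := fun_ap_in Ft Hi).
  assert (Fi := nat_fixed (nat_el Nn Hi)).
  assert (Q1 : app (J t) i (J (ap t i))).
  { rewrite <- (proj2 Fi) at 1. apply J_app; [exact Yt|apply Fi|exact (YV (UV _ Uti))|]. exact (fun_app Ft Hi). }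
  assert (Q2 : app e' i (J (ap t i))).
  { apply (C i (ap t i)).
    - exact (proj1 (proj1 (restr_app Rt _ _) (fun_app Ft Hi))).
    - rewrite <- (Vg _ Uti). exact (fun_app Fg Uti). }
  split; intro Q.
  - rewrite (fun_unique Fe' Q Q2). exact Q1.
  - rewrite (fun_unique FJt Q Q1). exact Q2. }
assert (E1 : is_assignment U e) by (exists w; auto).
assert (E1' : is_assignment (J U) e') by (exists w; auto).
assert (M1 : structure_satisfies L B p e <-> structure_satisfies L B p e0).
{ split; [exact (Dn e e0 E1 A0 Ag)|]. apply (Dn e0 e A0 E1). intros i x Hi. symmetry. exact (Ag i x Hi). }
assert (M2 : structure_satisfies L B p e0 <-> structure_satisfies L (J B) p (J e0)).
{ rewrite (JE4 UD_satisfies (proj1 FL) YB Yp Ye0), (proj2 FL), Jp. tauto. }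
rewrite M1, M2. split; [|exact (Dn' e' (J e0) E1' A0' Ag')].
apply (Dn' (J e0) e' A0' E1'). intros i x Hi. symmetry. exact (Ag' i x Hi).
Qed.

Theorem no_counterexample (p : form) (m : nat) : ~ Exo (S m) (Counter p m) (fun _ => l).
Proof.
intro K. destruct (Exo_fixed (UD_Counter p m) (v := fun _ => l) (fun _ => Fl) K) as (w & Fw & Ew & C).
assert (El : w (S m) = l) by (rewrite <- (Ew 0); f_equal; lia).
destruct C as (vr & L & P & Hr & rl & Lr & PL & CS & NU). rewrite El in rl, NU.
assert (rV := V_mem HV Hr rl). assert (Tr := V_trans Hr).
assert (Fr := fixed_pointwise rV Tr (fixed_V (Fw 0) Hr)).
assert (FL := Fr L Lr). assert (FLs : forall s, s ∈ L -> fixed s) by (intros s S; exact (Fr s (Tr L Lr s S))).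
assert (LV : subset L Vl) by (intros s S; exact (TV rV (Tr L Lr s S))).
assert (FP := FLs P PL).
destruct moved_cardinal as (c & Cc & cl & cJ). assert (Yc : Y c) by (apply YV, (V_self HV), cl).
(* [B] is a counterexample to square root reflection with f = [k] and mu = [c]. *)
set (R := fun (N : universe) (o : nat -> N) => CC p m (fun i : nat => o (i + 5)) (o 0) /\
  has_type (o 3) (o 0) (o 2) (o (m + 6)) /\
  ~ exists n A r U I g : N, n ∈ o 2 /\ CC p m (fun i : nat => o (i + 5)) A /\ has_type (o 3) A n (o (m + 6)) /\
    is_square_root (o (m + 6)) (o 1) r /\ is_pair A U I /\ is_restriction r U g /\
    elementary_embedding (o 4) A (o 0) g).
assert (UR : UD R) by (unfold R, CC; ud).
(* With [B] in front, five entries precede [w], and lambda stands in place 5 + S m. *)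
set (o := k .: c .: P .: L .: w).
assert (Yo : forall i : nat, Y (o i)).
{ intros [|[|[|[|i]]]]; [exact Yk|exact Yc|apply FP|apply FL|apply Fw]. }
assert (CCo : forall x : N, (fun i : nat => (x .: o) (i + 5)) = w).
{ intro x. apply functional_extensionality; intro i. replace (i + 5) with (5 + i) by lia. reflexivity. }
assert (lo : forall x : N, (x .: o) (m + 6) = l).
{ intro x. replace (m + 6) with (5 + S m) by lia. exact El. }
(* Otherwise [k] and [c] would witness square root reflection. *)
assert (Ex : exists B, R N (B .: o)).
{ apply NNPP. intro No. apply NU. exists k, c. split; [exists Vl; auto|]. split; [exact Cc|].
  split; [exact cl|]. intros B CB TB. apply NNPP. intro No'. apply No. exists B. unfold R.
  rewrite CCo, lo. split; [exact CB|]. split; [exact TB|exact No']. }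
destruct (TVY UR Yo Ex) as [B [YB HB]].
(* The image of [B] is a counterexample for J(k) and J(c) with the same class, predicate symbol and
   language, as [w], [P] and [L] are fixed. *)
assert (HB' := proj1 (JE (P := R) (v := B .: o) UR ltac:(intros [|i]; [exact YB|apply Yo])) HB).
assert (CCj : (fun i : nat => J ((B .: o) (i + 5))) = w).
{ apply functional_extensionality; intro i. replace (i + 5) with (5 + i) by lia. apply Fw. }
assert (lj : J ((B .: o) (m + 6)) = l) by (rewrite lo; apply Fl).
unfold R in HB, HB'. rewrite CCo, lo in HB. rewrite CCj, lj in HB'.
destruct HB as (CB & TB & _). destruct HB' as (_ & _ & No). simpl in No, TB.
rewrite (proj2 FP), (proj2 FL) in No. apply No.
destruct (CS B CB) as (U & I & SD). destruct (restr_ex k U) as [g Rg].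
exists c, B, k, U, I, g. split; [exact cJ|]. split; [exact CB|]. split; [exact TB|].
split; [exact k_square_root|]. split; [apply SD|]. split; [exact Rg|].
apply (k_elementary FL LV FLs YB (I := I) (U := U)); [|exact SD|exact Rg].
destruct TB as (U' & I' & PA & Q & [[v [Hv Uv]] _] & _).
apply is_pairE in Q. assert (Q' := proj1 SD). apply is_pairE in Q'. rewrite Q in Q'.
apply opr_inj in Q'. destruct Q'; subst U' I'. rewrite <- (V_unique Hv HV). exact Uv.
Qed.
End Core.

(** * Ultraexactness implies square root reflection *)

(** The sentence about lambda that is reflected to V_delta: reflection fails there for the class
    given by [p], and [Facts] supplies the set theory needed to refute this. *)
Definition Bad (p : form) (m : nat) (N : universe) (v : nat -> N) : Prop :=
  is_limit_cardinal (v 0) /\ Facts N /\ Exo (S m) (Counter p m) (fun _ => v 0).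

Lemma UD_Bad p m : UD (Bad p m).
Proof.
unfold Bad. apply UD_and; [ud|]. apply UD_and; [exact UD_Facts|].
exact (UD_ren (fun _ => 0) (UD_Exo (S m) (UD_Counter p m))).
Qed.

(** [W] is a rank level in disguise: transitivity, closure under subsets and the facts contained in
    [b] make it some V_delta. Without mention of ordinals or of the hierarchy the condition has low
    complexity and is absolute to rank levels. *)
Definition Phi (b : form) (N : universe) (W l : N) : Prop := transitive W /\
  (forall x y, x ∈ W -> subset y x -> y ∈ W) /\ l ∈ W /\ satisfies (fun z => z ∈ W) b (fun _ => l).

#[global] Instance UD_Phi b : UD2 (Phi b).
Proof. unfold UD2, Phi. repeat (apply UD_and; [ud|]). exact (UD_satrel b 0 (fun _ => 1)). Qed.

(** Minimality refers to membership. As the sets in question are levels of the hierarchy, it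
    determines [W]. *)
Definition PhiMin (b : form) (N : universe) (W l : N) : Prop :=
  Phi b W l /\ forall W', W' ∈ W -> ~ Phi b W' l.

#[global] Instance UD_PhiMin b : UD2 (PhiMin b).
Proof.
unfold UD2, PhiMin. apply UD_and; [exact (UD_Phi b)|].
apply (@UD_all (fun N v W' => W' ∈ v 0 -> ~ Phi b W' (v 1))). apply UD_imp; [ud|].
apply UD_not. exact (UD_app2 (UD_Phi b) 0 2).
Qed.

(** The existence of such a W as a Sigma_2 formula: closure under subsets is the only unbounded
    universal condition. The name [K] stands for W and 0 for lambda; [K] is chosen fresh for [b],
    and the names above it are auxiliary. *)
Definition psi_form (K : nat) (b : form) : form :=
  f_ex K (f_all (S K) (f_all (S (S K)) (f_and
    (f_imp (f_and (f_mem (S K) K)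
       (f_all (S (S (S K))) (f_imp (f_mem (S (S (S K))) (S (S K))) (f_mem (S (S (S K))) (S K)))))
     (f_mem (S (S K)) K))
    (f_and (trans_form K) (f_and (f_mem 0 K) (rel K b)))))).

Lemma psi_Sigma2 K b : names K b -> Sigma 2 (psi_form K b).
Proof.
intro Nb. apply Sigma_ex, Sigma_Pi, Pi_all, Pi_all, Pi_Sigma, Sigma_zero.
apply Delta0_and.
- apply Delta0_imp; [|apply Delta0_mem]. apply Delta0_and; [apply Delta0_mem|].
  apply Delta0_ball; [lia|apply Delta0_mem].
- apply Delta0_and; [apply trans_Delta0|]. apply Delta0_and; [apply Delta0_mem|].
  apply rel_Delta0, Nb.
Qed.

(** * A least failing segment and its invariance under j *)

Section Outer.
Context {M : universe} {hM : ZFC M}.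
Implicit Types X W a c d f g j k l r s t u w x y z : M.
Notation "' a" := (proj1_sig a) (at level 1, format "' a").

Lemma psi_sat (D : M -> Prop) K b l : trcls D -> (forall x y, D x -> subset y x -> D y) ->
  D l -> names K b -> 0 < K ->
  (satisfies D (psi_form K b) (fun _ => l) <-> exists W, D W /\ Phi b W l).
Proof.
intros TD SD Dl Nb K0.
assert (Body : forall W x y, D W -> D x -> D y ->
  let o := upd (upd (upd (fun _ : nat => l) K W) (S K) x) (S (S K)) y in
  (satisfies D (f_and (trans_form K) (f_and (f_mem 0 K) (rel K b))) o <->
   transitive W /\ l ∈ W /\ satisfies (fun z => z ∈ W) b (fun _ => l))).
{ intros W x y DW Dx Dy o.
  assert (oK : o K = W) by (unfold o; rewrite !upd_other by lia; apply upd_same).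
  assert (ol : forall i, i < K -> o i = l) by (intros i Hi; unfold o; rewrite !upd_other by lia; reflexivity).
  assert (E1 : satisfies D (trans_form K) o <-> transitive W).
  { rewrite (trans_form_sat TD) by (rewrite oK; exact DW). rewrite oK. tauto. }
  assert (E2 : satisfies D (rel K b) o <-> satisfies (fun z => z ∈ W) b (fun _ => l)).
  { rewrite (rel_sat Nb) by (intro z; rewrite oK; exact (TD W z DW)).
    apply (satisfies_ext (m := K)); [|exact Nb|exact ol]. intro z. rewrite oK. tauto. }
  change (satisfies D (trans_form K) o /\ o 0 ∈ o K /\ satisfies D (rel K b) o <-> 
    transitive W /\ l ∈ W /\ satisfies (fun z => z ∈ W) b (fun _ => l)).
  rewrite E1, E2, oK, (ol 0 K0). tauto. }
assert (Sub : forall W x y, D W -> D x -> D y ->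
  let o := upd (upd (upd (fun _ : nat => l) K W) (S K) x) (S (S K)) y in
  (satisfies D (f_imp (f_and (f_mem (S K) K)
       (f_all (S (S (S K))) (f_imp (f_mem (S (S (S K))) (S (S K))) (f_mem (S (S (S K))) (S K)))))
     (f_mem (S (S K)) K)) o <-> (x ∈ W -> subset y x -> y ∈ W))).
{ intros W x y DW Dx Dy o.
  assert (oK : o K = W) by (unfold o; rewrite !upd_other by lia; apply upd_same).
  assert (ox : o (S K) = x) by (unfold o; rewrite upd_other by lia; apply upd_same).
  assert (oy : o (S (S K)) = y) by (unfold o; apply upd_same).
  assert (E : (forall z, D z -> upd o (S (S (S K))) z (S (S (S K))) ∈ upd o (S (S (S K))) z (S (S K)) ->
    upd o (S (S (S K))) z (S (S (S K))) ∈ upd o (S (S (S K))) z (S K)) <-> subset y x).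
  { split.
    - intros Q z Hz. assert (Dz := TD y z Dy Hz). specialize (Q z Dz).
      rewrite upd_same, !upd_other, ox, oy in Q by lia. exact (Q Hz).
    - intros Q z _. rewrite upd_same, !upd_other, ox, oy by lia. apply Q. }
  change ((o (S K) ∈ o K /\ (forall z, D z -> upd o (S (S (S K))) z (S (S (S K))) ∈ upd o (S (S (S K))) z (S (S K)) ->
    upd o (S (S (S K))) z (S (S (S K))) ∈ upd o (S (S (S K))) z (S K)) -> o (S (S K)) ∈ o K) <->
    (x ∈ W -> subset y x -> y ∈ W)).
  rewrite E, oK, ox, oy. tauto. }
split.
- intros [W [DW Q]]. exists W. split; [exact DW|].
  assert (Q' : forall x y, D x -> D y -> (x ∈ W -> subset y x -> y ∈ W) /\
    transitive W /\ l ∈ W /\ satisfies (fun z => z ∈ W) b (fun _ => l)).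
  { intros x y Dx Dy. destruct (Q x Dx y Dy) as [Q1 Q2]. split.
    - apply (Sub W x y DW Dx Dy). exact Q1.
    - apply (Body W x y DW Dx Dy). exact Q2. }
  destruct (Q' l l Dl Dl) as (_ & T & lW & S). split; [exact T|]. split; [|auto].
  intros x y Hx Hy. assert (Dx := TD W x DW Hx). exact (proj1 (Q' x y Dx (SD x y Dx Hy)) Hx Hy).
- intros [W [DW (T & Sp & lW & S)]]. exists W. split; [exact DW|]. intros x Dx y Dy. split.
  + apply (Sub W x y DW Dx Dy). apply Sp.
  + apply (Body W x y DW Dx Dy). auto.
Qed.

Lemma abs_Phi b a v (W l : setu v) : is_V a v -> (Phi b W l <-> Phi b 'W 'l).
Proof.
intro HV. assert (TV := V_trans HV). unfold Phi. rewrite (abs_trans TV).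
rewrite (sat_setu TV W b (fun _ => l)).
assert (E : (forall x y : setu v, x ∈ W -> subset y x -> y ∈ W) <-> (forall x y : M, x ∈ 'W -> subset y x -> y ∈ 'W)).
{ split; intros Q x y Hx Hy.
  - assert (Vx := inW TV (proj2_sig W) Hx). assert (Vy := V_super HV Vx Hy).
    apply (Q (exist _ x Vx) (exist _ y Vy) Hx). apply (abs_subset TV). exact Hy.
  - apply (Q 'x 'y Hx). apply (abs_subset TV). exact Hy. }
rewrite E. tauto.
Qed.

Lemma abs_PhiMin b a v (W l : setu v) : is_V a v -> (PhiMin b W l <-> PhiMin b 'W 'l).
Proof.
intro HV. unfold PhiMin. rewrite (abs_Phi b W l HV). split; intros [Q1 Q2]; split; try exact Q1.
- intros W' Hw K. assert (Vw := inW (V_trans HV) (proj2_sig W) Hw).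
  apply (Q2 (exist _ W' Vw) Hw). apply (abs_Phi b (exist _ W' Vw : setu v) l HV). exact K.
- intros W' Hw K. apply (Q2 'W' Hw). apply (abs_Phi b W' l HV). exact K.
Qed.

Section Segment.
Variables (p : form) (m : nat) (b : form).
Hypothesis Hb : forall (N : universe) (v : nat -> N), Bad p m v <-> satisfies (@all_sets N) b v.

Lemma Phi_Bad W l (h : l ∈ W) : Phi b W l -> Bad p m (fun _ => exist _ l h : setu W).
Proof. intros (_ & _ & _ & S). apply Hb, (satisfies_subu b (fun _ => exist _ l h : setu W)). exact S. Qed.

(** Let d be the set of ordinals in [W]. By [Facts], [W] computes V_c for each c in d and covers
    itself by these levels; closure under subsets makes the levels correct. *)
Lemma Phi_V W l : Phi b W l -> exists d, is_V d W.
Proof.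
intro Q. destruct Q as (T & Sp & lW & S).
destruct (Phi_Bad lW (conj T (conj Sp (conj lW S)))) as (_ & (_ & _ & _ & _ & _ & Un & VE & _) & _).
assert (Dd : dfn1 (fun x => is_ordinal x)) by df.
set (d := sep W (fun x => is_ordinal x)).
assert (dE : forall x, x ∈ d <-> x ∈ W /\ is_ordinal x) by (intro; apply (sepE _ Dd)).
assert (Od : is_ordinal d).
{ split.
  - intros x Hx z Hz. apply dE in Hx. apply dE. split; [exact (inW T (proj1 Hx) Hz)|].
    exact (ord_el (proj2 Hx) Hz).
  - intros x Hx. apply dE in Hx. exact (ord_trans (proj2 Hx)). }
assert (Vin : forall c, c ∈ d -> exists u, is_V c u /\ u ∈ W).
{ intros c Hc. apply dE in Hc. destruct Hc as [Wc Oc].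
  destruct (VE (exist _ c Wc)) as [u Hu]; [apply (abs_ord T); exact Oc|].
  exists 'u. split; [|exact (proj2_sig u)]. exact (up_V T Sp Hu). }
exists d. replace W with (V_ d); [exact (VP Od)|]. apply set_ext. intro x.
rewrite (V_eqn x (VP Od)). split.
- intros (c & u & Hc & Hu & xu). destruct (Vin c Hc) as [u' [Hu' Wu]].
  rewrite (V_unique Hu Hu') in xu. exact (Sp u' x Wu xu).
- intro Wx. destruct (Un (exist _ x Wx)) as (c & u & Hu & xu).
  apply (up_V T Sp) in Hu. exists 'c, 'u. split; [|split; [exact Hu|]].
  + apply dE. split; [exact (proj2_sig c)|exact (V_ordinal Hu)].
  + exact (V_trans Hu xu).
Qed.

Lemma PhiMin_unique W W' l : PhiMin b W l -> PhiMin b W' l -> W = W'.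
Proof.
intros [Q1 Q2] [Q1' Q2']. destruct (Phi_V Q1) as [d Hd], (Phi_V Q1') as [d' Hd'].
destruct (ord_tri (V_ordinal Hd) (V_ordinal Hd')) as [K|[K|K]].
- destruct (Q2' W (V_mem Hd' Hd K) Q1).
- subst d'. exact (V_unique Hd Hd').
- destruct (Q2 W' (V_mem Hd Hd' K) Q1').
Qed.

Lemma Phi_ex l : is_ordinal l -> Bad p m (fun _ => l) -> exists W, Phi b W l.
Proof.
intros Ol HB. destruct (UD_Bad p m) as [q Hq].
destruct (reflection q Ol) as (a & La & la & St). assert (HV := VP (proj1 La)).
assert (lV : l ∈ V_ a) by (apply (V_self HV), la).
exists (V_ a). split; [exact (V_trans HV)|]. split; [intros x y; exact (V_super HV)|].
split; [exact lV|]. set (o := fun _ : nat => exist (fun z : M => z ∈ V_ a) l lV : setu (V_ a)).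
change (satisfies (fun z => z ∈ V_ a) b (fun i => '(o i))).
apply (satisfies_subu b o), Hb, Hq, (stp_fix St). apply Hq. exact HB.
Qed.

(** A definable part of an element of [W] is a subset of it and hence an element of [W]. *)
Lemma Zer_segment d W : is_V d W -> Facts (setu W) -> Zer (setu W).
Proof.
intros HW F. apply (Zer_Facts F). intros P DP x.
assert (D := dfn1_setu DP). set (s := sep 'x (fun z => exists h : z ∈ W, P (exist _ z h))).
assert (sE : forall z, z ∈ s <-> z ∈ 'x /\ exists h : z ∈ W, P (exist _ z h)) by (intro; apply (sepE _ D)).
assert (Ws : s ∈ W) by (apply (V_super HW (proj2_sig x)); intros z Hz; apply sE, Hz).
exists (exist _ s Ws). intros [z Wz]. change (z ∈ s <-> z ∈ 'x /\ P (exist _ z Wz)). rewrite sE.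
split; intros [Q1 Q2]; split; try exact Q1; [|eauto].
destruct Q2 as [h Q2]. rewrite (proof_irrelevance _ Wz h). exact Q2.
Qed.

Lemma ultraexacting_not_bad l : ultraexacting l -> ~ Bad p m (fun _ => l).
Proof.
intros (Hl & n & eta & zeta & Vl & Ve & Vz & X & j & k & n0 & HVl & HVe & HVz & _ & _ & le & EX & VX & lX &
  _ & Cz & lz & Ej & jl & (a0 & a0l & Ma) & Rk & kX) HB.
destruct (sub_ext EX) as [XV EXid]. destruct (map_ext Ej) as [Fj Ejx].
assert (TVe := V_trans HVe). assert (TVz := V_trans HVz).
assert (jin : forall x, x ∈ X -> ap j x ∈ Vz) by (intros x Hx; exact (fun_ap_in Fj Hx)).
assert (jl' : ap j l = l) by (symmetry; exact (fun_val Fj jl)).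
assert (lVe : l ∈ Ve) by exact (XV l lX).
assert (lVz : l ∈ Vz) by (rewrite <- jl'; exact (jin l lX)).
(* A statement about elements of [X] passes from [Ve] down to [X] and along [j] up to [Vz]. *)
assert (Tr : forall (P : forall N : universe, (nat -> N) -> Prop) (v : nat -> setu Ve) (w : nat -> setu Vz),
  UD P -> (forall i : nat, '(v i) ∈ X) -> (forall i : nat, '(w i) = ap j '(v i)) ->
  (P (setu Ve) v <-> P (setu Vz) w)).
{ intros P v w UP O E. set (vX := fun i : nat => exist (fun z : M => z ∈ X) '(v i) (O i) : setu X).
  rewrite <- (ext_UD (v := vX) (w := v) UP EXid (fun _ => eq_refl)). exact (ext_UD (v := vX) UP Ejx E). }
(* [Vz] is Sigma_2-correct, so that it contains some W; then so does [Ve]. *)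
destruct (Phi_ex (proj1 (proj1 Hl)) HB) as [W0 HW0].
assert (ExZ : exists W, W ∈ Vz /\ Phi b W l).
{ destruct (names_ex b) as [K Nb]. assert (Nb' : names (S K) b) by (apply (names_mono (m := K)); [lia|exact Nb]).
  apply (psi_sat (K := S K) (trcls_set TVz)); [|exact lVz|exact Nb'|lia|].
  - intros x y. exact (V_super HVz).
  - destruct Cz as (v & Hv & Cor). rewrite (V_unique Hv HVz) in Cor. apply Cor.
    + apply (Sigma_le (n := 2)); [lia|]. exact (psi_Sigma2 Nb').
    + intros _. exact lVz.
    + apply (psi_sat (K := S K) (@trcls_all M)); [exact (fun _ _ _ _ => I)|exact I|exact Nb'|lia|].
      exists W0. split; [exact I|exact HW0]. }
destruct ExZ as [W1 [W1V HW1]].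
set (le' := exist (fun z : M => z ∈ Ve) l lVe : setu Ve). set (lz' := exist (fun z : M => z ∈ Vz) l lVz : setu Vz).
assert (ExE : exists W : setu Ve, Phi b W le').
{ apply (Tr (fun (N : universe) (v : nat -> N) => exists W : N, Phi b W (v 0)) (fun _ => le') (fun _ => lz')).
  - apply (@UD_ex (fun (N : universe) (v : nat -> N) (W : N) => Phi b W (v 0))). exact (UD_app2 (UD_Phi b) 0 1).
  - intros _. exact lX.
  - intros _. symmetry. exact jl'.
  - exists (exist _ W1 W1V). apply (abs_Phi b (exist _ W1 W1V : setu Vz) lz' HVz). exact HW1. }
destruct ExE as [W2 HW2]. apply (abs_Phi b W2 le' HVe) in HW2.
destruct (set_min (P := fun W => Phi b W l) (s := Ve) (dfn_UD2 (UD_Phi b) (tm_var M 0) (tm_cst l)))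
  as (W3 & W3V & HW3 & Min).
{ exists 'W2. split; [exact (proj2_sig W2)|exact HW2]. }
(* The least segment is defined from lambda in [Ve], so [X] contains it. *)
destruct (tarski_vaught (P := fun N v => PhiMin b (v 0) (v 1)) (v := fun _ => le') (UD_PhiMin b) XV EXid
  (fun _ => lX)) as [We [WX HWe]].
{ exists (exist _ W3 W3V). apply (abs_PhiMin b (exist _ W3 W3V : setu Ve) le' HVe).
  split; [exact HW3|]. intros W' Hw. exact (Min W' Hw (inW TVe W3V Hw)). }
set (W := 'We) in *. assert (HWm := proj1 (abs_PhiMin b We le' HVe) HWe). fold W in HWm. change 'le' with l in HWm.
(* j(W) is least in [Vz], and leastness is absolute for [Ve] and [Vz], so both sets solve the same
   condition in [M]. *)
assert (jW : ap j W = W).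
{ assert (Q : PhiMin b (exist (fun z : M => z ∈ Vz) (ap j W) (jin W WX) : setu Vz) lz').
  { apply (Tr (fun N v => PhiMin b (v 0) (v 1)) (We .: fun _ => le')
      ((exist (fun z : M => z ∈ Vz) (ap j W) (jin W WX) : setu Vz) .: fun _ => lz')).
    - exact (UD_PhiMin b).
    - intros [|i]; [exact WX|exact lX].
    - intros [|i]; [reflexivity|symmetry; exact jl'].
    - exact HWe. }
  apply (abs_PhiMin b _ lz' HVz) in Q. exact (PhiMin_unique Q HWm). }
destruct HWm as [HW _]. destruct (Phi_V HW) as [d Hd]. assert (TW := V_trans Hd).
assert (SW : forall x y, x ∈ W -> subset y x -> y ∈ W) by (intros x y; exact (V_super Hd)).
assert (lW : l ∈ W) by apply HW.
destruct (Phi_Bad lW HW) as (Hl' & FN & HE).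
assert (ZN := Zer_segment Hd FN).
set (ln := exist (fun z : M => z ∈ W) l lW : setu W) in *.
set (Y := fun x : setu W => 'x ∈ X).
(* On [Y] this is j, whose values stay in W because j(W) = W; elsewhere the value is arbitrary. *)
set (J := fun x : setu W => epsilon (inhabits x) (fun y : setu W => 'y = ap j 'x)).
assert (jmem : forall x y, x ∈ X -> y ∈ X -> x ∈ y -> ap j x ∈ ap j y).
{ intros x y Hx Hy Q.
  apply (Tr (fun N v => v 0 ∈ v 1) ((exist (fun z : M => z ∈ Ve) x (XV x Hx) : setu Ve) .: fun _ => exist _ y (XV y Hy))
    ((exist (fun z : M => z ∈ Vz) (ap j x) (jin x Hx) : setu Vz) .: fun _ => exist _ (ap j y) (jin y Hy))).
  - ud.
  - intros [|i]; assumption.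
  - intros [|i]; reflexivity.
  - exact Q. }
assert (JP : forall x : setu W, Y x -> '(J x) = ap j 'x).
{ intros x Hx. assert (Q : ap j 'x ∈ W) by (rewrite <- jW; exact (jmem 'x W Hx WX (proj2_sig x))).
  exact (epsilon_spec (inhabits x) (fun y : setu W => 'y = ap j 'x) (ex_intro _ (exist _ (ap j 'x) Q) eq_refl)). }
assert (WVe : forall x : setu W, 'x ∈ Ve) by (intro x; exact (inW TVe (XV W WX) (proj2_sig x))).
assert (WVz : forall x : setu W, 'x ∈ Vz).
{ intro x. apply (inW TVz (x := W)); [rewrite <- jW; exact (jin W WX)|exact (proj2_sig x)]. }
assert (WzV : W ∈ Vz) by (rewrite <- jW; exact (jin W WX)).
(* Truth in W is a property of W that [Ve] and [Vz] express by a formula with bounded quantifiers,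
   and W is fixed. *)
assert (JE : forall (P : forall N : universe, (nat -> N) -> Prop) (v : nat -> setu W), UD P ->
  (forall i : nat, Y (v i)) -> (P (setu W) v <-> P (setu W) (fun i : nat => J (v i)))).
{ intros P v UP Yv. destruct (UD_form UP) as [q Hq]. rewrite !Hq.
  rewrite (satisfies_subu q v), (satisfies_subu q (fun i : nat => J (v i))).
  set (ve := We .: fun i : nat => exist (fun z : M => z ∈ Ve) '(v i) (WVe (v i)) : setu Ve).
  set (vz := (exist (fun z : M => z ∈ Vz) W WzV : setu Vz) .:
    fun i : nat => exist (fun z : M => z ∈ Vz) '(J (v i)) (WVz (J (v i))) : setu Vz).
  assert (Q := Tr (fun (N : universe) (o : nat -> N) => satisfies (fun x : N => x ∈ o 0) q (fun i : nat => o (S i))) ve vz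
    (UD_satrel q 0 S) ltac:(intros [|i]; [exact WX|exact (Yv i)])
    ltac:(intros [|i]; [symmetry; exact jW|exact (JP (v i) (Yv i))])).
  change (satisfies (fun x : setu Ve => x ∈ We) q (fun i : nat => ve (S i)) <->
    satisfies (fun x : setu Vz => x ∈ vz 0) q (fun i : nat => vz (S i))) in Q.
  rewrite (sat_setu TVe We q (fun i : nat => ve (S i))) in Q.
  rewrite (sat_setu TVz (vz 0) q (fun i : nat => vz (S i))) in Q. exact Q. }
(* The Tarski-Vaught criterion for [X] in [Ve], applied to truth in the element W; [sh] drops the
   place occupied by W. *)
assert (TVY : forall (P : forall N : universe, (nat -> N) -> Prop) (v : nat -> setu W), UD P ->
  (forall i : nat, Y (v i)) -> (exists x : setu W, P (setu W) (x .: v)) ->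
  exists x : setu W, Y x /\ P (setu W) (x .: v)).
{ intros P v UP Yv [x Hx]. destruct (UD_form UP) as [q Hq].
  set (sh := fun i : nat => match i with 0 => 0 | S i => S (S i) end).
  set (ve := We .: fun i : nat => exist (fun z : M => z ∈ Ve) '(v i) (WVe (v i)) : setu Ve).
  assert (Con : forall y : setu W, P (setu W) (y .: v) <->
    satisfies (fun z : setu Ve => z ∈ We) q (fun i : nat => ((exist (fun z : M => z ∈ Ve) 'y (WVe y) : setu Ve) .: ve) (sh i))).
  { intro y. rewrite Hq, (satisfies_subu q (y .: v)).
    rewrite (sat_setu TVe We q (fun i : nat => ((exist (fun z : M => z ∈ Ve) 'y (WVe y) : setu Ve) .: ve) (sh i))).
    replace (fun i : nat => '(((exist (fun z : M => z ∈ Ve) 'y (WVe y) : setu Ve) .: ve) (sh i)))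
      with (fun i : nat => '((y .: v) i)); [tauto|].
    apply functional_extensionality; intros [|i]; reflexivity. }
  destruct (tarski_vaught (P := fun (N : universe) (o : nat -> N) => o 0 ∈ o 1 /\ satisfies (fun z : N => z ∈ o 1) q (fun i : nat => o (sh i)))
    (v := ve) (UD_and (UD_mem 0 1) (UD_satrel q 1 sh)) XV EXid) as [y [yX [yW Hy]]].
  - intros [|i]; [exact WX|exact (Yv i)].
  - exists (exist _ 'x (WVe x)). split; [exact (proj2_sig x)|]. apply Con, Hx.
  - exists (exist (fun z : M => z ∈ W) 'y yW). split; [exact yX|]. apply Con.
    replace (exist (fun z : M => z ∈ Ve) '(exist (fun z : M => z ∈ W) 'y yW : setu W) (WVe (exist (fun z : M => z ∈ W) 'y yW)) : setu Ve) with y;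
      [exact Hy|]. apply sub_eq. reflexivity. }
assert (FNV := FN). destruct FNV as (_ & _ & _ & _ & _ & _ & VE & _).
destruct (VE ln) as [Vn HVn]; [apply Hl'|].
(* The level V_lambda of W is the true one, as W is transitive and closed under subsets. *)
assert (EV : 'Vn = Vl) by exact (V_unique (up_V TW SW HVn) HVl).
destruct (restr_fun Fj Rk VX) as [Fk Ek].
assert (Ll := limit_cardinal_limit Hl).
assert (VY : forall x : setu W, x ∈ Vn -> Y x).
{ intros x Hx. apply VX. rewrite <- EV. exact Hx. }
assert (Fln : fixed Y J ln).
{ split; [exact lX|]. apply sub_eq. rewrite (JP ln lX). exact jl'. }
assert (FVn : fixed Y J Vn) by exact (fixed_V JE TVY Fln HVn).
(* V_lambda is definable from lambda in W, hence fixed, so j maps its elements into it. *)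
assert (kV : is_function k Vl Vl).
{ apply (fun_range Fk). intros x Hx. rewrite (Ek x Hx).
  assert (Wx : x ∈ W) by (rewrite <- EV in Hx; exact (inW TW (proj2_sig Vn) Hx)).
  assert (xV : (exist (fun z : M => z ∈ W) x Wx : setu W) ∈ Vn)
    by exact (eq_ind_r (fun u => x ∈ u) Hx EV).
  assert (Q := J_up JE (VY _ xV) (proj1 FVn) xV). rewrite (proj2 FVn) in Q.
  assert (Q' := eq_ind _ (fun u => '(J (exist (fun z : M => z ∈ W) x Wx)) ∈ u) Q _ EV).
  exact (eq_ind _ (fun u => u ∈ Vl) Q' _ (JP (exist (fun z : M => z ∈ W) x Wx) (VY _ xV))). }
assert (kW : k ∈ W).
{ apply (SW Vl); [rewrite <- EV; exact (proj2_sig Vn)|]. intros q Q. apply (fun_mem _ kV) in Q.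
  destruct Q as [x [Hx ->]]. exact (limit_V_opr Ll HVl Hx (fun_ap_in kV Hx)). }
set (kn := exist (fun z : M => z ∈ W) k kW : setu W).
assert (Fkn : is_function kn Vn Vn) by (apply (abs_function TW); change 'kn with k; rewrite EV; exact kV).
apply (no_counterexample (HZ := ZN) JE TVY FN Hl' HVn Fln VY (k := kn)) in HE; [exact HE|exact kX|exact Fkn| |].
- intros x Hx. symmetry. apply (fun_val Fkn), (abs_app TW). rewrite (JP x (VY x Hx)).
  assert (Hx' : 'x ∈ Vl) by (rewrite <- EV; exact Hx). change 'kn with k.
  rewrite <- (Ek 'x Hx'). exact (fun_app Fk Hx').
- assert (a0V : a0 ∈ Vl) by (apply (V_self HVl), a0l).
  exists (exist (fun z : M => z ∈ W) a0 (inW TW lW a0l)). split; [exact a0l|]. intro Q. apply Ma.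
  assert (Q' := f_equal (@proj1_sig _ _) Q). rewrite JP in Q' by exact (VX a0 a0V). simpl in Q'.
  rewrite <- Q' at 2. exact (fun_app Fj (VX a0 a0V)).
Qed.
End Segment.

Lemma UXSR_ext L P (C C' : M -> Prop) l : (forall x, C x <-> C' x) -> UXSR L P C l -> UXSR L P C' l.
Proof.
intros E (f & c & F & Cc & cl & Main). exists f, c. split; [exact F|]. split; [exact Cc|].
split; [exact cl|]. intros B CB TB. destruct (Main B) as (n & A & r & U & I & g & nc & CA & Q);
  [apply E, CB|exact TB|]. exists n, A, r, U, I, g. split; [exact nc|]. split; [apply E, CA|exact Q].
Qed.

Theorem ultraexacting_UXSR l L P (C : M -> Prop) : ultraexacting l ->
  (exists Vl, is_V l Vl /\ L ∈ Vl) -> P ∈ L -> ordinal_definable C ->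
  (forall A, C A -> is_structure L A) -> UXSR L P C l.
Proof.
intros Ul [Vl [HV LV]] PL (p & v & Ov & HC) CS. apply NNPP. intro No.
assert (Hl := proj1 Ul). assert (Ll := limit_cardinal_limit Hl).
destruct (names_ex p) as [m Nm].
apply (V_eqn _ HV) in LV. destruct LV as (c & u & cl & Hc & Lu).
assert (sl := limit_suc Ll cl). assert (Os := ord_el (proj1 Ll) sl).
(* Place 0 receives rho = c + 1, place m - i the parameter with number i < m, and every place beyond
   m receives lambda. This is the order in which [CC] reads the parameters. *)
set (w := fun i : nat => match i with 0 => suc c | S i => if i <? m then v (m - S i) else l end).
assert (wl : forall i : nat, w (S m + i) = l).
{ intro i. simpl. destruct (Nat.ltb_spec (m + i) m); [lia|reflexivity]. }
assert (CE : forall x, CC p m w x <-> C x).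
{ intro x. rewrite HC. unfold CC. apply (satisfies_ext (m := m)); [tauto|exact Nm|].
  intros [|i] Hi; [reflexivity|]. rewrite !upd_other by lia.
  replace (m - S i) with (S (m - S (S i))) by lia. simpl.
  destruct (Nat.ltb_spec (m - S (S i)) m); [|lia]. f_equal. lia. }
destruct (UD_form (UD_Bad p m)) as [b Hb].
apply (ultraexacting_not_bad Hb Ul). split; [exact Hl|]. split; [exact (Facts_M hM)|].
replace (fun _ : nat => l) with (fun i : nat => w (S m + i)) by (apply functional_extensionality; exact wl).
apply Exo_intro.
- intros [|i] Hi; [exact Os|]. simpl. destruct (Nat.ltb_spec i m); [apply Ov|lia].
- assert (wm : w (S m) = l) by (rewrite <- (wl 0); f_equal; lia).
  exists (V_ (suc c)), L, P. rewrite wm. split; [exact (VP Os)|]. split; [exact sl|]. split; [|split; [exact PL|split]].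
  + apply (V_eqn _ (VP Os)). exists c, u. split; [apply suc_mem|auto].
  + intros A HA. apply CS, CE, HA.
  + intro Q. exact (No (UXSR_ext CE Q)).
Qed.
End Outer.

Theorem theorem6p6 (M : universe) (hM : ZFC M) (lambda : M)
    (hlambda : is_limit_cardinal lambda) :
  (ultraexacting lambda <->
   (forall (L P : M), is_language L ->
      (exists Vl : M, is_V lambda Vl /\ L ∈ Vl) ->
      is_unary_predicate_symbol P -> P ∈ L ->
      forall C : M -> Prop, ordinal_definable C ->
        (forall A : M, C A -> is_structure L A) ->
        UXSR L P C lambda)) /\
  (ultraexacting lambda <->
   (exists L P : M, is_Lstar L /\ is_P_symbol P /\ UXSR L P classU lambda)).
Proof.
set (ii := forall L P : M, _). set (iii := exists L P : M, _).
assert (H1 : ultraexacting lambda -> ii).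
{ intros U L P _ HL _ PL C OC CS. exact (ultraexacting_UXSR U HL PL OC CS). }
assert (H2 : ii -> iii).
{ intro H. destruct Lstar_ex as [L HL]. exists L, sP. split; [exact HL|].
  split; [apply sPE; reflexivity|]. assert (LE := LstarE HL).
  assert (Ll := limit_cardinal_limit hlambda). assert (HV := VP (proj1 Ll)).
  assert (CK := limit_V_adjcl Ll HV).
  assert (St : forall i j k : nat, opr (num i) (opr (num j) (num k)) ∈ V_ lambda).
  { intros i j k. repeat apply (adjcl_opr CK); apply (adjcl_nat CK), num_nat. }
  apply H.
  - intros s Hs. apply LE in Hs. destruct Hs as [->|[->|[->| ->]]].
    + exists (num 2). left. exact smem_rel.
    + exists (num 1). right. exact (std_fun 1 0).
    + exists (num 2). left. exact (std_rel 2 1).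
    + exists (num 1). left. exact (std_rel 1 0).
  (* The language is a finite set of hereditarily finite symbols, so it belongs to V_lambda. *)
  - exists (V_ lambda). split; [exact HV|].
    replace L with (adj (adj (upr smem sf) sE) sP).
    + repeat apply (adjcl_adj CK); try apply (adjcl_upr CK); apply St.
    + apply set_ext. intro s. rewrite LE, !adjE, uprE. tauto.
  - exists (num 1). split; [apply is_numE; reflexivity|exact (std_rel 1 0)].
  - apply LE. auto.
  - exact classU_definable.
  - intros A (L' & l' & Vl & HL' & SA & _).
    replace L with L'; [exact SA|]. apply set_ext. intro s. rewrite (HL s), (HL' s). tauto. }
assert (H3 : iii -> ultraexacting lambda).
{ intros (L & P & HL & HP & U). exact (UXSR_ultraexacting hlambda HL HP U). }
split; split; auto.
Qed.
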